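(* Consider the fully discrete scheme (S) for fluid structure interaction described in the context. Assume that the strain energy density $W(F)$ is convex, and assume $u_b=0$, $\Sigma_2=\emptyset$ and $\partial_t\varphi_b=0$. Then for any time step $\Delta t$ satisfying the collision free condition (the time step $\Delta t$ that is taken does not make the fluid-structure interface collide with itself or with other fixed boundaries), the solution of (S) satisfies $$\frac{\rho^f}{2\Delta t}\Big(\|u_h^n\|^2_{(t^n)}-\|u_h^{n-1}\|^2_{(t^{n-1})}\Big)+\frac{\rho^f\nu^f}{2}\|\nabla u_h^n+(\nabla u_h^n)^\top\|^2_{(t^n)}+\frac1{\Delta t}\Big(\mathcal{E}_s(v_h^n;\varphi_h^n+\Delta t\,v_h^n)-\mathcal{E}_s(v_h^{n-1};\varphi_h^{n-1}+\Delta t\,v_h^{n-1})\Big)$$ $$\le \langle\rho^f g^f,u_h^n\rangle_{(t^n)}+\langle\rho^s g^s,v_h^n\rangle_{\Omega^s}+\langle\sigma_b^s,v_h^n\rangle_{\Sigma_4},$$ where $\mathcal{E}_s(v;\varphi)=\frac{\rho^s}{2}\|v\|^2_{\Omega^s}+\int_{\Omega^s}W(\nabla\varphi)$. In particular, the quantity $$2\,\mathcal{E}_s(v_h^n;\varphi_h^n+\Delta t\,v_h^n)+\rho^f\|u_h^n\|^2_{(t^n)}+\sum_{\ell=1}^n\rho^f\nu^f\|\nabla u_h^\ell+(\nabla u_h^\ell)^\top\|^2_{(t^\ell)}\,\Delta t$$ is uniformly bounded in $n$, and the bound is independent of the fluid mesh velocity.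
   Context: **Physical data.** $d\in\{2,3\}$. $\rho^f,\nu^f,\rho^s>0$ are constants. $\Omega^s\subset\mathbb{R}^d$ is the reference domain of the solid, $\Gamma=\partial\Omega^f_{(0)}\cap\partial\Omega^s$ the initial fluid-structure (FS) interface. The rest of the fluid boundary is a fixed set $\Sigma_1\cup\Sigma_2$; $\partial\Omega^s=\Gamma\cup\Sigma_3\cup\Sigma_4$. Data: fluid velocity $u_b$ on $\Sigma_1$, fluid traction $\sigma^f_b$ on $\Sigma_2$, solid position $\varphi_b$ on $\Sigma_3$, solid traction $\sigma_b^s$ on $\Sigma_4$, body forces $g^f,g^s$. Fluid stress: $\sigma^f(u,p)=\rho^f\nu^f(\nabla u+\nabla u^\top)-pI$. The solid is elastic with strain energy $\int_{\Omega^s}W(\nabla\varphi)$, and $\sigma^s(\varphi)=\frac{\partial W}{\partial F}(\nabla\varphi)$. Conventions: $(\nabla\cdot A)_i=\partial_jA_{ij}$, $(a\otimes b)_{ij}=a_ib_j$; $\langle\cdot,\cdot\rangle_D$ and $\|\cdot\|_D$ are the $L^2(D)$ inner product and norm; $\langle\cdot,\cdot\rangle_{(t)}$ and $\|\cdot\|_{(t)}$ are those of $L^2(\Omega^f_{h,t})$. **Meshes.** $m\ge1$ is an integer. $\hat T\subset\mathbb{R}^d$ is the reference simplex with vertices $0,e_1,\dots,e_d$, and $\hat\phi_0,\dots,\hat\phi_{L-1}$ is the Lagrange basis of $\mathbb{P}_m(\hat T)$. $\mathcal{T}^s_h$ is a fixed isoparametric $\mathbb{P}_m$ mesh of $\Omega^s$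 with element maps $\Psi^s_j:\hat T\to T^s_j$; its restriction to $\Gamma$ is $\mathcal{T}^\Gamma_h$. For each $k$, $\mathcal{T}^f_{h,t^k}$ is an isoparametric $\mathbb{P}_m$ mesh of the numerical fluid domain $\Omega^f_{h,t^k}$ with grid points $a^k_1,\dots,a^k_G$; the connectivity (the global index $i_{(j,p)}$ of the $p$-th node of the $j$-th element) does not depend on $k$. Its element maps are $\Psi^{f,k}_j(\hat x)=\sum_{p=0}^{L-1}\hat\phi_p(\hat x)\,a^k_{i_{(j,p)}}$, mapping $\hat T$ onto $T^{f,k}_j$, and $\phi^{f,k}_i$ denotes the scalar Lagrange basis function of the $i$-th grid point. Here $t^k=t^{k-1}+\Delta t$. **One time step.** Given $u_h^{n-1},v_h^{n-1},\varphi_h^{n-1}$ and $\mathcal{T}^f_{h,t^{n-1}}$ (with $u_h^{n-1}(\varphi_h^{n-1}(z_i))=v_h^{n-1}(z_i)$ at all grid points $z_i$ of $\mathcal{T}_h^\Gamma$), set $\varphi_h^n=\varphi_h^{n-1}+\Delta t\,v_h^{n-1}$ on $\Omega^s$. The grid points of $\mathcal{T}^f_{h,t^n}$ on the FS interface $\partial\Omega^f_{h,t^n}\setminus(\Sigma_1\cup\Sigma_2)$ are $\varphi_h^n(z_i)$, $z_i$ a grid point of $\mathcal{T}_h^\Gamma$; those on $\Sigma_1\cup\Sigma_2$ come from the fixed boundaries; the remaining ones are determined from the boundary grid points by an explicit mesh-motion procedure (e.g. a linear elasticity solve on the initial mesh for the vertices). The collision free condition ensures that the fluid mesh can be constructed.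 For $t\in[t^{n-1},t^n]$ define elementwise $$\Phi^n(x,t)\big|_{T^{f,n}_j}=\frac{t-t^{n-1}}{\Delta t}x+\frac{t^n-t}{\Delta t}\,\Psi^{f,n-1}_j\circ(\Psi^{f,n}_j)^{-1}(x),$$ $\Omega^f_{h,t}=\Phi^n(\Omega^f_{h,t^n},t)$, and $w^n(x)=\partial_t\Phi^n(x,t)$ (independent of $t$; the fluid mesh velocity). $\Phi^n(\cdot,t)$ is assumed to be a bijection onto $\Omega^f_{h,t}$ with positive Jacobian determinant on each element. For a function $f$ on $\Omega^f_{h,t^n}$, its backward in time extension is $\overleftarrow{f}(y,t)=f\big([\Phi^n(\cdot,t)]^{-1}(y)\big)$, $y\in\Omega^f_{h,t}$. For $u_h^{n-1}=\sum_iu^{n-1}_{h,i}\phi^{f,n-1}_i$, its forward in time extension is $\overrightarrow{u}_h^{n-1}(y,t)=\sum_iu^{n-1}_{h,i}\overleftarrow{\phi}{}^{f,n}_i(y,t)$. **Space.** $V^{\varphi_h^n}_{h,t^n}$ is the set of triples $(u_h;p_h;v_h)$ with $u_h\in C^0(\Omega^f_{h,t^n})$ ($\mathbb{R}^d$-valued), $p_h\in C^0(\Omega^f_{h,t^n})$ (scalar), $v_h\in C^0(\Omega^s)$ ($\mathbb{R}^d$-valued), $u_h\circ\Psi_j^{f,n}\in\mathbb{P}_m(\hat T)$, $p_h\circ\Psi_j^{f,n}\in\mathbb{P}_{m-1}(\hat T)$, $v_h\circ\Psi^s_j\in\mathbb{P}_m(\hat T)$ for all elements, and $u_h(\varphi_h^n(z_i))=v_h(z_i)$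 for all grid points $z_i$ of $\mathcal{T}^\Gamma_h$. **Quadrature in time.** If $d=2$: one node $\tau_1=t^{n-\frac12}=t^n-\frac{\Delta t}2$ with weight $\omega_1=1$. If $d=3$: two nodes $\tau_1=t^n-(\frac12+\frac1{2\sqrt3})\Delta t$, $\tau_2=t^n-(\frac12-\frac1{2\sqrt3})\Delta t$ with weights $\omega_1=\omega_2=\frac12$. **Scheme (S).** Find $(u_h^n;p_h^n;v_h^n)\in V^{\varphi_h^n}_{h,t^n}$ with $u_h^n|_{\Sigma_1}=u_b$, $v_h^n|_{\Sigma_3}=\partial_t\varphi_b$ such that for all $(\phi^f;q^f;\phi^s)\in V^{\varphi_h^n}_{h,t^n}$ with $\phi^f|_{\Sigma_1}=0$, $\phi^s|_{\Sigma_3}=0$, $$\frac{\rho^f}{\Delta t}\Big(\langle u_h^n,\phi^f\rangle_{(t^n)}-\langle u_h^{n-1},\overleftarrow{\phi^f}(\cdot,t^{n-1})\rangle_{(t^{n-1})}\Big)$$ $$+\rho^f\sum_\ell\omega_\ell\Big\langle\nabla\cdot\big(\overleftarrow{u}_h^n(\cdot,\tau_\ell)\otimes(\overrightarrow{u}_h^{n-1}(\cdot,\tau_\ell)-\overleftarrow{w}^n(\cdot,\tau_\ell))\big),\overleftarrow{\phi^f}(\cdot,\tau_\ell)\Big\rangle_{(\tau_\ell)}$$ $$-\rho^f\sum_\ell\omega_\ell\Big\langle\tfrac12\big(\nabla\cdot\overrightarrow{u}_h^{n-1}(\cdot,\tau_\ell)\big)\overleftarrow{u}_h^n(\cdot,\tau_\ell),\overleftarrow{\phi^f}(\cdot,\tau_\ell)\Big\rangle_{(\tau_\ell)}+\langle\sigma^f(u_h^n,p_h^n),\nabla\phi^f\rangle_{(t^n)}-\langle\nabla\cdot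 u_h^n,q^f\rangle_{(t^n)}$$ $$+\Big\langle\rho^s\frac{v_h^n-v_h^{n-1}}{\Delta t},\phi^s\Big\rangle_{\Omega^s}+\langle\sigma^s(\varphi_h^n+\Delta t\,v_h^n),\nabla\phi^s\rangle_{\Omega^s}$$ $$=\langle\rho^fg^f,\phi^f\rangle_{(t^n)}+\langle\sigma_b^f,\phi^f\rangle_{\Sigma_2}+\langle\rho^sg^s,\phi^s\rangle_{\Omega^s}+\langle\sigma^s_b,\phi^s\rangle_{\Sigma_4}.$$
   Formalization: With nonzero forces the uniform bound in n fails as stated (W=0, constant body force); it is given as: quantity at n ≤ initial quantity + 2Δt × summed power of the forces, and, for forces bounded in L² by M, a bound for t^n ≤ T independent of the fluid mesh velocity. *)

(* Defs.v *)
From HB Require Import structures.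
From mathcomp Require Import all_boot all_order all_algebra perm.
From mathcomp Require Import all_classical all_reals all_analysis.
Set Implicit Arguments.
Unset Strict Implicit.
Unset Printing Implicit Defensive.
Import Order.TTheory GRing.Theory Num.Theory.
Import numFieldNormedType.Exports.
Local Open Scope classical_set_scope.
Local Open Scope ring_scope.

Section LebesgueRn.
Context {R : realType}.
Local Notation mR := (measurableTypeR R).

Definition tcons n (p : mR * n.-tuple mR) : n.+1.-tuple mR :=
  [the n.+1.-tuple mR of p.1 :: p.2].

Lemma measurable_tcons n : measurable_fun setT (@tcons n).
Proof. by apply: (@measurable_cons _ _ _ _ fst n snd). Qed.

Section step.
Variables (n : nat) (mu : {sigma_finite_measure set (n.-tuple mR) -> \bar R}).

Definition leb_step : set (n.+1.-tuple mR) -> \bar R :=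
  pushforward (lebesgue_measure \x mu)%E (@tcons n).

Let pre (A : set (n.+1.-tuple mR)) :
  measurable A -> measurable (@tcons n @^-1` A).
Proof. by move=> mA; rewrite -[X in measurable X]setTI; exact: measurable_tcons. Qed.

Let leb_step0 : leb_step set0 = 0%E.
Proof. by rewrite /leb_step /pushforward preimage_set0 measure0. Qed.

Let leb_step_ge0 A : (0 <= leb_step A)%E.
Proof. by rewrite /leb_step /pushforward; exact: measure_ge0. Qed.

Let leb_step_sigma_additive : semi_sigma_additive leb_step.
Proof.
move=> F mF tF mUF; rewrite /leb_step /pushforward preimage_bigcup.
apply: measure_semi_sigma_additive.
- by move=> k; exact: pre.
- apply/trivIsetP => /= i j _ _ ij; rewrite -preimage_setI.
  by move/trivIsetP : tF => /(_ _ _ _ _ ij) ->//; rewrite preimage_set0.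
- by rewrite -preimage_bigcup; exact: pre.
Qed.

HB.instance Definition _ := isMeasure.Build _ _ _ leb_step
  leb_step0 leb_step_ge0 leb_step_sigma_additive.

Let leb_step_sigma_finite : sigma_finite setT leb_step.
Proof.
pose m1 : {sigma_finite_measure set mR -> \bar R} := lebesgue_measure.
have /sigma_finiteP[F [TF ndF Foo]] := sigma_finiteT m1.
have /sigma_finiteP[G [TG ndG Goo]] := sigma_finiteT mu.
pose H k : set (n.+1.-tuple mR) :=
  [set t | F k (thead t) /\ G k [tuple of behead t]].
have HE k : @tcons n @^-1` H k = F k `*` G k.
  apply/seteqP; split => -[x t] /=; rewrite /H/=.
    by have -> : [tuple of behead (tcons (x, t))] = t by exact/val_inj.
  by have -> : [tuple of behead (tcons (x, t))] = t by exact/val_inj.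
exists H.
  apply/seteqP; split => // t _.
  have [i _ Fi] : (\bigcup_k F k) (thead t) by rewrite -TF.
  have [j _ Gj] : (\bigcup_k G k) [tuple of behead t] by rewrite -TG.
  exists (maxn i j) => //; split.
    by move: (thead t) Fi; exact/subsetPset/ndF/leq_maxl.
  by move: [tuple of behead t] Gj; exact/subsetPset/ndG/leq_maxr.
move=> k; have [mF Fk] := Foo k; have [mG Gk] := Goo k; split.
  rewrite (_ : H k = (fun t : n.+1.-tuple mR => thead t) @^-1` F k `&`
                     (fun t : n.+1.-tuple mR => [tuple of behead t]) @^-1` G k)//.
  apply: measurableI; rewrite -[X in measurable X]setTI.
    exact: (@measurable_tnth _ _ _ ord0).
  exact: measurable_behead.
rewrite /leb_step /pushforward HE product_measure1E//.
by rewrite lte_mul_pinfty// ge0_fin_numE.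
Qed.

HB.instance Definition _ := @Measure_isSigmaFinite.Build _ _ _ leb_step
  leb_step_sigma_finite.

End step.

(* Lebesgue measure on R^n, as an iterated product measure on n-tuples. *)
Fixpoint leb n : {sigma_finite_measure set (n.-tuple mR) -> \bar R} :=
  match n with
  | 0 => [the {sigma_finite_measure set (0.-tuple mR) -> \bar R} of
           dirac ([tuple] : 0.-tuple mR)]
  | n'.+1 => [the {sigma_finite_measure set (n'.+1.-tuple mR) -> \bar R} of
           leb_step (leb n')]
  end.

Definition row_of n (t : n.-tuple mR) : 'rV[R]_n := \row_i tnth t i.

Definition vint n (D : set 'rV[R]_n) (f : 'rV[R]_n -> R) : R :=
  \int[leb n]_(t in @row_of n @^-1` D) f (row_of t).

(* The L^2(D) inner product of vector fields (p = 1) and matrix fields. *)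
Definition ip n p q (D : set 'rV[R]_n) (f g : 'rV[R]_n -> 'M[R]_(p, q)) : R :=
  vint D (fun x => \sum_i \sum_j f x i j * g x i j).

Definition L2_le n q (D : set 'rV[R]_n) (f : 'rV[R]_n -> 'rV[R]_q) (M : R) :=
  (forall i, measurable_fun (@row_of n @^-1` D) (fun t => f (row_of t) 0 i)) /\
  (\int[leb n]_(t in @row_of n @^-1` D)
     (\sum_i f (row_of t) 0 i ^+ 2)%:E <= (M ^+ 2)%:E)%E.

End LebesgueRn.

Section Calculus.
Context {R : realType} {d : nat}.
Implicit Types (u : 'rV[R]_d -> 'rV[R]_d) (A : 'rV[R]_d -> 'M[R]_d).

Definition partial (j : 'I_d) (f : 'rV[R]_d -> R) (x : 'rV[R]_d) : R :=
  'D_(delta_mx 0 j) f x.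

Definition grad u (x : 'rV[R]_d) : 'M[R]_d :=
  \matrix_(i, j) partial j (fun y => u y 0 i) x.

Definition div u (x : 'rV[R]_d) : R := \sum_j partial j (fun y => u y 0 j) x.

Definition mxdiv A (x : 'rV[R]_d) : 'rV[R]_d :=
  \row_i \sum_j partial j (fun y => A y i j) x.

Definition outer (a b : 'rV[R]_d) : 'M[R]_d := \matrix_(i, j) (a 0 i * b 0 j).

Definition symgrad u (x : 'rV[R]_d) : 'M[R]_d := grad u x + (grad u x)^T.

Definition dmx (W : 'M[R]_d -> R) (F : 'M[R]_d) : 'M[R]_d :=
  \matrix_(i, j) 'D_(delta_mx i j) W F.

Definition frontier (D : set 'rV[R]_d) : set 'rV[R]_d :=
  closure D `\` interior D.

Definition polyfun (k : nat) (f : 'rV[R]_d -> R) :=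
  exists c : {ffun 'I_d -> 'I_k.+1} -> R, forall x,
    f x = \sum_(a : {ffun 'I_d -> 'I_k.+1} | (\sum_i a i <= k)%N)
            c a * \prod_i x 0 i ^+ a i.

End Calculus.

Section ReferenceSimplex.
Context {R : realType}.

(* Barycentric coordinate number k of x with respect to the vertices
   0, e_1, .., e_n of the reference simplex. *)
Definition bary n (x : 'rV[R]_n) (k : nat) : R :=
  if k is k'.+1 then oapp (fun i : 'I_n => x 0 i) 0 (insub k')
  else 1 - \sum_i x 0 i.

Definition simplex n : set 'rV[R]_n :=
  [set x | forall v : 'I_n.+1, 0 <= bary x v].

Definition vertex n (v : 'I_n.+1) : 'rV[R]_n :=
  \row_(j < n) (v == j.+1 :> nat)%:R.

Definition subsimplex n (A : {set 'I_n.+1}) : set 'rV[R]_n :=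
  [set x | simplex x /\ forall v, v \notin A -> bary x v = 0].

(* The face opposite to the vertex v. *)
Definition face n (v : 'I_n.+1) : set 'rV[R]_n := subsimplex (~: [set v])%SET.

(* The affine map from the reference (n-1)-simplex onto that face. *)
Definition face_par n (v : 'I_n.+1) (y : 'rV[R]_(n.-1)) : 'rV[R]_n :=
  \sum_(k < n) bary y k *: vertex (lift v k).

End ReferenceSimplex.

(* The nodes of P_m on the d-simplex: the point of barycentric coordinates
   a_v / m, for nonnegative integers a_v of sum m. *)
Definition node (d m : nat) : finType :=
  {a : {ffun 'I_d.+1 -> 'I_m.+1} | (\sum_v a v == m)%N}.

Definition nodept (R : realType) d m (a : node d m) : 'rV[R]_d :=
  \row_i ((val a (lift ord0 i))%:R / m%:R).

(* The Lagrange basis function of the node a; the standard product formula in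
   barycentric coordinates (see lagE). *)
Definition lag (R : realType) d m (a : node d m) (x : 'rV[R]_d) : R :=
  \prod_(v < d.+1) \prod_(k < val a v) ((m%:R * bary x v - k%:R) / k.+1%:R).

Lemma bary_nodept (R : realType) d m (a : node d m) (v : 'I_d.+1) :
  (0 < m)%N -> bary (nodept R a) v = (val a v)%:R / m%:R.
Proof.
move=> m0; have mn0 : m%:R != 0 :> R by rewrite pnatr_eq0 -lt0n.
case: (unliftP ord0 v) => [i ->|->].
  by rewrite /bary /= valK /= mxE.
rewrite /bary /=; under eq_bigr do rewrite mxE.
rewrite -mulr_suml -natr_sum; apply: (mulIf mn0).
rewrite mulrBl !divfK// mul1r; apply/eqP; rewrite subr_eq -natrD.
have /eqP := valP a; rewrite big_ord_recl /= => am.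
by apply/eqP; congr _%:R; rewrite -[LHS]am.
Qed.

Lemma lagE (R : realType) d m (a b : node d m) :
  (0 < m)%N -> lag a (nodept R b) = (a == b)%:R.
Proof.
move=> m0; have mn0 : m%:R != 0 :> R by rewrite pnatr_eq0 -lt0n.
have -> : lag a (nodept R b) = \prod_(v < d.+1) \prod_(k < val a v)
    (((val b v)%:R - k%:R) / k.+1%:R).
  apply: eq_bigr => v _; apply: eq_bigr => k _.
  by rewrite bary_nodept// (mulrC m%:R) divfK.
have [<-|ab] := eqVneq a b.
  apply: big1 => v _; rewrite big_split /= prodfV.
  set n := (X in \prod_(_ < X) _ * _); rewrite (reindex_inj rev_ord_inj)/=.
  rewrite (_ : \prod_(_ < _) _ = \prod_(k < n) k.+1%:R).
    by rewrite divff//; apply/prodf_neq0 => k _; rewrite pnatr_eq0.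
  by apply: eq_bigr => k _; rewrite -natrB ?leq_subr// subKn.
have [v bav] : exists v, (val b v < val a v)%N.
  apply/existsP; apply: contraNT ab => /existsPn ab.
  have abv v : (val a v <= val b v)%N by rewrite leqNgt ab.
  have := leqif_sum (fun v (_ : xpredT v) => leqif_eq (abv v)).
  move=> [_]; rewrite (eqP (valP a)) (eqP (valP b)) eqxx => /esym/forallP eab.
  by apply/eqP/val_inj/ffunP => v; apply/val_inj/eqP; exact: eab.
by rewrite (bigD1 v)//= (bigD1 (Ordinal bav))//= subrr !mul0r.
Qed.

(* Connectivity of a mesh: conn j a is the global index of node a of element
   j.  Faces are pairs (element, local number of the opposite vertex). *)
Record mesh_top (d m : nat) := MeshTop {
  nelt : nat;
  npt : nat;
  conn : 'I_nelt -> node d m -> 'I_npt }.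
Arguments conn {d m} _ _ _.

Section Mesh.
Context {R : realType} {d m : nat} (T : mesh_top d m).
Local Notation faces := {set 'I_(nelt T) * 'I_d.+1}.
Implicit Types (a : 'I_(npt T) -> 'rV[R]_d) (j : 'I_(nelt T)) (F : faces).

Definition elmap a j (x : 'rV[R]_d) : 'rV[R]_d :=
  \sum_(b : node d m) lag b x *: a (conn T j b).

Definition elem a j : set 'rV[R]_d := elmap a j @` @simplex R d.

Definition domain a : set 'rV[R]_d := \bigcup_j elem a j.

Definition faces_set a F : set 'rV[R]_d :=
  \bigcup_(f in [set` F]) (elmap a f.1 @` @face R d f.2).

Definition face_nodes F : {set 'I_(npt T)} :=
  [set i | [exists f in F, exists b : node d m,
     (val b f.2 == 0%N :> nat) && (i == conn T f.1 b)]]%SET.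

(* Two elements meet in a common (possibly empty) proper subsimplex, spanned
   by the vertices S of j, on which a relabelling s of the vertices
   identifies their nodes. *)
Definition conforming a := forall j j', j != j' ->
  exists (S : {set 'I_d.+1}) (s : {perm 'I_d.+1}),
    [/\ exists v, v \notin S,
        elem a j `&` elem a j' = elmap a j @` @subsimplex R d S &
        forall b b' : node d m,
          (forall v, v \notin S -> val b v = 0%N :> nat) ->
          (forall v, val b' (s v) = val b v) ->
          conn T j b = conn T j' b'].

Definition is_mesh a :=
  [/\ forall j, set_inj (@simplex R d) (elmap a j),
      forall j x, simplex x -> \det ('J (elmap a j) x) != 0,
      conforming a &
      forall i, exists j b, conn T j b = i].

Definition pw_poly a k (f : 'rV[R]_d -> R) := forall j,
  exists2 q, polyfun k q & forall x, simplex x -> f (elmap a j x) = q x.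

Definition pw_polyv a k (f : 'rV[R]_d -> 'rV[R]_d) :=
  forall i, pw_poly a k (fun x => f x 0 i).

(* An element containing x, and the preimage of x under its element map. *)
Definition locate a (x : 'rV[R]_d) : option 'I_(nelt T) :=
  [pick j | `[< elem a j x >]].

Definition elinv a j (x : 'rV[R]_d) : 'rV[R]_d :=
  'pinv_(fun=> 0) (@simplex R d) (elmap a j) x.

Definition hat a (i : 'I_(npt T)) (x : 'rV[R]_d) : R :=
  if locate a x is Some j
  then \sum_(b : node d m | conn T j b == i) lag b (elinv a j x) else 0.

(* Surface integrals are computed in the parametrization of a face by the
   reference (d-1)-simplex; surf_elt is the (Gram) area element.  Mind that 'J
   acts on row vectors: it is the transpose of the usual Jacobian matrix. *)
Definition fpar a (f : 'I_(nelt T) * 'I_d.+1) (y : 'rV[R]_(d.-1)) : 'rV[R]_d :=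
  elmap a f.1 (face_par f.2 y).

Definition surf_elt a f (y : 'rV[R]_(d.-1)) : R :=
  Num.sqrt (\det ('J (fpar a f) y *m ('J (fpar a f) y)^T)).

Definition surf_ip a F (g h : 'rV[R]_d -> 'rV[R]_d) : R :=
  \sum_(f in F) vint (@simplex R d.-1) (fun y =>
     (\sum_i g (fpar a f y) 0 i * h (fpar a f y) 0 i) * surf_elt a f y).

Definition surf_L2_le a F (g : 'rV[R]_d -> 'rV[R]_d) (M : R) :=
  (forall f i, f \in F -> measurable_fun (@row_of R d.-1 @^-1` @simplex R d.-1)
     (fun t => g (fpar a f (row_of t)) 0 i)) /\
  (\sum_(f in F) \int[leb d.-1]_(t in @row_of R d.-1 @^-1` @simplex R d.-1)
     ((\sum_i g (fpar a f (row_of t)) 0 i ^+ 2)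
        * surf_elt a f (row_of t))%:E <= (M ^+ 2)%:E)%E.

End Mesh.

Record fsi_data (R : realType) (d m : nat) := FsiData {
  rho_f : R;  nu_f : R;  rho_s : R;
  dt : R;
  energy : 'M[R]_d -> R;                       (* W *)
  g_f : R -> 'rV[R]_d -> 'rV[R]_d;             (* data: time, then space *)
  g_s : R -> 'rV[R]_d -> 'rV[R]_d;
  u_b : R -> 'rV[R]_d -> 'rV[R]_d;
  sigma_fb : R -> 'rV[R]_d -> 'rV[R]_d;
  phi_b : R -> 'rV[R]_d -> 'rV[R]_d;
  sigma_sb : R -> 'rV[R]_d -> 'rV[R]_d;
  smesh : mesh_top d m;
  spt : 'I_(npt smesh) -> 'rV[R]_d;
  s_gamma : {set 'I_(nelt smesh) * 'I_d.+1};
  s_3 : {set 'I_(nelt smesh) * 'I_d.+1};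
  s_4 : {set 'I_(nelt smesh) * 'I_d.+1};
  fmesh : mesh_top d m;
  f_fs : {set 'I_(nelt fmesh) * 'I_d.+1};      (* faces on the FS interface *)
  f_1 : {set 'I_(nelt fmesh) * 'I_d.+1};
  f_2 : {set 'I_(nelt fmesh) * 'I_d.+1};
  Sigma1 : set 'rV[R]_d;
  Sigma2 : set 'rV[R]_d;
  (* index in the fluid mesh of an interface grid point of the solid mesh *)
  fs_index : 'I_(npt smesh) -> 'I_(npt fmesh) }.

(* The discrete unknowns at one time level; functions are total, only their
   values on the corresponding domain matter. *)
Record fsi_state (R : realType) (d m : nat) (D : fsi_data R d m) := FsiState {
  fpt : 'I_(npt (fmesh D)) -> 'rV[R]_d;
  vel : 'rV[R]_d -> 'rV[R]_d;                  (* u_h *)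
  prs : 'rV[R]_d -> R;                         (* p_h *)
  svel : 'rV[R]_d -> 'rV[R]_d;                 (* v_h *)
  spos : 'rV[R]_d -> 'rV[R]_d }.               (* phi_h *)

Section Scheme.
Context {R : realType} {d m : nat} (D : fsi_data R d m).
Implicit Types (s : fsi_state D) (n : nat) (t : R).
Local Notation vfield := ('rV[R]_d -> 'rV[R]_d).

Definition tk n : R := n%:R * dt D.
Definition Omega_s : set 'rV[R]_d := domain (@spt _ _ _ D).
Definition Omega_f s : set 'rV[R]_d := domain (fpt s).
Definition Gamma : set 'rV[R]_d := faces_set (@spt _ _ _ D) (s_gamma D).
Definition Sigma3 : set 'rV[R]_d := faces_set (@spt _ _ _ D) (s_3 D).
Definition gamma_nodes := face_nodes (s_gamma D).

Definition data_ok :=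
  [/\ is_mesh (@spt _ _ _ D),
      frontier Omega_s =
        faces_set (@spt _ _ _ D) (s_gamma D :|: s_3 D :|: s_4 D),
      [/\ [disjoint s_gamma D & s_3 D]%B, [disjoint s_gamma D & s_4 D]%B &
          [disjoint s_3 D & s_4 D]%B],
      [/\ [disjoint f_fs D & f_1 D]%B, [disjoint f_fs D & f_2 D]%B &
          [disjoint f_1 D & f_2 D]%B] &
      {in gamma_nodes &, injective (@fs_index _ _ _ D)} /\
      (@fs_index _ _ _ D) @: gamma_nodes = face_nodes (f_fs D)].

Definition fluid_mesh_ok s :=
  [/\ is_mesh (fpt s),
      frontier (Omega_f s) = faces_set (fpt s) (f_fs D :|: f_1 D :|: f_2 D),
      faces_set (fpt s) (f_1 D) = Sigma1 D,
      faces_set (fpt s) (f_2 D) = Sigma2 D &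
      forall i, i \in gamma_nodes -> fpt s (fs_index i) = spos s (spt i)].

Definition coupled s (u v : vfield) :=
  forall i, i \in gamma_nodes -> u (spos s (spt i)) = v (spt i).

Definition fluid_velocity s (u : vfield) :=
  {within Omega_f s, continuous u} /\ pw_polyv (fpt s) m u.

Definition solid_field (v : vfield) :=
  {within Omega_s, continuous v} /\ pw_polyv (@spt _ _ _ D) m v.

Definition fluid_pressure s (p : 'rV[R]_d -> R) :=
  {within Omega_f s, continuous p} /\ pw_poly (fpt s) m.-1 p.

(* The space V, for the fluid mesh and the solid position of s. *)
Definition in_V s (u : vfield) (p : 'rV[R]_d -> R) (v : vfield) :=
  [/\ fluid_velocity s u, fluid_pressure s p, solid_field v & coupled s u v].

Definition initial_ok s :=
  [/\ fluid_mesh_ok s, solid_field (spos s), fluid_velocity s (vel s),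
      solid_field (svel s) & coupled s (vel s) (svel s)].

(* In what follows s and s' are the states at t^(n-1) and t^n. *)
Definition Phi n s s' (x : 'rV[R]_d) (t : R) : 'rV[R]_d :=
  if locate (fpt s') x is Some j
  then ((t - tk n.-1) / dt D) *: x +
       ((tk n - t) / dt D) *: elmap (fpt s) j (elinv (fpt s') j x)
  else x.

Definition Omega_t n s s' t : set 'rV[R]_d :=
  (fun x => Phi n s s' x t) @` Omega_f s'.

Definition bext n s s' (V : Type) (f : 'rV[R]_d -> V) t (y : 'rV[R]_d) : V :=
  f ('pinv_(fun=> 0) (Omega_f s') (fun x => Phi n s s' x t) y).

(* w^n; the time derivative does not depend on the time t^n chosen here. *)
Definition mesh_velocity n s s' : vfield :=
  fun x => derive1 (Phi n s s' x) (tk n).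

(* The nodal values of u_h^(n-1), carried by the backward extended basis. *)
Definition fext n s s' t (y : 'rV[R]_d) : 'rV[R]_d :=
  \sum_i bext n s s' (hat (fpt s') i) t y *: vel s (fpt s i).

Definition mesh_motion_ok n s s' := forall t, tk n.-1 <= t <= tk n ->
  set_bij (Omega_f s') (Omega_t n s s' t) (fun x => Phi n s s' x t) /\
  forall j x, interior (elem (fpt s') j) x ->
    0 < \det ('J (fun z => Phi n s s' z t) x).

(* The interface, moving with velocity v_h^(n-1) over the time step, neither
   meets itself nor makes a new contact with the fixed boundary. *)
Definition collision_free n s := forall t, tk n.-1 <= t <= tk n ->
  let pos x := spos s x + (t - tk n.-1) *: svel s x in
  set_inj Gamma pos /\
  forall x, Gamma x -> (Sigma1 D `|` Sigma2 D) (pos x) ->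
    (Sigma1 D `|` Sigma2 D) (spos s x).

(* Pairs (tau_l, omega_l). *)
Definition quadrature n : seq (R * R) :=
  if d == 2%N then [:: (tk n - dt D / 2, 1)]
  else [:: (tk n - (1 / 2 + 1 / (2 * Num.sqrt 3)) * dt D, 1 / 2);
           (tk n - (1 / 2 - 1 / (2 * Num.sqrt 3)) * dt D, 1 / 2)].

Definition stress_f s (x : 'rV[R]_d) : 'M[R]_d :=
  (rho_f D * nu_f D) *: symgrad (vel s) x - (prs s x)%:M.

Definition stress_s (phi : vfield) (x : 'rV[R]_d) : 'M[R]_d :=
  dmx (energy D) (grad phi x).

Definition convection n s s' (phif : vfield) : R :=
  \sum_(q <- quadrature n) q.2 *
    ip (Omega_t n s s' q.1)
       (mxdiv (fun y => outer (bext n s s' (vel s') q.1 y)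
          (fext n s s' q.1 y - bext n s s' (mesh_velocity n s s') q.1 y)))
       (bext n s s' phif q.1).

Definition convection_correction n s s' (phif : vfield) : R :=
  \sum_(q <- quadrature n) q.2 *
    ip (Omega_t n s s' q.1)
       (fun y => (1 / 2 * div (fext n s s' q.1) y) *:
                   bext n s s' (vel s') q.1 y)
       (bext n s s' phif q.1).

Definition predicted s : vfield := fun x => spos s x + dt D *: svel s x.

Definition scheme_eq n s s' (phif : vfield) (q : 'rV[R]_d -> R)
    (phis : vfield) :=
  rho_f D / dt D *
    (ip (Omega_f s') (vel s') phif -
     ip (Omega_f s) (vel s) (bext n s s' phif (tk n.-1)))
  + rho_f D * convection n s s' phif
  - rho_f D * convection_correction n s s' phif
  + ip (Omega_f s') (stress_f s') (grad phif)
  - vint (Omega_f s') (fun x => div (vel s') x * q x)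
  + ip Omega_s (fun x => rho_s D *: ((dt D)^-1 *: (svel s' x - svel s x))) phis
  + ip Omega_s (stress_s (predicted s')) (grad phis)
  = ip (Omega_f s') (fun x => rho_f D *: g_f D (tk n) x) phif
    + surf_ip (fpt s') (f_2 D) (sigma_fb D (tk n)) phif
    + ip Omega_s (fun x => rho_s D *: g_s D (tk n) x) phis
    + surf_ip (@spt _ _ _ D) (s_4 D) (sigma_sb D (tk n)) phis.

Definition fsi_step n s s' :=
  [/\ forall x, Omega_s x -> spos s' x = spos s x + dt D *: svel s x,
      fluid_mesh_ok s' /\ mesh_motion_ok n s s',
      in_V s' (vel s') (prs s') (svel s'),
      (forall x, Sigma1 D x -> vel s' x = u_b D (tk n) x) /\
      (forall x, Sigma3 x ->
         svel s' x = derive1 (fun t => phi_b D t x) (tk n)) &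
      forall phif q phis, in_V s' phif q phis ->
        (forall x, Sigma1 D x -> phif x = 0) ->
        (forall x, Sigma3 x -> phis x = 0) ->
        scheme_eq n s s' phif q phis].

Definition fsi_run N (S : nat -> fsi_state D) :=
  initial_ok (S 0) /\
  forall n, (0 < n <= N)%N ->
    collision_free n (S n.-1) /\ fsi_step n (S n.-1) (S n).

Definition solid_energy (v phi : vfield) : R :=
  rho_s D / 2 * ip Omega_s v v + vint Omega_s (fun x => energy D (grad phi x)).

Definition dissipation s : R :=
  ip (Omega_f s) (symgrad (vel s)) (symgrad (vel s)).

Definition power n s : R :=
  ip (Omega_f s) (fun x => rho_f D *: g_f D (tk n) x) (vel s)
  + ip Omega_s (fun x => rho_s D *: g_s D (tk n) x) (svel s)
  + surf_ip (@spt _ _ _ D) (s_4 D) (sigma_sb D (tk n)) (svel s).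

Definition total_energy (S : nat -> fsi_state D) n : R :=
  2 * solid_energy (svel (S n)) (predicted (S n))
  + rho_f D * ip (Omega_f (S n)) (vel (S n)) (vel (S n))
  + \sum_(1 <= l < n.+1) rho_f D * nu_f D * dissipation (S l) * dt D.

Definition forces_le N (S : nat -> fsi_state D) (M : R) :=
  forall n, (0 < n <= N)%N ->
    [/\ L2_le (Omega_f (S n)) (g_f D (tk n)) M,
        L2_le Omega_s (g_s D (tk n)) M &
        surf_L2_le (@spt _ _ _ D) (s_4 D) (sigma_sb D (tk n)) M].

End Scheme.

(* Main.v *)
(* Everything is pulled back to the reference simplex.  For theta in [0, 1] let
   Psi_theta = (1 - theta) Psi^(n-1) + theta Psi^n be the element maps of the
   moving mesh.  The integral over Psi_theta(simplex) of (k / det Psi_theta') o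
   Psi_theta^-1 does not depend on theta: its time derivative is the integral of
   a divergence, and cut-offs remove the boundary.  So every integral of the
   scheme is the integral of a fixed function times a polynomial in theta, and no
   change of variables formula is needed.

   Tested with u^n, convection minus its correction is
   1/2 int div (|u|^2 (u^(n-1) - w)) - 1/2 int |u|^2 div w.  The field in the first
   term vanishes on the boundary of the fluid domain; as the moved map may
   degenerate on element boundaries for theta < 1, integration by parts is only
   done for theta near 1, and the term vanishes for all theta because it is
   polynomial in theta.  The second one is a time derivative of determinants, a
   polynomial of degree d - 1 in theta, which the quadrature integrates exactly.
   This gives the fluid part of the energy inequality; the solid part is
   convexity of W, and the pressure drops out by testing with q = p and q = 0.

   For the uniform bound, on the fixed solid mesh pointwise values and gradients
   of piecewise polynomials are controlled by the L^2 norm, and W lies above its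
   tangent at 0; Young's inequality bounds one step, and tk n <= T leaves finitely
   many steps. *)
From HB Require Import structures.
From mathcomp Require Import all_boot all_order all_algebra perm.
From mathcomp Require Import all_classical all_reals all_analysis.
From mathcomp Require Import measurable_realfun ring lra zify.
Require Import Defs.
Set Implicit Arguments.
Unset Strict Implicit.
Unset Printing Implicit Defensive.
Import Order.TTheory GRing.Theory Num.Theory.
Import numFieldNormedType.Exports HBNNSimple.
Local Open Scope classical_set_scope.
Local Open Scope ring_scope.

(** * Lebesgue measure on R^n *)

Section MeasureRn.
Context {R : realType}.
Local Notation mR := (measurableTypeR R).
Local Notation V n := ('rV[R]_n).

(** At intermediate times the motion is regular only inside the elements: determinants may tend to
    zero at their boundaries, and integrability of quotients by them is not clear. The argument
    starts at theta = 0, where the old mesh bounds them from below. As integrals with cut-off do not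
    depend on theta, the bound found there serves at all times. The transport velocity u^(n-1) - w^n
    is an interpolant of nodal values. These are zero on the interface, whose grid points move with
    v^(n-1), equal there to u^(n-1). On [Sigma1] the factor |u^n|^2 vanishes. Exact quadrature turns
    convection minus its correction into the integral of |u^n|^2 on the old domain minus that on the
    new one, over 2 dt. The old-domain part is exactly what Young's inequality costs for the mixed
    term <u^(n-1), u^n>. For the uniform bound the constants are fixed by recursion on n before the
    run is given. Inverse estimates are used on the solid mesh only: the fluid force is paired with
    |u^n|^2 itself, so that no constant depends on the fluid mesh or on its velocity. *)

Lemma rat_near (z e : R) : 0 < e -> exists q : rat, `|z - ratr q| < e.
Proof.
move=> e0; have /rat_in_itvoo[q] : z - e < z + e by lra.
by rewrite in_itv /= => /andP[q1 q2]; exists q; rewrite ltr_norml; lra.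
Qed.

Lemma dist_near3 (z w a e1 e : R) : `|z - a| < e1 -> `|w - a| < e1 -> e1 < e / 2 ->
  `|z - w| < e.
Proof. by rewrite !ltr_norml; lra. Qed.

Definition mset n (D : set (V n)) := measurable (@row_of R n @^-1` D).
Definition vol n (D : set (V n)) := leb n (@row_of R n @^-1` D).
Definition mfun n (D : set (V n)) (f : V n -> R) :=
  measurable_fun (@row_of R n @^-1` D) (f \o @row_of R n).

(** An open set is the union of the rational cubes inside it, a countable family; on tuples a cube
    is a finite intersection of preimages under coordinates. *)
Lemma mset_open n (U : set (V n)) : open U -> mset U.
Proof.
move=> oU; rewrite /mset.
pose B (p : n.-tuple rat * nat) : set (n.-tuple mR) :=
  [set t | forall i, `|tnth t i - ratr (tnth p.1 i)| < p.2.+1%:R^-1].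
have mB p : measurable (B p).
  rewrite (_ : B p = \bigcap_(i in [set: 'I_n]) ((fun t : n.-tuple mR => tnth t i) @^-1`
     [set x | `|x - ratr (tnth p.1 i)| < p.2.+1%:R^-1])); last first.
    apply/seteqP; split => t /= Bt i; first by move=> _; exact: Bt.
    exact: (Bt i I).
  apply: fin_bigcap_measurable => // i _.
  rewrite -[X in measurable X]setTI; apply: measurable_tnth => //.
  apply: open_measurable.
  rewrite (_ : [set x | _] = ball (ratr (tnth p.1 i) : R) p.2.+1%:R^-1).
    exact: ball_open.
  by apply/seteqP; split => x /=; rewrite -ball_normE /= distrC.
rewrite (_ : _ @^-1` _ = \bigcup_(p in [set p | B p `<=` @row_of R n @^-1` U]) B p).
  rewrite bigcup_mkcond; apply: countable_bigcupT_measurable => [|p].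
    exact: countableP.
  by case: ifPn.
apply/seteqP; split => [t /= Ut|t [p /= Bp Bpt]]; last exact: Bp.
have /nbhs_ballP[e /= e0 eU] := open_nbhs_nbhs (conj oU Ut).
have [k _ ke] : exists2 k : nat, True & k.+1%:R^-1 < e / 2 :> R.
  have e2 : 0 < e / 2 by rewrite divr_gt0.
  have [k _ /(_ k) ke] := near_infty_natSinv_lt (PosNum e2).
  by exists k => //; apply: ke => /=.
have k0 : 0 < k.+1%:R^-1 :> R by rewrite invr_gt0.
have rt i : exists q : rat, `|tnth t i - ratr q| < k.+1%:R^-1.
  exact: rat_near.
have {rt}[q rq] := choice rt.
exists ([tuple q i | i < n], k) => /=; last by move=> i; rewrite tnth_mktuple.
move=> s /= Bs; apply: eU; split => // i j.
rewrite !mxE /ball /= /ball_ /=.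
have := Bs j; rewrite /= tnth_mktuple => h.
exact: dist_near3 (rq j) h ke.
Qed.

Lemma mset_closed n (U : set (V n)) : closed U -> mset U.
Proof.
move=> cU; rewrite /mset -[U]setCK preimage_setC; apply: measurableC.
exact: (@mset_open _ (~` U) (closed_openC cU)).
Qed.

Lemma msetI n (A B : set (V n)) : mset A -> mset B -> mset (A `&` B).
Proof. by move=> mA mB; rewrite /mset preimage_setI; exact: measurableI. Qed.
Lemma msetU n (A B : set (V n)) : mset A -> mset B -> mset (A `|` B).
Proof. by move=> mA mB; rewrite /mset preimage_setU; exact: measurableU. Qed.
Lemma msetD n (A B : set (V n)) : mset A -> mset B -> mset (A `\` B).
Proof.
by move=> mA mB; rewrite /mset setDE preimage_setI preimage_setC -setDE; exact: measurableD.
Qed.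

Lemma mset_bigcup n (I : finType) (F : I -> set (V n)) :
  (forall i, mset (F i)) -> mset (\bigcup_i F i).
Proof.
move=> mF; rewrite /mset preimage_bigcup.
by apply: fin_bigcup_measurable => // i _; exact: mF.
Qed.

Lemma mfun_open n (U : set (V n)) (f : V n -> R) : open U ->
  {in U, continuous f} -> mfun U f.
Proof.
move=> oU cf; apply: (measurability _ (RGenOpens.measurableE R)).
move=> _ [_ [a [b ->] <-]].
have oI : open (U `&` f @^-1` `]a, b[).
  rewrite openE => x [Ux fx]; apply: filterI; first exact: open_nbhs_nbhs.
  apply: cf; first exact/mem_set.
  by apply: open_nbhs_nbhs; split => //; exact: interval_open.
exact: (mset_open oI).
Qed.

Lemma mfun_closed n (D : set (V n)) (f : V n -> R) : closed D ->
  {within D, continuous f} -> mfun D f.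
Proof.
move=> cD cf; apply: (measurability _ (RGenOpens.measurableE R)).
move=> _ [_ [a [b ->] <-]].
have /(_ `]a, b[%classic) := (continuousP _).1 cf.
have oab : open (`]a, b[%classic : set R) by exact: interval_open.
move=> /(_ oab) h.
have [W oW WD] := (open_subspaceP _ _).1 h.
suff -> : @row_of R n @^-1` D `&` (f \o @row_of R n) @^-1` `]a, b[ =
   @row_of R n @^-1` (W `&` D) by apply: msetI; [exact: mset_open|exact: mset_closed].
by rewrite WD; apply/seteqP; split => t /= [].
Qed.

Section negl.
Context d (T : measurableType d) (mu : {measure set T -> \bar R}).
Local Open Scope ereal_scope.

(* The integral of a nonnegative function is a supremum over simple functions, so that null sets can be discarded without measurability of the integrand. *)
Lemma integral_setD_negligible (D N : set T) (f : T -> \bar R) :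
  measurable N -> mu N = 0 ->
  \int[mu]_(x in D) f x = \int[mu]_(x in D `\` N) f x.
Proof.
move=> mN N0.
pose nn (G : T -> \bar R) := ereal_sup [set sintegral mu h |
   h in [set h : {nnsfun T >-> R} | forall x, (h x)%:E <= G x]].
have nnE G : (forall x, 0 <= G x) -> nn G = nn (G \_ (~` N)).
  move=> G0; apply/eqP; rewrite eq_le; apply/andP; split.
    apply: ub_ereal_sup => _ [h /= hG <-].
    have mNC : measurable (~` N) by exact: measurableC.
    have hE : (proj_nnsfun h mNC : T -> R) = (h : T -> R) \_ (~` N).
      by rewrite -mrestrict.
    apply: ereal_sup_ubound; exists (proj_nnsfun h mNC).
      by move=> x; rewrite hE !patchE; case: ifPn => // _.
    rewrite hE -integral_nnsfun// -setTD -ge0_negligible_integral//.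
    - by rewrite integral_nnsfun// patch_setT.
    - by apply/measurable_EFinP; exact: measurable_funTS.
    - by move=> x _; rewrite lee_fin.
  apply: le_ereal_sup => _ [h /= hG <-]; exists h => // x.
  by apply: (le_trans (hG x)); rewrite patchE; case: ifP => // _.
rewrite /integral -!/(nn _) nnE; last by move=> x; exact: funepos_ge0.
rewrite [X in _ - X]nnE; last by move=> x; exact: funeneg_ge0.
have rE (g : T -> \bar R) : (g \_ D) \_ (~` N) = g \_ (D `\` N).
  by rewrite setDE setIC patch_setI.
by rewrite !funepos_restrict !funeneg_restrict !rE.
Qed.

End negl.

Lemma le_vol n (A B : set (V n)) : mset A -> mset B -> A `<=` B -> (vol A <= vol B)%E.
Proof. by move=> mA mB AB; apply: le_measure; rewrite ?inE// => t; exact: AB. Qed.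

(* Derivatives of piecewise polynomial fields have junk values on the skeleton
   of the mesh, so integrability is only asked off a null set, which [vint]
   does not see. *)
Definition hasint n (D : set (V n)) (f : V n -> R) (I : R) :=
  exists N, [/\ mset N, vol N = 0%E, mset D,
    (leb n).-integrable (@row_of R n @^-1` (D `\` N)) (EFin \o (f \o @row_of R n)) &
    \int[leb n]_(t in @row_of R n @^-1` (D `\` N)) (f (row_of t)) = I].

Lemma pre_setD n (A B : set (V n)) :
  @row_of R n @^-1` (A `\` B) = @row_of R n @^-1` A `\` @row_of R n @^-1` B.
Proof. by []. Qed.

Lemma hasint_vint n (D : set (V n)) f I : hasint D f I -> vint D f = I.
Proof.
move=> [N [mN N0 mD intf <-]]; rewrite /vint /Rintegral pre_setD.
by rewrite (@integral_setD_negligible _ _ (leb n) _ (@row_of R n @^-1` N)).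
Qed.

Lemma hasint_uniq n (D : set (V n)) f I J : hasint D f I -> hasint D f J -> I = J.
Proof. by move=> /hasint_vint <- /hasint_vint <-. Qed.

Lemma vol0U n (N M : set (V n)) : mset N -> mset M -> vol N = 0%E -> vol M = 0%E ->
  vol (N `|` M) = 0%E.
Proof.
move=> mN mM N0 M0; apply/eqP; rewrite -measure_le0.
apply: (le_trans (@measureU2 _ _ _ (leb n) _ _ mN mM)).
by rewrite -[leLHS]/(vol N + vol M)%E N0 M0 adde0.
Qed.

(** Any larger null set serves as well, so that several integrals can be taken off a common one;
    linearity and monotonicity below rest on this. *)
Lemma hasint_enlarge n (D : set (V n)) f I : hasint D f I ->
  exists N, [/\ mset N, vol N = 0%E, mset D & forall M, mset M -> vol M = 0%E -> N `<=` M ->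
    (leb n).-integrable (@row_of R n @^-1` (D `\` M)) (EFin \o (f \o @row_of R n)) /\
    \int[leb n]_(t in @row_of R n @^-1` (D `\` M)) (f (row_of t)) = I].
Proof.
move=> [N [mN N0 mD intf <-]]; exists N; split => // M mM M0 NM; split.
  apply: (integrableS _ _ _ intf) => //; [exact: msetD|exact: msetD|].
  by move=> t [Dt Mt]; split => // /NM.
rewrite /Rintegral; congr fine; apply/esym.
rewrite (@integral_setD_negligible _ _ (leb n) _ (@row_of R n @^-1` M))//.
congr integral; apply/seteqP; split => t /=; first by move=> [[? ?] ?].
by move=> [? h]; split => //; split => // /NM.
Qed.

Lemma hasint_eq n (D : set (V n)) f g I N : mset N -> vol N = 0%E ->
  (forall x, D x -> ~ N x -> f x = g x) -> hasint D f I -> hasint D g I.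
Proof.
move=> mN N0 fg /hasint_enlarge[M [mM M0 mD h]].
have mNM : mset (N `|` M) by exact: msetU.
have [intf <-] := h (N `|` M) mNM (vol0U mN mM N0 M0) (@subsetUr _ _ _).
exists (N `|` M); split => //; first exact: vol0U.
  apply: eq_integrable intf; first exact: msetD.
  by move=> t; rewrite inE => -[Dt /not_orP[Nt _]] /=; rewrite fg.
by apply: eq_Rintegral => t; rewrite inE => -[Dt /not_orP[Nt _]] /=; rewrite fg.
Qed.

Lemma hasint_ext n (D : set (V n)) f g I : 
  (forall x, D x -> f x = g x) -> hasint D f I -> hasint D g I.
Proof.
by move=> fg; apply: (@hasint_eq _ _ _ _ _ set0) => [||x Dx _];
  rewrite /mset /vol ?preimage_set0 ?measure0//; exact: fg.
Qed.

Lemma hasintD n (D : set (V n)) f g I J : hasint D f I -> hasint D g J ->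
  hasint D (fun x => f x + g x) (I + J).
Proof.
move=> /hasint_enlarge[N [mN N0 mD h]] /hasint_enlarge[M [mM M0 _ k]].
have mNM : mset (N `|` M) by exact: msetU.
have v0 := vol0U mN mM N0 M0.
have [intf <-] := h (N `|` M) mNM v0 (@subsetUl _ _ _).
have [intg <-] := k (N `|` M) mNM v0 (@subsetUr _ _ _).
exists (N `|` M); split => //.
  apply: eq_integrable (integrableD _ intf intg); [exact: msetD| |exact: msetD].
  by move=> t _ /=; rewrite EFinD.
by rewrite RintegralD//; exact: msetD.
Qed.

Lemma hasintZ n (D : set (V n)) f I c : hasint D f I -> hasint D (fun x => c * f x) (c * I).
Proof.
move=> [N [mN N0 mD intf <-]]; exists N; split => //.
  apply: eq_integrable (integrableZl _ c intf); [exact: msetD| |exact: msetD].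
  by move=> t _ /=; rewrite EFinM.
by rewrite RintegralZl//; exact: msetD.
Qed.

Lemma hasint0 n (D : set (V n)) : mset D -> hasint D (fun=> 0) 0.
Proof.
move=> mD; exists set0; rewrite /mset /vol preimage_set0 measure0 setD0; split => //.
  exact: integrable0.
by rewrite /Rintegral /= integral0.
Qed.

Lemma hasint_sum n (D : set (V n)) (T : Type) (r : seq T) (P : pred T) (f : T -> V n -> R) (I : T -> R) :
  mset D -> (forall i, P i -> hasint D (f i) (I i)) ->
  hasint D (fun x => \sum_(i <- r | P i) f i x) (\sum_(i <- r | P i) I i).
Proof.
move=> mD h; elim: r => [|i r IH].
  by rewrite big_nil; apply: hasint_ext (hasint0 mD) => x _; rewrite big_nil.
rewrite big_cons; case: ifPn => Pi.
  by apply: hasint_ext (hasintD (h i Pi) IH) => x _; rewrite big_cons Pi.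
by apply: hasint_ext IH => x _; rewrite big_cons (negbTE Pi).
Qed.

Lemma hasint_le n (D : set (V n)) f g I J N : mset N -> vol N = 0%E ->
  (forall x, D x -> ~ N x -> f x <= g x) -> hasint D f I -> hasint D g J -> I <= J.
Proof.
move=> mN N0 fg hf hg.
have /hasint_enlarge[M [mM M0 mD h]] := hasintD hg (hasintZ (-1) hf).
have mNM : mset (N `|` M) by exact: msetU.
have [_ e] := h (N `|` M) mNM (vol0U mN mM N0 M0) (@subsetUr _ _ _).
rewrite -subr_ge0 -[- I]mulN1r -e; apply: Rintegral_ge0 => t [Dt /not_orP[Nt _]].
by rewrite mulN1r subr_ge0; exact: fg.
Qed.

Lemma hasint_bounded n (D : set (V n)) f C N : mset D -> (vol D < +oo)%E ->
  mset N -> vol N = 0%E -> mfun (D `\` N) f ->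
  (forall x, D x -> ~ N x -> `|f x| <= C) -> exists I, hasint D f I.
Proof.
move=> mD Doo mN N0 mf fC; eexists; exists N; split; [by []|by []|by []| |reflexivity].
apply: (@le_integrable _ _ _ _ _ (msetD mD mN) _ (cst C%:E)).
- exact/measurable_EFinP.
- move=> t [Dt Nt] /=; rewrite lee_fin.
  by apply: (le_trans (fC _ Dt Nt)); rewrite ler_norm.
- apply/integrableP; split => //; rewrite /= integral_cst; last exact: msetD.
  apply: lte_mul_pinfty => //.
  by apply: le_lt_trans Doo; apply: le_vol => //; exact: msetD.
Qed.

(** Meant for a mesh: U j is an open element and N contains the skeleton. *)
Lemma hasint_bigcup n (D : set (V n)) (T : finType) (U : T -> set (V n)) N f (I : T -> R) :
  mset D -> mset N -> vol N = 0%E -> (forall j, U j `<=` D) ->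
  (forall x, D x -> ~ N x -> exists j, U j x) ->
  (forall i j x, U i x -> U j x -> i = j) ->
  (forall j, hasint (U j) f (I j)) -> hasint D f (\sum_j I j).
Proof.
move=> mD mN N0 UD DU Udisj h.
have mU j : mset (U j) by have [? []] := h j.
have key j : hasint D (fun x => f x * \1_(U j) x) (I j).
  have [M [mM M0 _ intf <-]] := h j; exists M; split => //.
    have -> : EFin \o ((fun x => f x * \1_(U j) x) \o @row_of R n) =
       (EFin \o (f \o @row_of R n)) \_ (@row_of R n @^-1` U j).
      apply/funext => t /=; rewrite patchE /indic; case: ifPn => tU.
        have -> : row_of t \in U j by rewrite inE; exact: set_mem tU.
        by rewrite mulr1.
      suff -> : (row_of t \in U j) = false by rewrite mulr0.
      by apply/negbTE; apply: contra tU => /set_mem h'; apply/mem_set.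
    apply: (integrable_restrict (leb n) (mU j) (msetD mD mM) _).1.
    apply: integrableS intf; [exact: msetD (mU j) mM| |].
      by apply: measurableI; [exact: msetD|exact: mU].
    by move=> t [[_ h1] h2]; split.
  apply/esym; rewrite /Rintegral.
  have -> : (\int[leb n]_(x in row_of (n:=n) @^-1` (D `\` M)) (f (row_of x) * \1_(U j) (row_of x))%:E)%E
     = (\int[leb n]_(x in row_of (n:=n) @^-1` (D `\` M)) ((fun t => (f (row_of t))%:E) \_ (@row_of R n @^-1` U j)) x)%E.
    apply: eq_integral => t _; rewrite patchE /indic; case: ifPn => tU.
      have -> : row_of t \in U j by rewrite inE; exact: set_mem tU.
      by rewrite mulr1.
    suff -> : (row_of t \in U j) = false by rewrite mulr0.
    by apply/negbTE; apply: contra tU => /set_mem h'; apply/mem_set.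
  rewrite -integral_mkcondr; congr (fine _); congr integral.
  apply/seteqP; split => t /=; last by move=> [[? ?] ?]; split.
  by move=> [Ut Mt]; split => //; split => //; exact: UD Ut.
apply: hasint_eq mN N0 _ (@hasint_sum _ _ _ (index_enum T) xpredT _ _ mD (fun j _ => key j)) => x Dx Nx.
have [j Uj] := DU x Dx Nx.
rewrite (bigD1 j)//= big1 ?addr0 => [|i ij].
  by rewrite /indic mem_set// mulr1.
rewrite /indic memNset ?mulr0// => Ui; move: ij; rewrite (Udisj i j x)// eqxx.
by [].
Qed.

(** * Translation invariance, boxes and null sets *)

Definition shift_tuple n (v : V n) (t : n.-tuple mR) : n.-tuple mR :=
  [tuple tnth t i + v 0 i | i < n].

Lemma measurable_shift_tuple n (v : V n) : measurable_fun setT (shift_tuple v).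
Proof.
apply/measurable_fun_tnthP => i.
rewrite (_ : _ \o _ = (fun t : n.-tuple mR => tnth t i + v 0 i)); last first.
  by apply/funext => t /=; rewrite tnth_mktuple.
by apply: measurable_funD => //; exact: measurable_tnth.
Qed.

Lemma lebesgue_measure_shift (a : R) (A : set mR) : measurable A ->
  lebesgue_measure ((fun x : mR => (x + a) : mR) @^-1` A) = lebesgue_measure A.
Proof.
move=> mA.
have ma : measurable_fun setT (fun x : mR => (x + a) : mR).
  exact: measurable_funD.
apply/esym; apply: (@lebesgue_measure_unique _ (pushforward lebesgue_measure (fun x : mR => (x + a) : mR))) => //.
move=> _ [[b c] _ <-] /=; rewrite /pushforward.
rewrite (_ : _ @^-1` _ = `]b - a, c - a]%classic); last first.
  by apply/seteqP; split => x /=; rewrite !in_itv /= => /andP[? ?]; apply/andP; split; lra.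
rewrite !lebesgue_measure_itv /= !lte_fin ltrD2r; case: ifP => // _.
by rewrite -!EFinB; congr EFin; lra.
Qed.

(** Induction on the dimension: [leb n.+1] is an integral of measures of sections, each section is
    shifted by the remaining coordinates, and the outer integral is invariant in dimension one. *)
Lemma leb_shift n (v : V n) (A : set (n.-tuple mR)) : measurable A ->
  leb n (shift_tuple v @^-1` A) = leb n A.
Proof.
elim: n => [|n IH] in v A *.
  move=> mA; congr (leb 0 _); apply/seteqP; split => t /=;
  by rewrite (tuple0 (shift_tuple v t)) (tuple0 t).
move=> mA /=; rewrite /leb_step /pushforward /product_measure1.
pose v' : V n := \row_i v 0 (lift ord0 i).
have mtA : measurable (@tcons R n @^-1` A).
  by rewrite -[X in measurable X]setTI; exact: measurable_tcons.
transitivity (\int[@lebesgue_measure R]_x ((fun x : mR => leb n (xsection (@tcons R n @^-1` A) x)) \o (fun x : mR => (x + v 0 ord0)%R : mR)) x)%E.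
  apply: eq_integral => x _ /=; rewrite -(IH v' (xsection (@tcons R n @^-1` A) (x + v 0 ord0)%R)); last first.
    by apply: measurable_xsection; exact: mtA.
  congr (leb n _); apply/seteqP; split => t; rewrite /xsection /= !inE /=.
  - set t1 := shift_tuple _ _; set t2 := tcons _; suff -> : t1 = t2 by [].
    apply/eq_from_tnth => i; rewrite tnth_mktuple /t2 /tcons.
    case: (unliftP ord0 i) => [j|] ->; last by rewrite !tnth0.
    by rewrite !tnthS tnth_mktuple mxE.
  - set t1 := shift_tuple _ (tcons _); set t2 := tcons _; suff -> : t1 = t2 by [].
    apply/eq_from_tnth => i; rewrite tnth_mktuple /t2 /tcons.
    case: (unliftP ord0 i) => [j|] ->; last by rewrite !tnth0.
    by rewrite !tnthS tnth_mktuple mxE.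
pose m := pushforward (@lebesgue_measure R) (fun x : mR => (x + v 0 ord0) : mR).
have ma : measurable_fun setT (fun x : mR => (x + v 0 ord0) : mR).
  exact: measurable_funD.
have mF : measurable_fun setT (fun x : mR => leb n (xsection (@tcons R n @^-1` A) x)).
  exact: measurable_fun_xsection.
rewrite -(@ge0_integral_pushforward _ _ _ _ _ _ ma lebesgue_measure setT
  (fun x : mR => leb n (xsection (@tcons R n @^-1` A) x)))//.
apply: eq_measure_integral => B mB _.
exact: lebesgue_measure_shift.
Qed.

(** The closed ball of the sup norm ([cboxP]), in coordinates so that its volume is a product. *)
Definition cbox n (c : V n) (r : R) : set (V n) :=
  [set x | forall i, c 0 i - r <= x 0 i <= c 0 i + r].

Lemma vol_cbox n (c : V n) r : 0 <= r -> vol (cbox c r) = ((r *+ 2) ^+ n)%:E.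
Proof.
move=> r0; elim: n c => [|n IH] c.
  rewrite /vol /= /dirac /indic /= mem_set//; last by move=> [].
pose c' : V n := \row_i c 0 (lift ord0 i).
rewrite /vol /= /leb_step /pushforward.
rewrite (_ : _ @^-1` _ = `[c 0 ord0 - r, c 0 ord0 + r]%classic `*` (@row_of R n @^-1` cbox c' r)).
  rewrite product_measure1E//; last first.
    rewrite (_ : _ @^-1` _ = \bigcap_(i in [set: 'I_n]) ((fun t : n.-tuple mR => tnth t i) @^-1`
     `[c' 0 i - r, c' 0 i + r]%classic)); last first.
      apply/seteqP; split => [t /= Bt i _|t /= Bt i].
        by have /= := Bt i; rewrite [row_of t _ _]mxE => h; rewrite /= in_itv.
      by have := Bt i I; rewrite /= in_itv /= [row_of t _ _]mxE.
    apply: fin_bigcap_measurable => // i _.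
    by rewrite -[X in measurable X]setTI; apply: measurable_tnth.
  rewrite -[X in (_ * X)%E]/(vol (cbox c' r)) IH exprS EFinM; congr (_ * _)%E.
  etransitivity; first exact: lebesgue_measure_itv.
  rewrite /= lte_fin; case: ltP => h.
    by rewrite -EFinB; congr EFin; lra.
  have -> : r = 0 by lra.
  by rewrite mul0rn.
apply/seteqP; split => [[x t]|[x t]] /=.
  move=> h; split; first by have := h ord0; rewrite mxE tnth0 in_itv.
  by move=> i; have := h (lift ord0 i); rewrite !mxE tnthS.
rewrite in_itv /= => -[h1 h2] i; rewrite mxE.
case: (unliftP ord0 i) => [j|] ->; last by rewrite tnth0.
by have := h2 j; rewrite !mxE tnthS.
Qed.

Lemma closed_cbox n (c : V n) r : closed (cbox c r).
Proof.
rewrite (_ : cbox c r = \bigcap_(i in [set: 'I_n]) ((fun x : V n => x 0 i) @^-1` `[c 0 i - r, c 0 i + r]%classic)).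
  apply: closed_bigI => i _; apply: closed_comp; last exact: interval_closed.
  by move=> x _; exact: coord_continuous.
apply/seteqP; split => [t /= Bt i _|t /= Bt i]; first by have := Bt i; rewrite /= in_itv.
by have := Bt i I; rewrite /= in_itv.
Qed.

Lemma mset_cbox n (c : V n) r : mset (cbox c r).
Proof. by apply: mset_closed; exact: closed_cbox. Qed.

Lemma cboxP n (c x : V n) r : 0 <= r -> cbox c r x <-> `|x - c| <= r.
Proof.
move=> r0; split => h.
  rewrite -[leLHS]/(mx_norm _) mx_normrE; apply: bigmax_le => //= -[i j] _; rewrite !mxE ord1 ler_norml.
  by have := h j; lra.
move=> i; have : `|(x - c) 0 i| <= r.
  apply: le_trans h; rewrite -[leRHS]/(mx_norm _) mx_normrE.
  exact: (le_bigmax _ (fun ij : 'I_1 * 'I_n => `|(x - c) ij.1 ij.2|) (0, i)).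
by rewrite !mxE ler_norml; lra.
Qed.

Lemma row_of_shift n (v : V n) t : row_of (shift_tuple v t) = row_of t + v.
Proof. by apply/rowP => i; rewrite !mxE tnth_mktuple. Qed.

Lemma Rintegral_shift n (v : V n) (f : V n -> R) : mfun setT f ->
  (leb n).-integrable setT (EFin \o (f \o @row_of R n)) ->
  (leb n).-integrable setT (fun t => (f (row_of t + v))%:E) /\
  \int[leb n]_t f (row_of t + v) = \int[leb n]_t f (row_of t).
Proof.
move=> mf intf.
have ms := measurable_shift_tuple v.
have mf' : measurable_fun setT (EFin \o (f \o @row_of R n)) by exact/measurable_EFinP.
have e1 : (fun t => (f (row_of t + v))%:E) = (EFin \o (f \o @row_of R n)) \o shift_tuple v.
  by apply/funext => t /=; rewrite row_of_shift.
have intp : (pushforward (leb n) (shift_tuple v)).-integrable setT (EFin \o (f \o @row_of R n)).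
  apply/integrableP; split => //.
  have /integrableP[_] := intf; congr (_ < _)%E.
  apply: eq_measure_integral => A mA _; apply/esym; exact: leb_shift.
have ints : (leb n).-integrable (shift_tuple v @^-1` setT) ((EFin \o (f \o @row_of R n)) \o shift_tuple v).
  apply/integrableP; split; first exact: measurableT_comp.
  have /integrableP[_] := intp; congr (_ < _)%E.
  rewrite (@ge0_integral_pushforward _ _ _ _ _ _ ms (leb n) setT)//.
  exact: measurableT_comp.
split; first by rewrite e1.
rewrite /Rintegral; congr fine; rewrite e1.
have := integral_pushforward ms mf' ints measurableT.
rewrite preimage_setT => <-; apply: eq_measure_integral => A mA _; exact: leb_shift.
Qed.

Lemma vol_bounded n (A : set (V n)) r : mset A -> (forall x, A x -> `|x| <= r) -> (vol A < +oo)%E.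
Proof.
move=> mA Ar; pose r' := Num.max 0 r.
have r'0 : 0 <= r' by rewrite le_max lexx.
apply: (@le_lt_trans _ _ (vol (cbox 0 r'))).
  apply: le_vol => //; first exact: mset_cbox.
  move=> x Ax; apply/cboxP => //; rewrite subr0 le_max Ar ?orbT//.
by rewrite vol_cbox// ltry.
Qed.

(* The difference quotients of g have integral 0 by translation invariance, and
   converge dominatedly. *)
Lemma ibp n (i : 'I_n) (g g' : V n -> R) (L r rho C : R) (N : set (V n)) :
  mfun setT g -> (forall x, `|g x| <= C) -> (forall x, rho < `|x| -> g x = 0) ->
  0 < r -> (forall x s, `|s| < r -> `|g (x + s *: delta_mx 0 i) - g x| <= L * `|s|) ->
  mset N -> vol N = 0%E ->
  (forall x, ~ N x ->
    k.+1%:R * (g (x + k.+1%:R^-1 *: delta_mx 0 i) - g x) @[k --> \oo] --> g' x) ->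
  hasint setT g' 0.
Proof.
move=> mg gC g0 r0 gL mN N0 gg'.
(* The steps [(k + k0).+1%:R^-1] stay below r, where the Lipschitz bound on increments is
   available. *)
have [k0 _ /(_ _ (leqnn _)) /= k0r] := near_infty_natSinv_lt (PosNum r0).
pose h k : R := (k + k0).+1%:R^-1.
have h0 k : 0 < h k by rewrite invr_gt0.
have hr k : h k < r.
  apply: le_lt_trans k0r; rewrite lef_pV2 ?posrE// ler_nat ltnS; exact: leq_addl.
have h1 k : h k <= 1 by rewrite invf_le1 ?ltr0n// ler1n.
have hn k : `|h k| = h k by rewrite gtr0_norm.
pose e : V n := delta_mx 0 i.
have e1 : `|e| <= 1.
  rewrite -[e]subr0; apply: (cboxP 0 e ler01).1 => j; rewrite /e !mxE /=.
  by case: (j == i); rewrite /= ?sub0r ?add0r ?mulr1n ?mulr0n; apply/andP; split; lra.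
pose f k (x : V n) := (h k)^-1 * (g (x + h k *: e) - g x).
have mgs v : mfun setT (fun x => g (x + v)).
  have -> : mfun setT (fun x => g (x + v)) = measurable_fun setT ((g \o @row_of R n) \o shift_tuple v).
    by congr measurable_fun; apply/funext => t /=; rewrite row_of_shift.
  by apply: measurableT_comp => //; exact: measurable_shift_tuple.
have mf k : mfun setT (f k).
  by apply: measurable_funM => //; apply: measurable_funB => //; exact: mgs.
have intg : (leb n).-integrable setT (EFin \o (g \o @row_of R n)).
  have B : mset (cbox (0 : V n) (Num.max 0 rho)) by exact: mset_cbox.
  have C0 : 0 <= C by apply: le_trans (gC 0).
  apply: (@le_integrable _ _ _ (leb n) _ measurableT _ (fun t => (C * \1_(@row_of R n @^-1` cbox (0 : V n) (Num.max 0 rho)) t)%:E)).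
  - exact/measurable_EFinP.
  - move=> t _ /=; rewrite lee_fin.
    have [xr|xr] := leP `|row_of t| rho.
      rewrite /indic mem_set; last by apply/cboxP; rewrite ?le_max ?lexx// subr0 xr orbT.
      by rewrite mulr1 (le_trans (gC _))// ler_norm.
    by rewrite g0// normr0.
  - apply/integrableP; split; first by apply/measurable_EFinP; apply: measurable_funM => //; exact: measurable_indic.
    under eq_integral do rewrite gee0_abs ?lee_fin ?mulr_ge0// EFinM.
    rewrite ge0_integralZl//; last by apply/measurable_EFinP; exact: measurable_indic.
    rewrite integral_indic// setIT lte_mul_pinfty//.
    apply: (@vol_bounded _ _ (Num.max 0 rho)) => // x /cboxP; rewrite subr0; apply.
    by rewrite le_max lexx.
have intf k : (leb n).-integrable setT (EFin \o (f k \o @row_of R n)) /\ \int[leb n]_t f k (row_of t) = 0.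
  have [i1 i2] := Rintegral_shift (h k *: e) mg intg.
  have ib : (leb n).-integrable setT (EFin \o (fun t => g (row_of t + h k *: e) - g (row_of t))).
    by apply: eq_integrable (integrableB _ i1 intg).
  split; last by rewrite /f RintegralZl// RintegralB// i2 subrr mulr0.
  by apply: eq_integrable (integrableZl _ _ ib) => //.
have mD : measurable (@row_of R n @^-1` (setT `\` N)).
  by apply: (@msetD _ setT) => //; rewrite /mset preimage_setT.
pose D := @row_of R n @^-1` (setT `\` N).
have fcv t : D t -> (f k (row_of t))%:E @[k --> \oo] --> (g' (row_of t))%:E.
  move=> [_ /= Nt]; apply: cvg_EFin; first exact: nearW.
  have := gg' _ Nt; rewrite -(cvg_shiftn k0); apply: cvg_trans.
  by apply: near_eq_cvg; apply: nearW => k; rewrite /f /h /= invrK.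
(* Dominating function: the steps are at most 1, so that the quotients vanish off the box enlarged
   by 1. *)
pose G (t : n.-tuple mR) := (L * \1_(@row_of R n @^-1` cbox (0 : V n) (Num.max 0 rho + 1)) t).
have L0 : 0 <= L.
  have := le_trans (normr_ge0 _) (gL 0 (h 0%N) _); rewrite hn => /(_ (hr 0%N)).
  by rewrite pmulr_lge0.
have rho0 : 0 <= Num.max 0 rho + 1 by rewrite addr_ge0// le_max lexx.
have fG k t : (`|f k (row_of t)| <= G t).
  rewrite /f normrM normfV hn /G.
  have [xr|xr] := leP `|row_of t| (Num.max 0 rho + 1).
    rewrite /indic mem_set ?mulr1; last by apply/cboxP; rewrite ?subr0.
    rewrite ler_pdivrMl// mulrC -{2}(hn k); apply: gL; rewrite hn; exact: hr.
  rewrite !g0 ?subr0 ?normr0 ?mulr0 ?mulr_ge0//.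
    by apply: le_lt_trans xr; rewrite (@le_trans _ _ (Num.max 0 rho)) ?le_max ?lexx ?orbT// lerDl.
  have : `|row_of t| <= `|row_of t + h k *: e| + 1.
    rewrite -{1}[row_of t](addrK (h k *: e)) (le_trans (ler_normB _ _))// lerD2l normrZ hn.
    by rewrite mulr_ile1 ?h1// ltW.
  have : rho <= Num.max 0 rho by rewrite le_max lexx orbT.
  by lra.
have intG : (leb n).-integrable D (EFin \o G).
  apply/integrableP; split.
    by apply/measurable_EFinP; apply: measurable_funM => //; apply: measurable_indic; exact: mset_cbox.
  have mcb : mset (cbox (0 : V n) (Num.max 0 rho + 1)) by exact: mset_cbox.
  under eq_integral do rewrite /= ger0_norm ?mulr_ge0// /G EFinM.
  rewrite ge0_integralZl//; last by apply/measurable_EFinP; exact: measurable_indic.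
  rewrite integral_indic// lte_mul_pinfty//.
  apply: (@le_lt_trans _ _ (vol (cbox (0 : V n) (Num.max 0 rho + 1)))).
    apply: (@le_vol _ (cbox (0 : V n) (Num.max 0 rho + 1) `&` (setT `\` N))) => //.
    exact: msetI.
  by rewrite vol_cbox// ltry.
have mf' k : measurable_fun D (fun t => (f k (row_of t))%:E).
  by apply/measurable_EFinP; apply: (measurable_funS measurableT _ (mf k)).
have mg' : measurable_fun D (fun t => (g' (row_of t))%:E).
  by apply: emeasurable_fun_cvg fcv => k; exact: mf'.
have [ig' _ cvi] := @dominated_convergence _ _ _ (leb n) D mD _ _ (EFin \o G) mf' mg'
  (aeW _ fcv) intG (aeW _ (fun t k _ => fG k t)).
exists N; split => //; first by rewrite /mset preimage_setT.
have e0 k : (\int[leb n]_(t in D) (f k (row_of t))%:E)%E = 0%:E.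
  have [ifk ik] := intf k; have := congr1 EFin ik.
  rewrite /Rintegral (@integral_setD_negligible _ _ (leb n) _ (@row_of R n @^-1` N))// fineK.
    by move=> e2; exact: e2.
  apply: integrable_fin_num => //; apply: integrableS ifk => //.
have -> : \int[leb n]_(t in D) g' (row_of t) = fine 0%:E; last by [].
congr fine; move/cvg_lim : cvi => <- //.
by under eq_fun do rewrite e0; rewrite lim_cst.
Qed.

Lemma vol_bigcup_le n (T : finType) (B : T -> set (V n)) (A : set (V n)) :
  mset A -> (forall i, mset (B i)) -> A `<=` \bigcup_i B i ->
  (vol A <= \sum_i vol (B i))%E.
Proof.
move=> mA mB AB.
have key (r : seq T) : mset (\big[setU/set0]_(i <- r) B i) /\
   (vol (\big[setU/set0]_(i <- r) B i) <= \sum_(i <- r) vol (B i))%E.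
  elim: r => [|i r [IH1 IH2]].
    by rewrite !big_nil /mset /vol preimage_set0 measure0.
  rewrite !big_cons; split; first exact: msetU.
  apply: (le_trans (@measureU2 _ _ _ (leb n) _ _ (mB i) IH1)).
  by apply: leeD => //.
have [k1 k2] := key (index_enum T).
apply: le_trans k2; apply: le_vol => // x /AB[i _ Bi].
by rewrite (bigD1 i)//=; left.
Qed.

(* The code puts the image into N ^ n boxes of side C / N in
   dimension n + 1: its volume is O(1 / N). *)
Lemma vol0_code n (X : Type) (F : set X) (g : X -> V n.+1) (C : R)
   (code : forall N : nat, X -> {ffun 'I_n -> 'I_N.+1}) : 0 <= C -> closed (g @` F) ->
  (forall N x y, (0 < N)%N -> F x -> F y -> code N x = code N y ->
     `|g x - g y| <= C / N%:R) ->
  vol (g @` F) = 0%E.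
Proof.
move=> C0 cF hc.
(* With N + 1 in place of N there are at most (N + 2)^n boxes of volume (2 C / (N + 1))^(n + 1); the
   factor 2^n bounds ((N + 2) / (N + 1))^n. *)
pose K := 2 ^+ n * (C *+ 2) ^+ n.+1.
have K0 : 0 <= K by rewrite mulr_ge0// exprn_ge0// mulrn_wge0.
suff h N : (vol (g @` F) <= (K / N.+1%:R)%:E)%E.
  apply/eqP; rewrite -measure_le0; apply/lee_addgt0Pr => e e0; rewrite add0e.
  have Ke : 0 < e / (K + 1) by rewrite divr_gt0// ltr_wpDl.
  have [N _ /(_ _ (leqnn _)) /= Ne] := near_infty_natSinv_lt (PosNum Ke).
  apply: (le_trans (h N)); rewrite lee_fin.
  apply: (@le_trans _ _ ((K + 1) * N.+1%:R^-1)); first by rewrite ler_wpM2r// lerDl.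
  by rewrite mulrC -ler_pdivlMr ?ltr_wpDl// ltW.
have [c hcen] : exists c : {ffun 'I_n -> 'I_N.+2} -> V n.+1,
    forall x, F x -> `|g x - c (code N.+1 x)| <= C / N.+1%:R.
  have /choice[c hc'] : forall k : {ffun 'I_n -> 'I_N.+2}, exists y, forall x, F x -> code N.+1 x = k ->
      `|g x - y| <= C / N.+1%:R.
    move=> k; have [[x0 [Fx0 ck]]|nx] := pselect (exists x, F x /\ code N.+1 x = k).
      by exists (g x0) => x Fx cx; apply: hc => //; rewrite cx ck.
    by exists 0 => x Fx cx; exfalso; apply: nx; exists x.
  by exists c => x Fx; exact: hc'.
have r0 : 0 <= C / N.+1%:R by rewrite divr_ge0.
have sub : g @` F `<=` \bigcup_k cbox (c k) (C / N.+1%:R).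
  by move=> _ [x Fx <-]; exists (code N.+1 x) => //; apply/cboxP => //; exact: hcen.
apply: (@le_trans _ _ (\sum_(k : {ffun 'I_n -> 'I_N.+2}) vol (cbox (c k) (C / N.+1%:R)))%E).
  by apply: vol_bigcup_le => // [|k]; [exact: mset_closed|exact: mset_cbox].
under eq_bigr do rewrite vol_cbox//.
rewrite sumEFin sumr_const card_ffun !card_ord lee_fin -[X in X <= _]mulr_natl natrX.
set M : R := N.+1%:R; have M0 : 0 < M by rewrite ltr0n.
have -> : C / M *+ 2 = (C *+ 2) * M^-1 by rewrite mulrnAl.
rewrite exprMn /K ler_pdivlMr// -!mulrA.
have M1 : M^-1 ^+ n.+1 * M = M^-1 ^+ n by rewrite exprSr -mulrA mulVf ?mulr1// gt_eqF.
rewrite M1 mulrCA [leRHS]mulrC ler_wpM2l// ?exprn_ge0 ?mulrn_wge0//.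
rewrite -exprMn; apply: lerXn2r; rewrite ?nnegrE ?mulr_ge0 ?invr_ge0// ?(ltW M0)//.
rewrite ler_pdivrMr// /M -[N.+2]addn1 natrD.
have : 1 <= N.+1%:R :> R by rewrite ler1n.
by lra.
Qed.

End MeasureRn.

(** Completeness, for the fixed point theorem in [solve_ball]. *)
HB.instance Definition _ (R : realType) n := Complete.on 'rV[R]_n.

(** * Polynomials and Hadamard derivatives *)

Section Poly.
Context {R : realType}.
Local Notation V n := ('rV[R]_n).
Local Notation Z n := (R * 'rV[R]_n)%type.

(* Polynomials in a time and a space variable, given by closure rules only:
   the monomials are never needed. *)
Inductive isP n : (Z n -> R) -> Prop :=
| isP_cst c : isP (fun=> c)
| isP_fst : isP fst
| isP_coord i : isP (fun z => z.2 0 i)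
| isP_add f g : isP f -> isP g -> isP (fun z => f z + g z)
| isP_mul f g : isP f -> isP g -> isP (fun z => f z * g z).

Lemma isP_ext n (f g : Z n -> R) : f =1 g -> isP f -> isP g.
Proof. by move=> /funext ->. Qed.

Lemma isP_sum n (T : Type) (r : seq T) (P : pred T) (f : T -> Z n -> R) :
  (forall i, P i -> isP (f i)) -> isP (fun z => \sum_(i <- r | P i) f i z).
Proof.
move=> h; elim: r => [|i r IH].
  by apply: isP_ext (isP_cst _ 0) => z; rewrite big_nil.
case Pi : (P i); last by apply: isP_ext IH => z; rewrite big_cons Pi.
by apply: isP_ext (isP_add (h i Pi) IH) => z; rewrite big_cons Pi.
Qed.

Lemma isP_prod n (T : Type) (r : seq T) (P : pred T) (f : T -> Z n -> R) :
  (forall i, P i -> isP (f i)) -> isP (fun z => \prod_(i <- r | P i) f i z).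
Proof.
move=> h; elim: r => [|i r IH].
  by apply: isP_ext (isP_cst _ 1) => z; rewrite big_nil.
case Pi : (P i); last by apply: isP_ext IH => z; rewrite big_cons Pi.
by apply: isP_ext (isP_mul (h i Pi) IH) => z; rewrite big_cons Pi.
Qed.

Lemma isP_opp n (f : Z n -> R) : isP f -> isP (fun z => - f z).
Proof. by move=> Pf; apply: isP_ext (isP_mul (isP_cst _ (-1)) Pf) => z; rewrite mulN1r. Qed.

Lemma isP_sub n (f g : Z n -> R) : isP f -> isP g -> isP (fun z => f z - g z).
Proof. by move=> Pf Pg; apply: isP_add => //; exact: isP_opp. Qed.

Lemma isP_exp n (f : Z n -> R) k : isP f -> isP (fun z => f z ^+ k).
Proof.
move=> Pf; elim: k => [|k IH]; first by apply: isP_ext (isP_cst _ 1) => z; rewrite expr0.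
by apply: isP_ext (isP_mul Pf IH) => z; rewrite exprS.
Qed.

Lemma isP_det n k (M : Z n -> 'M[R]_k) : (forall i j, isP (fun z => M z i j)) ->
  isP (fun z => \det (M z)).
Proof.
move=> h; rewrite /determinant; apply: isP_sum => s _.
apply: isP_mul; first exact: isP_cst.
by apply: isP_prod => i _.
Qed.

Lemma isP_adj n k (M : Z n -> 'M[R]_k) i j : (forall i j, isP (fun z => M z i j)) ->
  isP (fun z => (\adj (M z)) i j).
Proof.
move=> h; apply: (@isP_ext _ (fun z => cofactor (M z) j i)) => [z|]; first by rewrite mxE.
rewrite /cofactor; apply: isP_mul; first exact: isP_cst.
apply: isP_det => i' j'; apply: isP_ext (h (lift j i') (lift i j')) => z.
by rewrite !mxE.
Qed.

Lemma isP_comp n k (f : Z n -> R) (G : Z k -> Z n) : isP f ->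
  isP (fun z => (G z).1) -> (forall i, isP (fun z => (G z).2 0 i)) -> isP (f \o G).
Proof.
move=> + G1 G2; elim=> [c||i|g h _ IHg _ IHh|g h _ IHg _ IHh].
- exact: isP_cst.
- exact: G1.
- exact: G2.
- exact: isP_add IHg IHh.
- exact: isP_mul IHg IHh.
Qed.

Lemma isP_cont n (f : Z n -> R) : isP f -> continuous f.
Proof.
elim=> [c||i|g h _ IHg _ IHh|g h _ IHg _ IHh] z.
- exact: cst_continuous.
- exact: cvg_fst.
- apply: (@continuous_comp _ _ _ snd (fun x : V n => x 0 i)); first exact: cvg_snd.
  exact: coord_continuous.
- exact: continuousD (IHg z) (IHh z).
- exact: continuousM (IHg z) (IHh z).
Qed.

Lemma isP_at n (f : Z n -> R) (z : Z n) : isP f -> f w @[w --> z] --> f z.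
Proof. by move=> Pf; apply: isP_cont. Qed.

Lemma near_all (T : topologicalType) (z : T) (P : T -> Prop) : (forall w, P w) -> nbhs z P.
Proof. by move=> h; exact: (filterS (fun w _ => h w) filterT). Qed.

Lemma near_forall (T : topologicalType) (z : T) (I : finType) (P : I -> T -> Prop) :
  (forall i, nbhs z (P i)) -> nbhs z (fun w => forall i, P i w).
Proof. by move=> h; apply: filter_forall. Qed.

Lemma cvg_sumR (T : Type) (F : set_system T) (FF : Filter F) (I : Type) (r : seq I)
  (f : I -> T -> R) (a : I -> R) : (forall i, f i x @[x --> F] --> a i) ->
  \sum_(i <- r) f i x @[x --> F] --> \sum_(i <- r) a i.
Proof.
move=> h; elim: r => [|i r IH].
  under eq_fun do rewrite big_nil; rewrite big_nil; exact: cvg_cst.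
under eq_fun do rewrite big_cons; rewrite big_cons; exact: cvgD.
Qed.

Lemma cvg_rV (T : Type) (F : set_system T) (FF : Filter F) n (X : T -> V n) (x : V n) :
  (forall i, X t 0 i @[t --> F] --> x 0 i) -> X t @[t --> F] --> x.
Proof.
move=> h; apply/cvg_mx_entourageP => A entA.
have : \forall t \near F, forall i, A (x 0 i, X t 0 i).
  by apply: filter_forall => i; have /cvg_entourageP := h i; apply.
by apply: filterS => t ht i j; rewrite ord1 inE.
Qed.

(* Differentiability in Hadamard's form: f w - f z is a combination of the
   increments with slopes that are continuous at z.  Products, compositions and
   inverses then only need algebra and continuity. *)
Definition hasD n (f : Z n -> R) (z : Z n) (a : R) (e : 'I_n -> R) :=
  exists (e0 : Z n -> R) (E : 'I_n -> Z n -> R),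
  [/\ {for z, continuous e0}, forall i, {for z, continuous (E i)},
      \forall w \near z, f w - f z =
        (w.1 - z.1) * e0 w + \sum_i (w.2 0 i - z.2 0 i) * E i w,
      e0 z = a & forall i, E i z = e i].

Lemma hasD_eq n (f : Z n -> R) z a e a' e' : hasD f z a e -> a = a' -> e =1 e' ->
  hasD f z a' e'.
Proof.
move=> [e0 [E [c0 cE h h0 hE]]] <- ee'; exists e0, E; split => // i.
by rewrite hE.
Qed.

Lemma hasD_near n (f g : Z n -> R) z a e : hasD f z a e ->
  (\forall w \near z, f w = g w) -> hasD g z a e.
Proof.
move=> [e0 [E [c0 cE h h0 hE]]] fg; exists e0, E; split => //.
have fgz : f z = g z by exact: nbhs_singleton fg.
by near=> w; rewrite -fgz -(near fg w)//; near: w.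
Unshelve. all: by end_near. Qed.

Lemma hasD_cst n c (z : Z n) : hasD (fun=> c) z 0 (fun=> 0).
Proof.
exists (fun=> 0), (fun _ _ => 0); split => //; first exact: cst_continuous.
  by move=> i; exact: cst_continuous.
by apply: near_all => w; rewrite subrr mulr0 big1 ?addr0// => i _; rewrite mulr0.
Qed.

Lemma hasD_fst n (z : Z n) : hasD fst z 1 (fun=> 0).
Proof.
exists (fun=> 1), (fun _ _ => 0); split => //; first exact: cst_continuous.
  by move=> i; exact: cst_continuous.
by apply: near_all => w; rewrite mulr1 big1 ?addr0// => i _; rewrite mulr0.
Qed.

Lemma hasD_coord n i (z : Z n) : hasD (fun w => w.2 0 i) z 0 (fun j => (j == i)%:R).
Proof.
exists (fun=> 0), (fun j _ => (j == i)%:R); split => //; first exact: cst_continuous.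
  by move=> j; exact: cst_continuous.
apply: near_all => w; rewrite mulr0 add0r (bigD1 i)//= eqxx mulr1 big1 ?addr0// => j ji.
by rewrite (negbTE ji) mulr0.
Qed.

Lemma hasD_cont n (f : Z n -> R) z a e : hasD f z a e -> {for z, continuous f}.
Proof.
move=> [e0 [E [c0 cE h h0 hE]]].
have cc : {for z, continuous (fun w : Z n => f z + ((w.1 - z.1) * e0 w + \sum_i (w.2 0 i - z.2 0 i) * E i w))}.
  apply: continuousD; first exact: cst_continuous.
  apply: continuousD.
    apply: continuousM => //; apply: continuousB; last exact: cst_continuous.
    exact: cvg_fst.
  apply: (@cvg_sumR _ _ _ _ _ (fun i (w : Z n) => (w.2 0 i - z.2 0 i) * E i w)
    (fun i => (z.2 0 i - z.2 0 i) * E i z)) => i.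
  apply: cvgM; last exact: cE.
  apply: cvgB; last exact: cvg_cst.
  exact: (isP_cont (isP_coord i)).
have ez : f z = f z + ((z.1 - z.1) * e0 z + \sum_i (z.2 0 i - z.2 0 i) * E i z).
  by rewrite subrr mul0r big1 ?addr0// => i _; rewrite subrr mul0r.
rewrite /prop_for /continuous_at [X in _ --> X]ez.
apply: cvg_trans cc; apply: near_eq_cvg; near=> w.
by rewrite -(near h w) ?subrKC //; near: w.
Unshelve. all: by end_near. Qed.

Lemma hasDD n (f g : Z n -> R) z a e b h : hasD f z a e -> hasD g z b h ->
  hasD (fun w => f w + g w) z (a + b) (fun i => e i + h i).
Proof.
move=> [e0 [E [c0 cE hf <- hE]]] [e0' [E' [c0' cE' hg <- hE']]].
exists (fun w => e0 w + e0' w), (fun i w => E i w + E' i w); split => //.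
- exact: continuousD.
- by move=> i; exact: continuousD.
- near=> w.
  transitivity ((f w - f z) + (g w - g z)); first by ring.
  rewrite (near hf w)// ?(near hg w)//; [|by near: w..].
  rewrite mulrDr addrACA -big_split; congr (_ + _).
  by apply: eq_bigr => i _; rewrite mulrDr.
- by move=> i; rewrite hE hE'.
Unshelve. all: by end_near. Qed.

Lemma hasDM n (f g : Z n -> R) z a e b h : hasD f z a e -> hasD g z b h ->
  hasD (fun w => f w * g w) z (a * g z + f z * b) (fun i => e i * g z + f z * h i).
Proof.
move=> Df Dg; have cg := hasD_cont Dg.
move: Df Dg => [e0 [E [c0 cE hf <- hE]]] [e0' [E' [c0' cE' hg <- hE']]].
exists (fun w => e0 w * g w + f z * e0' w), (fun i w => E i w * g w + f z * E' i w); split => //.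
- by apply: continuousD; apply: continuousM => //; exact: cst_continuous.
- by move=> i; apply: continuousD; apply: continuousM => //; exact: cst_continuous.
- near=> w.
  transitivity ((f w - f z) * g w + f z * (g w - g z)); first by ring.
  rewrite (near hf w)// ?(near hg w)//; [|by near: w..].
  rewrite !mulrDl !mulrDr addrACA; congr (_ + _); first by ring.
  by rewrite mulr_suml mulr_sumr -big_split; apply: eq_bigr => i _ /=; ring.
- by move=> i; rewrite hE hE'.
Unshelve. all: by end_near. Qed.

Lemma hasDZ n (f : Z n -> R) z a e c : hasD f z a e ->
  hasD (fun w => c * f w) z (c * a) (fun i => c * e i).
Proof.
move=> Df; apply: hasD_eq (hasDM (hasD_cst c z) Df) _ _; first by rewrite mul0r add0r.
by move=> i; rewrite mul0r add0r.
Qed.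

Lemma hasD_sum n (T : Type) (r : seq T) (P : pred T) (f : T -> Z n -> R) z a e :
  (forall t, hasD (f t) z (a t) (e t)) ->
  hasD (fun w => \sum_(t <- r | P t) f t w) z (\sum_(t <- r | P t) a t)
    (fun i => \sum_(t <- r | P t) e t i).
Proof.
move=> h; elim: r => [|t r IH].
  apply: (hasD_near (f := fun=> 0)); last by apply: near_all => w; rewrite big_nil.
  by apply: hasD_eq (hasD_cst 0 z) _ _ => [|i]; rewrite big_nil.
case Pt : (P t).
  apply: (hasD_near (f := fun w => f t w + \sum_(t <- r | P t) f t w)).
    by apply: hasD_eq (hasDD (h t) IH) _ _ => [|i]; rewrite big_cons Pt.
  by apply: near_all => w; rewrite big_cons Pt.
apply: (hasD_near (f := fun w => \sum_(t <- r | P t) f t w)).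
  by apply: hasD_eq IH _ _ => [|i]; rewrite big_cons Pt.
by apply: near_all => w; rewrite big_cons Pt.
Qed.

Lemma hasDV n (f : Z n -> R) z a e : hasD f z a e -> f z != 0 ->
  hasD (fun w => (f w)^-1) z (- a / f z ^+ 2) (fun i => - e i / f z ^+ 2).
Proof.
move=> Df fz; have cf := hasD_cont Df.
move: Df => [e0 [E [c0 cE hf <- hE]]].
have cV : {for z, continuous (fun w => (f w)^-1)} by exact: continuousV.
exists (fun w => - e0 w * ((f w)^-1 * (f z)^-1)), (fun i w => - E i w * ((f w)^-1 * (f z)^-1)); split => //.
- apply: continuousM; first exact: continuousN.
  by apply: continuousM => //; exact: cst_continuous.
- move=> i; apply: continuousM; first exact: continuousN.
  by apply: continuousM => //; exact: cst_continuous.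
- have fn : \forall w \near z, f w != 0 by exact: cvgr_neq0 cf fz.
  near=> w.
  have fw : f w != 0 by near: w.
  have hw : f w - f z = (w.1 - z.1) * e0 w + \sum_i (w.2 0 i - z.2 0 i) * E i w.
    by near: w.
  transitivity (- (f w - f z) * ((f w)^-1 * (f z)^-1)); first by field; rewrite fw fz.
  rewrite hw.
  rewrite opprD mulrDl; congr (_ + _); first by ring.
  by rewrite -sumrN mulr_suml; apply: eq_bigr => i _ /=; ring.
- by field.
- by move=> i; rewrite hE; field.
Unshelve. all: by end_near. Qed.

(* The positive part squared is of class C^1; it serves as a cut-off. *)
Definition pp (s : R) : R := Num.max s 0 ^+ 2.

Lemma pp_le0 s : s <= 0 -> pp s = 0.
Proof. by move=> s0; rewrite /pp (max_idPr s0) expr0n. Qed.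

Lemma pp_ge0 s : 0 <= s -> pp s = s ^+ 2.
Proof. by move=> s0; rewrite /pp (max_idPl s0). Qed.

Lemma hasD_pp n (f : Z n -> R) z a e : hasD f z a e ->
  hasD (fun w => pp (f w)) z (a * (2 * Num.max (f z) 0)) (fun i => e i * (2 * Num.max (f z) 0)).
Proof.
move=> Df; have cf := hasD_cont Df.
have cm : {for z, continuous (fun w => Num.max (f w) 0)}.
  by apply: continuous_max => //; exact: cst_continuous.
have [f0|f0|f0] := ltgtP (f z) 0.
- rewrite mulr0 mulr0; apply: (hasD_near (f := fun=> 0)).
    by apply: hasD_eq (hasD_cst 0 z) _ _ => // i; rewrite !mulr0.
  have : \forall w \near z, f w < 0 by exact: (cvgr_lt _ cf).
  by apply: filterS => w fw; rewrite pp_le0// ltW.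
- apply: (hasD_near (f := fun w => f w * f w)).
    by apply: hasD_eq (hasDM Df Df) _ _ => [|i]; ring.
  have : \forall w \near z, 0 < f w by exact: (cvgr_gt _ cf).
  by apply: filterS => w fw; rewrite pp_ge0 ?ltW// expr2.
(* At a zero of f one has [pp (f w) = (f w - f z) * Num.max (f w) 0]: the slopes of f times a factor
   that is continuous and vanishes at z. *)
- rewrite f0 !mulr0; move: Df => [e0 [E [c0 cE hf e0E hE]]].
  exists (fun w => e0 w * Num.max (f w) 0), (fun i w => E i w * Num.max (f w) 0); split => //.
  + by apply: continuousM.
  + by move=> i; apply: continuousM.
  + near=> w; rewrite f0 (pp_le0 (lexx 0)) subr0.
    transitivity ((f w - f z) * Num.max (f w) 0).
      rewrite f0 subr0 /pp; case: (leP (f w) 0) => h; last by rewrite expr2.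
      by rewrite mulr0 expr0n.
    have -> : f w - f z = (w.1 - z.1) * e0 w + \sum_i (w.2 0 i - z.2 0 i) * E i w.
      by near: w.
    rewrite mulrDl mulrA; congr (_ + _).
    by rewrite mulr_suml; apply: eq_bigr => i _; rewrite mulrA.
  + by rewrite f0 maxxx mulr0.
  + by move=> i; rewrite f0 maxxx !mulr0.
Unshelve. all: by end_near. Qed.

Lemma hasD_comp n (f : Z n -> R) (X : Z n -> V n) (z : Z n) a e (b : 'I_n -> R) (h : 'I_n -> 'I_n -> R) :
  hasD f (z.1, X z) a e -> (forall i, hasD (fun w => X w 0 i) z (b i) (h i)) ->
  hasD (fun w => f (w.1, X w)) z (a + \sum_i b i * e i) (fun j => \sum_i h i j * e i).
Proof.
move=> [e0 [E [c0 cE hf e0E hE]]] DX.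
have cX : {for z, continuous X}.
  by apply: cvg_rV => i; exact: hasD_cont (DX i).
have cG : {for z, continuous (fun w : Z n => (w.1, X w))}.
  have c1 : w.1 @[w --> z] --> z.1 by exact: cvg_fst.
  exact: (cvg_pair c1 cX).
have /choice[b0 /choice[H DXH]] := DX.
exists (fun w => e0 (w.1, X w) + \sum_i b0 i w * E i (w.1, X w)),
  (fun j w => \sum_i H i j w * E i (w.1, X w)).
have cEG i : {for z, continuous (fun w => E i (w.1, X w))}.
  by apply: (@continuous_comp _ _ _ (fun w : Z n => (w.1, X w)) (E i)).
split.
- apply: continuousD; first by apply: (@continuous_comp _ _ _ (fun w : Z n => (w.1, X w)) e0).
  apply: cvg_sumR => i.
  by apply: cvgM; [have [] := DXH i|exact: cEG].
- move=> j; apply: cvg_sumR => i.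
  by apply: cvgM; [have [_ cH _ _ _] := DXH i; exact: cH|exact: cEG].
- have hfG : \forall w \near z, f (w.1, X w) - f (z.1, X z) =
        (w.1 - z.1) * e0 (w.1, X w) + \sum_i (X w 0 i - X z 0 i) * E i (w.1, X w).
    exact: cG hf.
  have hX : \forall w \near z, forall i, X w 0 i - X z 0 i =
        (w.1 - z.1) * b0 i w + \sum_j (w.2 0 j - z.2 0 j) * H i j w.
    by apply: near_forall => i; have [] := DXH i.
  near=> w.
  have -> : f (w.1, X w) - f (z.1, X z) =
        (w.1 - z.1) * e0 (w.1, X w) + \sum_i (X w 0 i - X z 0 i) * E i (w.1, X w) by near: w.
  have hXw : forall i, X w 0 i - X z 0 i =
        (w.1 - z.1) * b0 i w + \sum_j (w.2 0 j - z.2 0 j) * H i j w by near: w.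
  under eq_bigr do rewrite hXw ?mulrDl//.
  rewrite big_split /= mulrDr -addrA; congr (_ + _); congr (_ + _).
    by rewrite mulr_sumr; apply: eq_bigr => i _ /=; ring.
  under eq_bigr do rewrite mulr_suml.
  rewrite exchange_big /=; apply: eq_bigr => j _; rewrite mulr_sumr.
  by apply: eq_bigr => i _; rewrite mulrA.
- rewrite /= e0E; congr (_ + _); apply: eq_bigr => i _; rewrite hE.
  by have [_ _ _ -> _] := DXH i.
- move=> j; apply: eq_bigr => i _; rewrite hE.
  by have [_ _ _ _ ->] := DXH i.
Unshelve. all: by end_near. Qed.

Lemma hasD_line n (f : Z n -> R) (z : Z n) a e (v0 : R) (v : V n) : hasD f z a e ->
  is_derive (0 : R) (1 : R) (fun s : R => f (z.1 + s * v0, z.2 + s *: v)) (v0 * a + \sum_i v 0 i * e i).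
Proof.
move=> [e0 [E [c0 cE hf <- hE]]].
pose G (s : R) : Z n := (z.1 + s * v0, z.2 + s *: v).
have G0 : G 0 = z by rewrite /G mul0r scale0r !addr0; case: (z).
have cG : G s @[s --> (0 : R)] --> z.
  have c1 : z.1 + s * v0 @[s --> (0 : R)] --> z.1 + 0 * v0.
    by apply: cvgD; [exact: cvg_cst|apply: cvgM; [exact: cvg_id|exact: cvg_cst]].
  have c2 : z.2 + s *: v @[s --> (0 : R)] --> z.2 + 0 *: v.
    by apply: cvgD; [exact: cvg_cst|apply: cvgZ; [exact: cvg_id|exact: cvg_cst]].
  by rewrite -[X in _ --> X]G0; exact: (cvg_pair c1 c2).
have cGd : G s @[s --> (0 : R)^'] --> z by apply: cvg_trans cG; apply: cvg_app; exact: cvg_within.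
have key : h^-1 *: (f (G (h + 0)) - f (G 0)) @[h --> (0 : R)^'] --> v0 * e0 z + \sum_i v 0 i * E i z.
  have c : v0 * e0 (G h) + \sum_i v 0 i * E i (G h) @[h --> (0 : R)^'] --> v0 * e0 z + \sum_i v 0 i * E i z.
    apply: cvgD; first by apply: cvgM; [exact: cvg_cst|exact: (@cvg_comp _ _ _ G e0 _ _ _ cGd c0)].
    apply: cvg_sumR => i; apply: cvgM; [exact: cvg_cst|exact: (@cvg_comp _ _ _ G (E i) _ _ _ cGd (cE i))].
  apply: cvg_trans c; apply: near_eq_cvg.
  have hfG : \forall h \near (0 : R)^', f (G h) - f z =
        ((G h).1 - z.1) * e0 (G h) + \sum_i ((G h).2 0 i - z.2 0 i) * E i (G h) by exact: cGd hf.
  have hn : \forall h \near (0 : R)^', h != 0 by exact: nbhs_dnbhs_neq.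
  near=> h; have h0 : h != 0 by near: h.
  rewrite addr0 G0.
  have -> : f (G h) - f z = ((G h).1 - z.1) * e0 (G h) + \sum_i ((G h).2 0 i - z.2 0 i) * E i (G h).
    by near: h.
  rewrite /G /= addrAC subrr add0r scalerDr; congr (_ + _).
    by rewrite /GRing.scale /=; field.
  rewrite scaler_sumr; apply: eq_bigr => i _.
  by rewrite !mxE addrAC subrr add0r /GRing.scale /=; field.
have -> : v0 * e0 z + \sum_i v 0 i * e i = v0 * e0 z + \sum_i v 0 i * E i z.
  by congr (_ + _); apply: eq_bigr => i _; rewrite hE.
apply: DeriveDef.
  apply/cvg_ex; eexists; move: key; apply: cvg_trans; apply: near_eq_cvg; near=> h.
  by rewrite /G /= /shift /= !addr0 /GRing.scale /= !mulr1.
apply: cvg_lim => //; move: key; apply: cvg_trans; apply: near_eq_cvg; near=> h.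
by rewrite /G /= /shift /= !addr0 /GRing.scale /= !mulr1.
Unshelve. all: by end_near. Qed.

Lemma hasD_derive1 n (f : Z n -> R) (z : Z n) a e : hasD f z a e ->
  is_derive z.1 (1 : R) (fun t : R => f (t, z.2)) a.
Proof.
move=> Df; have := hasD_line 1 0 Df.
rewrite mul1r big1 ?addr0 => [H|i _]; last by rewrite mxE mul0r.
move: H => [H1 H2].
have E : (fun h : R => h^-1 *: (((fun s : R => f (z.1 + s * 1, z.2 + s *: 0)) \o shift 0) (h *: 1) - f (z.1 + 0 * 1, z.2 + 0 *: 0))) =
  (fun h : R => h^-1 *: (((fun t : R => f (t, z.2)) \o shift z.1) (h *: 1) - f (z.1, z.2))).
  apply/funext => h /=; rewrite !scaler0 !addr0 mul0r addr0 /GRing.scale /= !mulr1.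
  by rewrite [h + z.1]addrC.
by apply: DeriveDef; [rewrite /derivable -E|rewrite /derive -E].
Qed.

Lemma hasD_slice n (f : Z n -> R) (z : Z n) a e (i : 'I_n) : hasD f z a e ->
  is_derive (0 : R) (1 : R) (fun s : R => f (z.1, z.2 + s *: delta_mx 0 i)) (e i).
Proof.
move=> Df; have := hasD_line 0 (delta_mx 0 i) Df.
rewrite mul0r add0r (bigD1 i)//= mxE !eqxx mul1r big1 ?addr0 => [|j ji].
  by under eq_fun do rewrite mulr0 addr0.
by rewrite mxE /= (negbTE ji) mul0r.
Qed.

Lemma hasD_partial n (f : Z n -> R) (z : Z n) a e (i : 'I_n) : hasD f z a e ->
  partial i (fun y => f (z.1, y)) z.2 = e i.
Proof.
move=> /(hasD_slice i) [D1 D2]; rewrite -D2 /partial /derive.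
suff -> : (fun h : R => h^-1 *: (((fun y : V n => f (z.1, y)) \o shift z.2) (h *: delta_mx 0 i) - f (z.1, z.2))) =
  (fun h : R => h^-1 *: (((fun s : R => f (z.1, z.2 + s *: delta_mx 0 i)) \o shift 0) (h *: 1) - f (z.1, z.2 + 0 *: delta_mx 0 i))) by [].
by apply/funext => h; rewrite /= addr0 scale0r addr0 [z.2 + _]addrC /GRing.scale /= mulr1.
Qed.

Definition dpart n (i : 'I_n) (f : Z n -> R) : Z n -> R :=
  fun z => partial i (fun y => f (z.1, y)) z.2.
Definition dtime n (f : Z n -> R) : Z n -> R :=
  fun z => derive1 (fun t : R => f (t, z.2)) z.1.

Lemma isP_D n (f : Z n -> R) : isP f -> exists (a : Z n -> R) (e : 'I_n -> Z n -> R),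
  [/\ isP a, forall i, isP (e i) & forall z, hasD f z (a z) (fun i => e i z)].
Proof.
elim=> [c||i|g h Pg [a [e [Pa Pe He]]] Ph [b [k [Pb Pk Hk]]]|g h Pg [a [e [Pa Pe He]]] Ph [b [k [Pb Pk Hk]]]].
- exists (fun=> 0), (fun _ _ => 0); split => [|i|z]; [exact: isP_cst|exact: isP_cst|exact: hasD_cst].
- exists (fun=> 1), (fun _ _ => 0); split => [|i|z]; [exact: isP_cst|exact: isP_cst|exact: hasD_fst].
- exists (fun=> 0), (fun j _ => (j == i)%:R); split => [|j|z]; [exact: isP_cst|exact: isP_cst|exact: hasD_coord].
- exists (fun z => a z + b z), (fun i z => e i z + k i z); split => [|i|z]; [exact: isP_add|exact: isP_add|exact: hasDD].
- exists (fun z => a z * h z + g z * b z), (fun i z => e i z * h z + g z * k i z); split => [|i|z].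
  + by apply: isP_add; apply: isP_mul.
  + by apply: isP_add; apply: isP_mul.
  + exact: hasDM.
Qed.

(** The slopes at z are the genuine derivatives; every calculus rule for [dtime] and [dpart] below
    is read off from a rule for [hasD] through this lemma. *)
Lemma hasD_unique n (f : Z n -> R) z a e : hasD f z a e -> a = dtime f z /\ forall i, e i = dpart i f z.
Proof.
move=> Df; split; last by move=> i; rewrite /dpart (hasD_partial i Df).
by rewrite /dtime derive1E; have [_ ->] := hasD_derive1 Df.
Qed.

Lemma isP_hasD n (f : Z n -> R) z : isP f -> hasD f z (dtime f z) (fun i => dpart i f z).
Proof.
move=> /isP_D[a [e [_ _ H]]]; have [aE eE] := hasD_unique (H z).
exact: hasD_eq (H z) aE eE.
Qed.

Lemma isP_dtime n (f : Z n -> R) : isP f -> isP (dtime f).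
Proof.
move=> /isP_D[a [e [Pa _ H]]]; apply: isP_ext Pa => z.
by have [-> _] := hasD_unique (H z).
Qed.

Lemma isP_dpart n i (f : Z n -> R) : isP f -> isP (dpart i f).
Proof.
move=> /isP_D[a [e [_ Pe H]]]; apply: isP_ext (Pe i) => z.
by have [_ ->] := hasD_unique (H z).
Qed.

Lemma dpartM n i (f g : Z n -> R) : isP f -> isP g ->
  dpart i (fun z => f z * g z) = (fun z => dpart i f z * g z + f z * dpart i g z).
Proof.
move=> Pf Pg; apply/funext => z.
by have [_ <-] := hasD_unique (hasDM (isP_hasD z Pf) (isP_hasD z Pg)).
Qed.

Lemma dpartD n i (f g : Z n -> R) : isP f -> isP g ->
  dpart i (fun z => f z + g z) = (fun z => dpart i f z + dpart i g z).
Proof.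
move=> Pf Pg; apply/funext => z.
by have [_ <-] := hasD_unique (hasDD (isP_hasD z Pf) (isP_hasD z Pg)).
Qed.

Lemma dpart_sum n i (T : Type) (r : seq T) (f : T -> Z n -> R) : (forall t, isP (f t)) ->
  dpart i (fun z => \sum_(t <- r) f t z) = (fun z => \sum_(t <- r) dpart i (f t) z).
Proof.
move=> Pf; apply/funext => z.
by have [_ <-] := hasD_unique (@hasD_sum _ _ r xpredT f z _ _ (fun t => isP_hasD z (Pf t))).
Qed.

Lemma dpartZ n i (f : Z n -> R) c : isP f ->
  dpart i (fun z => c * f z) = (fun z => c * dpart i f z).
Proof.
move=> Pf; apply/funext => z.
by have [_ <-] := hasD_unique (hasDZ c (isP_hasD z Pf)).
Qed.

(** Divided differences. Unlike the slopes of [hasD] they are continuous in both points at once, as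
    contraction and bilipschitz estimates require. *)
Lemma isP_slope n (f : Z n -> R) : isP f -> exists d : 'I_n -> R -> V n -> V n -> R,
  (forall i t x y, {for (t, (x, y)), continuous (fun w : R * (V n * V n) => d i w.1 w.2.1 w.2.2)}) /\
  forall t x y, f (t, x) - f (t, y) = \sum_i (x 0 i - y 0 i) * d i t x y.
Proof.
have c1 t x y (g : Z n -> R) : isP g -> {for (t, (x, y)), continuous (fun w : R * (V n * V n) => g (w.1, w.2.1))}.
  move=> Pg; apply: (@continuous_comp _ _ _ (fun w : R * (V n * V n) => (w.1, w.2.1)) g); last exact: isP_cont.
  have c1 : w.1 @[w --> (t, (x, y))] --> t by exact: cvg_fst.
  have c2 : w.2 @[w --> (t, (x, y))] --> (x, y) by exact: cvg_snd.
  have c3 : w.2.1 @[w --> (t, (x, y))] --> x by exact: (@cvg_comp _ _ _ snd fst _ _ _ c2 cvg_fst).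
  exact: (cvg_pair c1 c3).
have c2 t x y (g : Z n -> R) : isP g -> {for (t, (x, y)), continuous (fun w : R * (V n * V n) => g (w.1, w.2.2))}.
  move=> Pg; apply: (@continuous_comp _ _ _ (fun w : R * (V n * V n) => (w.1, w.2.2)) g); last exact: isP_cont.
  have c1' : w.1 @[w --> (t, (x, y))] --> t by exact: cvg_fst.
  have c2 : w.2 @[w --> (t, (x, y))] --> (x, y) by exact: cvg_snd.
  have c3 : w.2.2 @[w --> (t, (x, y))] --> y by exact: (@cvg_comp _ _ _ snd snd _ _ _ c2 cvg_snd).
  exact: (cvg_pair c1' c3).
elim=> [c||i|g h Pg [dg [cg Hg]] Ph [dh [ch Hh]]|g h Pg [dg [cg Hg]] Ph [dh [ch Hh]]].
- exists (fun _ _ _ _ => 0); split => [i t x y|t x y]; first exact: cst_continuous.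
  by rewrite subrr big1// => i _; rewrite mulr0.
- exists (fun _ _ _ _ => 0); split => [i t x y|t x y]; first exact: cst_continuous.
  by rewrite subrr big1// => i _; rewrite mulr0.
- exists (fun j _ _ _ => (j == i)%:R); split => [j t x y|t x y]; first exact: cst_continuous.
  rewrite (bigD1 i)//= eqxx mulr1 big1 ?addr0// => j ji.
  by rewrite (negbTE ji) mulr0.
- exists (fun i t x y => dg i t x y + dh i t x y); split => [i t x y|t x y]; first exact: continuousD.
  transitivity ((g (t, x) - g (t, y)) + (h (t, x) - h (t, y))); first by ring.
  by rewrite Hg Hh -big_split; apply: eq_bigr => i _; rewrite mulrDr.
- exists (fun i t x y => dg i t x y * h (t, x) + g (t, y) * dh i t x y); split => [i t x y|t x y].
    by apply: continuousD; apply: continuousM => //; [exact: c1|exact: c2].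
  transitivity ((g (t, x) - g (t, y)) * h (t, x) + g (t, y) * (h (t, x) - h (t, y))); first by ring.
  by rewrite Hg Hh mulr_suml mulr_sumr -big_split; apply: eq_bigr => i _ /=; ring.
Qed.

End Poly.

(** * Local inversion *)

Section Inverse.
Context {R : realType}.
Local Notation V n := ('rV[R]_n).
Local Notation Z n := (R * 'rV[R]_n)%type.

Lemma coord_le n (x : V n) i : `|x 0 i| <= `|x|.
Proof.
rewrite -[leRHS]/(mx_norm _) mx_normrE.
exact: (le_bigmax _ (fun ij : 'I_1 * 'I_n => `|x ij.1 ij.2|) (0, i)).
Qed.

Lemma norm_rV_le n (x : V n) r : 0 <= r -> (forall i, `|x 0 i| <= r) -> `|x| <= r.
Proof.
move=> r0 h; rewrite -[leLHS]/(mx_norm _) mx_normrE; apply: bigmax_le => //= -[i j] _.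
by rewrite ord1.
Qed.

Lemma norm_mulmx n (v : V n) (B : 'M[R]_n) c : 0 <= c -> (forall i j, `|B i j| <= c) ->
  `|v *m B| <= n%:R * c * `|v|.
Proof.
move=> c0 hB; apply: norm_rV_le => [|j]; first by rewrite !mulr_ge0.
rewrite mxE (le_trans (ler_norm_sum _ _ _))//.
have -> : n%:R * c * `|v| = \sum_(i < n) `|v| * c.
  by rewrite sumr_const card_ord -mulr_natl; ring.
apply: ler_sum => i _; rewrite normrM ler_pM//; exact: coord_le.
Qed.

(* Contraction principle for x |-> y + x - F x. *)
Lemma solve_ball n (F : V n -> V n) (x0 y : V n) (rho : R) : 0 <= rho ->
  (forall x x', `|x - x0| <= rho -> `|x' - x0| <= rho ->
     `|(x - F x) - (x' - F x')| <= 2^-1 * `|x - x'|) ->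
  `|y - F x0| <= rho / 2 -> exists2 x, `|x - x0| <= rho & F x = y.
Proof.
move=> rho0 hF hy; pose U : set (V n) := [set x | `|x - x0| <= rho].
pose G x := x + (y - F x).
have hG : {homo G : x / U x >-> U x}.
  move=> x Ux; rewrite /U /=.
  have -> : G x - x0 = ((x - F x) - (x0 - F x0)) + (y - F x0).
    by rewrite /G; apply/rowP => i; rewrite !mxE; ring.
  apply: (le_trans (ler_normD _ _)).
  have := hF x x0 Ux; rewrite subrr normr0 => /(_ rho0) h.
  have : 2^-1 * `|x - x0| <= 2^-1 * rho by rewrite ler_wpM2l.
  by lra.
have cU : closed U.
  have -> : U = closed_ball_ (fun x => `|x|) x0 rho.
    by apply/seteqP; split => x; rewrite /U /closed_ball_ /= distrC.
  exact: closed_closed_ball_.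
have U0 : U !=set0 by exists x0; rewrite /U /= subrr normr0.
have ctr : is_contraction (mkfun_fun hG).
  exists 2^-1%:nng; split => /=; first by rewrite invf_lt1// ltr1n.
  move=> [x x'] /= [Ux Ux']; have -> : G x - G x' = (x - F x) - (x' - F x').
    by rewrite /G; apply/rowP => i; rewrite !mxE; ring.
  exact: hF.
have [x Ux /= xE] := banach_fixed_point ctr cU U0.
exists x => //; apply/esym/eqP; rewrite -subr_eq0; apply/eqP.
have xE' : x = G x := xE.
by apply: (@addrI _ x); rewrite addr0; exact: esym xE'.
Qed.

Definition pmap n (P : Z n -> V n) := forall i, isP (fun z => P z 0 i).
(** As for ['J], rows are indexed by the direction of derivation, so that increments multiply from
    the left. *)
Definition Jm n (P : Z n -> V n) (z : Z n) : 'M[R]_n :=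
  \matrix_(k, i) dpart k (fun w => P w 0 i) z.
Definition Det n (P : Z n -> V n) (z : Z n) : R := \det (Jm P z).

Lemma isP_Jm n (P : Z n -> V n) i j : pmap P -> isP (fun z => Jm P z i j).
Proof.
move=> PP; apply: isP_ext (isP_dpart i (PP j)) => z; by rewrite mxE.
Qed.

Lemma isP_Det n (P : Z n -> V n) : pmap P -> isP (Det P).
Proof. by move=> PP; apply: isP_det => i j; exact: isP_Jm. Qed.

Lemma cvg_prodR (T : Type) (F : set_system T) (FF : Filter F) (I : Type) (r : seq I)
  (f : I -> T -> R) (a : I -> R) : (forall i, f i x @[x --> F] --> a i) ->
  \prod_(i <- r) f i x @[x --> F] --> \prod_(i <- r) a i.
Proof.
move=> h; elim: r => [|i r IH].
  under eq_fun do rewrite big_nil; rewrite big_nil; exact: cvg_cst.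
under eq_fun do rewrite big_cons; rewrite big_cons; exact: cvgM.
Qed.

Lemma cvg_det (T : Type) (F : set_system T) (FF : Filter F) n (M : T -> 'M[R]_n) (A : 'M[R]_n) :
  (forall i j, M t i j @[t --> F] --> A i j) -> \det (M t) @[t --> F] --> \det A.
Proof.
move=> h; rewrite /determinant; apply: cvg_sumR => s; apply: cvgM; first exact: cvg_cst.
by apply: cvg_prodR => i.
Qed.

Lemma cvg_adj (T : Type) (F : set_system T) (FF : Filter F) n (M : T -> 'M[R]_n) (A : 'M[R]_n) i j :
  (forall i j, M t i j @[t --> F] --> A i j) -> (\adj (M t)) i j @[t --> F] --> (\adj A) i j.
Proof.
move=> h; rewrite mxE; under eq_fun do rewrite mxE.
rewrite /cofactor; apply: cvgM; first exact: cvg_cst.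
by apply: cvg_det => k l; rewrite !mxE; under eq_fun do rewrite !mxE; exact: h.
Qed.

Lemma invmxE n (A : 'M[R]_n) i j : \det A != 0 -> (invmx A) i j = (\det A)^-1 * (\adj A) i j.
Proof. by move=> dA; rewrite /invmx unitmxE unitfE dA mxE. Qed.

(** On the diagonal the divided differences are Hadamard slopes at frozen time, hence the partial
    derivatives. *)
Lemma pmap_slope n (P : Z n -> V n) : pmap P -> exists M : R -> V n -> V n -> 'M[R]_n,
  [/\ forall t x y k i, {for (t, (x, y)), continuous (fun w : R * (V n * V n) => M w.1 w.2.1 w.2.2 k i)},
     forall t x y, P (t, x) - P (t, y) = (x - y) *m M t x y &
     forall t x, M t x x = Jm P (t, x)].
Proof.
move=> PP; have /choice[d hd] := fun i => isP_slope (PP i).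
exists (fun t x y => \matrix_(k, i) d i k t x y); split.
- move=> t x y k i.
  have -> : (fun w : R * (V n * V n) => (\matrix_(k0, i0) d i0 k0 w.1 w.2.1 w.2.2) k i) =
    (fun w => d i k w.1 w.2.1 w.2.2) by apply/funext => w; rewrite mxE.
  by have [+ _] := hd i; apply.
- move=> t x y; apply/rowP => i; rewrite !mxE; have [_ ->] := hd i.
  by apply: eq_bigr => k _; rewrite !mxE.
- move=> t x; apply/matrixP => k i; rewrite !mxE; have [cd hdi] := hd i.
  have H : hasD (fun w : Z n => P (t, w.2) 0 i) (t, x) 0 (fun k => d i k t x x).
    exists (fun=> 0), (fun k w => d i k t w.2 x); split => //=; first exact: cst_continuous.
      move=> k'; have c := cd k' t x x.
      have c1 : w.2 @[w --> ((t, x) : Z n)] --> x by exact: cvg_snd.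
      have c2 : (t, (w.2, x)) @[w --> ((t, x) : Z n)] --> (t, (x, x)).
        have ct : t @[w --> ((t, x) : Z n)] --> t by exact: cvg_cst.
        have cx : x @[w --> ((t, x) : Z n)] --> x by exact: cvg_cst.
        exact: (cvg_pair ct (cvg_pair c1 cx)).
      exact: (@cvg_comp _ _ _ (fun w : Z n => (t, (w.2, x))) _ _ _ _ c2 c).
    by apply: near_all => w; rewrite mulr0 add0r hdi.
  by have [_ /(_ k) ->] := hasD_unique H.
Qed.

(** Inverse function theorem with time as a parameter. With [A], the inverse Jacobian at z, as a
    fixed preconditioner, the slopes of x - P (t, x) *m A are [1%:M - M *m A], which vanish at z and
    are small nearby, so that [solve_ball] applies. *)
Lemma local_sol n (P : Z n -> V n) (z : Z n) (U : set (V n)) : pmap P -> Det P z != 0 ->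
  nbhs z.2 U -> \forall w \near ((z.1, P z) : Z n), exists2 x, U x & P (w.1, x) = w.2.
Proof.
move=> PP D0 Ux0; have [M [cM hM MJ]] := pmap_slope PP.
set t0 := z.1; set x0 := z.2; set A := invmx (Jm P z).
have zE : z = (t0, x0) by rewrite /t0 /x0; case: (z).
have uJ : Jm P z \in unitmx by rewrite unitmxE unitfE.
(* Entries below c make the factor [n%:R * c] of [norm_mulmx] at most 1 / 2. *)
pose c : R := (2 * n.+1%:R)^-1.
have c0 : 0 < c by rewrite invr_gt0 mulr_gt0.
have near1 : \forall w \near ((t0, (x0, x0)) : R * (V n * V n)), forall i j, `|(1%:M - M w.1 w.2.1 w.2.2 *m A) i j| < c.
  apply: near_forall => i; apply: near_forall => j.
  have C : (1%:M - M w.1 w.2.1 w.2.2 *m A) i j @[w --> ((t0, (x0, x0)) : R * (V n * V n))] -->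
      (1%:M - M t0 x0 x0 *m A) i j.
    rewrite !mxE; under eq_fun do rewrite !mxE.
    apply: cvgB; first exact: cvg_cst.
    by apply: cvg_sumR => k; apply: cvgM; [exact: cM|exact: cvg_cst].
  have E0 : (1%:M - M t0 x0 x0 *m A) i j = 0.
    by rewrite MJ -zE /A mulmxV// subrr mxE.
  rewrite E0 in C; exact: (cvgr0_norm_lt _ C _ c0).
have [e /= e0 he] := (nbhs_ballP _ _).1 near1.
have [e' /= e'0 he'] := (nbhs_ballP _ _).1 Ux0.
pose rho := Num.min e e' / 2.
have rho0 : 0 < rho by rewrite divr_gt0// lt_min e0 e'0.
have rhoe : rho < e.
  by rewrite /rho ltr_pdivrMr// (@le_lt_trans _ _ e) ?ge_min ?lexx// ltr_pMr// ltr1n.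
have rhoe' : rho < e'.
  by rewrite /rho ltr_pdivrMr// (@le_lt_trans _ _ e') ?ge_min ?lexx ?orbT// ltr_pMr// ltr1n.
have C2 : (w.2 - P (w.1, x0)) *m A @[w --> ((t0, P z) : Z n)] --> (0 : V n).
  apply: cvg_rV => i; under eq_fun do rewrite mxE.
  have -> : (0 : V n) 0 i = \sum_j ((P z) 0 j - P (t0, x0) 0 j) * A j i.
    by rewrite mxE big1// => j _; rewrite -zE subrr mul0r.
  apply: cvg_sumR => j; apply: cvgM; last exact: cvg_cst.
  under eq_fun do rewrite !mxE.
  have cj : (fun w : Z n => w.2 0 j) @ ((t0, P z) : Z n) --> P z 0 j.
    exact: (@isP_at R n _ (t0, P z) (@isP_coord R n j)).
  apply: cvgB; first exact: cj.
  have c1 : (w.1, x0) @[w --> ((t0, P z) : Z n)] --> (t0, x0).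
    have ct : w.1 @[w --> ((t0, P z) : Z n)] --> t0 by exact: cvg_fst.
    have cx : x0 @[w --> ((t0, P z) : Z n)] --> x0 by exact: cvg_cst.
    exact: (cvg_pair ct cx).
  exact: (@cvg_comp _ _ _ _ _ _ _ _ c1 (@isP_at R n _ (t0, x0) (PP j))).
have near2 : \forall w \near ((t0, P z) : Z n), `|(w.2 - P (w.1, x0)) *m A| < rho / 2.
  have rho2 : 0 < rho / 2 by rewrite divr_gt0.
  exact: (cvgr0_norm_lt _ C2 _ rho2).
have near3 : \forall w \near ((t0, P z) : Z n), `|w.1 - t0| < e.
  have c1 : w.1 @[w --> ((t0, P z) : Z n)] --> t0 by exact: cvg_fst.
  exact: (cvgr_distC_lt _ _ c1 _ e0).
near=> w.
have w2 : `|(w.2 - P (w.1, x0)) *m A| < rho / 2 by near: w.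
have w3 : `|w.1 - t0| < e by near: w.
have [x xr xE] : exists2 x, `|x - x0| <= rho & P (w.1, x) *m A = w.2 *m A.
  apply: (@solve_ball _ (fun x => P (w.1, x) *m A)) => [|x x' hx hx'|]; first exact: ltW.
    have -> : x - P (w.1, x) *m A - (x' - P (w.1, x') *m A) =
       (x - x') *m (1%:M - M w.1 x x' *m A).
      rewrite mulmxBr mulmx1 mulmxA -hM mulmxBl.
      move: (P (w.1, x) *m A) (P (w.1, x') *m A) => a b.
      by apply/rowP => i; rewrite !mxE; ring.
    have nB : forall i j, `|(1%:M - M w.1 x x' *m A) i j| <= c.
      move=> i j; apply/ltW; apply: (he (w.1, (x, x'))); split => /=.
        by rewrite /ball /= distrC.
      by split; rewrite -ball_normE /ball_ /= distrC (le_lt_trans _ rhoe).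
    apply: (le_trans (norm_mulmx _ (ltW c0) nB)).
    rewrite ler_wpM2r//.
    rewrite /c invfM mulrCA ler_piMr ?invr_ge0// ler_pdivrMr// mul1r.
    by rewrite ler_nat.
  by rewrite -mulmxBl ltW.
exists x.
  apply: he'; rewrite -ball_normE /ball_ /= distrC.
  exact: le_lt_trans rhoe'.
by rewrite -[LHS](mulmxK (_ : A \in unitmx)) ?xE ?mulmxK// ?unitmx_inv.
Unshelve. all: by end_near. Qed.

(** Along X the increments of P are those of X times a matrix [N] of Hadamard slopes. This matrix is
    invertible near z; solving for the increments of X exhibits its slopes, by Cramer's formula. *)
Lemma hasD_inv n (P : Z n -> V n) (X : Z n -> V n) (z : Z n) : pmap P ->
  P (z.1, X z) = z.2 -> Det P (z.1, X z) != 0 -> {for z, continuous X} ->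
  (\forall w \near z, P (w.1, X w) = w.2) ->
  forall i, hasD (fun w => X w 0 i) z
    (- \sum_k dtime (fun w => P w 0 k) (z.1, X z) * (invmx (Jm P (z.1, X z))) k i)
    (fun j => (invmx (Jm P (z.1, X z))) j i).
Proof.
move=> PP Pz D0 cX hP i; set z0 := (z.1, X z).
have /choice[e0 /choice[E hE]] : forall k, exists (e0 : Z n -> R) (E : 'I_n -> Z n -> R),
  [/\ {for z0, continuous e0}, forall i, {for z0, continuous (E i)},
      \forall w \near z0, P w 0 k - P z0 0 k =
        (w.1 - z0.1) * e0 w + \sum_i (w.2 0 i - z0.2 0 i) * E i w,
      e0 z0 = dtime (fun w => P w 0 k) z0 & forall j, E j z0 = dpart j (fun w => P w 0 k) z0].
  by move=> k; exact: isP_hasD.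
pose G (w : Z n) : Z n := (w.1, X w).
have cG : {for z, continuous G}.
  have c1 : w.1 @[w --> z] --> z.1 by exact: cvg_fst.
  exact: (cvg_pair c1 cX).
pose N (w : Z n) : 'M[R]_n := \matrix_(j, k) E k j (G w).
have cEG k j : {for z, continuous (fun w => E k j (G w))}.
  by apply: (@continuous_comp _ _ _ G (E k j)) => //; have [_ + _ _ _] := hE k; apply.
have ceG k : {for z, continuous (fun w => e0 k (G w))}.
  by apply: (@continuous_comp _ _ _ G (e0 k)) => //; have [+ _ _ _ _] := hE k; apply.
have Nz : N z = Jm P z0.
  by apply/matrixP => j k; rewrite !mxE; have [_ _ _ _ ->] := hE k.
have cN j k : N w j k @[w --> z] --> N z j k.
  by rewrite mxE; under eq_fun do rewrite mxE; exact: cEG.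
have cdN : \det (N w) @[w --> z] --> \det (N z) by exact: cvg_det.
have dNz : \det (N z) != 0 by rewrite Nz.
have nN : \forall w \near z, \det (N w) != 0 by exact: (cvgr_neq0 _ cdN dNz).
pose iN (w : Z n) j k := (\det (N w))^-1 * (\adj (N w)) j k.
have ciN j k : {for z, continuous (fun w => iN w j k)}.
  by apply: cvgM; [exact: cvgV|exact: cvg_adj].
exists (fun w => - \sum_k e0 k (G w) * iN w k i), (fun j w => iN w j i); split => //.
- apply: continuousN; apply: cvg_sumR => k; apply: cvgM; [exact: ceG|exact: ciN].
- have nE : \forall w \near z, forall k, P (G w) 0 k - P z0 0 k =
        ((G w).1 - z0.1) * e0 k (G w) + \sum_i ((G w).2 0 i - z0.2 0 i) * E k i (G w).
    by apply: near_forall => k; have [_ _ h _ _] := hE k; exact: cG h.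
  near=> w.
  have nEw : forall k, P (G w) 0 k - P z0 0 k =
        ((G w).1 - z0.1) * e0 k (G w) + \sum_i ((G w).2 0 i - z0.2 0 i) * E k i (G w) by near: w.
  have Pw : P (w.1, X w) = w.2 by near: w.
  have dN : \det (N w) != 0 by near: w.
  have uN : N w \in unitmx by rewrite unitmxE unitfE.
  have iNE j k : iN w j k = (invmx (N w)) j k by rewrite invmxE.
  have key : (X w - X z) *m N w = (w.2 - z.2) - (w.1 - z.1) *: \row_k e0 k (G w).
    apply/rowP => k; rewrite !mxE.
    have := nEw k; rewrite /G /= Pw -/z0 Pz => ->.
    rewrite addrAC subrr add0r; apply: eq_bigr => j _; rewrite !mxE //.
  have -> : X w 0 i - X z 0 i = ((X w - X z) *m N w *m invmx (N w)) 0 i.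
    by rewrite mulmxK// !mxE.
  rewrite key mulmxBl -scalemxAl !mxE addrC mulrN -mulrN; congr (_ + _).
    by rewrite mulrN; congr (- (_ * _)); apply: eq_bigr => k _; rewrite !mxE iNE.
  by apply: eq_bigr => j _; rewrite !mxE iNE.
- congr (- _); apply: eq_bigr => k _; rewrite /iN Nz invmxE//.
  by have [_ _ _ -> _] := hE k.
- by move=> j; rewrite /iN Nz invmxE.
Unshelve. all: by end_near. Qed.

Lemma hasD_inv_comp n (P : Z n -> V n) (X : Z n -> V n) (z : Z n) (f : Z n -> R) a e : pmap P ->
  P (z.1, X z) = z.2 -> Det P (z.1, X z) != 0 -> {for z, continuous X} ->
  (\forall w \near z, P (w.1, X w) = w.2) -> hasD f (z.1, X z) a e ->
  hasD (fun w => f (w.1, X w)) z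
    (a - \sum_i (\sum_k dtime (fun w => P w 0 k) (z.1, X z) * (invmx (Jm P (z.1, X z))) k i) * e i)
    (fun j => \sum_i (invmx (Jm P (z.1, X z))) j i * e i).
Proof.
move=> PP Pz D0 cX hP Df.
apply: hasD_eq (hasD_comp Df (hasD_inv PP Pz D0 cX hP)) _ _ => //.
by rewrite -sumrN; congr (_ + _); apply: eq_bigr => i _; rewrite mulNr.
Qed.

Lemma compact_bound (T : topologicalType) (A : set T) (f : T -> R) : compact A ->
  (forall x, A x -> {for x, continuous f}) -> exists2 C, 0 <= C & forall x, A x -> `|f x| <= C.
Proof.
move=> cA cf; have [[a Aa]|A0] := pselect (A !=set0); last first.
  by exists 0 => // x Ax; exfalso; apply: A0; exists x.
have cn : {within A, continuous (fun x => `|f x|)}.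
  apply: continuous_in_subspaceT => x /set_mem Ax.
  by apply: (@continuous_comp _ _ _ f (fun y : R => `|y|)); [exact: cf|exact: norm_continuous].
have [c _ hc] := compact_EVT_max (ex_intro _ a Aa) cA cn.
by exists `|f c| => // x Ax; apply: hc; exact/mem_set.
Qed.

End Inverse.

(** * The reference simplex *)

Section Simplex.
Context {R : realType}.
Local Notation V n := ('rV[R]_n).
Local Notation Z n := (R * 'rV[R]_n)%type.

Lemma isP_bary n k : isP (fun z : Z n => bary z.2 k).
Proof.
case: k => [|k] /=.
  by apply: isP_sub; [exact: isP_cst|apply: isP_sum => i _; exact: isP_coord].
by case: insub => [i|] /=; [exact: isP_coord|exact: isP_cst].
Qed.

Lemma isP_cst_time n (f : Z n -> R) : isP f -> forall t, continuous (fun x : V n => f (t, x)).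
Proof.
move=> Pf t x; have c1 : (fun _ : V n => t) @ x --> t by apply: cst_continuous.
have c2 : (fun y : V n => y) @ x --> x by exact: cvg_id.
have c3 : (fun y : V n => (t, y)) @ x --> (t, x) by exact: (cvg_pair c1 c2).
exact: (@cvg_comp _ _ _ (fun y => (t, y)) f _ _ _ c3 (@isP_at R n _ (t, x) Pf)).
Qed.

Lemma bary_cont n k : continuous (fun x : V n => bary x k).
Proof. move=> x; exact: (@isP_cst_time n _ (isP_bary n k) 0 x). Qed.

Lemma baryS n (x : V n) (i : 'I_n) : bary x i.+1 = x 0 i.
Proof. by rewrite /bary /= valK. Qed.

Lemma baryL n (x : V n) (i : 'I_n) : bary x (lift ord0 i) = x 0 i.
Proof. exact: baryS. Qed.

Lemma sum_bary n (x : V n) : \sum_(v < n.+1) bary x v = 1.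
Proof.
rewrite big_ord_recl (eq_bigr (fun i : 'I_n => x 0 i)) => [|i _]; last exact: baryL.
by rewrite /= subrK.
Qed.

Lemma bary_affine n (x y : V n) s k : (k <= n)%N ->
  bary (x + s *: (y - x)) k = bary x k + s * (bary y k - bary x k).
Proof.
case: k => [|k] kn /=; last by rewrite insubT /= !mxE.
rewrite (eq_bigr (fun i => (1 - s) * x 0 i + s * y 0 i)); last first.
  by move=> i _; rewrite !mxE; ring.
by rewrite big_split /= -!mulr_sumr; ring.
Qed.

Definition Ko n : set (V n) := [set x | forall v : 'I_n.+1, 0 < bary x v].

Lemma KoK n : @Ko n `<=` @simplex R n.
Proof. by move=> x h v; exact/ltW. Qed.

Lemma open_Ko n : open (@Ko n).
Proof.
rewrite openE => x Kx; apply: near_forall => v.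
exact: (cvgr_gt _ (@bary_cont n v x) _ (Kx v)).
Qed.

Lemma closed_simplex n : closed (@simplex R n).
Proof.
have -> : @simplex R n = \bigcap_(v in [set: 'I_n.+1]) ((fun x : V n => bary x v) @^-1` [set r | 0 <= r]).
  by apply/seteqP; split => x h v; [move=> _; exact: h|exact: (h v I)].
apply: closed_bigI => v _; apply: closed_comp; last exact: closed_ge.
by move=> x _; exact: bary_cont.
Qed.

Lemma simplex_bary_le1 n (x : V n) (v : 'I_n.+1) : simplex x -> 0 <= bary x v <= 1.
Proof.
move=> Kx; rewrite Kx /= -(sum_bary x) (bigD1 v)//= lerDl.
by apply: sumr_ge0 => w _; exact: Kx.
Qed.

Lemma simplex_norm n (x : V n) : simplex x -> `|x| <= 1.
Proof.
move=> Kx; apply: norm_rV_le => // i; rewrite -baryL.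
have /andP[h1 h2] := simplex_bary_le1 (lift ord0 i) Kx.
by rewrite ger0_norm.
Qed.

Lemma compact_simplex n : compact (@simplex R n).
Proof.
apply: bounded_closed_compact; last exact: closed_simplex.
exists 1; split; first exact: num_real.
by move=> M M1 x Kx; exact: le_trans (simplex_norm Kx) (ltW M1).
Qed.

Definition bcen n : V n := \row_i (n.+1%:R)^-1.

Lemma bary_bcen n (v : 'I_n.+1) : bary (bcen n) v = (n.+1%:R)^-1.
Proof.
case: (unliftP ord0 v) => [i ->|->]; first by rewrite baryL mxE.
rewrite /= (eq_bigr (fun=> n.+1%:R^-1)); last by move=> i _; rewrite mxE.
rewrite sumr_const card_ord -[_ *+ n]mulr_natl.
have h : n.+1%:R != 0 :> R by rewrite pnatr_eq0.
by rewrite -{1}(divff h) -mulrBl -natr1 addrAC subrr add0r mul1r.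
Qed.

Lemma simplex_segment n (x : V n) s : simplex x -> 0 < s -> s <= 1 ->
  Ko (x + s *: (bcen n - x)).
Proof.
move=> Kx s0 s1 v; rewrite bary_affine ?leq_ord// bary_bcen.
have -> : bary x v + s * (n.+1%:R^-1 - bary x v) = (1 - s) * bary x v + s * n.+1%:R^-1 by ring.
by rewrite ltr_wpDl ?mulr_ge0 ?subr_ge0// mulr_gt0.
Qed.

Lemma closure_Ko n (x : V n) (g : V n -> R) c : simplex x -> {for x, continuous g} ->
  (forall y, Ko y -> g y <= c) -> g x <= c.
Proof.
move=> Kx cg gc.
have C : g (x + k.+1%:R^-1 *: (bcen n - x)) @[k --> \oo] --> g x.
  apply: (@cvg_comp _ _ _ (fun k : nat => x + k.+1%:R^-1 *: (bcen n - x)) g _ _ _ _ cg).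
  have c' : (fun k : nat => x + k.+1%:R^-1 *: (bcen n - x)) @ \oo --> x + (0 : R) *: (bcen n - x).
    by apply: cvgD; [exact: cvg_cst|apply: cvgZ; [exact: cvg_harmonic|exact: cvg_cst]].
  by rewrite scale0r addr0 in c'; exact: c'.
apply: (cvgr_to_le C); apply: nearW => k; apply: gc; apply: simplex_segment => //.
by rewrite invf_le1// ler1n.
Qed.

(** Both N a and N b have integer part at most N, so [inord] is faithful and equal codes mean equal
    integer parts. *)
Lemma frac_eq (a b : R) (N : nat) : (0 < N)%N -> 0 <= a -> a <= 1 -> 0 <= b -> b <= 1 ->
  (inord (Num.truncn (N%:R * a)) : 'I_N.+1) = inord (Num.truncn (N%:R * b)) ->
  `|a - b| <= N%:R^-1.
Proof.
move=> N0 a0 a1 b0 b1.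
have Nn : 0 < N%:R :> R by rewrite ltr0n.
have tr (c : R) : 0 <= c -> c <= 1 -> (Num.truncn (N%:R * c) < N.+1)%N.
  move=> c0 c1; rewrite ltnS -(ler_nat R).
  have /andP[h _] := truncn_itv (mulr_ge0 (ltW Nn) c0).
  by apply: (le_trans h); rewrite ler_piMr// ltW.
move=> /(congr1 val) /=; rewrite !inordK ?tr// => e.
have /andP[h1 h2] := truncn_itv (mulr_ge0 (ltW Nn) a0).
have /andP[h3 h4] := truncn_itv (mulr_ge0 (ltW Nn) b0).
move: h1 h2 h3 h4; rewrite e; set q : R := (Num.truncn _)%:R.
rewrite -natr1 -/q => h1 h2 h3 h4.
rewrite -(ler_pM2l Nn) divff ?gt_eqF// -{1}(gtr0_norm Nn) -normrM ler_norml.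
by rewrite mulrBr; apply/andP; split; lra.
Qed.

(** On the face the n + 1 other barycentric coordinates sum to 1, so that rounding n of them
    determines the point up to O(1 / N). With the Lipschitz bound this is a code as in
    [vol0_code]. *)
Lemma vol0_face n (g : V n.+1 -> V n.+1) L (v : 'I_n.+2) : 0 <= L -> {in @simplex R n.+1, continuous g} ->
  (forall x y, simplex x -> simplex y -> `|g x - g y| <= L * `|x - y|) ->
  let F := [set x | simplex x /\ bary x v = 0] in
  mset (g @` F) /\ vol (g @` F) = 0%E.
Proof.
move=> L0 cg hg F.
have cF : compact F.
  have -> : F = @simplex R n.+1 `&` [set x | bary x v = 0] by [].
  apply: compact_closedI; first exact: compact_simplex.
  have -> : [set x : V n.+1 | bary x v = 0] = (fun x => bary x v) @^-1` [set 0] by [].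
  by apply: closed_comp; [move=> x _; exact: bary_cont|exact: closed_eq].
have cgF : closed (g @` F).
  apply: compact_closed; first exact: norm_hausdorff.
  apply: continuous_compact => //; apply: continuous_in_subspaceT => x /set_mem[Kx _].
  by apply: cg; exact/mem_set.
split; first exact: mset_closed.
pose code N (x : V n.+1) : {ffun 'I_n -> 'I_N.+1} :=
  [ffun i => inord (Num.truncn (N%:R * bary x (lift v (lift ord0 i))))].
apply: (@vol0_code _ _ _ _ _ (L * n.+1%:R) code) => //; first by rewrite mulr_ge0.
move=> N x y N0 [Kx xv] [Ky yv] /ffunP cxy.
have d1 (i : 'I_n) : `|bary x (lift v (lift ord0 i)) - bary y (lift v (lift ord0 i))| <= N%:R^-1.
  have := cxy i; rewrite !ffunE.
  have /andP[x0 x1] := simplex_bary_le1 (lift v (lift ord0 i)) Kx.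
  have /andP[y0 y1] := simplex_bary_le1 (lift v (lift ord0 i)) Ky.
  exact: frac_eq.
have N0' : 0 <= N%:R^-1 :> R by rewrite invr_ge0.
have d2 : `|bary x (lift v ord0) - bary y (lift v ord0)| <= n%:R * N%:R^-1.
  have sx (z : V n.+1) : bary z v = 0 -> bary z (lift v ord0) = 1 - \sum_(i < n) bary z (lift v (lift ord0 i)).
    move=> zv; have := sum_bary z; rewrite (bigD1_ord v)//= zv add0r big_ord_recl => <-.
    by rewrite addrK.
  rewrite (sx _ xv) (sx _ yv) opprB addrC addrA subrK -sumrB.
  apply: (le_trans (ler_norm_sum _ _ _)).
  have -> : n%:R * N%:R^-1 = \sum_(i < n) N%:R^-1 :> R by rewrite sumr_const card_ord mulr_natl.
  by apply: ler_sum => i _; rewrite distrC.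
have d (w : 'I_n.+2) : `|bary x w - bary y w| <= n.+1%:R * N%:R^-1.
  case: (unliftP v w) => [w1|] ->; last by rewrite xv yv subrr normr0 mulr_ge0.
  case: (unliftP ord0 w1) => [w2|] ->.
    by apply: (le_trans (d1 w2)); rewrite ler_peMl// ler1n.
  by apply: (le_trans d2); rewrite ler_wpM2r// ler_nat.
rewrite -mulrA; apply: (le_trans (hg _ _ Kx Ky)); rewrite ler_wpM2l//.
apply: norm_rV_le => [|i]; first by rewrite mulr_ge0.
by have := d (lift ord0 i); rewrite !baryL !mxE.
Qed.

Lemma pmap_lip n (P : Z n -> V n) t : pmap P -> exists2 L, 0 <= L &
  forall x y, simplex x -> simplex y -> `|P (t, x) - P (t, y)| <= L * `|x - y|.
Proof.
move=> PP; have [M [cM hM _]] := pmap_slope PP.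
have cK : compact (@simplex R n `*` @simplex R n) by apply: compact_setX; exact: compact_simplex.
have /choice[c hc] : forall ki : 'I_n * 'I_n, exists C, 0 <= C /\ forall w : V n * V n,
    (@simplex R n `*` @simplex R n) w -> `|M t w.1 w.2 ki.1 ki.2| <= C.
  move=> [k i] /=.
  have cM' : forall w : V n * V n, (@simplex R n `*` @simplex R n) w ->
     {for w, continuous (fun w : V n * V n => M t w.1 w.2 k i)}.
    move=> [x y] _.
    have ct : (fun _ : V n * V n => t) @ (x, y) --> t by exact: cvg_cst.
    have cw : (fun w : V n * V n => w) @ (x, y) --> (x, y) by exact: cvg_id.
    exact: (@cvg_comp _ _ _ (fun w : V n * V n => (t, w)) _ _ _ _ (cvg_pair ct cw) (cM t x y k i)).
  by have [C C0 hC] := compact_bound cK cM'; exists C.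
pose C := \sum_ki c ki.
have C0 : 0 <= C by apply: sumr_ge0 => ki _; have [] := hc ki.
exists (n%:R * C); first by rewrite mulr_ge0.
move=> x y Kx Ky; rewrite hM; apply: norm_mulmx => // i j.
have [_ /(_ (x, y)) /= h] := hc (i, j).
apply: (le_trans (h _)) => //; rewrite /C (bigD1 (i, j))//= lerDl.
by apply: sumr_ge0 => ki _; have [] := hc ki.
Qed.

End Simplex.

(** * Jacobi's formula *)

Section Jacobi.
Context {R : realType}.
Local Notation V n := ('rV[R]_n).
Local Notation Z n := (R * 'rV[R]_n)%type.

Lemma hasD_prod n (I : eqType) (r : seq I) (f : I -> Z n -> R) z (a : I -> R) e : uniq r ->
  (forall t, hasD (f t) z (a t) (e t)) ->
  hasD (fun w => \prod_(t <- r) f t w) z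
    (\sum_(k <- r) \prod_(t <- r) (if t == k then a t else f t z))
    (fun i => \sum_(k <- r) \prod_(t <- r) (if t == k then e t i else f t z)).
Proof.
move=> + h; elim: r => [_|t r IH /= /andP[tr ur]].
  apply: (@hasD_near _ _ (fun=> 1)); last by apply: near_all => w; rewrite big_nil.
  by apply: hasD_eq (hasD_cst 1 z) _ _ => [|i]; rewrite big_nil.
apply: (@hasD_near _ _ (fun w => f t w * \prod_(t <- r) f t w)); last first.
  by apply: near_all => w; rewrite big_cons.
have key (g : I -> R) : \sum_(k <- t :: r) \prod_(s <- t :: r) (if s == k then g s else f s z) =
   g t * \prod_(s <- r) f s z + f t z * \sum_(k <- r) \prod_(s <- r) (if s == k then g s else f s z).
  rewrite big_cons big_cons eqxx; congr (_ * _ + _).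
    apply: eq_big_seq => s sr; case: eqP => // st; by rewrite st (negbTE tr) in sr.
  rewrite mulr_sumr; apply: eq_big_seq => k kr; rewrite big_cons.
  by case: eqP => // tk; rewrite tk kr in tr.
by apply: hasD_eq (hasDM (h t) (IH ur)) _ _ => [|i]; rewrite key.
Qed.

(** Leibniz formula for A with row k taken from B, expanded along that row. *)
Lemma row_replace_det n (A B : 'M[R]_n) k :
  \sum_(s : 'S_n) (-1) ^+ s * \prod_i (if i == k then B i (s i) else A i (s i)) =
  \sum_j B k j * (\adj A) j k.
Proof.
pose C : 'M[R]_n := \matrix_(i, j) if i == k then B i j else A i j.
transitivity (\det C).
  by apply: eq_bigr => s _; congr (_ * _); apply: eq_bigr => i _; rewrite mxE.
rewrite (expand_det_row C k); apply: eq_bigr => j _; rewrite !mxE eqxx; congr (_ * _).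
rewrite /cofactor; congr (_ * \det _); apply/matrixP => i' j'; rewrite !mxE.
by rewrite eq_sym (negbTE (neq_lift _ _)).
Qed.

Lemma hasD_det n m (N : Z n -> 'M[R]_m) z (a : 'M[R]_m) (e : 'I_n -> 'M[R]_m) :
  (forall i j, hasD (fun w => N w i j) z (a i j) (fun k => e k i j)) ->
  hasD (fun w => \det (N w)) z (\sum_i \sum_j a i j * (\adj (N z)) j i)
    (fun k => \sum_i \sum_j e k i j * (\adj (N z)) j i).
Proof.
move=> h; rewrite /determinant.
have H (s : 'S_m) := hasDZ ((-1) ^+ s) (@hasD_prod _ _ (index_enum 'I_m) (fun i w => N w i (s i)) z
  (fun i => a i (s i)) (fun i k => e k i (s i)) (index_enum_uniq _) (fun i => h i (s i))).
apply: hasD_eq (hasD_sum (index_enum _) xpredT H) _ _ => [|k].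
  under eq_bigr do rewrite mulr_sumr; rewrite exchange_big /=.
  by apply: eq_bigr => i _; rewrite row_replace_det.
under eq_bigr do rewrite mulr_sumr; rewrite exchange_big /=.
by apply: eq_bigr => i _; rewrite row_replace_det.
Qed.

Lemma dtimeM n (f g : Z n -> R) : isP f -> isP g ->
  dtime (fun z => f z * g z) = (fun z => dtime f z * g z + f z * dtime g z).
Proof.
move=> Pf Pg; apply/funext => z.
by have [<- _] := hasD_unique (hasDM (isP_hasD z Pf) (isP_hasD z Pg)).
Qed.

Lemma dtimeD n (f g : Z n -> R) : isP f -> isP g ->
  dtime (fun z => f z + g z) = (fun z => dtime f z + dtime g z).
Proof.
move=> Pf Pg; apply/funext => z.
by have [<- _] := hasD_unique (hasDD (isP_hasD z Pf) (isP_hasD z Pg)).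
Qed.

Lemma dtime_cst n (c : R) : dtime (fun _ : Z n => c) = (fun=> 0).
Proof. by apply/funext => z; have [<- _] := hasD_unique (hasD_cst c z). Qed.

Lemma dpart_cst n i (c : R) : dpart i (fun _ : Z n => c) = (fun=> 0).
Proof. by apply/funext => z; have [_ <-] := hasD_unique (hasD_cst c z). Qed.

Lemma dtime_dpart n i (f : Z n -> R) : isP f -> dtime (dpart i f) = dpart i (dtime f).
Proof.
elim=> [c||j|g h Pg IHg Ph IHh|g h Pg IHg Ph IHh].
- by rewrite dpart_cst dtime_cst dpart_cst.
- have -> : dpart i fst = (fun _ : Z n => 0).
    by apply/funext => z; have [_ <-] := hasD_unique (hasD_fst z).
  have -> : dtime fst = (fun _ : Z n => 1).
    by apply/funext => z; have [<- _] := hasD_unique (hasD_fst z).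
  by rewrite dpart_cst dtime_cst.
- have -> : dpart i (fun z : Z n => z.2 0 j) = (fun _ : Z n => (i == j)%:R).
    by apply/funext => z; have [_ <-] := hasD_unique (hasD_coord j z).
  have -> : dtime (fun z : Z n => z.2 0 j) = (fun _ : Z n => 0).
    by apply/funext => z; have [<- _] := hasD_unique (hasD_coord j z).
  by rewrite dpart_cst dtime_cst.
- rewrite (dpartD i Pg Ph) (dtimeD (isP_dpart i Pg) (isP_dpart i Ph)) (dtimeD Pg Ph).
  by rewrite IHg IHh (dpartD i (isP_dtime Pg) (isP_dtime Ph)).
- have P1 := isP_dpart i Pg; have P2 := isP_dpart i Ph.
  have P3 := isP_dtime Pg; have P4 := isP_dtime Ph.
  rewrite (dpartM i Pg Ph) (dtimeM Pg Ph) (dtimeD (isP_mul P1 Ph) (isP_mul Pg P2)).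
  rewrite (dtimeM P1 Ph) (dtimeM Pg P2) (dpartD i (isP_mul P3 Ph) (isP_mul Pg P4)).
  rewrite (dpartM i P3 Ph) (dpartM i Pg P4) IHg IHh; apply/funext => z.
  move: (dpart i (dtime g) z) (dpart i (dtime h) z) (dpart i g z) (dpart i h z) (dtime g z) (dtime h z) (g z) (h z) => *; ring.
Qed.

Lemma dtime_Det n (P : Z n -> V n) z : pmap P ->
  dtime (Det P) z = \sum_k \sum_i dpart k (dtime (fun w => P w 0 i)) z * (\adj (Jm P z)) i k.
Proof.
move=> PP.
have H := @hasD_det n n (Jm P) z (\matrix_(k, i) dtime (fun w => Jm P w k i) z)
  (fun l => \matrix_(k, i) dpart l (fun w => Jm P w k i) z).
have [|<- _] := hasD_unique (H _).
  move=> i j; apply: hasD_eq (isP_hasD z (isP_Jm i j PP)) _ _ => [|l]; by rewrite mxE.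
apply: eq_bigr => k _; apply: eq_bigr => i _; rewrite mxE; congr (_ * _).
rewrite -dtime_dpart//; congr dtime; apply/funext => w; by rewrite mxE.
Qed.

(* The inverse of P (t, .) on the interior of the reference simplex, and the
   moving image of that interior. *)
Definition Xo n (P : Z n -> V n) (w : Z n) : V n :=
  xget 0 [set x | Ko x /\ P (w.1, x) = w.2].

Definition Uo n (P : Z n -> V n) (t : R) : set (V n) := (fun x => P (t, x)) @` @Ko R n.

Section Xo.
Variables (n : nat) (P : Z n -> V n) (PP : pmap P) (T : set R).
Hypothesis injP : forall t, T t -> set_inj (@Ko R n) (fun x => P (t, x)).
Hypothesis detP : forall t x, T t -> Ko x -> Det P (t, x) != 0.

Lemma XoP w : Uo P w.1 w.2 -> Ko (Xo P w) /\ P (w.1, Xo P w) = w.2.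
Proof. by move=> [x Kx xE]; rewrite /Xo; case: xgetP => [y _ //|/(_ x)] /= []. Qed.

Lemma XoE t x : T t -> Ko x -> Xo P (t, P (t, x)) = x.
Proof.
move=> Tt Kx; have [|K1 e1] := @XoP (t, P (t, x)); first by exists x.
by apply: (injP Tt) => //; exact/mem_set.
Qed.

(** [local_sol] finds a preimage in N and injectivity identifies it with [Xo P w]. Injectivity is
    known for times in T only, and T need not be a neighbourhood of t, as at the end points of
    [0, 1]; hence the premise [T w.1]. *)
Lemma Xo_near t x (N : set (V n)) : T t -> Ko x -> nbhs x N ->
  \forall w \near ((t, P (t, x)) : Z n), T w.1 -> Uo P w.1 w.2 /\ N (Xo P w).
Proof.
move=> Tt Kx Nx.
have NK : nbhs x (N `&` @Ko R n).
  by apply: filterI => //; apply: open_nbhs_nbhs; split => //; exact: open_Ko.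
have := local_sol PP (detP Tt Kx : Det P (t, x) != 0) NK.
apply: filterS => -[s y] /= [x' [Nx' Kx'] Ey] Ts; split; first by exists x'.
by rewrite -Ey XoE.
Qed.

Lemma open_Uo t : T t -> open (Uo P t).
Proof.
move=> Tt; rewrite openE => _ [x Kx <-].
have H := Xo_near Tt Kx (@filterT _ (nbhs x) (nbhs_filter x)).
have ct : (fun _ : V n => t) @ (P (t, x)) --> t by apply: cst_continuous.
have cy : (fun y : V n => y) @ (P (t, x)) --> P (t, x) by exact: cvg_id.
have cw : (fun y : V n => (t, y)) @ (P (t, x)) --> (t, P (t, x)) by exact: (cvg_pair ct cy).
have H' : \forall y \near P (t, x), T t -> Uo P t y /\ setT (Xo P (t, y)) by exact: (cw _ H).
by move: H'; rewrite /interior /=; apply: filterS => y /= /(_ Tt) [].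
Qed.

Lemma Xo_cvg_in t x (S : Type) (F : set_system S) (FF : Filter F) (G : S -> Z n) : T t -> Ko x ->
  G s @[s --> F] --> ((t, P (t, x)) : Z n) -> (\forall s \near F, T (G s).1) ->
  Xo P (G s) @[s --> F] --> x.
Proof.
move=> Tt Kx cG TG N Nx; rewrite /nbhs /=.
have h : \forall s \near F, T (G s).1 -> Uo P (G s).1 (G s).2 /\ N (Xo P (G s)).
  exact: cG (Xo_near Tt Kx Nx).
by apply: (filterS _ (filterI h TG)) => s [hs Ts]; have [] := hs Ts.
Qed.

End Xo.

End Jacobi.

(** * Transport of integrals *)

Section Transport.
Context {R : realType}.
Local Notation V n := ('rV[R]_n).
Local Notation Z n := (R * 'rV[R]_n)%type.

Definition bnd (T : Type) (S : set T) (f : T -> R) := exists C, forall z, S z -> `|f z| <= C.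

Lemma bnd_ext T (S : set T) f g : (forall z, S z -> f z = g z) -> bnd S f -> bnd S g.
Proof. by move=> fg [C hC]; exists C => z Sz; rewrite -fg// hC. Qed.

Lemma bndD T (S : set T) f g : bnd S f -> bnd S g -> bnd S (fun z => f z + g z).
Proof.
move=> [C hC] [C' hC']; exists (C + C') => z Sz.
by rewrite (le_trans (ler_normD _ _))// lerD ?hC ?hC'.
Qed.

Lemma bndM T (S : set T) f g : bnd S f -> bnd S g -> bnd S (fun z => f z * g z).
Proof.
by move=> [C hC] [C' hC']; exists (C * C') => z Sz; rewrite normrM ler_pM ?hC ?hC'.
Qed.

Lemma bndN T (S : set T) f : bnd S f -> bnd S (fun z => - f z).
Proof. by move=> [C hC]; exists C => z Sz; rewrite normrN hC. Qed.

Lemma bnd_cst T (S : set T) c : bnd S (fun=> c).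
Proof. by exists `|c|. Qed.

Lemma bnd_sum T (S : set T) (I : finType) (f : I -> T -> R) : (forall i, bnd S (f i)) ->
  bnd S (fun z => \sum_i f i z).
Proof.
move=> h.
elim: (index_enum I) => [|i r IH].
  by apply: bnd_ext (bnd_cst S 0) => z _; rewrite big_nil.
by apply: bnd_ext (bndD (h i) IH) => z _; rewrite big_cons.
Qed.

Lemma bnd_max T (S : set T) f : bnd S f -> bnd S (fun z => Num.max (f z) 0).
Proof.
move=> [C hC]; exists C => z Sz; apply: le_trans (hC z Sz).
by case: (leP (f z) 0) => // h; rewrite normr0.
Qed.

Lemma bnd_compact (T : topologicalType) (S : set T) f : compact S ->
  (forall z, S z -> {for z, continuous f}) -> bnd S f.
Proof. by move=> cS cf; have [C _ hC] := compact_bound cS cf; exists C. Qed.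

Lemma bndV_compact (T : topologicalType) (S : set T) (f : T -> R) : compact S ->
  (forall z, S z -> {for z, continuous f}) -> (forall z, S z -> f z != 0) -> bnd S (fun z => (f z)^-1).
Proof.
move=> cS cf f0; apply: bnd_compact => // z Sz.
by apply: cvgV; [exact: f0|exact: cf].
Qed.

Definition bpoly n (z : Z n) : R := \prod_(v < n.+1) bary z.2 v.

Lemma isP_bpoly n : isP (@bpoly n).
Proof. by apply: isP_prod => v _; exact: isP_bary. Qed.

Lemma bpoly_gt0 n t (x : V n) : Ko x -> 0 < bpoly (t, x).
Proof. by move=> Kx; apply: prodr_gt0 => v _; exact: Kx. Qed.

Lemma bpoly_Ko n t (x : V n) : simplex x -> 0 < bpoly (t, x) -> Ko x.
Proof.
move=> Kx b0 v; have := Kx v; rewrite /= le_eqVlt => /orP[/eqP e|//].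
by move: b0; rewrite /bpoly (bigD1 v)//= -e mul0r ltxx.
Qed.

Variables (n : nat) (P : Z n -> V n) (PP : pmap P) (sg : R).
Let T : set R := `[0, 1]%classic.
Hypothesis injP : forall t, T t -> set_inj (@Ko R n) (fun x => P (t, x)).
Hypothesis detP : forall t x, T t -> Ko x -> 0 < sg * Det P (t, x).

Let detP0 t x : T t -> Ko x -> Det P (t, x) != 0.
Proof. by move=> Tt Kx; have := detP Tt Kx; apply: contraTneq => ->; rewrite mulr0 ltxx. Qed.

Variables (eps : R) (eps0 : 0 < eps).

(** Where [bpoly z <= eps] the cut-off vanishes. Bounds are thus needed on this compact set only; it
    stays inside the open simplex, where the determinant has no zero. *)
Let S : set (Z n) := [set z | T z.1 /\ simplex z.2 /\ eps <= bpoly z].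

Let compS : compact S.
Proof.
have -> : S = (T `*` @simplex R n) `&` (@bpoly n @^-1` [set r | eps <= r]).
  by apply/seteqP; split => z; rewrite /S /=; tauto.
apply: compact_closedI; first by apply: compact_setX; [exact: segment_compact|exact: compact_simplex].
apply: closed_comp; last exact: closed_ge.
by move=> z _; exact: isP_at (isP_bpoly n).
Qed.

Let SKo z : S z -> Ko z.2.
Proof.
case: z => t x [_ [Kx bx]]; apply: (@bpoly_Ko _ t) => //.
exact: lt_le_trans bx.
Qed.

Let bnd_isP (f : Z n -> R) : isP f -> bnd S f.
Proof. by move=> Pf; apply: bnd_compact => // z _; exact: isP_at Pf. Qed.

Let q (z : Z n) : R := bpoly z ^+ 2 * (sg * Det P z).
Let Pq : isP q.
Proof.
by apply: isP_mul; [apply: isP_exp; exact: isP_bpoly|apply: isP_mul; [exact: isP_cst|exact: isP_Det]].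
Qed.
Let q0 t x : T t -> Ko x -> 0 < q (t, x).
Proof. by move=> Tt Kx; rewrite mulr_gt0// ?exprn_gt0 ?bpoly_gt0// detP. Qed.

Let b (z : Z n) := bpoly z - eps.
Let Pb : isP b. Proof. by apply: isP_sub; [exact: isP_bpoly|exact: isP_cst]. Qed.

(* tr_c k pulls back to k * (cut-off) / (sg * Det P), where the cut-off
   pp (b - eps) / b ^ 2, b the product of the barycentric coordinates, vanishes
   near the boundary of the simplex and increases to 1 as eps tends to 0.  The
   suffixes t and i denote its time and space derivatives; tr_h is the function
   carried to physical space, tr_A and tr_B are its derivatives there. *)
Definition tr_m (k : Z n -> R) (z : Z n) := k z * pp (b z).
Definition tr_c (k : Z n -> R) (z : Z n) := tr_m k z * (q z)^-1.
Definition tr_mt (k : Z n -> R) (z : Z n) := dtime k z * pp (b z) + k z * (dtime b z * (2 * Num.max (b z) 0)).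
Definition tr_mi (k : Z n -> R) i (z : Z n) := dpart i k z * pp (b z) + k z * (dpart i b z * (2 * Num.max (b z) 0)).
Definition tr_ct (k : Z n -> R) (z : Z n) := tr_mt k z * (q z)^-1 + tr_m k z * (- dtime q z / q z ^+ 2).
Definition tr_ci (k : Z n -> R) i (z : Z n) := tr_mi k i z * (q z)^-1 + tr_m k z * (- dpart i q z / q z ^+ 2).

Lemma hasD_tr_c k z : isP k -> q z != 0 -> hasD (tr_c k) z (tr_ct k z) (fun i => tr_ci k i z).
Proof.
move=> Pk qz.
exact: hasDM (hasDM (isP_hasD z Pk) (hasD_pp (isP_hasD z Pb))) (hasDV (isP_hasD z Pq) qz).
Qed.

Lemma tr_c0 k z : bpoly z <= eps -> [/\ tr_c k z = 0, tr_ct k z = 0 & forall i, tr_ci k i z = 0].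
Proof.
move=> be; have b0 : b z <= 0 by rewrite /b subr_le0.
have m0 : tr_m k z = 0 by rewrite /tr_m pp_le0// mulr0.
have x0 : Num.max (b z) 0 = 0 by exact/max_idPr.
split; first by rewrite /tr_c m0 mul0r.
  by rewrite /tr_ct m0 mul0r addr0 /tr_mt pp_le0// x0 !mulr0 addr0 mul0r.
by move=> i; rewrite /tr_ci m0 mul0r addr0 /tr_mi pp_le0// x0 !mulr0 addr0 mul0r.
Qed.

Definition tr_h (k : Z n -> R) (w : Z n) : R :=
  if w.2 \in Uo P w.1 then tr_c k (w.1, Xo P w) else 0.

Let Ji (z : Z n) i j := (invmx (Jm P z)) i j.

Definition tr_A (k : Z n -> R) (w : Z n) : R :=
  if w.2 \in Uo P w.1 then let z := (w.1, Xo P w) in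
    tr_ct k z - \sum_i (\sum_k dtime (fun w => P w 0 k) z * Ji z k i) * tr_ci k i z else 0.
Definition tr_B (k : Z n -> R) j (w : Z n) : R :=
  if w.2 \in Uo P w.1 then let z := (w.1, Xo P w) in \sum_i Ji z j i * tr_ci k i z else 0.

(** At times in T the function [tr_h] vanishes off this closed set, which lies inside the moving
    element; hence [tr_h] is zero near every point outside the element and differentiable across its
    boundary. *)
Let Sim : set (Z n) := (fun z : Z n => (z.1, P z)) @` S.
Let closed_Sim : closed Sim.
Proof.
apply: compact_closed; first exact: norm_hausdorff.
apply: continuous_compact => //; apply: continuous_subspaceT => z.
have c1 : (fun z : Z n => z.1) @ z --> z.1 by exact: cvg_fst.
have c2 : P @ z --> P z by apply: cvg_rV => i; exact: isP_at (PP i).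
exact: (cvg_pair c1 c2).
Qed.

Lemma tr_h_hasD k t y : isP k -> 0 < t < 1 ->
  hasD (tr_h k) (t, y) (tr_A k (t, y)) (fun j => tr_B k j (t, y)).
Proof.
move=> Pk /andP[t0 t1]; have Tt : T t by rewrite /T /= in_itv /= !ltW.
have nT : \forall w \near ((t, y) : Z n), T w.1.
  have c1 : (fun z : Z n => z.1) @ (t, y) --> t by exact: cvg_fst.
  have h1 : \forall w \near ((t, y) : Z n), 0 < w.1 by exact: cvgr_gt _ c1 _ t0.
  have h2 : \forall w \near ((t, y) : Z n), w.1 < 1 by exact: cvgr_lt _ c1 _ t1.
  by near=> w; rewrite /T /= in_itv /= !ltW//; near: w.
have [Uy|Uy] := pselect (Uo P t y).
  have [x Kx xy] := Uy.
  have XE : Xo P (t, y) = x by rewrite -xy; exact: (XoE injP).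
  have cX : {for (t, y), continuous (Xo P)}.
    rewrite /prop_for /continuous_at XE.
    apply: (@Xo_cvg_in _ _ _ PP T injP detP0 t x _ _ _ (fun w => w)) => //.
    by rewrite xy; exact: cvg_id.
  have nU : \forall w \near ((t, y) : Z n), Uo P w.1 w.2.
    have h := Xo_near PP injP detP0 Tt Kx (@filterT _ (nbhs x) (nbhs_filter x)).
    rewrite xy in h.
    near=> w; have Tw : T w.1 by near: w.
    have hw : T w.1 -> Uo P w.1 w.2 /\ setT (Xo P w) by near: w.
    by have [] := hw Tw.
  have nP : \forall w \near ((t, y) : Z n), P (w.1, Xo P w) = w.2.
    by apply: filterS nU => w /XoP[].
  have D0 : Det P (t, Xo P (t, y)) != 0 by rewrite XE; exact: detP0.
  have qz : q (t, Xo P (t, y)) != 0 by rewrite XE gt_eqF// q0.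
  have := hasD_inv_comp PP (nbhs_singleton nP) D0 cX nP (hasD_tr_c Pk qz).
  move=> H; apply: hasD_eq (hasD_near H _) _ _.
  - by apply: filterS nU => w Uw; rewrite /tr_h mem_set.
  - by rewrite /tr_A /= mem_set.
  - by move=> j; rewrite /tr_B /= mem_set.
have -> : tr_A k (t, y) = 0 by rewrite /tr_A /= memNset.
apply: (@hasD_eq _ _ _ _ 0 (fun=> 0) _ (fun j => tr_B k j (t, y))) => //; last by move=> j; rewrite /tr_B /= memNset.
apply: hasD_near (hasD_cst 0 _) _.
have nS : \forall w \near ((t, y) : Z n), ~ Sim w.
  apply: open_nbhs_nbhs; split; first exact: closed_openC.
  move=> [[s x] [/= Ts [Kx bx]] [st xy]]; subst s; apply: Uy; exists x => //.
  exact: (@SKo (t, x)).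
near=> w; have Sw : ~ Sim w by near: w.
have Tw : T w.1 by near: w.
rewrite /tr_h.
case: ifPn => // /set_mem Uw; have [Kx xE] := XoP Uw.
have [|be] := leP (bpoly (w.1, Xo P w)) eps; first by move=> /(tr_c0 k) [-> _ _].
exfalso; apply: Sw; exists (w.1, Xo P w); last by rewrite /= xE; case: (w).
by split => //; split; [exact: KoK|exact: ltW].
Unshelve. all: by end_near. Qed.

Lemma bnd_Uo (f : Z n -> R) (g : Z n -> R) : bnd S f ->
  (forall z, bpoly z <= eps -> f z = 0) ->
  (forall w, g w = if w.2 \in Uo P w.1 then f (w.1, Xo P w) else 0) ->
  exists2 C, 0 <= C & forall t y, T t -> `|g (t, y)| <= C.
Proof.
move=> [C hC] f0 gE; exists (Num.max C 0); first by rewrite le_max lexx orbT.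
move=> t y Tt; rewrite gE /=; case: ifPn => [/set_mem Uy|_]; last by rewrite normr0 le_max lexx orbT.
have [Kx xE] := @XoP _ _ P (t, y) Uy.
have [h|h] := leP (bpoly (t, Xo P (t, y))) eps; first by rewrite f0// normr0 le_max lexx orbT.
rewrite le_max hC//; split => //; split; [exact: KoK|exact: ltW].
Qed.

Let bndpp : bnd S (fun z => pp (b z)).
Proof.
have h := bnd_max (bnd_isP Pb).
by apply: bnd_ext (bndM h h) => z _; rewrite /pp expr2.
Qed.

Let bndq : bnd S (fun z => (q z)^-1).
Proof.
apply: bndV_compact => // z Sz; first exact: isP_at Pq.
case: z Sz => t x Sz; rewrite gt_eqF// q0//; [by case: Sz|exact: (SKo Sz)].
Qed.

Let bnd_m k : isP k -> bnd S (tr_m k).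
Proof. by move=> Pk; apply: bndM => //; exact: bnd_isP. Qed.

Let bnd_ct k : isP k -> bnd S (tr_ct k).
Proof.
move=> Pk; have B := bnd_max (bnd_isP Pb).
apply: bndD; [apply: (fun h => bndM h bndq)|apply: (bndM (bnd_m Pk))].
- apply: bndD; apply: bndM => //; [exact: bnd_isP (isP_dtime Pk)|exact: bnd_isP|].
  by apply: bndM; [exact: bnd_isP (isP_dtime Pb)|apply: bndM => //; exact: bnd_cst].
- apply: bndM; first by apply: bndN; exact: bnd_isP (isP_dtime Pq).
  by apply: bnd_ext (bndM bndq bndq) => z _; rewrite -exprVn expr2.
Qed.

Let bnd_ci k i : isP k -> bnd S (tr_ci k i).
Proof.
move=> Pk; have B := bnd_max (bnd_isP Pb).
apply: bndD; [apply: (fun h => bndM h bndq)|apply: (bndM (bnd_m Pk))].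
- apply: bndD; apply: bndM => //; [exact: bnd_isP (isP_dpart i Pk)|exact: bnd_isP|].
  by apply: bndM; [exact: bnd_isP (isP_dpart i Pb)|apply: bndM => //; exact: bnd_cst].
- apply: bndM; first by apply: bndN; exact: bnd_isP (isP_dpart i Pq).
  by apply: bnd_ext (bndM bndq bndq) => z _; rewrite -exprVn expr2.
Qed.

Let bnd_Ji i j : bnd S (fun z => Ji z i j).
Proof.
have B : bnd S (fun z => (Det P z)^-1).
  apply: bndV_compact => // [z _|[t x] Sz]; first exact: isP_at (isP_Det PP).
  by apply: detP0; [case: Sz|exact: (SKo Sz)].
apply: (@bnd_ext _ _ (fun z => (Det P z)^-1 * (\adj (Jm P z)) i j)).
  move=> [t x] Sz; rewrite /Ji invmxE//; apply: detP0; [by case: Sz|exact: (SKo Sz)].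
by apply: bndM => //; apply: bnd_isP; apply: isP_adj => k l; exact: isP_Jm.
Qed.

Lemma tr_h_bound k : isP k -> exists2 C, 0 <= C & forall t y, T t -> `|tr_h k (t, y)| <= C.
Proof.
move=> Pk; apply: (@bnd_Uo (tr_c k)) => //.
- by apply: (bndM (bnd_m Pk) bndq).
- by move=> z /(tr_c0 k)[].
Qed.

Lemma tr_A_bound k : isP k -> exists2 C, 0 <= C & forall t y, T t -> `|tr_A k (t, y)| <= C.
Proof.
move=> Pk; apply: (@bnd_Uo (fun z => tr_ct k z - \sum_i (\sum_k dtime (fun w => P w 0 k) z * Ji z k i) * tr_ci k i z)) => //.
- apply: bndD; first exact: bnd_ct.
  apply: bndN; apply: bnd_sum => i; apply: bndM; last exact: bnd_ci.
  by apply: bnd_sum => j; apply: (bndM (bnd_isP (isP_dtime (PP j))) (bnd_Ji _ _)).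
- by move=> z /(tr_c0 k)[_ -> h]; rewrite big1 ?subr0// => i _; rewrite h mulr0.
Qed.

Lemma tr_B_bound k j : isP k -> exists2 C, 0 <= C & forall t y, T t -> `|tr_B k j (t, y)| <= C.
Proof.
move=> Pk; apply: (@bnd_Uo (fun z => \sum_i Ji z j i * tr_ci k i z)) => //.
- by apply: bnd_sum => i; apply: (bndM (bnd_Ji _ _) (bnd_ci i Pk)).
- by move=> z /(tr_c0 k)[_ _ h]; rewrite big1// => i _; rewrite h mulr0.
Qed.

Lemma tr_supp : exists rho, forall t y, T t -> Uo P t y -> `|y| <= rho.
Proof.
have cTK : compact (T `*` @simplex R n) by apply: compact_setX; [exact: segment_compact|exact: compact_simplex].
have /choice[c hc] : forall i, exists C, forall z : Z n, (T `*` @simplex R n) z -> `|P z 0 i| <= C.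
  move=> i; have [C _ hC] := compact_bound cTK (fun z _ => isP_at (z := z) (PP i)).
  by exists C.
pose C := \sum_i Num.max (c i) 0.
have C0 : 0 <= C by apply: sumr_ge0 => i _; rewrite le_max lexx orbT.
exists C => t _ Tt [x Kx <-]; apply: norm_rV_le => // i.
apply: (le_trans (hc i (t, x) _)); first by split => //; exact: KoK.
rewrite /C (bigD1 i)//= (@le_trans _ _ (Num.max (c i) 0)) ?le_max ?lexx// lerDl.
by apply: sumr_ge0 => j _; rewrite le_max lexx orbT.
Qed.

(* Conservation of mass, d_t (c / det) + div (c V / det) = 0, for the velocity V
   of the motion P; this is Jacobi's formula. *)
Lemma tr_div k t y : isP k -> (forall z, dtime k z = 0) -> T t ->
  tr_A k (t, y) + \sum_j tr_B (fun z => k z * dtime (fun w => P w 0 j) z) j (t, y) = 0.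
Proof.
move=> Pk k0 Tt; rewrite /tr_A /=; case: ifPn => [/set_mem Uy|nU]; last first.
  by rewrite add0r big1// => j _; rewrite /tr_B /= (negbTE nU).
have [Kx xE] := @XoP _ _ P (t, y) Uy.
set z : Z n := (t, Xo P (t, y)).
have qz : q z != 0 by rewrite gt_eqF// q0.
have D0 : Det P z != 0 by exact: detP0.
have sgn0 : sg != 0 by have := detP Tt Kx; apply: contraTneq => ->; rewrite mul0r ltxx.
have b0 : bpoly z != 0 by rewrite gt_eqF// bpoly_gt0.
pose w j := dtime (fun w => P w 0 j).
have Pw j : isP (w j) by exact: isP_dtime (PP j).
have ciM j i : tr_ci (fun z => k z * w j z) i z = tr_ci k i z * w j z + tr_c k z * dpart i (w j) z.
  have H := hasDM (hasD_tr_c Pk qz) (isP_hasD z (Pw j)).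
  have H' := hasD_tr_c (isP_mul Pk (Pw j)) qz.
  have [_ e1] := hasD_unique H; have [_ e2] := hasD_unique H'.
  rewrite e2 e1; congr (dpart i _ z); apply/funext => z'.
  by rewrite /tr_c /tr_m; ring.
(* The factor [bpoly] does not depend on time, so that only the determinant contributes; [dtime_Det]
   turns its derivative into the divergence of the velocity [w]. *)
have -> : tr_ct k z = - (tr_c k z * (\sum_j \sum_i Ji z j i * dpart i (w j) z)).
  have dq : dtime q z = bpoly z ^+ 2 * (sg * dtime (Det P) z).
    have PD := isP_Det PP.
    rewrite /q (dtimeM (isP_exp 2 (isP_bpoly n)) (isP_mul (isP_cst _ sg) PD)) (dtimeM (isP_cst _ sg) PD).
    rewrite dtime_cst mul0r add0r.
    suff -> : dtime (fun z : Z n => bpoly z ^+ 2) z = 0 by rewrite mul0r add0r.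
    have -> : (fun z : Z n => bpoly z ^+ 2) = (fun z => (fun x => bpoly (0, x) ^+ 2) z.2) by [].
    by rewrite /dtime /= derive1_cst.
  have db : dtime b z = 0 by rewrite /dtime /b /bpoly /= derive1_cst.
  rewrite /tr_ct (_ : tr_mt k z = 0) ?mul0r ?add0r ?dq ?(dtime_Det z PP); last by rewrite /tr_mt k0 db !mul0r mulr0 addr0.
  have -> : \sum_j \sum_i Ji z j i * dpart i (w j) z =
     (Det P z)^-1 * (\sum_k \sum_i dpart k (dtime (fun w => P w 0 i)) z * (\adj (Jm P z)) i k).
    rewrite mulr_sumr exchange_big /=; apply: eq_bigr => i _; rewrite mulr_sumr.
    by apply: eq_bigr => j _; rewrite /Ji invmxE// /w; ring.
  move: (\sum_k \sum_i _) => s; rewrite /tr_c /q; field.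
  by rewrite D0 sgn0 b0.
rewrite -opprD; apply/eqP; rewrite addrC subr_eq0; apply/eqP.
rewrite mulr_sumr -[in RHS](eq_bigr _ (fun i _ => erefl)).
transitivity (\sum_j (tr_c k z * (\sum_i Ji z j i * dpart i (w j) z) + \sum_i Ji z j i * tr_ci k i z * w j z)).
  apply: eq_bigr => j _; rewrite /tr_B /= mem_set// mulr_sumr -big_split /=.
  by apply: eq_bigr => i _; rewrite ciM; ring.
rewrite big_split /=; congr (_ + _).
rewrite exchange_big /=; apply: eq_bigr => i _; rewrite mulr_suml.
by apply: eq_bigr => j _; rewrite /w; ring.
Qed.

Lemma is_derive_shift (f : R -> R) (s0 a : R) :
  is_derive (0 : R) (1 : R) (fun s => f (s0 + s)) a -> is_derive s0 (1 : R) f a.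
Proof.
move=> [H1 H2].
have E : (fun h : R => h^-1 *: (((fun s : R => f (s0 + s)) \o shift 0) (h *: 1) - f (s0 + 0))) =
  (fun h : R => h^-1 *: ((f \o shift s0) (h *: 1) - f s0)).
  by apply/funext => h /=; rewrite !addr0 [s0 + _]addrC.
by split; [move: H1; rewrite /derivable E|rewrite -H2 /derive E].
Qed.

Lemma is_derive_seq (f : R -> R) (a : R) : is_derive (0 : R) (1 : R) f a ->
  k.+1%:R * (f k.+1%:R^-1 - f 0) @[k --> \oo] --> a.
Proof.
move=> [H1 H2]; have := H1; rewrite /derivable => /cvg_ex[l hl].
have la : l = a by rewrite -H2; apply/esym/cvg_lim.
rewrite la in hl.
have c0 : (k.+1%:R^-1 : R) @[k --> \oo] --> 0^'.
  have c := @cvg_harmonic R; move=> N hN.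
  have hN' : \forall y \near (0 : R), y != 0 -> N y by exact: hN.
  have h2 : \forall k \near \oo, @harmonic R k != 0 -> N (harmonic k) by exact: c _ hN'.
  suff : \forall k \near \oo, N (k.+1%:R^-1) by [].
  by apply: filterS h2 => k; apply; apply: lt0r_neq0; exact: harmonic_gt0.
have := @cvg_comp _ _ _ (fun k : nat => k.+1%:R^-1 : R) _ _ _ _ c0 hl.
apply: cvg_trans; apply: near_eq_cvg; apply: nearW => k /=.
by rewrite invrK addr0 /GRing.scale /= mulr1.
Qed.

(** Arbitrary filters staying in T cover both continuity in space at a fixed time and the passage to
    the times 0 and 1. *)
Lemma tr_cvg (f g : Z n -> R) (I : Type) (F : set_system I) (FF : Filter F) (G : I -> Z n) t y :
  (forall z, T z.1 -> Ko z.2 -> {for z, continuous f}) ->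
  (forall z, bpoly z <= eps -> f z = 0) ->
  (forall w, g w = if w.2 \in Uo P w.1 then f (w.1, Xo P w) else 0) ->
  T t -> G s @[s --> F] --> ((t, y) : Z n) -> (\forall s \near F, T (G s).1) ->
  g (G s) @[s --> F] --> g (t, y).
Proof.
move=> cf f0 gE Tt cG TG.
have [[x Kx xy]|Uy] := pselect (Uo P t y).
  have Uy : Uo P t y by exists x.
  have XE : Xo P (t, y) = x by rewrite -xy; exact: (XoE injP).
  have cG' : G s @[s --> F] --> ((t, P (t, x)) : Z n) by rewrite xy.
  have cX := Xo_cvg_in PP injP detP0 FF Tt Kx cG' TG.
  have c1 : (G s).1 @[s --> F] --> t.
    exact: (@cvg_comp _ _ _ G fst _ _ _ cG (@cvg_fst _ _ _ _ _)).
  have c2 : ((G s).1, Xo P (G s)) @[s --> F] --> ((t, x) : Z n) by exact: (cvg_pair c1 cX).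
  have := @cvg_comp _ _ _ (fun s => ((G s).1, Xo P (G s)) : Z n) f _ _ _ c2 (cf (t, x) Tt Kx).
  rewrite gE /= mem_set// XE; apply: cvg_trans; apply: near_eq_cvg.
  have hU : \forall s \near F, T (G s).1 -> Uo P (G s).1 (G s).2 /\ setT (Xo P (G s)).
    exact: cG' _ (Xo_near PP injP detP0 Tt Kx (@filterT _ (nbhs x) (nbhs_filter x))).
  near=> s; have Ts : T (G s).1 by near: s.
  have hs : T (G s).1 -> Uo P (G s).1 (G s).2 /\ setT (Xo P (G s)) by near: s.
  by rewrite gE mem_set//; have [] := hs Ts.
have nS : \forall w \near ((t, y) : Z n), ~ Sim w.
  apply: open_nbhs_nbhs; split; first exact: closed_openC.
  move=> [[s x] [/= Ts [Kx bx]] [st xy]]; subst s; apply: Uy; exists x => //.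
  exact: (@SKo (t, x)).
have nS' : \forall s \near F, ~ Sim (G s) by exact: cG _ nS.
rewrite gE /= memNset//; have h0 : (fun _ : I => 0 : R) @ F --> (0 : R) by exact: cvg_cst.
apply: cvg_trans h0; apply: near_eq_cvg.
near=> s; have Sw : ~ Sim (G s) by near: s.
have Tw : T (G s).1 by near: s.
rewrite gE; case: ifPn => // /set_mem Uw; have [Kx xE] := XoP Uw.
have [|be] := leP (bpoly ((G s).1, Xo P (G s))) eps; first by move=> /f0 ->.
exfalso; apply: Sw; exists ((G s).1, Xo P (G s)); last by rewrite /= xE; case: (G s).
by split => //; split; [exact: KoK|exact: ltW].
Unshelve. all: by end_near. Qed.

Let cont_c k z : isP k -> T z.1 -> Ko z.2 -> {for z, continuous (tr_c k)}.
Proof.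
move=> Pk Tz Kz; have qz : q z != 0 by case: z Tz Kz => t x Tz Kz; rewrite gt_eqF// q0.
exact: hasD_cont (hasD_tr_c Pk qz).
Qed.

Lemma tr_h_cvg k (I : Type) (F : set_system I) (FF : Filter F) (G : I -> Z n) t y : isP k ->
  T t -> G s @[s --> F] --> ((t, y) : Z n) -> (\forall s \near F, T (G s).1) ->
  tr_h k (G s) @[s --> F] --> tr_h k (t, y).
Proof.
move=> Pk; apply: (@tr_cvg (tr_c k)) => // z; first exact: cont_c.
by move=> /(tr_c0 k)[].
Qed.

Lemma tr_h_mfun k t : isP k -> T t -> mfun setT (fun y => tr_h k (t, y)).
Proof.
move=> Pk Tt; apply: mfun_open; first exact: openT.
move=> y _; apply: (tr_h_cvg (nbhs_filter y) (t := t) Pk Tt); last exact: nearW.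
have ct : (fun _ : V n => t) @ y --> t by apply: cst_continuous.
exact: (cvg_pair ct (@cvg_id _ _)).
Qed.

(** [tr_h] has bounded support, and the bound on its derivative [tr_B] gives, by the mean value
    theorem, the Lipschitz condition of [ibp]. *)
Lemma tr_B_int k j t : isP k -> 0 < t < 1 -> hasint setT (fun y => tr_B k j (t, y)) 0.
Proof.
move=> Pk t01; have Tt : T t by rewrite /T /= in_itv /=; case/andP: t01 => *; rewrite !ltW.
have [C C0 hC] := tr_h_bound Pk; have [L L0 hL] := tr_B_bound j Pk.
have [rho hrho] := tr_supp.
have H x (s0 : R) : is_derive s0 (1 : R) (fun s : R => tr_h k (t, x + s *: delta_mx 0 j)) (tr_B k j (t, x + s0 *: delta_mx 0 j)).
  apply: is_derive_shift; have := hasD_slice j (tr_h_hasD (x + s0 *: delta_mx 0 j) Pk t01).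
  by rewrite /= => h; under eq_fun do rewrite scalerDl addrA.
apply: (@ibp _ _ j (fun y => tr_h k (t, y)) _ L 1 rho C set0) => //.
- exact: tr_h_mfun.
- by move=> x; exact: hC.
- move=> x xr; rewrite /tr_h /= memNset// => /(hrho _ _ Tt); by rewrite leNgt xr.
- move=> x s _.
  have [s0|s0] := leP 0 s.
    have [|c _] := MVT_segment s0 (fun c _ => H x c).
      apply: derivable_within_continuous => c _; exact: ex_derive.
    by rewrite scale0r addr0 subr0 => ->; rewrite normrM ler_wpM2r//; exact: hL.
  have [|c _] := MVT_segment (ltW s0) (fun c _ => H x c).
    apply: derivable_within_continuous => c _; exact: ex_derive.
  by rewrite scale0r addr0 sub0r distrC => ->; rewrite normrM normrN ler_wpM2r//; exact: hL.
- by rewrite /mset preimage_set0.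
- move=> x _; have := is_derive_seq (H x 0).
  by rewrite scale0r addr0.
Qed.

Lemma hasint_EFin m (D : set (V m)) f I : hasint D f I ->
  (\int[leb m]_(t in @row_of R m @^-1` D) (f (row_of t))%:E = I%:E)%E.
Proof.
move=> [N [mN N0 mD intf <-]].
rewrite (@integral_setD_negligible _ _ _ (leb m) _ (@row_of R m @^-1` N))// /Rintegral fineK//.
by apply: integrable_fin_num => //; exact: msetD.
Qed.

Lemma hasint_sub m (D U : set (V m)) f I : mset U -> U `<=` D ->
  (forall x, D x -> ~ U x -> f x = 0) -> hasint D f I -> hasint U f I.
Proof.
move=> mU UD f0 [N [mN N0 mD intf <-]]; exists N; split => //.
  apply: integrableS intf; [exact: msetD|exact: msetD|].
  by move=> t [Ut Nt]; split => //; exact: UD.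
rewrite /Rintegral; congr fine; rewrite integral_mkcond [RHS]integral_mkcond.
congr (integral _ _ _); apply/funext => t; rewrite !patchE.
case: ifPn => [/set_mem [Ut Nt]|nU]; first by rewrite mem_set//; split => //; exact: UD.
case: ifPn => // /set_mem [Dt Nt]; rewrite f0//.
by move=> Ut; move: nU; rewrite mem_set.
Qed.

Lemma hasint_dct m (D : set (V m)) (f : nat -> V m -> R) g C : mset D -> (vol D < +oo)%E ->
  (forall k, mfun D (f k)) -> (forall k x, D x -> `|f k x| <= C) ->
  (forall x, D x -> f k x @[k --> \oo] --> g x) ->
  exists2 J, hasint D g J & forall I, (forall k, hasint D (f k) (I k)) -> I k @[k --> \oo] --> J.
Proof.
move=> mD Doo mf fC cf; pose Dt := @row_of R m @^-1` D.
have fcv t : Dt t -> (f k (row_of t))%:E @[k --> \oo] --> (g (row_of t))%:E.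
  by move=> Dx; apply: cvg_EFin; [exact: nearW|exact: cf].
have mef k : measurable_fun Dt (fun t => (f k (row_of t))%:E).
  by apply/measurable_EFinP; exact: mf.
have mg : measurable_fun Dt (fun t => (g (row_of t))%:E) by exact: (emeasurable_fun_cvg _ _ mef fcv).
have iC : (leb m).-integrable Dt (cst C%:E) by apply/integrableP; split => //; rewrite /= integral_cst// lte_mul_pinfty.
have fC' t k : Dt t -> (`|(f k (row_of t))%:E| <= cst C%:E t)%E by move=> Dx; rewrite /= lee_fin fC.
have [ig _ cvi] := @dominated_convergence _ _ _ (leb m) Dt mD _ _ (cst C%:E) mef mg
  (aeW _ fcv) iC (aeW _ (fun t k Dx => fC' t k Dx)).
exists (\int[leb m]_(t in Dt) g (row_of t)).
  by exists set0; rewrite /mset /vol preimage_set0 measure0 setD0; split.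
move=> I hI; move: cvi; rewrite -(fineK (integrable_fin_num mD ig)).
by under eq_fun do rewrite (hasint_EFin (hI _)); move=> /fine_cvg.
Qed.

Lemma hasint_mct m (D : set (V m)) (f : nat -> V m -> R) g I M : mset D ->
  (forall k, mfun D (f k)) -> (forall k x, D x -> 0 <= f k x) ->
  (forall x, D x -> nondecreasing_seq (f^~ x)) ->
  (forall x, D x -> f k x @[k --> \oo] --> g x) ->
  (forall k, hasint D (f k) (I k)) -> (forall k, I k <= M) ->
  exists2 J, hasint D g J & I k @[k --> \oo] --> J.
Proof.
move=> mD mf f0 ndf cf hI IM; pose Dt := @row_of R m @^-1` D.
have fcv t : Dt t -> (f k (row_of t))%:E @[k --> \oo] --> (g (row_of t))%:E.
  by move=> Dx; apply: cvg_EFin; [exact: nearW|exact: cf].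
have mef k : measurable_fun Dt (fun t => (f k (row_of t))%:E).
  by apply/measurable_EFinP; exact: mf.
have mg : measurable_fun Dt (fun t => (g (row_of t))%:E) by exact: (emeasurable_fun_cvg _ _ mef fcv).
have g0 x : D x -> 0 <= g x by move=> Dx; apply: (cvgr_to_ge (cf x Dx)); exact: nearW (fun k => f0 k x Dx).
have cI : cvgn I.
  apply: nondecreasing_is_cvgn; last by exists M => _ [k _ <-].
  apply/nondecreasing_seqP => k; apply: (@hasint_le _ _ D (f k) (f k.+1) _ _ set0) (hI k) (hI k.+1).
  - by rewrite /mset preimage_set0.
  - by rewrite /vol preimage_set0 measure0.
  - by move=> x Dx _; exact: ndf.
exists (limn I) => //.
have E : (\int[leb m]_(t in Dt) (g (row_of t))%:E = (limn I)%:E)%E.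
  have := @cvg_monotone_convergence _ _ _ (leb m) Dt mD (fun k t => (f k (row_of t))%:E) mef.
  move=> /(_ (fun k t Dx => f0 k _ Dx)) h.
  have h' := h (fun t Dx a b ab => ndf _ Dx a b ab).
  have := cvg_lim _ h'; move=> /(_ (@ereal_hausdorff R)).
  under eq_fun do rewrite (hasint_EFin (hI _)).
  rewrite (EFin_lim cI) => ->; apply: eq_integral => t /set_mem Dx.
  by apply/esym/cvg_lim => //; exact: fcv.
exists set0; rewrite /mset /vol preimage_set0 measure0 setD0; split => //; last by rewrite /Rintegral E.
apply/integrableP; split => //.
rewrite (eq_integral (fun t => (g (row_of t))%:E)) ?E ?ltry// => t /set_mem Dx.
by rewrite /= ger0_norm// g0.
Qed.

Lemma tr_const k : isP k -> (forall z, dtime k z = 0) ->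
  exists I, forall t, T t -> hasint (Uo P t) (fun y => tr_c k (t, Xo P (t, y))) I.
Proof.
move=> Pk k0; have [rho0 hrho0] := tr_supp.
have [C C0 hC] := tr_h_bound Pk; have [A A0 hA] := tr_A_bound Pk.
pose rho := Num.max 0 rho0; have rho_ge0 : 0 <= rho by rewrite le_max lexx.
pose D := cbox (0 : V n) rho.
have mD : mset D by exact: mset_cbox.
have vD : (vol D < +oo)%E by rewrite vol_cbox// ltry.
have UD t : T t -> Uo P t `<=` D.
  by move=> Tt y /(hrho0 _ _ Tt) h; apply/cboxP; rewrite ?subr0// /rho le_max h orbT.
have mset0 : mset (set0 : set (V n)) by rewrite /mset preimage_set0.
have vset0 : vol (set0 : set (V n)) = 0%E by rewrite /vol preimage_set0 measure0.
have mh t : T t -> mfun D (fun y => tr_h k (t, y)).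
  by move=> Tt; apply: (measurable_funS _ _ (tr_h_mfun Pk Tt)) => //; rewrite preimage_setT.
pose Phi t := vint D (fun y => tr_h k (t, y)).
have hPhi t : T t -> hasint D (fun y => tr_h k (t, y)) (Phi t).
  move=> Tt; have [I hI] : exists I, hasint D (fun y => tr_h k (t, y)) I.
    apply: (@hasint_bounded _ _ _ _ C set0) => //; first by rewrite setD0; exact: mh.
    by move=> x _ _; exact: hC.
  by rewrite /Phi (hasint_vint hI).
have TI (t : R) : 0 < t < 1 -> T t by move=> /andP[? ?]; rewrite /T /= in_itv /= !ltW.
have dPhi (t : R) : 0 < t < 1 -> is_derive t (1 : R) Phi 0.
  move=> t01; have It : `]0, 1[%classic t by rewrite /= in_itv.
  have iC (c : R) : (leb n).-integrable (@row_of R n @^-1` D) (EFin \o (fun=> c)).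
    have -> : EFin \o (fun=> c) = cst c%:E :> (n.-tuple (measurableTypeR R) -> \bar R) by [].
    by apply/integrableP; split => //; rewrite /= integral_cst// lte_mul_pinfty.
  have H := @cvg_differentiation_under_integral R _ _ (leb n) (fun t y => tr_h k (t, row_of y))
    (@row_of R n @^-1` D) mD t 0 1 It.
  have d1 (s : R) y : 0 < s < 1 -> is_derive s (1 : R) (fun x : R => tr_h k (x, y)) (tr_A k (s, y)).
    by move=> s01; exact: (hasD_derive1 (tr_h_hasD y Pk s01)).
  have {}H := H _ _ (fun=> A) (fun=> A0) (iC A).
  have {}H : h^-1 *: (Phi (h + t) - Phi t) @[h --> 0^'] -->
    \int[leb n]_(y in @row_of R n @^-1` D) partial1of2 (fun t y => tr_h k (t, row_of y)) t y.
    apply: H => s.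
    - rewrite /= in_itv /= => s01; have [N [mN N0 _ intf _]] := hPhi s (TI s s01).
      apply/integrableP; split; first by apply/measurable_EFinP; exact: mh (TI _ s01).
      move/integrableP : intf => [_]; rewrite pre_setD -integral_setD_negligible//.
    - by move=> y; rewrite /= in_itv /= => s01 _; have [] := d1 s (row_of y) s01.
    - move=> y; rewrite /= in_itv /= => s01 _; rewrite partial1of2E.
      by have [_ ->] := d1 s (row_of y) s01; apply: hA; exact: TI.
  have E : \int[leb n]_(y in @row_of R n @^-1` D) partial1of2 (fun t y => tr_h k (t, row_of y)) t y = 0.
    transitivity (vint D (fun y => tr_A k (t, y))).
      rewrite /vint; congr (Rintegral _ _ _); apply/funext => y; rewrite partial1of2E.
      by have [_ ->] := d1 t (row_of y) t01.
    apply: hasint_vint.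
    have HB j := tr_B_int j (isP_mul Pk (isP_dtime (PP j))) t01.
    have HS := hasintZ (-1) (hasint_sum (index_enum 'I_n) (P := xpredT) (measurableT : mset setT) (fun j _ => HB j)).
    rewrite big1 ?mulr0// in HS.
    apply: (@hasint_ext _ _ _ (fun y => -1 * \sum_(j <- index_enum 'I_n) tr_B (fun z => k z * dtime (fun w => P w 0 j) z) j (t, y))).
      by move=> y _; have := tr_div y Pk k0 (TI t t01); lra.
    apply: hasint_sub HS => // y _ nD.
    rewrite big1 ?mulr0// => j _; rewrite /tr_B /= memNset// => /(UD _ (TI t t01)); exact: nD.
  rewrite E in H.
  have H' : h^-1 *: ((Phi \o shift t) (h *: (1 : R)) - Phi t) @[h --> 0^'] --> (0 : R).
    have EE : (fun h : R => h^-1 *: ((Phi \o shift t) (h *: (1 : R)) - Phi t)) = (fun h : R => h^-1 *: (Phi (h + t) - Phi t)).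
      by apply/funext => h; rewrite /= /GRing.scale /= mulr1.
    by rewrite EE; exact: H.
  by split; [apply/cvg_ex; exists 0|exact/cvg_lim].
have cPhi (s t : R) : 0 < s -> s <= t -> t < 1 -> Phi s = Phi t.
  move=> s0 st t1.
  have [||c _] := @MVT_segment _ Phi (fun=> 0) s t st.
  - move=> x /itvP xx; apply: dPhi; rewrite (lt_trans s0) ?(lt_trans _ t1)//=; by rewrite xx.
  - apply: derivable_within_continuous => x /itvP xx; apply: (@ex_derive _ _ _ _ _ _ _ (dPhi x _)).
    by rewrite (lt_le_trans s0) ?(le_lt_trans _ t1)//=; rewrite xx.
  - by move: (Phi t) (Phi s) => u v; rewrite mul0r => uv; apply/esym/subr0_eq.
exists (Phi (1/2)) => t Tt.
suff -> : Phi (1/2) = Phi t.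
  apply: (@hasint_ext _ _ _ (fun y => tr_h k (t, y))).
    by move=> y Uy; rewrite /tr_h /= mem_set.
  apply: hasint_sub (hPhi t Tt).
  - by apply: mset_open; exact: (open_Uo PP injP detP0).
  - exact: UD.
  - by move=> y _ Uy; rewrite /tr_h /= memNset.
pose s (i : nat) : R := t + i.+2%:R^-1 * (1/2 - t).
have [t0 t1] : 0 <= t /\ t <= 1 by move: Tt; rewrite /T /= in_itv /= => /andP.
have s01 i : 0 < s i < 1.
  have i0 : 0 < i.+2%:R^-1 :> R by rewrite invr_gt0 ltr0n.
  have i1 : i.+2%:R^-1 <= 1/2 :> R.
    by rewrite div1r lef_pV2 ?posrE ?ltr0n// ler_nat.
  rewrite /s; move: (i.+2%:R^-1) i0 i1 => a a0 a1; apply/andP; split; nra.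
have cs : s i @[i --> \oo] --> t.
  have c0 : (i.+2%:R^-1 : R) @[i --> \oo] --> (0 : R).
    by have := @cvg_harmonic R; rewrite -(cvg_shiftS (harmonic (R := R))).
  have c1 : s i @[i --> \oo] --> t + 0 * (1/2 - t).
    by apply: cvgD; [exact: cvg_cst|apply: cvgM => //; exact: cvg_cst].
  by rewrite mul0r addr0 in c1.
have hcv y : D y -> tr_h k (s i, y) @[i --> \oo] --> tr_h k (t, y).
  move=> _; apply: (tr_h_cvg _ (G := fun i => (s i, y))) => //.
    exact: (cvg_pair cs (@cvg_cst _ y _ \oo _)).
  by apply: nearW => i; exact: TI (s01 i).
have [J hJ hc] := @hasint_dct _ D (fun i y => tr_h k (s i, y)) (fun y => tr_h k (t, y)) C mD vD
  (fun i => mh _ (TI _ (s01 i))) (fun i x _ => hC _ _ (TI _ (s01 i))) hcv.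
rewrite (hasint_uniq (hPhi t Tt) hJ).
have := hc (fun i => Phi (s i)) (fun i => hPhi _ (TI _ (s01 i))).
have E i : Phi (s i) = Phi (1/2).
  have [h|h] := leP (s i) (1/2).
    by apply: cPhi => //; [case/andP: (s01 i)|lra].
  by apply/esym; apply: cPhi; [lra|exact: ltW|case/andP: (s01 i)].
under eq_fun do rewrite E; move=> /cvg_lim <-//; by rewrite lim_cst.
Qed.

End Transport.

(** * Removing the cut-off *)

Section TransportLimit.
Context {R : realType}.
Local Notation V n := ('rV[R]_n).
Local Notation Z n := (R * 'rV[R]_n)%type.

Variables (n : nat) (P : Z n -> V n) (PP : pmap P) (sg : R).
Let T : set R := `[0, 1]%classic.
Hypothesis injP : forall t, T t -> set_inj (@Ko R n) (fun x => P (t, x)).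
Hypothesis detP : forall t x, T t -> Ko x -> 0 < sg * Det P (t, x).

Let detP0 t x : T t -> Ko x -> Det P (t, x) != 0.
Proof. by move=> Tt Kx; have := detP Tt Kx; apply: contraTneq => ->; rewrite mulr0 ltxx. Qed.

Variable C : R.
Hypothesis det0 : forall x, Ko x -> C <= sg * Det P (0, x).
Hypothesis C0 : 0 < C.

Lemma simplex_isP_bound (k : Z n -> R) t : isP k ->
  exists2 M, 0 <= M & forall x, simplex x -> `|k (t, x)| <= M.
Proof.
move=> Pk; have ct x : (fun x : V n => (t, x)) @ x --> ((t, x) : Z n).
  have c1 : (fun _ : V n => t) @ x --> t by apply: cst_continuous.
  exact: (cvg_pair c1 (@cvg_id _ _)).
have [M M0 hM] := compact_bound (f := fun x => k (t, x)) (@compact_simplex R n) (fun x _ => @cvg_comp _ _ _ _ k _ _ _ (ct x) (isP_at Pk)).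
by exists M.
Qed.

(** For k >= 0 the integrands increase as the cut-off parameter decreases. At time 0 they are
    bounded by M / C, so that their integrals are bounded; these being the same at all times,
    monotone convergence yields integrability even at times when the determinant degenerates on the
    boundary. *)
Lemma transport_ge0 (k : V n -> R) : isP (fun z : Z n => k z.2) -> (forall x, Ko x -> 0 <= k x) ->
  exists I, forall t, T t -> hasint (Uo P t)
    (fun y => k (Xo P (t, y)) / (sg * Det P (t, Xo P (t, y)))) I.
Proof.
move=> Pk k_ge0; pose K := fun z : Z n => k z.2.
have dK z : dtime K z = 0 by rewrite /dtime /K /= derive1_cst.
pose e i : R := i.+1%:R^-1; have e0 i : 0 < e i by rewrite invr_gt0 ltr0n.
pose f t i y := tr_c P sg (e i) K (t, Xo P (t, y)).
pose g t y := k (Xo P (t, y)) / (sg * Det P (t, Xo P (t, y))).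
have /choice[I hI] : forall i, exists I, forall t, T t -> hasint (Uo P t) (f t i) I.
  by move=> i; exact: (tr_const PP injP detP (e0 i) Pk dK).
have T0 : T 0 by rewrite /T /= in_itv /= lexx ler01.
have fE t i x : T t -> Ko x -> f t i (P (t, x)) =
    (pp (bpoly (t, x) - e i) / bpoly (t, x) ^+ 2) * (k x / (sg * Det P (t, x))).
  move=> Tt Kx; rewrite /f (XoE injP)// /tr_c /tr_m /K /=.
  have D0 := detP0 Tt Kx; have := detP Tt Kx => D1.
  have sgn0 : sg != 0 by apply: contraTneq D1 => ->; rewrite mul0r ltxx.
  have b0 : bpoly (t, x) != 0 by rewrite gt_eqF// bpoly_gt0.
  by move: (pp _) => p; field; rewrite D0 sgn0 b0.
have gE t x : T t -> Ko x -> g t (P (t, x)) = k x / (sg * Det P (t, x)).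
  by move=> Tt Kx; rewrite /g (XoE injP).
have g0 t x : T t -> Ko x -> 0 <= k x / (sg * Det P (t, x)).
  by move=> Tt Kx; rewrite divr_ge0 ?k_ge0// ltW// detP.
have r01 t i (x : V n) : Ko x -> 0 <= pp (bpoly (t, x) - e i) / bpoly (t, x) ^+ 2 <= 1.
  move=> Kx; have b0 := bpoly_gt0 t Kx; rewrite divr_ge0 ?sqr_ge0//= ler_pdivrMr ?exprn_gt0// mul1r.
  rewrite /pp ler_pXn2r ?nnegrE ?le_max ?lexx ?orbT ?(ltW b0)//.
  by rewrite ge_max (ltW b0) andbT gerBl ltW.
have mU t : T t -> mset (Uo P t) by move=> Tt; apply: mset_open; exact: (open_Uo PP injP detP0).
have mf t i : T t -> mfun (Uo P t) (f t i).
  move=> Tt; have := tr_h_mfun PP injP detP (e0 i) Pk Tt; rewrite /mfun preimage_setT => m1.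
  apply: (@eq_measurable_fun _ _ _ _ _ ((fun y => tr_h P sg (e i) K (t, y)) \o @row_of R n)).
    by move=> y /set_mem Uy; rewrite /= /tr_h /= mem_set.
  exact: measurable_funS m1.
have f0 t i y : T t -> Uo P t y -> 0 <= f t i y.
  move=> Tt [x Kx <-]; rewrite fE// mulr_ge0 ?g0//; by have /andP[] := r01 t i x Kx.
have ndf t y : T t -> Uo P t y -> nondecreasing_seq (fun i => f t i y).
  move=> Tt [x Kx <-]; apply/nondecreasing_seqP => i; rewrite !fE// ler_wpM2r ?g0//.
  rewrite ler_pM2r ?invr_gt0 ?exprn_gt0 ?bpoly_gt0// /pp.
  have h : Num.max (bpoly (t, x) - e i) 0 <= Num.max (bpoly (t, x) - e i.+1) 0.
    rewrite ge_max !le_max lexx orbT andbT; apply/orP; left.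
    by rewrite lerB// /e lef_pV2 ?posrE ?ltr0n// ler_nat.
  by rewrite ler_pXn2r// nnegrE le_max lexx orbT.
have cf t y : T t -> Uo P t y -> f t i y @[i --> \oo] --> g t y.
  move=> Tt [x Kx <-]; rewrite gE//; under eq_fun do rewrite fE//.
  suff h1 : pp (bpoly (t, x) - e i) / bpoly (t, x) ^+ 2 @[i --> \oo] --> (1 : R).
    have h2 := cvgM h1 (@cvg_cst _ (k x / (sg * Det P (t, x))) _ \oo _); rewrite mul1r in h2; exact: h2.
  have b0 := bpoly_gt0 t Kx.
  have ce : e i @[i --> \oo] --> (0 : R) by exact: cvg_harmonic.
  have c1 : bpoly (t, x) - e i @[i --> \oo] --> bpoly (t, x).
    have h := cvgB (@cvg_cst _ (bpoly (t, x)) _ \oo _) ce; rewrite subr0 in h; exact: h.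
  have c2 : pp (bpoly (t, x) - e i) @[i --> \oo] --> bpoly (t, x) ^+ 2.
    have h : (bpoly (t, x) - e i) * (bpoly (t, x) - e i) @[i --> \oo] --> bpoly (t, x) ^+ 2.
      by rewrite expr2; exact: (cvgM c1 c1).
    apply: cvg_trans h; apply: near_eq_cvg; near=> i; rewrite pp_ge0 ?expr2//.
    apply: ltW; near: i; exact: cvgr_gt _ c1 _ b0.
  have h := cvgM c2 (@cvg_cst _ (bpoly (t, x) ^- 2) _ \oo _).
  by rewrite divff ?expf_neq0 ?gt_eqF// in h; exact: h.
have [rho hrho] := tr_supp PP.
have [M M0 hM] := simplex_isP_bound 0 Pk.
have fM i y : Uo P 0 y -> `|f 0 i y| <= M / C.
  move=> [x Kx <-]; have /andP[r0 r1] := r01 0 i x Kx.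
  have h0 := g0 0 x T0 Kx; have D1 := detP T0 Kx.
  have h1 : k x / (sg * Det P (0, x)) <= M / C.
    apply: ler_pM; rewrite ?k_ge0 ?invr_ge0 ?(ltW D1)//.
      by apply: le_trans (hM x (KoK Kx)); exact: ler_norm.
    by rewrite lef_pV2 ?posrE ?det0.
  rewrite fE// ger0_norm; last exact: mulr_ge0.
  by apply: le_trans h1; rewrite ler_piMl.
have [J hJ _] := @hasint_dct _ _ (Uo P 0) (f 0) (g 0) (M / C) (mU 0 T0)
  (vol_bounded (mU 0 T0) (fun y => hrho 0 y T0)) (fun i => mf 0 i T0) fM (fun y => cf 0 y T0).
(* Shown at time 0, used at every time: the numbers [I i] do not depend on t. *)
have IJ i : I i <= J.
  apply: (@hasint_le _ _ (Uo P 0) (f 0 i) (g 0) _ _ set0) (hI i 0 T0) hJ.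
  - by rewrite /mset preimage_set0.
  - by rewrite /vol preimage_set0 measure0.
  - move=> _ [x Kx <-] _; rewrite fE// gE// ler_piMl ?g0//; by have /andP[] := r01 0 i x Kx.
have H t : T t -> exists2 J', hasint (Uo P t) (g t) J' & I k @[k --> \oo] --> J'.
  move=> Tt; apply: (hasint_mct (mU t Tt) (mf t ^~ Tt) (fun i y => f0 t i y Tt) (fun y => ndf t y Tt)
    (fun y => cf t y Tt) (fun i => hI i t Tt) IJ).
have [J' _ cJ'] := H 0 T0; exists J' => t Tt; have [J'' hJ'' cJ''] := H t Tt.
suff -> : J' = J'' by exact: hJ''.
exact: (cvg_unique _ cJ' cJ'').
Unshelve. all: by end_near. Qed.

(** A sign is gained by adding the bound M of |k| and subtracting the integral of M afterwards. *)
Lemma transport (k : V n -> R) : isP (fun z : Z n => k z.2) ->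
  exists I, forall t, T t -> hasint (Uo P t)
    (fun y => k (Xo P (t, y)) / (sg * Det P (t, Xo P (t, y)))) I.
Proof.
move=> Pk; have [M M0 hM] := simplex_isP_bound 0 Pk.
have P1 : isP (fun z : Z n => M) by exact: isP_cst.
have [I hI] := @transport_ge0 (fun=> M) P1 (fun _ _ => M0).
have [|J hJ] := @transport_ge0 (fun x => k x + M) (isP_add Pk P1).
  by move=> x /KoK /hM; rewrite ler_norml => /andP[]; lra.
exists (J + -1 * I) => t Tt.
apply: hasint_ext (hasintD (hJ t Tt) (hasintZ (-1) (hI t Tt))) => y _.
by move: (_^-1) => r; ring.
Qed.

End TransportLimit.

(** * Integration by parts on a mesh *)

Section Cover.
Context {R : realType}.
Local Notation V n := ('rV[R]_n).
Local Notation Z n := (R * 'rV[R]_n)%type.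

(* A function that is Lipschitz on each of finitely many closed sets covering a
   segment is Lipschitz along it: leave each set at its last point. *)
Lemma line_cover (I : finType) (S : I -> set R) (phi : R -> R) (L : R) (A : {set I}) (u : R) :
  (forall i, closed (S i)) ->
  (forall i s s', S i s -> S i s' -> `|phi s - phi s'| <= L * `|s - s'|) -> u <= 1 ->
  (forall s, u <= s <= 1 -> exists2 i, i \in A & S i s) ->
  `|phi 1 - phi u| <= L * (1 - u).
Proof.
move=> cS SL; have [m] := ubnP #|A|; elim: m A u => // m IH A u Am u1 cov.
have [i iA Siu] : exists2 i, i \in A & S i u by apply: cov; rewrite lexx.
pose B := [set s | u <= s <= 1] `&` S i.
have Bu : B u by split => //=; rewrite lexx.
have uB : ubound B 1 by move=> s [/andP[]].
have hB : has_ubound B by exists 1.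
have cB : closed B.
  apply: closedI; last exact: cS.
  have -> : [set s : R | u <= s <= 1] = `[u, 1]%classic.
    by apply/seteqP; split => s; rewrite /= in_itv.
  exact: interval_closed.
have [s1i Ss1] : B (sup B) by apply: cB; apply: closure_sup => //; exists u.
set s1 := sup B in s1i Ss1; have /andP[us1 s11] := s1i.
have h1 : `|phi s1 - phi u| <= L * (s1 - u).
  by apply: le_trans (SL i _ _ Ss1 Siu) _; rewrite ger0_norm ?subr_ge0.
have [s1E|s1N] := eqVneq s1 1; first by rewrite -s1E.
have s1lt : s1 < 1 by rewrite lt_neqAle s1N.
have cov' s : s1 < s -> s <= 1 -> exists2 j, j \in A :\ i & S j s.
  move=> ss s_1; have [|j jA Sj] := cov s; first by rewrite s_1 (le_trans us1) ?ltW.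
  exists j => //; rewrite !inE jA andbT; apply/eqP => ji; subst j.
  have : s <= s1 by apply: ub_le_sup => //; split => //=; rewrite s_1 (le_trans us1) ?ltW.
  by rewrite leNgt ss.
have h2 : `|phi 1 - phi s1| <= L * (1 - s1).
  apply: (IH (A :\ i)) => //.
    by move: Am; rewrite (cardsD1 i A) iA.
  move=> s /andP[]; rewrite le_eqVlt => /predU1P[<- _|]; last exact: cov'.
  (* At s1 itself another set of the cover is needed: if none contained s1, then, these sets being
     closed and finitely many, none would meet a small interval to the right of s1, which they
     cover. *)
  apply: contrapT => nS.
  have nr : \forall s \near s1, forall j, j \in A :\ i -> ~ S j s.
    apply: near_forall => j; have [jA|jA] := boolP (j \in A :\ i); last exact: near_all.
    have : nbhs s1 (~` S j).
      by apply: open_nbhs_nbhs; split; [exact: closed_openC|move=> Sj; apply: nS; exists j].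
    by apply: filterS => s' h _.
  have [e /= e0 he] := nr.
  pose s2 := Num.min 1 (s1 + e / 2).
  have [s12 s2e] : s1 < s2 /\ s2 - s1 < e.
    rewrite /s2; case: (leP 1 (s1 + e / 2)) => h; split; lra.
  have s21 : s2 <= 1 by rewrite ge_min lexx.
  have [j jA Sj] := cov' s2 s12 s21; apply: (he s2 _ j jA Sj).
  by rewrite /ball /= ltr_distlC; lra.
have -> : phi 1 - phi u = (phi 1 - phi s1) + (phi s1 - phi u) by ring.
by apply: (le_trans (ler_normD _ _)); lra.
Qed.

Lemma cover_lip n (I : finType) (C : I -> set (V n)) (f : V n -> R) (L : R) (a b : V n) :
  (forall i, closed (C i)) ->
  (forall i x y, C i x -> C i y -> `|f x - f y| <= L * `|x - y|) ->
  (forall s, 0 <= s <= 1 -> exists i, C i (a + s *: (b - a))) ->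
  `|f b - f a| <= L * `|b - a|.
Proof.
move=> cC fL cov; pose g (s : R) := a + s *: (b - a).
have cg : continuous g.
  move=> s; apply: cvgD; first exact: cvg_cst.
  by apply: cvgZr_tmp; exact: cvg_id.
have g1 : g 1 = b by rewrite /g scale1r addrC subrK.
have g0 : g 0 = a by rewrite /g scale0r addr0.
suff: `|(f \o g) 1 - (f \o g) 0| <= L * `|b - a| * (1 - 0).
  by rewrite /= g1 g0 subr0 mulr1.
apply: (line_cover (S := fun i => g @^-1` C i) (A := [set: I]%SET)) => //.
- by move=> i; apply: closed_comp => // s _; exact: cg.
- move=> i s s' h h'; apply: (le_trans (fL i _ _ h h')).
  rewrite opprD addrACA subrr add0r -scalerBl normrZ.
  by rewrite mulrAC mulrA.
- by move=> s s01; have [i Ci] := cov s s01; exists i.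
Qed.

(** Near the diagonal the slope matrix is invertible with bounded inverse; away from it injectivity
    keeps the images apart. Compactness of the set of pairs makes the constant uniform. *)
Lemma bilip n (P : Z n -> V n) t : pmap P -> set_inj (@simplex R n) (fun x => P (t, x)) ->
  (forall x, simplex x -> Det P (t, x) != 0) ->
  exists2 c, 0 < c & forall x y, simplex x -> simplex y -> c * `|x - y| <= `|P (t, x) - P (t, y)|.
Proof.
move=> PP injP detP; have [M [cM hM MJ]] := pmap_slope PP.
pose KK := @simplex R n `*` @simplex R n.
have cK : compact KK by apply: compact_setX; exact: compact_simplex.
pose Q (i : nat) (w : V n * V n) := `|w.1 - w.2| <= i%:R * `|P (t, w.1) - P (t, w.2)|.
have cP (x : V n) : (fun x => P (t, x)) @ x --> P (t, x).
  by apply: (cvg_rV (nbhs_filter x)) => i; exact: isP_cst_time (PP i) t x.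
have ct (x y : V n) : (fun w : V n * V n => (t, w)) @ (x, y) --> (t, (x, y)).
  have c1 : (fun _ : V n * V n => t) @ (x, y) --> t by apply: cst_continuous.
  exact: (cvg_pair c1 (@cvg_id _ _)).
have cd (x y : V n) : (fun w : V n * V n => `|P (t, w.1) - P (t, w.2)|) @ (x, y) --> `|P (t, x) - P (t, y)|.
  have c1 : (fun w : V n * V n => P (t, w.1)) @ (x, y) --> P (t, x).
    exact: (@cvg_comp _ _ _ fst (fun x => P (t, x)) _ _ _ (@cvg_fst _ _ _ _ _) (cP x)).
  have c2 : (fun w : V n * V n => P (t, w.2)) @ (x, y) --> P (t, y).
    exact: (@cvg_comp _ _ _ snd (fun x => P (t, x)) _ _ _ (@cvg_snd _ _ _ _ _) (cP y)).
  exact: (cvg_norm (cvgB c1 c2)).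
have loc x y : simplex x -> simplex y -> exists C : R, \forall w \near ((x, y) : V n * V n),
    KK w -> `|w.1 - w.2| <= C * `|P (t, w.1) - P (t, w.2)|.
  move=> Kx Ky; have [xy|xy] := eqVneq x y.
    have c1 k i : (fun w : V n * V n => M t w.1 w.2 k i) @ (x, y) --> M t x y k i.
      exact: (@cvg_comp _ _ _ (fun w : V n * V n => (t, w)) (fun w : R * (V n * V n) => M w.1 w.2.1 w.2.2 k i) _ _ _ (ct x y) (cM t x y k i)).
    have D0 : \det (M t x y) != 0 by rewrite -xy MJ; exact: detP.
    have c2 := cvg_det (nbhs_filter ((x, y) : V n * V n)) c1.
    pose A (w : V n * V n) := M t w.1 w.2.
    have cinv i j : (fun w => (\det (A w))^-1 * (\adj (A w)) i j) @ (x, y) --> (\det (M t x y))^-1 * (\adj (M t x y)) i j.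
      by apply: cvgM; [exact: cvgV|exact: cvg_adj].
    pose C0 : R := \sum_i \sum_j (`|(\det (M t x y))^-1 * (\adj (M t x y)) i j| + 1).
    have C00 : 0 <= C0 by rewrite sumr_ge0// => i _; rewrite sumr_ge0// => j _; rewrite addr_ge0.
    have nC : \forall w \near ((x, y) : V n * V n), forall i j, `|(\det (A w))^-1 * (\adj (A w)) i j| <= C0.
      apply: near_forall => i; apply: near_forall => j.
      have : \forall w \near ((x, y) : V n * V n), `|(\det (A w))^-1 * (\adj (A w)) i j| < `|(\det (M t x y))^-1 * (\adj (M t x y)) i j| + 1.
        by apply: (cvgr_lt _ (cvg_norm (cinv i j))); rewrite ltrDl.
      apply: filterS => w /ltW h; apply: (le_trans h).
      rewrite /C0 (bigD1 i)//= (bigD1 j)//= -addrA lerDl addr_ge0 ?sumr_ge0// => *; rewrite ?addr_ge0 ?sumr_ge0// => *.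
    have nD : \forall w \near ((x, y) : V n * V n), \det (A w) != 0 by exact: (cvgr_neq0 _ c2 D0).
    exists (n%:R * C0); near=> w => _.
    have D1 : \det (A w) != 0 by near: w.
    have hC : forall i j, `|(\det (A w))^-1 * (\adj (A w)) i j| <= C0 by near: w.
    have -> : w.1 - w.2 = (P (t, w.1) - P (t, w.2)) *m invmx (A w).
      by rewrite hM mulmxK// unitmxE unitfE.
    by apply: norm_mulmx => // i j; rewrite invmxE.
  have d0 : 0 < `|P (t, x) - P (t, y)|.
    rewrite normr_gt0 subr_eq0; apply: contra xy => /eqP e; apply/eqP.
    by apply: injP => //; exact: mem_set.
  have nd := cvgr_gt _ (cd x y) (`|P (t, x) - P (t, y)| / 2) _.
  exists (4 / `|P (t, x) - P (t, y)|); near=> w => -[K1 K2].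
  have hd : `|P (t, x) - P (t, y)| / 2 < `|P (t, w.1) - P (t, w.2)|.
    by near: w; apply: nd; move: d0; lra.
  apply: (@le_trans _ _ 2).
    apply: (le_trans (ler_normB _ _)); have := simplex_norm K1; have := simplex_norm K2; lra.
  by rewrite mulrAC ler_pdivlMr//; lra.
have near_cov := (compact_near_coveringP KK).1 cK.
have /near_cov H : forall w, KK w -> \forall w' \near w & i \near \oo, KK w' -> Q i w'.
  move=> [x y] [Kx Ky]; have [C hC] := loc x y Kx Ky.
  have hi : \forall i \near \oo, C <= i%:R by exact: nbhs_infty_ger.
  near=> w i.
  have hCi : C <= i%:R by near: i.
  have h1 : KK w -> `|w.1 - w.2| <= C * `|P (t, w.1) - P (t, w.2)| by near: w.
  by move=> Kw; apply: (le_trans (h1 Kw)); rewrite ler_wpM2r.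
have [N _ hN] := H.
pose m := N.+1; exists (m%:R^-1); first by rewrite invr_gt0 ltr0n.
move=> x y Kx Ky; rewrite ler_pdivrMl ?ltr0n//.
by apply: (hN m _ (x, y)) => //=; rewrite /m.
Unshelve. all: by end_near. Qed.

End Cover.

(** * Piecewise fields glued over a moving mesh *)

Section PiecewiseIBP.
Context {R : realType}.
Local Notation V n := ('rV[R]_n).
Local Notation Z n := (R * 'rV[R]_n)%type.
Let T : set R := `[0, 1]%classic.

Lemma partial_slice m (f : V m -> R) i y (a : R) :
  is_derive (0 : R) (1 : R) (fun s : R => f (y + s *: delta_mx 0 i)) a -> partial i f y = a.
Proof.
move=> [_ <-]; rewrite /partial /derive.
suff -> : (fun h : R => h^-1 *: ((f \o shift y) (h *: delta_mx 0 i) - f y)) =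
  (fun h : R => h^-1 *: (((fun s : R => f (y + s *: delta_mx 0 i)) \o shift 0) (h *: (1 : R)) - f (y + 0 *: delta_mx 0 i))) by [].
by apply/funext => h; rewrite /= addr0 scale0r addr0 [y + _]addrC /GRing.scale /= mulr1.
Qed.

Variables (n : nat) (I : finType).
Local Notation d := n.+1.
Variables (P : I -> Z d -> V d) (PP : forall j, pmap (P j)).
Local Notation K := (@simplex R d).

Lemma null_skeleton t : exists N : set (V d), [/\ mset N, vol N = 0%E &
  forall j x, K x -> ~ Ko x -> N (P j (t, x))].
Proof.
pose F (jv : I * 'I_d.+1) := (fun x => P jv.1 (t, x)) @` [set x | K x /\ bary x jv.2 = 0].
have hF jv : mset (F jv) /\ vol (F jv) = 0%E.
  have [L L0 hL] := pmap_lip t (PP jv.1).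
  apply: (vol0_face jv.2 L0 _ hL) => x _.
  by apply: (cvg_rV (nbhs_filter x)) => i; exact: isP_cst_time (PP jv.1 i) t x.
exists (\bigcup_jv F jv); split.
- by apply: mset_bigcup => jv; have [] := hF jv.
- apply/eqP; rewrite eq_le measure_ge0 andbT.
  apply: (le_trans (vol_bigcup_le (B := F) _ _ _)) => //.
  + by apply: mset_bigcup => jv; have [] := hF jv.
  + by move=> jv; have [] := hF jv.
  + by rewrite big1// => jv _; have [] := hF jv.
- move=> j x Kx nKo; have [v hv] : exists v : 'I_d.+1, ~ 0 < bary x v.
    by apply: contrapT => h; apply: nKo => v; apply: contrapT => hv; apply: h; exists v.
  exists (j, v) => //; exists x => //; split => //.
  by apply/eqP; rewrite eq_le Kx andbT leNgt; apply/negP.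
Qed.

Definition Om t : set (V d) := \bigcup_(j in [set: I]) ((fun x => P j (t, x)) @` K).

Lemma compact_elt j t : compact ((fun x => P j (t, x)) @` K).
Proof.
apply: continuous_compact; last exact: compact_simplex.
apply: continuous_subspaceT => x.
by apply: (cvg_rV (nbhs_filter x)) => i; exact: isP_cst_time (PP j i) t x.
Qed.

Lemma closed_elt j t : closed ((fun x => P j (t, x)) @` K).
Proof. by apply: compact_closed; [exact: norm_hausdorff|exact: compact_elt]. Qed.

Lemma closed_Om t : closed (Om t).
Proof.
by rewrite /Om; apply: closed_bigcup => [|j _]; [exact: finite_finset|]; exact: closed_elt.
Qed.

Lemma Om_bounded t : exists r, forall y, Om t y -> `|y| <= r.
Proof.
have /choice[c hc] : forall j, exists C, forall x, K x -> `|P j (t, x)| <= C.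
  move=> j; have [C _ hC] := compact_bound (f := fun y : V d => `|y|) (@compact_elt j t) (fun y _ => @norm_continuous _ _ y).
  by exists C => x Kx; have := hC (P j (t, x)); rewrite normr_id; apply; exists x.
exists (\sum_j `|c j|) => _ [j _ [x Kx <-]]; apply: (le_trans (hc j x Kx)).
by rewrite (bigD1 j)//= (le_trans (ler_norm _))// lerDl sumr_ge0.
Qed.

Hypothesis injK : forall j, set_inj K (fun x => P j (1, x)).
Hypothesis detK : forall j x, K x -> Det (P j) (1, x) != 0.
(** Backward displacement: in the application the old element map minus the new one, time 1 being
    the new mesh. *)
Variable Q : I -> V d -> V d.
Hypothesis PQ : forall j t x, P j (t, x) = P j (1, x) + (1 - t) *: Q j x.
Hypothesis cons : forall i j t x y, T t -> K x -> K y ->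
  P i (1, x) = P j (1, y) <-> P i (t, x) = P j (t, y).
Hypothesis consQ : forall i j x y, K x -> K y -> P i (1, x) = P j (1, y) -> Q i x = Q j y.

Variable J : finType.
Variable g : I -> J -> V d -> R.
Hypothesis Pg : forall j k, isP (fun z : Z d => g j k z.2).
Hypothesis gcons : forall i j k x y, K x -> K y -> P i (1, x) = P j (1, y) -> g i k x = g j k y.
Hypothesis gfront : forall j k x, K x -> frontier (Om 1) (P j (1, x)) -> g j k x = 0.

Lemma unif_bilip : exists2 c, 0 < c & forall j x y, K x -> K y ->
  c * `|x - y| <= `|P j (1, x) - P j (1, y)|.
Proof.
have /choice[c hc] : forall j, exists c, 0 < c /\ forall x y, K x -> K y ->
    c * `|x - y| <= `|P j (1, x) - P j (1, y)|.
  by move=> j; have [c c0 h] := bilip (PP j) (@injK j) (@detK j); exists c.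
have s0 : 0 < 1 + \sum_j (c j)^-1.
  by rewrite ltr_wpDr// sumr_ge0// => j _; rewrite invr_ge0 ltW//; have [] := hc j.
exists (1 + \sum_j (c j)^-1)^-1; first by rewrite invr_gt0.
move=> j x y Kx Ky; have [c0 h] := hc j; apply: le_trans (h x y Kx Ky).
rewrite ler_wpM2r// -[leRHS]invrK lef_pV2 ?posrE ?invr_gt0//.
rewrite (bigD1 j)//= addrCA lerDl addr_ge0 ?sumr_ge0// => i _.
by rewrite invr_ge0 ltW//; have [] := hc i.
Qed.

Lemma lip_family (f : I -> Z d -> R) t : (forall j, isP (f j)) -> exists2 L, 0 <= L &
  forall j x y, K x -> K y -> `|f j (t, x) - f j (t, y)| <= L * `|x - y|.
Proof.
move=> Pf.
have /choice[c hc] : forall j, exists c, 0 <= c /\ forall x y, K x -> K y ->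
    `|f j (t, x) - f j (t, y)| <= c * `|x - y|.
  move=> j; have PF : @pmap _ d (fun z => const_mx (f j z)).
    by move=> i; apply: isP_ext (Pf j) => z; rewrite mxE.
  have [L L0 h] := pmap_lip t PF; exists L; split => // x y Kx Ky.
  apply: le_trans (h x y Kx Ky); apply: le_trans (coord_le _ ord0).
  by rewrite !mxE.
exists (\sum_j c j); first by apply: sumr_ge0 => j _; have [] := hc j.
move=> j x y Kx Ky; have [c0 h] := hc j; apply: (le_trans (h x y Kx Ky)).
rewrite ler_wpM2r// (bigD1 j)//= lerDl sumr_ge0// => i _; by have [] := hc i.
Qed.

Lemma isP_Q j i : isP (fun z : Z d => Q j z.2 0 i).
Proof.
have c : isP (fun z : Z d => P j (0, z.2) 0 i - P j (1, z.2) 0 i).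
  have h s : isP (fun z : Z d => P j (s, z.2) 0 i).
    apply: (isP_comp (G := fun z => (s, z.2)) (PP j i)) => [|k]; [exact: isP_cst|exact: isP_coord].
  by apply: isP_sub; exact: h.
by apply: isP_ext c => z; rewrite (PQ j 0) subr0 scale1r !mxE [X in X - _]addrC addrK.
Qed.

Lemma lip_Q : exists2 L, 0 <= L & forall j x y, K x -> K y -> `|Q j x - Q j y| <= L * `|x - y|.
Proof.
have /choice[c hc] : forall i, exists L, 0 <= L /\ forall j x y, K x -> K y -> `|Q j x 0 i - Q j y 0 i| <= L * `|x - y|.
  by move=> i; have [L L0 h] := lip_family 0 (fun j => isP_Q j i); exists L; split => // j x y Kx Ky; exact: h.
have s0 : 0 <= \sum_i c i by apply: sumr_ge0 => i _; have [] := hc i.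
exists (\sum_i c i) => // j x y Kx Ky; apply: norm_rV_le => [|i]; first exact: mulr_ge0.
rewrite !mxE; have [c0 h] := hc i; apply: (le_trans (h j x y Kx Ky)).
by rewrite ler_wpM2r// (bigD1 i)//= lerDl sumr_ge0// => k _; have [] := hc k.
Qed.

(** The motion differs from the map at time 1 by (1 - t) Q, of Lipschitz constant (1 - t) L; half of
    c survives as long as (1 - t) (L + 1) <= c / 2. *)
Lemma near_one_bilip : exists2 c, 0 < c & exists2 e, 0 < e <= 1 & forall t, 1 - e < t -> t <= 1 ->
  forall j x y, K x -> K y -> c * `|x - y| <= `|P j (t, x) - P j (t, y)|.
Proof.
have [c c0 hc] := unif_bilip; have [L L0 hL] := lip_Q.
exists (c / 2); first by rewrite divr_gt0.
have e0 : 0 < c / (2 * (L + 1)) by rewrite divr_gt0// mulr_gt0// ltr_wpDl.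
exists (Num.min 1 (c / (2 * (L + 1)))); first by rewrite lt_min ltr01 e0 ge_min lexx.
move=> t; rewrite ltrBlDr -ltrBlDl lt_min => /andP[_ te] t1 j x y Kx Ky.
have := hc j x y Kx Ky; have := hL j x y Kx Ky; rewrite (PQ j t x) (PQ j t y).
have -> : P j (1, x) + (1 - t) *: Q j x - (P j (1, y) + (1 - t) *: Q j y) =
  (P j (1, x) - P j (1, y)) - (- ((1 - t) *: (Q j x - Q j y))).
  by rewrite opprK scalerBr opprD addrACA.
move=> h1 h2; apply: le_trans (lerB_dist _ _); rewrite normrN normrZ ger0_norm ?subr_ge0//.
have h3 : (1 - t) * `|Q j x - Q j y| <= c / 2 * `|x - y|.
  apply: (@le_trans _ _ ((1 - t) * (L * `|x - y|))); first by rewrite ler_wpM2l// subr_ge0.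
  rewrite mulrA ler_wpM2r//.
  have h4 : (1 - t) * (L + 1) <= c / 2.
    move: te; rewrite invfM mulrA ltr_pdivlMr ?ltr_wpDl// => /ltW; apply.
  apply: le_trans h4; rewrite ler_wpM2l ?subr_ge0// lerDl//.
by lra.
Qed.

(* Near time 1 the piecewise motion is a small Lipschitz perturbation of the
   identity, hence open. *)
Lemma Phi_interior : exists2 e, 0 < e <= 1 & forall t, 1 - e < t -> t <= 1 ->
  forall j x, K x -> interior (Om 1) (P j (1, x)) -> interior (Om t) (P j (t, x)).
Proof.
have [c c0 hc] := unif_bilip; have [L L0 hL] := lip_Q.
pose L' := L / c; have L'0 : 0 <= L' by rewrite divr_ge0// ltW.
have e0 : 0 < 2^-1 / (L' + 1) by rewrite divr_gt0// ltr_wpDl.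
exists (Num.min 1 (2^-1 / (L' + 1))); first by rewrite lt_min ltr01 e0 ge_min lexx.
move=> t; rewrite ltrBlDr -ltrBlDl lt_min => /andP[t0 te] t1 j x Kx iy.
have T1 : T t by rewrite /T /= in_itv /= t1 andbT; lra.
have tL : (1 - t) * L' <= 2^-1.
  have /ltW h : (1 - t) * (L' + 1) < 2^-1 by rewrite -ltr_pdivlMr// ltr_wpDl.
  by apply: le_trans h; rewrite ler_wpM2l ?subr_ge0// lerDl.
(* The displacement as a function of the physical point; [consQ] makes it independent of the
   element. *)
pose q y := xget (0 : V d) [set v | exists i x', [/\ K x', P i (1, x') = y & v = Q i x']].
have qE i x' : K x' -> q (P i (1, x')) = Q i x'.
  move=> Kx'; rewrite /q; case: xgetP => [v _ [i' [x'' [Kx'' e ->]]]|/(_ (Q i x'))]; first exact: consQ e.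
  by case; exists i, x'.
have qL i y y' : ((fun x => P i (1, x)) @` K) y -> ((fun x => P i (1, x)) @` K) y' ->
    `|q y - q y'| <= L' * `|y - y'|.
  move=> [u Ku <-] [w Kw <-]; rewrite !qE//; apply: (le_trans (hL i u w Ku Kw)).
  by rewrite /L' -mulrA ler_wpM2l// ler_pdivlMl// hc.
have [r /= r0 hr] := (nbhs_ballP _ _).1 iy.
pose y0 := P j (1, x).
have inO y : `|y - y0| <= r / 2 -> Om 1 y.
  move=> h; apply: hr; rewrite -ball_normE /= distrC; apply: (le_lt_trans h); lra.
(* Elementwise Lipschitz bounds extend along a segment covered by elements. The domain need not be
   convex, hence the restriction to a ball inside it. *)
have qlip y y' : `|y - y0| <= r / 2 -> `|y' - y0| <= r / 2 -> `|q y' - q y| <= L' * `|y' - y|.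
  move=> hy hy'; apply: norm_rV_le => [|k]; first exact: mulr_ge0.
  rewrite !mxE; apply: (@cover_lip _ _ I (fun i => (fun x => P i (1, x)) @` K) (fun y => q y 0 k)) => [i|i u w hu hw|s /andP[s0 s1]].
  - exact: closed_elt.
  - by apply: le_trans (qL i u w hu hw); apply: le_trans (coord_le _ k); rewrite !mxE.
  - have [i _ hi] : Om 1 (y + s *: (y' - y)).
      apply: inO; have -> : y + s *: (y' - y) - y0 = (1 - s) *: (y - y0) + s *: (y' - y0).
        by apply/rowP => l; rewrite !mxE; ring.
      apply: (le_trans (ler_normD _ _)); rewrite !normrZ !ger0_norm ?subr_ge0//.
      have h1 : (1 - s) * `|y - y0| <= (1 - s) * (r / 2) by rewrite ler_wpM2l// subr_ge0.
      have h2 : s * `|y' - y0| <= s * (r / 2) by rewrite ler_wpM2l.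
      lra.
    by exists i.
pose F y := y + (1 - t) *: q y.
have FE i x' : K x' -> F (P i (1, x')) = P i (t, x') by move=> Kx'; rewrite /F qE// (PQ i t).
apply/nbhs_ballP; exists (r / 4); first by rewrite /= divr_gt0.
move=> y; rewrite -ball_normE /= => hy.
have ctr u u' : `|u - y0| <= r / 2 -> `|u' - y0| <= r / 2 ->
    `|(u - F u) - (u' - F u')| <= 2^-1 * `|u - u'|.
  move=> hu hu'; have -> : (u - F u) - (u' - F u') = (1 - t) *: (q u' - q u).
    by apply/rowP => l; rewrite !mxE; ring.
  rewrite normrZ ger0_norm ?subr_ge0//.
  apply: (@le_trans _ _ ((1 - t) * (L' * `|u - u'|))); last by rewrite mulrA ler_wpM2r.
  by rewrite ler_wpM2l ?subr_ge0// distrC qlip.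
have hy' : `|y - F y0| <= r / 2 / 2.
  by rewrite /y0 FE// distrC; apply: ltW; apply: (lt_le_trans hy); lra.
have r20 : 0 <= r / 2 by rewrite divr_ge0// ltW.
have [z hz Fz] := solve_ball r20 ctr hy'.
have [i _ [x' Kx' e]] := inO z hz.
by exists i => //; exists x' => //; rewrite -Fz -e FE.
Qed.

(** The default value 0 extends the field by zero outside the domain. *)
Definition glue t k (y : V d) : R :=
  xget 0 [set r | exists j x, [/\ K x, P j (t, x) = y & r = g j k x]].

Lemma glueE t j k x : T t -> K x -> glue t k (P j (t, x)) = g j k x.
Proof.
move=> Tt Kx; rewrite /glue; case: xgetP => [v _ [i [x' [Kx' e ->]]]|/(_ (g j k x))].
  by apply: gcons => //; apply/(cons i j Tt Kx' Kx).
by case; exists j, x.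
Qed.

Lemma glue0 t k y : ~ Om t y -> glue t k y = 0.
Proof.
move=> nO; rewrite /glue; case: xgetP => // v _ [i [x' [Kx' e _]]]; exfalso; apply: nO.
by exists i => //; exists x'.
Qed.

Hypothesis injT : forall j t, T t -> set_inj (@Ko R d) (fun x => P j (t, x)).
Hypothesis detT : forall j t x, T t -> Ko x -> Det (P j) (t, x) != 0.
Hypothesis disjT : forall i j t y, T t -> Uo (P i) t y -> Uo (P j) t y -> i = j.

Lemma glue_near t j k x : T t -> Ko x ->
  \forall y \near P j (t, x), glue t k y = g j k (Xo (P j) (t, y)).
Proof.
move=> Tt Kx; have oU := open_Uo (PP j) (@injT j) (@detT j) Tt.
have : nbhs (P j (t, x)) (Uo (P j) t) by apply: open_nbhs_nbhs; split => //; exists x.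
apply: filterS => y Uy; have [Kx' e] := @XoP _ _ (P j) (t, y) Uy.
have <- : glue t k (P j (t, Xo (P j) (t, y))) = glue t k y by rewrite e.
by rewrite glueE//; exact: KoK.
Qed.

Definition dX t j k (i : 'I_d) (x : V d) : R :=
  \sum_l (invmx (Jm (P j) (t, x))) i l * dpart l (fun z : Z d => g j k z.2) (t, x).

Lemma glue_slice t j k i x : T t -> Ko x ->
  is_derive (0 : R) (1 : R) (fun s : R => glue t k (P j (t, x) + s *: delta_mx 0 i)) (dX t j k i x).
Proof.
move=> Tt Kx; set y := P j (t, x).
pose G (y : V d) := Xo (P j) (t, y).
pose Pt (z : Z d) := P j (t, z.2).
have PPt : pmap Pt.
  by move=> l; apply: (isP_comp (G := fun z : Z d => (t, z.2)) (PP j l)) => [|m]; [exact: isP_cst|exact: isP_coord].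
have JE z : Jm Pt z = Jm (P j) (t, z.2) by [].
have Gy : G y = x by rewrite /G /y (XoE (@injT j)).
have cG : {for ((t, y) : Z d), continuous (fun w : Z d => G w.2)}.
  rewrite /prop_for /continuous_at /= Gy.
  apply: (@Xo_cvg_in _ _ _ (PP j) T (@injT j) (@detT j) t x _ _ _ (fun w : Z d => (t, w.2))) => //; last exact: nearW.
  have c1 : (fun _ : Z d => t) @ ((t, y) : Z d) --> t by apply: cst_continuous.
  exact: (cvg_pair c1 (@cvg_snd _ _ _ _ _)).
have nU : \forall w \near ((t, y) : Z d), Uo (P j) t w.2.
  have oU := open_Uo (PP j) (@injT j) (@detT j) Tt.
  have : nbhs y (Uo (P j) t) by apply: open_nbhs_nbhs; split => //; exists x.
  have c2 : (fun w : Z d => w.2) @ ((t, y) : Z d) --> y by exact: cvg_snd.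
  by move=> h; exact: c2 _ h.
have nP : \forall w \near ((t, y) : Z d), Pt (w.1, G w.2) = w.2.
  near=> w; have Uw : Uo (P j) t w.2 by near: w.
  by have [] := @XoP _ _ (P j) (t, w.2) Uw.
have D0 : Det Pt (t, G y) != 0 by rewrite Gy; exact: detT.
have H := @hasD_inv_comp _ _ Pt (fun w : Z d => G w.2) (t, y) (fun z : Z d => g j k z.2) _ _ PPt (nbhs_singleton nP) D0 cG nP (isP_hasD (t, G y) (Pg j k)).
have H2 := hasD_slice i H; rewrite /= Gy in H2.
have E0 : glue t k y = g j k (G y) by rewrite /y glueE// ?Gy//; exact: KoK.
have N : \forall s \near (0 : R), g j k (G (y + s *: delta_mx 0 i)) = glue t k (y + s *: delta_mx 0 i).
  have cl : (fun s : R => y + s *: delta_mx 0 i) @ (0 : R) --> y.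
    have c1 : (fun s : R => y + s *: delta_mx 0 i) @ (0 : R) --> y + (0 : R) *: delta_mx 0 i.
      by apply: cvgD; [exact: cvg_cst|apply: cvgZr_tmp; exact: cvg_id].
    by rewrite scale0r addr0 in c1.
  have N0 : \forall s \near (0 : R), glue t k (y + s *: delta_mx 0 i) = g j k (Xo (P j) (t, y + s *: delta_mx 0 i)).
    exact: cl _ (@glue_near t j k x Tt Kx).
  by apply: filterS N0 => s ->.
exact: near_eq_is_derive N H2.
Unshelve. all: by end_near. Qed.

(** A segment is covered by the elements together with the complement of the interior of the domain.
    On the latter the glued field vanishes: a point there that belongs to an element comes, by
    [Phi_interior], from a frontier point at time 1, and [gfront] applies. *)
Lemma glue_lip : exists2 e, 0 < e <= 1 & forall t, 1 - e < t -> t <= 1 -> exists2 L, 0 <= L &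
  forall k y y', `|glue t k y - glue t k y'| <= L * `|y - y'|.
Proof.
have [e1 /andP[e10 e11] hint] := Phi_interior; have [c c0 [e2 /andP[e20 e21] hc]] := near_one_bilip.
have [Lg Lg0 hLg] : exists2 L, 0 <= L & forall k j x y, K x -> K y -> `|g j k x - g j k y| <= L * `|x - y|.
  have /choice[l hl] : forall k, exists L, 0 <= L /\ forall j x y, K x -> K y -> `|g j k x - g j k y| <= L * `|x - y|.
    by move=> k; have [L L0 h] := lip_family 0 (fun j => Pg j k); exists L; split => // j x y Kx Ky; exact: h.
  exists (\sum_k l k); first by apply: sumr_ge0 => i _; have [] := hl i.
  move=> k j x y Kx Ky; have [_ h] := hl k; apply: (le_trans (h j x y Kx Ky)).
  by rewrite ler_wpM2r// (bigD1 k)//= lerDl sumr_ge0// => i _; have [] := hl i.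
exists (Num.min e1 e2); first by rewrite lt_min e10 e20 ge_min e11.
move=> t; rewrite ltrBlDr -ltrBlDl lt_min => /andP[te1 te2] t1.
have {}te1 : 1 - e1 < t by lra. have {}te2 : 1 - e2 < t by lra.
have Tt : T t by rewrite /T /= in_itv /= t1 andbT; lra.
exists (Lg / c); first by rewrite divr_ge0// ltW.
move=> k y y'.
have L0 : 0 <= Lg / c by rewrite divr_ge0// ltW.
have front0 z : ~ interior (Om t) z -> glue t k z = 0.
  move=> nz; have [[j _ [x Kx xz]]|nO] := pselect (Om t z); last exact: glue0.
  rewrite -xz glueE//; apply: gfront => //; split.
    by apply: subset_closure; exists j => //; exists x.
  by move=> h; apply: nz; rewrite -xz; exact: hint.
pose C (o : option I) := if o is Some j then (fun x => P j (t, x)) @` K else ~` interior (Om t).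
apply: (@cover_lip _ _ _ C (glue t k)) => [[j|]|[j|] u w /=|s _].
- exact: closed_elt.
- by apply: open_closedC; exact: open_interior.
- move=> [x Kx <-] [x' Kx' <-]; rewrite !glueE//; apply: (le_trans (hLg k j x x' Kx Kx')).
  by rewrite -mulrA ler_wpM2l// ler_pdivlMl//; exact: hc.
- by move=> hu hw; rewrite !front0// subrr normr0 mulr_ge0.
- have [|h] := pselect (Om t (y' + s *: (y - y'))); first by move=> [j _ h]; exists (Some j).
  by exists None => /= /interior_subset.
Qed.

Lemma glue_int t k i : T t -> (exists2 L, 0 <= L & forall y y', `|glue t k y - glue t k y'| <= L * `|y - y'|) ->
  hasint setT (partial i (glue t k)) 0.
Proof.
move=> Tt [L L0 gL]; have [r hr] := Om_bounded t; have [N [mN N0 hN]] := null_skeleton t.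
(* A point off the domain, where the field is zero, turns the Lipschitz bound into a bound on the
   values. *)
have [y0 y0N] : exists y0, ~ Om t y0.
  exists (const_mx (`|r| + 1)) => /hr; have := coord_le (const_mx (`|r| + 1) : V d) ord0.
  rewrite mxE => /le_trans h /h; rewrite ger0_norm ?addr_ge0// => h2.
  by have := ler_norm r; lra.
have bd y : `|glue t k y| <= L * (`|r| + `|y0|).
  have [Oy|nO] := pselect (Om t y); last by rewrite glue0// normr0 mulr_ge0 ?addr_ge0.
  have := gL y y0; rewrite (glue0 _ y0N) subr0 => h; apply: (le_trans h).
  rewrite ler_wpM2l// (le_trans (ler_normB _ _))// lerD2r (le_trans (hr _ Oy))//.
  exact: ler_norm.
apply: (@ibp _ _ i (glue t k) _ L 1 r (L * (`|r| + `|y0|)) N) => //.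
- apply: mfun_open; first exact: openT.
  move=> y _; apply/(@cvgrPdist_lt _ _ _ _ (nbhs_filter y)) => e e0.
  near=> z; apply: (le_lt_trans (gL _ _)).
  have : `|y - z| < e / (L + 1).
    by near: z; apply: cvgr_dist_lt; [exact: cvg_id|rewrite divr_gt0// ltr_wpDl].
  rewrite ltr_pdivlMr ?ltr_wpDl// => h; apply: le_lt_trans h.
  by rewrite mulrC ler_wpM2l// lerDl.
- by move=> y yr; apply: glue0 => /hr; rewrite leNgt yr.
- move=> y s _; apply: (le_trans (gL _ _)); rewrite ler_wpM2l//.
  rewrite addrAC subrr add0r normrZ -[leRHS]mulr1 ler_wpM2l//.
  by apply: norm_rV_le => // l; rewrite mxE /=; case: (_ == _); rewrite ?normr1 ?normr0.
- move=> y Ny.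
  suff [a H] : exists a, is_derive (0 : R) (1 : R) (fun s : R => glue t k (y + s *: delta_mx 0 i)) a.
    have -> : partial i (glue t k) y = a.
      exact: partial_slice H.
    by have := is_derive_seq H; rewrite scale0r addr0.
  have [[j _ [x Kx xy]]|nO] := pselect (Om t y).
    have [Kox|nK] := pselect (Ko x); last by exfalso; apply: Ny; rewrite -xy; exact: hN.
    by exists (dX t j k i x); rewrite -xy; exact: glue_slice.
  exists 0; have cl : (fun s : R => y + s *: delta_mx 0 i) @ (0 : R) --> y.
    have c1 : (fun s : R => y + s *: delta_mx 0 i) @ (0 : R) --> y + (0 : R) *: delta_mx 0 i.
      by apply: cvgD; [exact: cvg_cst|apply: cvgZr_tmp; exact: cvg_id].
    by rewrite scale0r addr0 in c1.
  have nb : nbhs y (~` Om t).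
    by apply: open_nbhs_nbhs; split => //; apply: closed_openC; exact: closed_Om.
  have H : \forall s \near (0 : R), ~ Om t (y + s *: delta_mx 0 i) by exact: cl _ nb.
  have Hd : is_derive (0 : R) (1 : R) (cst (0 : R)) (0 : R) by exact: is_derive_cst.
  apply: near_eq_is_derive _ Hd.
  by apply: filterS H => s /= ns; rewrite glue0.
Unshelve. all: by end_near. Qed.

(** Direction in which component k is derived; the identity gives a divergence. *)
Variable ci : J -> 'I_d.

Lemma pw_ibp : exists2 e, 0 < e <= 1 & forall t, 1 - e < t -> t <= 1 -> forall Ij : I -> R,
  (forall j, hasint (Uo (P j) t) (fun y => \sum_k dX t j k (ci k) (Xo (P j) (t, y))) (Ij j)) ->
  \sum_j Ij j = 0.
Proof.
have [e /andP[e0 e1] he] := glue_lip; exists e; first by rewrite e0.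
move=> t te t1 Ij hI; have Tt : T t by rewrite /T /= in_itv /= t1 andbT; lra.
have [L L0 hL] := he t te t1; have [N [mN N0 hN]] := null_skeleton t.
have mO : mset (Om t) by apply: mset_closed; exact: closed_Om.
have H k := glue_int (ci k) Tt (ex_intro2 _ _ L L0 (hL k)).
have HS := hasint_sum (index_enum J) (P := xpredT) (measurableT : mset setT) (fun k _ => H k).
rewrite [in X in hasint _ _ X]big1// in HS.
have HO : hasint (Om t) (fun y => \sum_k partial (ci k) (glue t k) y) 0.
  apply: hasint_sub HS => // y _ nO; rewrite big1// => k _.
  have nb : nbhs y (~` Om t).
    by apply: open_nbhs_nbhs; split => //; apply: closed_openC; exact: closed_Om.
  rewrite /partial (@near_eq_derive _ _ _ _ (fun=> 0)); first exact: derive_cst.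
  by apply: filterS nb => z nz; rewrite glue0.
apply/esym/(hasint_uniq HO).
apply: (hasint_bigcup mO mN N0 (U := fun j => Uo (P j) t)).
- by move=> j y [x Kx <-]; exists j => //; exists x => //; exact: KoK.
- move=> y [j _ [x Kx xy]] Ny; exists j; exists x => //.
  by apply: contrapT => nK; apply: Ny; rewrite -xy; exact: hN.
- by move=> i j y; exact: disjT.
- move=> j; apply: hasint_ext (hI j) => y Uy; apply: eq_bigr => k _.
  have [Kx xE] := @XoP _ _ (P j) (t, y) Uy.
  by have := partial_slice (@glue_slice t j k (ci k) _ Tt Kx); rewrite xE.
Qed.

End PiecewiseIBP.

(** * Lagrange interpolation on a mesh *)

Section MeshAlgebra.
Context {R : realType}.
Local Notation V n := ('rV[R]_n).
Local Notation Z n := (R * 'rV[R]_n)%type.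
Variables (d m : nat).
Local Notation K := (@simplex R d).

Lemma isP_lag (b : node d m) : isP (fun z : Z d => lag b z.2).
Proof.
apply: isP_prod => v _; apply: isP_prod => k _; apply: isP_mul; last exact: isP_cst.
by apply: isP_sub; [apply: isP_mul; [exact: isP_cst|exact: isP_bary]|exact: isP_cst].
Qed.

Lemma lag_vanish (b : node d m) (x : V d) (v : 'I_d.+1) : bary x v = 0 -> val b v <> 0%N :> nat -> lag b x = 0.
Proof.
move=> xv /eqP; rewrite -lt0n => bv; rewrite /lag (bigD1 v)//= (bigD1 (Ordinal bv))//=.
by rewrite xv mulr0 subrr mul0r !mul0r.
Qed.

Lemma lag_perm (s : {perm 'I_d.+1}) (b b' : node d m) (x x' : V d) :
  (forall v : 'I_d.+1, bary x' (s v) = bary x v) -> (forall v, val b' (s v) = val b v) ->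
  lag b' x' = lag b x.
Proof.
move=> xs bs; rewrite /lag (reindex_inj (@perm_inj _ s)) /=.
by apply: eq_bigr => v _; rewrite xs bs.
Qed.

Lemma bary_exists (y : 'I_d.+1 -> R) : \sum_v y v = 1 -> exists x : V d, forall v : 'I_d.+1, bary x v = y v.
Proof.
move=> y1; exists (\row_i y (lift ord0 i)) => v.
case: (unliftP ord0 v) => [i ->|->]; first by rewrite baryL mxE.
rewrite /= -y1 big_ord_recl [X in _ - X](eq_bigr (fun i : 'I_d => y (lift ord0 i))) ?addrK// => i _.
by rewrite mxE.
Qed.

Lemma node_permP (s : {perm 'I_d.+1}) (b : node d m) :
  (\sum_v ([ffun v => val b ((s^-1)%g v)] : {ffun 'I_d.+1 -> 'I_m.+1}) v == m)%N.
Proof.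
rewrite (reindex_inj (@perm_inj _ s)) /=; under eq_bigr do rewrite ffunE permK.
exact: (valP b).
Qed.

Definition node_perm (s : {perm 'I_d.+1}) (b : node d m) : node d m := 
  exist (fun a : {ffun 'I_d.+1 -> 'I_m.+1} => (\sum_v a v == m)%N) _ (node_permP s b).

Lemma node_permE s (b : node d m) v : val (node_perm s b) (s v) = val b v.
Proof. by rewrite /= ffunE permK. Qed.

Lemma node_permK s : cancel (node_perm s) (node_perm (s^-1)%g).
Proof.
move=> b; apply/val_inj/ffunP => v.
have e : v = (s^-1)%g (s v) by rewrite permK.
by rewrite {1}e node_permE node_permE.
Qed.

Lemma nodept_simplex (b : node d m) : (0 < m)%N -> K (nodept R b).
Proof. by move=> m0 v; rewrite bary_nodept// divr_ge0. Qed.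

Variables (T : mesh_top d m) (m0 : (0 < m)%N).
Implicit Types (a : 'I_(npt T) -> V d) (j : 'I_(nelt T)).

(** [elmap a] is the case of grid points; nodal velocities are treated alike. *)
Definition interp (W : lmodType R) (g : 'I_(npt T) -> W) j (x : V d) : W :=
  \sum_(b : node d m) lag b x *: g (conn T j b).

Lemma interp_nodept (W : lmodType R) (g : 'I_(npt T) -> W) j (b : node d m) :
  interp g j (nodept R b) = g (conn T j b).
Proof.
rewrite /interp (bigD1 b)//= lagE// eqxx scale1r big1 ?addr0// => c cb.
by rewrite lagE// (negbTE cb) scale0r.
Qed.

(** Let x1 have the barycentric coordinates of x, permuted by s. Lagrange functions of nodes off the
    common subsimplex vanish at x, and the other nodes are identified by s, so that every
    interpolant takes the same value at x in j and at x1 in j'. Applied to the grid points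
    themselves, this forces x' = x1 by injectivity. *)
Lemma conf_sub a j j' x x' : is_mesh a -> j != j' -> K x -> K x' -> elmap a j x = elmap a j' x' ->
  (exists2 v : 'I_d.+1, bary x v = 0 & True) /\
  forall (W : lmodType R) (g : 'I_(npt T) -> W), interp g j x = interp g j' x'.
Proof.
move=> [inj det conf _] jj' Kx Kx' e; have [S [s [[v vS] eS cS]]] := conf j j' jj'.
have [xS xS0] : (elem a j `&` elem a j') (elmap a j x) by split; [exists x|rewrite e; exists x'].
have : (elem a j `&` elem a j') (elmap a j x) by split; [exists x|rewrite e; exists x'].
rewrite eS => -[x0 [Kx0 x00]] /(inj j) x0x.
have {x0x} x0E : x0 = x by apply: x0x; exact: mem_set.
subst x0; split; first by exists v => //; exact: x00.
have [x1 x1E] : exists x1 : V d, forall w : 'I_d.+1, bary x1 w = bary x ((s^-1)%g w).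
  apply: bary_exists; rewrite (reindex_inj (@perm_inj _ s)) /= -[RHS](sum_bary x).
  by apply: eq_bigr => w _; rewrite permK.
have x1s w : bary x1 (s w) = bary x w by rewrite x1E permK.
have Kx1 : K x1 by move=> w; rewrite x1E; exact: Kx.
have key (W : lmodType R) (g : 'I_(npt T) -> W) : interp g j x = interp g j' x1.
  rewrite /interp [RHS](reindex (node_perm s)) /=; last first.
    exists (node_perm (s^-1)%g) => b _; first exact: node_permK.
    by have := node_permK (s^-1)%g b; rewrite invgK.
  apply: eq_bigr => b _; rewrite (lag_perm x1s (node_permE s b)).
  have [bS|] := pselect (forall w, w \notin S -> val b w = 0%N :> nat).
    by rewrite (cS b (node_perm s b) bS (node_permE s b)).
  move=> /existsNP[w] /not_implyP[wS bw].
  by rewrite (lag_vanish (x00 w wS) bw) !scale0r.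
suff -> : x' = x1 by exact: key.
apply: (inj j'); [exact: mem_set|exact: mem_set|].
by rewrite -e; exact: key.
Qed.

Lemma interp_cons a j j' x x' : is_mesh a -> K x -> K x' -> elmap a j x = elmap a j' x' ->
  forall (W : lmodType R) (g : 'I_(npt T) -> W), interp g j x = interp g j' x'.
Proof.
move=> ma Kx Kx' e W g; have [jj|jj] := eqVneq j j'.
  subst j'; suff -> : x = x' by [].
  by case: ma => inj _ _ _; apply: (inj j) => //; exact: mem_set.
by have [_] := conf_sub ma jj Kx Kx' e.
Qed.

Lemma elem_disj a j j' x x' : is_mesh a -> Ko x -> K x' -> elmap a j x = elmap a j' x' -> j = j'.
Proof.
move=> ma Kx Kx' e; apply/eqP; case: eqVneq => // jj.
have [[v xv _] _] := conf_sub ma jj (KoK Kx) Kx' e.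
by have := Kx v; rewrite xv ltxx.
Qed.

Lemma elinvK a j x : is_mesh a -> K x -> elinv a j (elmap a j x) = x.
Proof.
by move=> [inj _ _ _] Kx; rewrite /elinv pinvKV//; [exact: inj|exact: mem_set].
Qed.

Lemma locateP a j x : K x -> exists2 j', locate a (elmap a j x) = Some j' &
  exists2 x', K x' & elmap a j' x' = elmap a j x.
Proof.
move=> Kx; rewrite /locate; case: pickP => [j' /asboolP[x' Kx' e]|/(_ j)]; first by exists j' => //; exists x'.
by move=> /asboolP; case; exists x.
Qed.

Lemma hat_interp a j x : is_mesh a -> K x -> forall (W : lmodType R) (g : 'I_(npt T) -> W),
  \sum_i hat a i (elmap a j x) *: g i = interp g j x.
Proof.
move=> ma Kx W g; have [j' lE [x' Kx' e]] := locateP a j Kx.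
rewrite -(interp_cons ma Kx' Kx e) /hat lE -e elinvK// /interp.
rewrite (partition_big (conn T j') xpredT)//=; apply: eq_bigr => i _.
by rewrite scaler_suml; apply: eq_bigr => b /eqP ->.
Qed.

Definition psi2 (a a' : 'I_(npt T) -> V d) j (z : Z d) : V d :=
  (1 - z.1) *: elmap a j z.2 + z.1 *: elmap a' j z.2.

Lemma isP_interp (g : 'I_(npt T) -> V d) j i : isP (fun z : Z d => interp g j z.2 0 i).
Proof.
have h : isP (fun z : Z d => \sum_(b : node d m) lag b z.2 * g (conn T j b) 0 i).
  by apply: isP_sum => b _; apply: isP_mul; [exact: isP_lag|exact: isP_cst].
by apply: isP_ext h => z; rewrite summxE; apply: eq_bigr => b _; rewrite mxE.
Qed.

Lemma pmap_psi a a' j : pmap (psi2 a a' j).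
Proof.
move=> i; have h := isP_add (isP_mul (isP_sub (isP_cst d 1) (isP_fst d)) (isP_interp a j i)) (isP_mul (isP_fst d) (isP_interp a' j i)).
by apply: isP_ext h => z; rewrite /psi2 !mxE.
Qed.

Lemma psi1 a a' j x : psi2 a a' j (1, x) = elmap a' j x.
Proof. by rewrite /psi2 /= subrr scale0r add0r scale1r. Qed.

Lemma psi0 a a' j x : psi2 a a' j (0, x) = elmap a j x.
Proof. by rewrite /psi2 /= subr0 scale1r scale0r addr0. Qed.

Lemma isP_polyfun k (q : V d -> R) : polyfun k q -> isP (fun z : Z d => q z.2).
Proof.
move=> [c qE]; apply: (@isP_ext _ _ (fun z : Z d => \sum_(a : {ffun 'I_d -> 'I_k.+1} | (\sum_i a i <= k)%N)
            c a * \prod_i z.2 0 i ^+ a i)); first by move=> z; rewrite qE.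
apply: isP_sum => a _; apply: isP_mul; first exact: isP_cst.
by apply: isP_prod => i _; apply: isP_exp; exact: isP_coord.
Qed.

End MeshAlgebra.

(** * Jacobian matrices from Hadamard derivatives *)

Section Jacobian.
Context {R : realType}.
Local Notation V n := ('rV[R]_n).
Local Notation Z n := (R * 'rV[R]_n)%type.

Lemma jacobian_hasD n p (f : V n.+1 -> V p.+1) t x (a : 'I_p.+1 -> R) (e : 'M[R]_(n.+1, p.+1)) :
  (forall i, hasD (fun z : Z n.+1 => f z.2 0 i) (t, x) (a i) (fun k => e k i)) -> 'J f x = e.
Proof.
move=> H; have ce : continuous (mulmxr e : V n.+1 -> V p.+1).
  move=> v; apply: (cvg_rV (nbhs_filter v)) => i.
  have -> : (fun w : V n.+1 => (mulmxr e w) 0 i) = (fun w => \sum_k w 0 k * e k i).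
    by apply/funext => w; rewrite mxE.
  rewrite mxE; apply: cvg_sumR => k; apply: cvgM; last exact: cvg_cst.
  exact: coord_continuous.
have E : f \o shift x = cst (f x) + mulmxr e +o_ (0 : V n.+1) id.
  apply/eqaddoP => eps eps0.
  have H' i : \forall h \near (0 : V n.+1), `|(f (h + x) - f x - h *m e) 0 i| <= eps * `|h|.
    have [e0 [E [ce0 cE hw e0E EE]]] := H i.
    have c1 : (fun h : V n.+1 => h + x) @ (0 : V n.+1) --> x.
      apply: (cvg_rV (nbhs_filter (0 : V n.+1))) => l.
      have -> : (fun h : V n.+1 => (h + x) 0 l) = (fun h : V n.+1 => h 0 l + x 0 l).
        by apply/funext => h; rewrite mxE.
      have -> : x 0 l = (0 : V n.+1) 0 l + x 0 l by rewrite mxE add0r.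
      apply: cvgD; last by rewrite mxE add0r; exact: cvg_cst.
      exact: coord_continuous.
    have c2 : (fun h : V n.+1 => (t, h + x)) @ (0 : V n.+1) --> ((t, x) : Z n.+1).
      exact: (cvg_pair (@cvg_cst _ t _ _ _) c1).
    have hw' : \forall h \near (0 : V n.+1), f (h + x) 0 i - f x 0 i =
       (t - t) * e0 (t, h + x) + \sum_k ((h + x) 0 k - x 0 k) * E k (t, h + x) by exact: c2 _ hw.
    have eps1 : 0 < eps / n.+1%:R by rewrite divr_gt0.
    have hE : \forall h \near (0 : V n.+1), forall k, `|e k i - E k (t, h + x)| < eps / n.+1%:R.
      apply: near_forall => k.
      have cEk : (fun h : V n.+1 => E k (t, h + x)) @ (0 : V n.+1) --> e k i.
        by rewrite -EE; exact: (@cvg_comp _ _ _ _ (E k) _ _ _ c2 (cE k)).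
      exact: (@cvgr_dist_lt _ _ _ _ _ _ _ cEk _ eps1).
    near=> h.
    have h1 : f (h + x) 0 i - f x 0 i =
       (t - t) * e0 (t, h + x) + \sum_k ((h + x) 0 k - x 0 k) * E k (t, h + x) by near: h.
    have h2 : forall k, `|e k i - E k (t, h + x)| < eps / n.+1%:R by near: h.
    rewrite !mxE h1 subrr mul0r add0r -sumrB; apply: (le_trans (ler_norm_sum _ _ _)).
    have -> : eps * `|h| = \sum_(k < n.+1) (eps / n.+1%:R) * `|h|.
      by rewrite sumr_const card_ord -[RHS]mulr_natl mulrA mulrCA divff ?mulr1 ?pnatr_eq0.
    apply: ler_sum => k _; rewrite mxE addrK -mulrBr normrM mulrC distrC.
    by apply: ler_pM => //; [exact: ltW|exact: coord_le].
  near=> h; rewrite /= !fctE /=; apply: norm_rV_le => [|i]; first by rewrite mulr_ge0// ltW.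
  have H'' : forall i, `|(f (h + x) - f x - h *m e) 0 i| <= eps * `|h|.
    by near: h; exact: near_forall H'.
  by rewrite opprD addrA.
have D := diff_unique ce E.
by apply/matrixP => k i; rewrite /jacobian /lin1_mx mxE D /= -rowE mxE.
Unshelve. all: by end_near. Qed.

End Jacobian.

(** * Constant sign of nonvanishing polynomials on the simplex *)

Section Orientation.
Context {R : realType}.
Local Notation V n := ('rV[R]_n).
Local Notation Z n := (R * 'rV[R]_n)%type.

Lemma sign_segment (f : R -> R) : continuous f -> (forall s, 0 <= s <= 1 -> f s != 0) ->
  0 < f 0 * f 1.
Proof.
move=> cf f0; have n0 : f 0 != 0 by apply: f0; rewrite lexx ler01.
have n1 : f 1 != 0 by apply: f0; rewrite lexx ler01.
rewrite lt_neqAle eq_sym mulf_neq0//= leNgt; apply/negP => h.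
have [c] : exists2 c, c \in `[0, 1]%R & f c = 0.
  apply: IVT => //; first by apply: continuous_subspaceT.
  rewrite ge_min le_max; have [p0|p0] := leP (f 0) 0.
    by rewrite orTb /=; apply/orP; right; rewrite leNgt; apply/negP => p1; nra.
  by rewrite /= (ltW p0) andbT leNgt; apply/negP => p1; nra.
by rewrite in_itv /= => /f0 /eqP.
Qed.

Lemma sign_simplex n (f : Z n -> R) t : isP f -> (forall x, simplex x -> f (t, x) != 0) ->
  forall x, simplex x -> 0 < Num.sg (f (t, bcen n)) * f (t, x).
Proof.
move=> Pf f0 x Kx; pose c : V n := bcen n; pose g (s : R) := f (t, c + s *: (x - c)).
have Kc : simplex c by move=> v; rewrite bary_bcen invr_ge0.
have cg : continuous g.
  move=> s; have c1 : (fun s : R => c + s *: (x - c)) @ s --> c + s *: (x - c).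
    by apply: cvgD; [exact: cvg_cst|apply: cvgZr_tmp; exact: cvg_id].
  exact: (@cvg_comp _ _ _ _ (fun x => f (t, x)) _ _ _ c1 (@isP_cst_time _ _ _ Pf t _)).
have g0 : g 0 = f (t, c) by rewrite /g scale0r addr0.
have g1 : g 1 = f (t, x) by rewrite /g scale1r addrC subrK.
have h : 0 < f (t, c) * f (t, x).
  rewrite -g0 -g1; apply: sign_segment => // s /andP[s0 s1].
  apply: f0 => v; rewrite bary_affine ?leq_ord//.
  have -> : bary c v + s * (bary x v - bary c v) = (1 - s) * bary c v + s * bary x v by ring.
  have := Kc v; have := Kx v; rewrite /= => h1 h2; nra.
have fc0 := f0 c Kc; rewrite -/c; case: sgrP fc0 h => [_|p _|p _]; rewrite ?eqxx//.
  by rewrite mul1r pmulr_rgt0.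
by rewrite mulN1r oppr_gt0 nmulr_rgt0.
Qed.

Lemma bounded_below n (f : Z n -> R) t : isP f -> (forall x, simplex x -> f (t, x) != 0) ->
  exists2 c, 0 < c & forall x, simplex x -> c <= `|f (t, x)|.
Proof.
move=> Pf f0; have [B B0 hB] := @compact_bound _ _ _ (fun x => (f (t, x))^-1) (@compact_simplex R n)
   (fun x Kx => @cvgV _ _ _ (nbhs_filter x) _ _ (f0 x Kx) (@isP_cst_time _ _ _ Pf t x)).
exists (B + 1)^-1; first by rewrite invr_gt0 ltr_wpDl.
move=> x Kx; have n0 : 0 < `|f (t, x)| by rewrite normr_gt0 f0.
rewrite -[leRHS]invrK lef_pV2 ?posrE ?invr_gt0 ?ltr_wpDl//.
by have := hB x Kx; rewrite normfV; lra.
Qed.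

End Orientation.

(** * The mesh motion *)

Section Motion.
Context {R : realType}.
Local Notation V n := ('rV[R]_n).
Local Notation Z n := (R * 'rV[R]_n)%type.
Variables (d' m : nat).
Local Notation d := d'.+1.
Local Notation K := (@simplex R d).
Variables (D : fsi_data R d m) (m0 : (0 < m)%N) (dt0 : 0 < dt D).
Variables (n : nat) (n0 : (0 < n)%N) (s s' : fsi_state D).
Hypotheses (ms : is_mesh (fpt s)) (ms' : is_mesh (fpt s')).
Hypothesis mm : mesh_motion_ok n s s'.

Local Notation psi := (psi2 (fpt s) (fpt s')).
Definition tm (th : R) : R := tk D n.-1 + th * dt D.

Lemma tkS : tk D n = tk D n.-1 + dt D.
Proof. by rewrite /tk -{1}(prednK n0) -natr1 mulrDl mul1r. Qed.

Lemma tm_in th : 0 <= th <= 1 -> tk D n.-1 <= tm th <= tk D n.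
Proof.
move=> /andP[h0 h1]; rewrite tkS /tm lerDl mulr_ge0 ?(ltW dt0)//= lerD2l.
by rewrite ler_piMl// ltW.
Qed.

(** [locate] may choose another element through the same point; by [interp_cons] the old element
    maps agree there as well. *)
Lemma PhiE th j x : K x -> Phi n s s' (elmap (fpt s') j x) (tm th) = psi j (th, x).
Proof.
move=> Kx; have [j' lE [x' Kx' e]] := locateP (fpt s') j Kx.
rewrite /Phi lE -e elinvK//; have dtn : dt D != 0 by rewrite gt_eqF.
have -> : (tm th - tk D n.-1) / dt D = th by rewrite /tm; field.
have -> : (tk D n - tm th) / dt D = 1 - th by rewrite tkS /tm; field.
have -> : elmap (fpt s) j' x' = elmap (fpt s) j x := interp_cons ms' Kx' Kx e (fpt s).
by rewrite /psi2 e addrC.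
Qed.

Lemma Omega_tE th : Omega_t n s s' (tm th) = Om psi th.
Proof.
apply/seteqP; split => [_ [_ [j _ [x Kx <-]] <-]|_ [j _ [x Kx <-]]].
  by exists j => //; exists x => //; rewrite PhiE.
exists (elmap (fpt s') j x); last by rewrite PhiE.
by exists j => //; exists x.
Qed.

Lemma Phi_inj th : 0 <= th <= 1 -> set_inj (Omega_f s') (fun x => Phi n s s' x (tm th)).
Proof. by move=> /tm_in /mm [[_ h _] _]. Qed.

Lemma in_Omega j x : K x -> Omega_f s' (elmap (fpt s') j x).
Proof. by move=> Kx; exists j => //; exists x. Qed.

Lemma psi_cons th i j x y : 0 <= th <= 1 -> K x -> K y ->
  elmap (fpt s') i x = elmap (fpt s') j y <-> psi i (th, x) = psi j (th, y).
Proof.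
move=> th01 Kx Ky; rewrite -!PhiE//; split => [->//|h].
by apply: (Phi_inj th01) h; apply: mem_set; exact: in_Omega.
Qed.

Lemma psi_inj th j : 0 <= th <= 1 -> set_inj K (fun x => psi j (th, x)).
Proof.
move=> th01 x y /set_mem Kx /set_mem Ky /(psi_cons j j th01 Kx Ky) h.
by case: ms' => inj _ _ _; apply: (inj j) h; exact: mem_set.
Qed.

Lemma bextE th (W : Type) (f : V d -> W) j x : 0 <= th <= 1 -> K x ->
  bext n s s' f (tm th) (psi j (th, x)) = f (elmap (fpt s') j x).
Proof.
move=> th01 Kx; rewrite /bext; congr f; rewrite -PhiE//.
by apply: (pinvKV _ (Phi_inj th01)); apply: mem_set; exact: in_Omega.
Qed.

Lemma fextE th j x : 0 <= th <= 1 -> K x ->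
  fext n s s' (tm th) (psi j (th, x)) = interp (fun i => vel s (fpt s i)) j x.
Proof.
move=> th01 Kx; rewrite /fext -(hat_interp j ms' Kx).
by apply: eq_bigr => i _; rewrite bextE.
Qed.

(** The derivative at t^n is two-sided. [PhiE] puts no restriction on th, so that the motion is
    affine in time beyond t^n too. *)
Lemma mesh_velocityE j x : K x ->
  mesh_velocity n s s' (elmap (fpt s') j x) = (dt D)^-1 *: (elmap (fpt s') j x - elmap (fpt s) j x).
Proof.
move=> Kx; have dtn : dt D != 0 by rewrite gt_eqF.
have E t : Phi n s s' (elmap (fpt s') j x) t = psi j (1, x) +
    (t - tk D n) *: ((dt D)^-1 *: (elmap (fpt s') j x - elmap (fpt s) j x)).
  have -> : t = tm ((t - tk D n.-1) / dt D) by rewrite /tm divfK// addrC subrK.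
  rewrite PhiE// psi1 /psi2 /= /tm tkS; move: (elmap _ j x) (elmap (fpt s') j x) => p p'.
  apply/rowP => i; rewrite !mxE; move: (p 0 i) (p' 0 i) (tk D n.-1) => a b c.
  by field.
rewrite /mesh_velocity (_ : Phi n s s' _ = fun t => psi j (1, x) + (t - tk D n) *: ((dt D)^-1 *: (elmap (fpt s') j x - elmap (fpt s) j x))); last exact/funext.
move: ((dt D)^-1 *: _) (psi j (1, x)) => w p; rewrite derive1E /derive.
apply: cvg_lim; first exact: norm_hausdorff.
apply: (@cvg_trans _ ((fun _ : R => w) @ (0 : R)^')); last exact: cvg_cst.
apply: near_eq_cvg; near=> h; have h0 : h != 0 by near: h; exact: nbhs_dnbhs_neq.
have -> : ((fun t => p + (t - tk D n) *: w) \o shift (tk D n)) (h *: 1) - (p + (tk D n - tk D n) *: w) = h *: w.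
  by rewrite /= subrr scale0r addr0 /GRing.scale /= mulr1 addrK addrC addKr.
by rewrite scalerA mulVf// scale1r.
Unshelve. all: by end_near. Qed.

Lemma frozen_pmap (P : Z d -> V d) t : pmap P -> pmap (fun z : Z d => P (t, z.2)).
Proof.
by move=> PP l; apply: (isP_comp (G := fun z : Z d => (t, z.2)) (PP l)) => [|k]; [exact: isP_cst|exact: isP_coord].
Qed.

(** Freezing the time asks for injectivity and a nonzero determinant at t alone and makes the
    derivative available at end points of the time interval. *)
Lemma hasD_frozen (P : Z d -> V d) (f : Z d -> R) t x : pmap P -> isP f ->
  set_inj (@Ko R d) (fun x => P (t, x)) -> (forall x, Ko x -> Det P (t, x) != 0) -> Ko x ->
  exists a, hasD (fun z : Z d => f (t, Xo P (t, z.2))) (t, P (t, x)) a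
    (fun i => \sum_l (invmx (Jm P (t, x))) i l * dpart l f (t, x)).
Proof.
move=> PP Pf injP detP Kx; set y := P (t, x).
have injP' s0 : [set t] s0 -> set_inj (@Ko R d) (fun x => P (s0, x)) by move=> ->.
have detP' s0 x0 : [set t] s0 -> Ko x0 -> Det P (s0, x0) != 0 by move=> ->; exact: detP.
pose G (y : V d) := Xo P (t, y); pose Pt (z : Z d) := P (t, z.2).
have Gy : G y = x by rewrite /G /y (XoE injP').
have ct : (fun w : Z d => (t, w.2)) @ ((t, y) : Z d) --> ((t, y) : Z d).
  have c1 : (fun _ : Z d => t) @ ((t, y) : Z d) --> t by apply: cst_continuous.
  exact: (cvg_pair c1 (@cvg_snd _ _ _ _ _)).
have cG : {for ((t, y) : Z d), continuous (fun w : Z d => G w.2)}.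
  rewrite /prop_for /continuous_at /= Gy.
  by apply: (@Xo_cvg_in _ _ _ PP _ injP' detP' t x _ _ _ (fun w : Z d => (t, w.2))) => //; exact: nearW.
have oU : open (Uo P t) by exact: (open_Uo PP injP' detP').
have nU : \forall w \near ((t, y) : Z d), Uo P t w.2.
  have c2 : (fun w : Z d => w.2) @ ((t, y) : Z d) --> y by exact: cvg_snd.
  by apply: (c2 (Uo P t)); apply: open_nbhs_nbhs; split => //; exists x.
have nP : \forall w \near ((t, y) : Z d), Pt (w.1, G w.2) = w.2.
  near=> w; have Uw : Uo P t w.2 by near: w.
  by have [] := @XoP _ _ P (t, w.2) Uw.
have D0 : Det Pt (t, G y) != 0 by rewrite Gy; exact: detP.
pose ft (z : Z d) := f (t, z.2).
have Pft : isP ft.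
  by apply: (isP_comp (G := fun z : Z d => (t, z.2)) Pf) => [|k]; [exact: isP_cst|exact: isP_coord].
have H := @hasD_inv_comp _ _ Pt (fun w : Z d => G w.2) (t, y) ft _ _ (frozen_pmap t PP)
  (nbhs_singleton nP) D0 cG nP (isP_hasD (t, G y) Pft).
by eexists; apply: hasD_eq H _ _ => [|i]; [reflexivity|rewrite /= Gy].
Unshelve. all: by end_near. Qed.

Lemma partial_pull (P : Z d -> V d) (f : Z d -> R) (F : V d -> R) t x i : pmap P -> isP f ->
  set_inj (@Ko R d) (fun x => P (t, x)) -> (forall x, Ko x -> Det P (t, x) != 0) -> Ko x ->
  (forall x, Ko x -> F (P (t, x)) = f (t, x)) ->
  is_derive (0 : R) (1 : R) (fun r : R => F (P (t, x) + r *: delta_mx 0 i))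
    (\sum_l (invmx (Jm P (t, x))) i l * dpart l f (t, x)) /\
  partial i F (P (t, x)) = \sum_l (invmx (Jm P (t, x))) i l * dpart l f (t, x).
Proof.
move=> PP Pf injP detP Kx Ff; have [a H] := hasD_frozen PP Pf injP detP Kx.
have injP' s0 : [set t] s0 -> set_inj (@Ko R d) (fun x => P (s0, x)) by move=> ->.
have detP' s0 x0 : [set t] s0 -> Ko x0 -> Det P (s0, x0) != 0 by move=> ->; exact: detP.
have oU : open (Uo P t) by exact: (open_Uo PP injP' detP').
have H2 := hasD_slice i H; rewrite /= in H2.
suff H3 : is_derive (0 : R) (1 : R) (fun r : R => F (P (t, x) + r *: delta_mx 0 i))
    (\sum_l (invmx (Jm P (t, x))) i l * dpart l f (t, x)).
  by split => //; exact: partial_slice H3.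
apply: near_eq_is_derive H2.
have cl : (fun r : R => P (t, x) + r *: delta_mx 0 i) @ (0 : R) --> P (t, x).
  have c1 : (fun r : R => P (t, x) + r *: delta_mx 0 i) @ (0 : R) --> P (t, x) + (0 : R) *: delta_mx 0 i.
    by apply: cvgD; [exact: cvg_cst|apply: cvgZr_tmp; exact: cvg_id].
  by rewrite scale0r addr0 in c1.
have nb : \forall r \near (0 : R), Uo P t (P (t, x) + r *: delta_mx 0 i).
  by apply: (cl (Uo P t)); apply: open_nbhs_nbhs; split => //; exists x.
apply: filterS nb => r Ur; have [Kr e] := @XoP _ _ P (t, _) Ur.
by rewrite -(Ff _ Kr) -[in RHS]/((t, P (t, x) + r *: delta_mx 0 i).2) -e.
Qed.

(** Element maps may reverse orientation. The Jacobian determinant of a new element map has no zero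
    on the simplex, hence the sign that it has at the barycentre. *)
Definition sgn j : R := Num.sg (Det (psi j) (1, bcen d)).

Lemma Det_psi1 j x : K x -> Det (psi j) (1, x) != 0.
Proof.
move=> Kx; case: ms' => _ det _ _; have := det j x Kx.
rewrite (@jacobian_hasD _ _ _ _ 1 x (fun i => dtime (fun z : Z d => elmap (fpt s') j z.2 0 i) (1, x)) (Jm (psi j) (1, x)))//.
move=> i; have PE := isP_interp (fpt s') j i.
apply: hasD_eq (isP_hasD (1, x) PE) _ _ => // k; rewrite mxE /dpart /=.
by congr (partial k _ x); apply/funext => z; rewrite psi1.
Qed.

Lemma Det_psi0 j x : K x -> Det (psi j) (0, x) != 0.
Proof.
move=> Kx; case: ms => _ det _ _; have := det j x Kx.
rewrite (@jacobian_hasD _ _ _ _ 0 x (fun i => dtime (fun z : Z d => elmap (fpt s) j z.2 0 i) (0, x)) (Jm (psi j) (0, x)))//.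
move=> i; have PE := isP_interp (fpt s) j i.
apply: hasD_eq (isP_hasD (0, x) PE) _ _ => // k; rewrite mxE /dpart /=.
by congr (partial k _ x); apply/funext => z; rewrite psi0.
Qed.

Lemma sgn_Det1 j x : K x -> 0 < sgn j * Det (psi j) (1, x).
Proof. by apply: sign_simplex; [exact: isP_Det (pmap_psi _ _ _)|exact: Det_psi1]. Qed.

Lemma psi1_inj j : set_inj K (fun x => psi j (1, x)).
Proof. by apply: psi_inj; rewrite ler01 lexx. Qed.

Lemma set_injS (A B : set (V d)) (f : V d -> V d) : B `<=` A -> set_inj A f -> set_inj B f.
Proof. by move=> BA h x y /set_mem Bx /set_mem By; apply: h; apply: mem_set; exact: BA. Qed.

Lemma Uo1_interior j x : Ko x -> interior (elem (fpt s') j) (elmap (fpt s') j x).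
Proof.
move=> Kx; have injP' s0 : [set (1 : R)] s0 -> set_inj (@Ko R d) (fun x => psi j (s0, x)).
  by move=> ->; exact: (set_injS (@KoK _ _) (@psi1_inj j)).
have detP' s0 x0 : [set (1 : R)] s0 -> Ko x0 -> Det (psi j) (s0, x0) != 0 by move=> -> /KoK; exact: Det_psi1.
have oU : open (Uo (psi j) 1) by exact: (open_Uo (pmap_psi _ _ _) injP' detP').
apply: (@interiorS _ (Uo (psi j) 1)); first by move=> _ [z Kz <-]; rewrite psi1; exists z => //; exact: KoK.
by move: oU; rewrite openE; apply; exists x => //; rewrite psi1.
Qed.

(** Inside a new element the motion is [psi j] at time th after the inverse of [psi j] at time 1.
    Its Jacobian, positive by assumption, is the quotient of the two determinants, so that the sign
    at time 1 persists. *)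
Lemma sgn_Det j th x : 0 <= th <= 1 -> Ko x -> 0 < sgn j * Det (psi j) (th, x).
Proof.
move=> th01 Kx; set y := elmap (fpt s') j x.
have [_ mdet] := mm (tm_in th01); have := mdet j y (Uo1_interior j Kx).
pose A := invmx (Jm (psi j) (1, x)) *m Jm (psi j) (th, x).
have inj1 : set_inj (@Ko R d) (fun x => psi j (1, x)) by exact: (set_injS (@KoK _ _) (@psi1_inj j)).
have det1 x0 : Ko x0 -> Det (psi j) (1, x0) != 0 by move=> /KoK; exact: Det_psi1.
pose f i (z : Z d) := psi j (th, z.2) 0 i.
have Pf i : isP (f i) by exact: (frozen_pmap th (pmap_psi (fpt s) (fpt s') j)).
have /choice[a H] : forall i, exists a, hasD (fun z : Z d => Phi n s s' z.2 (tm th) 0 i) (1, y) a (fun k => A k i).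
  move=> i; have [a H] := hasD_frozen (pmap_psi (fpt s) (fpt s') j) (Pf i) inj1 det1 Kx.
  exists a; rewrite psi1 in H; apply: (@hasD_near _ _ _ _ _ _ _ (hasD_eq H erefl _)).
    by move=> k; rewrite /A mxE; apply: eq_bigr => l _; rewrite mxE.
  have injP' s0 : [set (1 : R)] s0 -> set_inj (@Ko R d) (fun x => psi j (s0, x)) by move=> ->.
  have detP' s0 x0 : [set (1 : R)] s0 -> Ko x0 -> Det (psi j) (s0, x0) != 0 by move=> ->; exact: det1.
  have oU : open (Uo (psi j) 1) by exact: (open_Uo (pmap_psi _ _ _) injP' detP').
  have c2 : (fun w : Z d => w.2) @ ((1, y) : Z d) --> y by exact: cvg_snd.
  have nU : \forall w \near ((1, y) : Z d), Uo (psi j) 1 w.2.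
    by apply: (c2 (Uo (psi j) 1)); apply: open_nbhs_nbhs; split => //; exists x => //; rewrite psi1.
  apply: filterS nU => w Uw; have [Kw e] := @XoP _ _ (psi j) (1, w.2) Uw.
  rewrite /f /= -(PhiE _ _ (KoK Kw)); congr (Phi n s s' _ _ 0 i).
  by rewrite -[RHS]e psi1.
rewrite (jacobian_hasD H) /A det_mulmx det_inv => h.
have h1 := sgn_Det1 j (KoK Kx); rewrite /Det in h1 *.
have n1 : \det (Jm (psi j) (1, x)) != 0 by exact: det1.
have -> : sgn j * \det (Jm (psi j) (th, x)) =
   ((\det (Jm (psi j) (1, x)))^-1 * \det (Jm (psi j) (th, x))) * (sgn j * \det (Jm (psi j) (1, x))).
  by move: n1; move: (\det _) (\det _) => u w u0; field.
exact: (mulr_gt0 h h1).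
Qed.

Lemma sgn_abs j : `|sgn j| = 1.
Proof.
rewrite /sgn normr_sg Det_psi1//.
by move=> v; rewrite bary_bcen invr_ge0.
Qed.

Lemma Uo_disj th i j y : 0 <= th <= 1 -> Uo (psi i) th y -> Uo (psi j) th y -> i = j.
Proof.
move=> th01 [x Kx <-] [x' Kx' e]; apply: (elem_disj ms' Kx (KoK Kx')).
by apply/(psi_cons i j th01 (KoK Kx) (KoK Kx')).
Qed.

(** The lower bound at time 0 asked for by [transport] holds since the old element maps have a
    nonzero Jacobian up to the boundary of the simplex. *)
Lemma transport_psi j (k : V d -> R) : isP (fun z : Z d => k z.2) ->
  exists I, forall th, 0 <= th <= 1 -> hasint (Uo (psi j) th)
    (fun y => k (Xo (psi j) (th, y)) / (sgn j * Det (psi j) (th, Xo (psi j) (th, y)))) I.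
Proof.
move=> Pk; have PD := isP_Det (pmap_psi (fpt s) (fpt s') j).
have [c c0 hc] := bounded_below PD (@Det_psi0 j).
have T01 (t : R) : `[0, 1]%classic t -> 0 <= t <= 1 by rewrite /= in_itv.
have hc' x : Ko x -> c <= sgn j * Det (psi j) (0, x).
  move=> Kx; have := hc x (KoK Kx); rewrite -[`|_|]mul1r -(sgn_abs j) -normrM gtr0_norm//.
  by apply: sgn_Det; rewrite ?lexx ?ler01.
have [I hI] := @transport _ _ (psi j) (pmap_psi _ _ _) (sgn j)
  (fun t Tt => set_injS (@KoK _ _) (@psi_inj t j (T01 t Tt)))
  (fun t x Tt => sgn_Det j (T01 t Tt)) c
  hc' c0 k Pk.
by exists I => th th01; apply: hI; rewrite /= in_itv.
Qed.

End Motion.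

(** * Integrals over a mesh *)

Section StaticMesh.
Context {R : realType}.
Local Notation V n := ('rV[R]_n).
Local Notation Z n := (R * 'rV[R]_n)%type.
Variables (d' m : nat).
Local Notation d := d'.+1.
Local Notation K := (@simplex R d).
Variables (T : mesh_top d m) (a : 'I_(npt T) -> V d) (ma : is_mesh a).

(** The time is a dummy variable, so that the lemmas on motions apply to a fixed mesh. *)
Definition emap j (z : Z d) : V d := elmap a j z.2.

Lemma pmap_emap j : pmap (emap j).
Proof. by move=> i; exact: isP_interp. Qed.

Lemma emap_inj j t : set_inj K (fun x => emap j (t, x)).
Proof. by case: ma => inj _ _ _; exact: inj. Qed.

Lemma emap_injo j t : set_inj (@Ko R d) (fun x => emap j (t, x)).
Proof. exact: (set_injS (@KoK _ _) (@emap_inj j t)). Qed.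

Lemma Det_emap j t x : K x -> Det (emap j) (t, x) != 0.
Proof.
move=> Kx; case: ma => _ det _ _; have := det j x Kx.
rewrite (@jacobian_hasD _ _ _ _ t x (fun i => dtime (fun z : Z d => elmap a j z.2 0 i) (t, x)) (Jm (emap j) (t, x)))//.
move=> i; have PE := isP_interp a j i.
by apply: hasD_eq (isP_hasD (t, x) PE) _ _ => // k; rewrite mxE.
Qed.

Lemma Det_emapo j t x : Ko x -> Det (emap j) (t, x) != 0.
Proof. by move=> /KoK; exact: Det_emap. Qed.

Lemma Om_domain t : Om emap t = domain a.
Proof. by []. Qed.

Lemma Uo_emap_open j t : open (Uo (emap j) t).
Proof.
apply: (@open_Uo _ _ _ (pmap_emap j) setT) => // [t' _|t' x _].
  exact: emap_injo.
exact: Det_emapo.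
Qed.

Lemma Uo_emap_disj i j y : Uo (emap i) 0 y -> Uo (emap j) 0 y -> i = j.
Proof. by move=> [x Kx <-] [x' Kx' /esym e]; exact: (elem_disj ma Kx (KoK Kx') e). Qed.

Lemma mset_domain : mset (domain a).
Proof. by apply: mset_closed; rewrite -(Om_domain 0); exact: (closed_Om pmap_emap). Qed.

Lemma domain_split (f : V d -> R) (I : 'I_(nelt T) -> R) :
  (forall j, hasint (Uo (emap j) 0) f (I j)) -> hasint (domain a) f (\sum_j I j).
Proof.
move=> hI; have [N [mN N0 hN]] := null_skeleton pmap_emap 0.
apply: (hasint_bigcup mset_domain mN N0 (U := fun j => Uo (emap j) 0)) hI.
- by move=> j y [x Kx <-]; exists j => //; exists x => //; exact: KoK.
- move=> y [j _ [x Kx xy]] Ny; exists j; exists x => //.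
  by apply: contrapT => nK; apply: Ny; rewrite -xy; exact: (hN j).
- by move=> i j y; exact: Uo_emap_disj.
Qed.

Lemma domain_null : exists N : set (V d), [/\ mset N, vol N = 0%E &
  forall y, domain a y -> ~ N y -> exists j x, Ko x /\ y = elmap a j x].
Proof.
have [N [mN N0 hN]] := null_skeleton pmap_emap 0; exists N; split => //.
move=> y [j _ [x Kx xy]] Ny; exists j, x; split => //.
by apply: contrapT => nK; apply: Ny; rewrite -xy; exact: (hN j).
Qed.

Lemma vol_Uo j : (vol (Uo (emap j) 0) < +oo)%E.
Proof.
have [r hr] := Om_bounded pmap_emap 0; apply: (@vol_bounded _ _ _ r).
  by apply: mset_open; exact: Uo_emap_open.
by move=> y [x Kx <-]; apply: hr; exists j => //; exists x => //; exact: KoK.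
Qed.

Lemma domain_int_bounded (f : V d -> R) :
  (forall j, mfun (Uo (emap j) 0) f) -> (exists C, forall j x, Ko x -> `|f (elmap a j x)| <= C) ->
  exists I, hasint (domain a) f I.
Proof.
move=> mf [C hC].
have /choice[I hI] : forall j, exists I, hasint (Uo (emap j) 0) f I.
  move=> j; apply: (@hasint_bounded _ _ _ _ C set0).
  - by apply: mset_open; exact: Uo_emap_open.
  - exact: vol_Uo.
  - by rewrite /mset preimage_set0.
  - by rewrite /vol preimage_set0 measure0.
  - by rewrite setD0; exact: mf.
  - by move=> _ [x Kx <-] _; exact: hC.
by exists (\sum_j I j); exact: domain_split.
Qed.

Lemma Xo_emap_cont j y : Uo (emap j) 0 y -> {for y, continuous (fun y => Xo (emap j) (0, y))}.
Proof.
move=> [x Kx <-]; rewrite /prop_for /continuous_at.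
rewrite (@XoE _ _ _ setT (fun t _ => @emap_injo j t))//.
have ct : (fun _ : V d => (0 : R)) @ (emap j (0, x)) --> (0 : R) by apply: cst_continuous.
have cp : (fun y : V d => (0, y)) @ (emap j (0, x)) --> ((0, emap j (0, x)) : Z d).
  exact: (cvg_pair ct (@cvg_id _ _)).
apply: (@Xo_cvg_in _ _ _ (pmap_emap j) setT (fun t _ => @emap_injo j t) (fun t x _ => @Det_emapo j t x) 0 x
  _ _ (nbhs_filter _) (fun y : V d => (0, y)) I Kx cp).
exact: nearW.
Qed.

Lemma emap_mfun j (f : V d -> R) (k : V d -> R) : (forall x, K x -> {for x, continuous k}) ->
  (forall x, Ko x -> f (elmap a j x) = k x) -> mfun (Uo (emap j) 0) f.
Proof.
move=> ck fk; apply: (@mfun_open _ _ _ f (@Uo_emap_open j 0)) => y /set_mem Uy.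
have [x Kx xy] := Uy.
have c1 : (fun y => k (Xo (emap j) (0, y))) @ y --> k (Xo (emap j) (0, y)).
  apply: (@cvg_comp _ _ _ (fun y => Xo (emap j) (0, y)) k _ _ _ (Xo_emap_cont Uy)).
  by apply: ck; apply: KoK; have [] := @XoP _ _ (emap j) (0, y) Uy.
have fE z : Uo (emap j) 0 z -> f z = k (Xo (emap j) (0, z)).
  by move=> Uz; have [Kz e] := @XoP _ _ (emap j) (0, z) Uz; rewrite -(fk _ Kz); have -> : elmap a j (Xo (emap j) (0, z)) = z by exact: e.
rewrite /continuous_at (fE y Uy); apply: cvg_trans c1; apply: near_eq_cvg; first exact: nbhs_filter.
have nb : \forall z \near y, Uo (emap j) 0 z by apply: open_nbhs_nbhs; split => //; exact: Uo_emap_open.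
by apply: filterS nb => z Uz; rewrite fE.
Qed.

Lemma domain_int (f : V d -> R) (k : 'I_(nelt T) -> V d -> R) :
  (forall j x, K x -> {for x, continuous (k j)}) ->
  (forall j x, Ko x -> f (elmap a j x) = k j x) -> exists I, hasint (domain a) f I.
Proof.
move=> ck fk; apply: domain_int_bounded.
  by move=> j; exact: emap_mfun (ck j) (fk j).
have /choice[c hc] : forall j, exists C, forall x, K x -> `|k j x| <= C.
  by move=> j; have [C _ hC] := compact_bound (@compact_simplex R d) (ck j); exists C.
exists (\sum_j `|c j|) => j x Kx; rewrite fk//; apply: (le_trans (hc j x (KoK Kx))).
by rewrite (bigD1 j)//= (le_trans (ler_norm _))// lerDl sumr_ge0.
Qed.

Lemma partial_emap (f : V d -> R) (q : V d -> R) j x i : isP (fun z : Z d => q z.2) -> Ko x ->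
  (forall x, Ko x -> f (elmap a j x) = q x) ->
  partial i f (elmap a j x) = \sum_l (invmx (Jm (emap j) (0, x))) i l * dpart l (fun z : Z d => q z.2) (0, x).
Proof.
move=> Pq Kx fq.
by have [_] := @partial_pull _ d' (emap j) (fun z => q z.2) f 0 x i (pmap_emap j) Pq (@emap_injo j 0) (@Det_emapo j 0) Kx fq.
Qed.

(** A physical partial derivative in reference coordinates. Unlike [partial] it has meaningful
    values, and is continuous, up to the boundary of the simplex. *)
Definition pdx j (q : V d -> R) i (x : V d) : R :=
  \sum_l (invmx (Jm (emap j) (0, x))) i l * dpart l (fun z : Z d => q z.2) (0, x).

Lemma pdx_cont j (q : V d -> R) i x : isP (fun z : Z d => q z.2) -> K x -> {for x, continuous (pdx j q i)}.
Proof.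
move=> Pq Kx; apply: (cvg_sumR (nbhs_filter x)) => l.
have D0 := Det_emap j 0 Kx.
have cD := @isP_cst_time _ _ _ (isP_Det (pmap_emap j)) 0 x.
have PA : isP (fun z => (\adj (Jm (emap j) z)) i l).
  by apply: isP_adj => k k'; exact: isP_Jm (pmap_emap j).
have cA : (fun x => (Det (emap j) (0, x))^-1 * (\adj (Jm (emap j) (0, x))) i l) @ x -->
   (Det (emap j) (0, x))^-1 * (\adj (Jm (emap j) (0, x))) i l.
  exact: (@cvgM _ _ _ (nbhs_filter x) _ _ _ _ (@cvgV _ _ _ (nbhs_filter x) _ _ D0 cD) (@isP_cst_time _ _ _ PA 0 x)).
have c0 : (fun x => (invmx (Jm (emap j) (0, x))) i l) @ x --> (Det (emap j) (0, x))^-1 * (\adj (Jm (emap j) (0, x))) i l.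
  apply: (cvg_trans _ cA); apply: near_eq_cvg; first exact: nbhs_filter.
  have nD : \forall y \near x, Det (emap j) (0, y) != 0 by exact: (@cvgr_neq0 _ _ _ _ (nbhs_filter x) _ _ cD D0).
  by apply: filterS nD => y Dy; exact: (esym (invmxE i l Dy)).
have c1 := eq_rect _ (fun b => (fun x => (invmx (Jm (emap j) (0, x))) i l) @ x --> b) c0 _ (esym (invmxE i l D0)).
exact: (@cvgM _ _ _ (nbhs_filter x) _ _ _ _ c1 (@isP_cst_time _ _ _ (isP_dpart l Pq) 0 x)).
Qed.

End StaticMesh.

(** * Polynomials in time *)

Section TimePoly.
Context {R : realType}.
Local Notation V n := ('rV[R]_n).
Local Notation Z n := (R * 'rV[R]_n)%type.

Lemma isP_time_expand n (f : Z n -> R) : isP f -> exists (N : nat) (c : nat -> V n -> R),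
  (forall l, isP (fun z : Z n => c l z.2)) /\ forall t x, f (t, x) = \sum_(l < N) t ^+ l * c l x.
Proof.
(* Coefficients are also required to vanish from N on, so that products are computed by the Cauchy
   formula for all indices. *)
suff H : isP f -> exists (N : nat) (c : nat -> V n -> R), [/\ forall l, isP (fun z : Z n => c l z.2),
    forall l, (N <= l)%N -> forall x, c l x = 0 & forall t x, f (t, x) = \sum_(l < N) t ^+ l * c l x].
  by move=> /H[N [c [h1 _ h2]]]; exists N, c.
have ext N M (c : nat -> V n -> R) t x : (forall l, (N <= l)%N -> forall x, c l x = 0) -> (N <= M)%N ->
    \sum_(l < N) t ^+ l * c l x = \sum_(l < M) t ^+ l * c l x.
  move=> c0 NM; rewrite (big_ord_widen M (fun l => t ^+ l * c l x) NM) big_mkcond /=.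
  by apply: eq_bigr => l _; case: ltnP => // h; rewrite c0// mulr0.
elim=> [r||i|g h Pg [N [c [Pc c0 cE]]] Ph [N' [c' [Pc' c0' cE']]]|g h Pg [N [c [Pc c0 cE]]] Ph [N' [c' [Pc' c0' cE']]]].
- exists 1%N, (fun l _ => if l is 0 then r else 0); split => [l|[|l] //|t x]; first exact: isP_cst.
  by rewrite big_ord1 expr0 mul1r.
- exists 2%N, (fun l _ => (l == 1%N)%:R); split => [l|[|[|l]] //|t x]; first exact: isP_cst.
  by rewrite !big_ord_recl big_ord0 /= mulr0 add0r addr0 mulr1.
- exists 1%N, (fun l x => if l is 0 then x 0 i else 0); split => [[|l]|[|l] //|t x]; [exact: isP_coord|exact: isP_cst|].
  by rewrite big_ord1 expr0 mul1r.
- exists (maxn N N'), (fun l x => c l x + c' l x); split => [l|l|t x]; first exact: isP_add.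
    by rewrite geq_max => /andP[h1 h2] x; rewrite c0// c0'// addr0.
  rewrite cE cE' (ext _ (maxn N N') _ t x c0) ?leq_maxl// (ext _ (maxn N N') _ t x c0') ?leq_maxr//.
  by rewrite -big_split; apply: eq_bigr => l _; rewrite mulrDr.
- exists (N + N')%N, (fun l x => \sum_(p < l.+1) c p x * c' (l - p)%N x); split => [l|l Nl x|t x].
  + by apply: isP_sum => p _; apply: isP_mul; [exact: Pc|exact: Pc'].
  + apply: big1 => p _; have [pN|pN] := leqP N p; first by rewrite c0// mul0r.
    rewrite c0' ?mulr0//; have := ltn_ord p; lia.
  + pose p1 := \poly_(l < N) c l x; pose p2 := \poly_(l < N') c' l x.
    have e1 : g (t, x) = p1.[t] by rewrite cE horner_poly; apply: eq_bigr => l _; rewrite mulrC.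
    have e2 : h (t, x) = p2.[t] by rewrite cE' horner_poly; apply: eq_bigr => l _; rewrite mulrC.
    have co1 l : p1`_l = c l x by rewrite coef_poly; case: ltnP => // hl; rewrite c0.
    have co2 l : p2`_l = c' l x by rewrite coef_poly; case: ltnP => // hl; rewrite c0'.
    rewrite e1 e2 -hornerM.
    have sz : (size (p1 * p2)%R <= N + N')%N.
      apply: (leq_trans (size_polyMleq _ _)); have := size_poly N (c ^~ x); have := size_poly N' (c' ^~ x).
      rewrite -/p1 -/p2; lia.
    rewrite (horner_coef_wide _ sz); apply: eq_bigr => l _; rewrite mulrC; congr (_ * _).
    by rewrite coefM; apply: eq_bigr => p _; rewrite co1 co2.
Qed.

Lemma poly_zero_near1 (p : {poly R}) e : 0 < e -> (forall t, 1 - e < t -> t <= 1 -> p.[t] = 0) -> p = 0.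
Proof.
move=> e0 h; apply/eqP; apply: contraT => pn0.
(* As many distinct roots as the size of p, one more than its degree allows. *)
pose rs := [seq 1 - e / (k.+2)%:R | k <- iota 0 (size p)].
have := max_poly_roots pn0 (rs := rs); rewrite size_map size_iota ltnn; apply.
  apply/allP => _ /mapP[k _ ->]; apply/rootP; apply: h.
    by rewrite ltrD2l ltrN2 ltr_pdivrMr ?ltr0n// ltr_pMr// ltr1n.
  by rewrite gerBl divr_ge0// ltW.
rewrite map_inj_uniq ?iota_uniq// => k l /addrI /oppr_inj /(mulfI (lt0r_neq0 e0)) /invr_inj /eqP.
by rewrite eqr_nat => /eqP [].
Qed.

(** In the Leibniz formula each product has n factors that are affine in time. The degree n is what
    the quadrature has to match. *)
Lemma Det_affine n (P : Z n -> V n) (A B : 'M[R]_n) x : pmap P ->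
  (forall t, Jm P (t, x) = (1 - t) *: A + t *: B) ->
  exists p : {poly R}, [/\ (size p <= n.+1)%N, forall t, Det P (t, x) = p.[t] &
    forall t, dtime (Det P) (t, x) = p^`().[t]].
Proof.
move=> PP JE; pose c i j : {poly R} := (A i j)%:P + (B i j - A i j) *: 'X.
pose p := \sum_(s : 'S_n) (-1) ^+ s *: \prod_i c i (s i).
have pE t : Det P (t, x) = p.[t].
  rewrite /Det JE /determinant horner_sum; apply: eq_bigr => s _.
  rewrite hornerZ horner_prod; congr (_ * _); apply: eq_bigr => i _.
  by rewrite !mxE hornerD hornerC hornerZ hornerX; ring.
have sc i j : (size (c i j) <= 2)%N.
  apply: (leq_trans (size_polyD _ _)); rewrite geq_max (leq_trans (size_polyC_leq1 _))//=.
  by apply: (leq_trans (size_scale_leq _ _)); rewrite size_polyX.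
exists p; split => // [|t].
  apply: (leq_trans (size_sum _ _ _)); apply/bigmax_leqP => s _.
  apply: (leq_trans (size_scale_leq _ _)).
  apply: (leq_trans (size_prod_leq _ _)); rewrite card_ord.
  have : (\sum_(i < n) size (c i (s i)) <= \sum_(i < n) 2)%N by apply: leq_sum => i _.
  by rewrite sum_nat_const card_ord; move: (\sum_(i < n) size (c i (s i)))%N => N; lia.
have := hasD_derive1 (isP_hasD (t, x) (isP_Det PP)); move=> /= [_ <-].
have -> : (fun t => Det P (t, x)) = horner p by apply/funext => r; rewrite pE.
by have [_ ->] := is_derive_poly p t.
Qed.

End TimePoly.

(** * The fluid energy *)

Section Fluid.
Context {R : realType}.
Local Notation V n := ('rV[R]_n).
Local Notation Z n := (R * 'rV[R]_n)%type.
Variables (d' m : nat).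
Local Notation d := d'.+1.
Local Notation K := (@simplex R d).
Variables (D : fsi_data R d m) (dt0 : 0 < dt D).
Variables (n : nat) (n0 : (0 < n)%N) (s s' : fsi_state D).
Hypotheses (ms : is_mesh (fpt s)) (ms' : is_mesh (fpt s')).
Hypothesis mm : mesh_motion_ok n s s'.
Local Notation psi := (psi2 (fpt s) (fpt s')).
Local Notation sg := (sgn s s').
Local Notation tmn := (tm D n).
Local Notation I := 'I_(nelt (fmesh D)).

Let psiP j : pmap (psi j) := pmap_psi (fpt s) (fpt s') j.
Let isP_at_time (f : Z d -> R) t : isP f -> isP (fun z : Z d => f (t, z.2)).
Proof.
by move=> Pf; apply: (isP_comp (G := fun z : Z d => (t, z.2)) Pf) => [|k]; [exact: isP_cst|exact: isP_coord].
Qed.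
Let injo th j : 0 <= th <= 1 -> set_inj (@Ko R d) (fun x => psi j (th, x)).
Proof. by move=> h; exact: (set_injS (@KoK _ _) (@psi_inj _ _ _ _ dt0 _ n0 _ _ ms' mm th j h)). Qed.
Let sgD j th x : 0 <= th <= 1 -> Ko x -> 0 < sg j * Det (psi j) (th, x).
Proof. exact: (sgn_Det dt0 n0 ms' mm). Qed.
Let detn0 j th x : 0 <= th <= 1 -> Ko x -> Det (psi j) (th, x) != 0.
Proof. by move=> h Kx; have := sgD j h Kx; apply: contraTneq => ->; rewrite mulr0 ltxx. Qed.
Let open_psi j th : 0 <= th <= 1 -> open (Uo (psi j) th).
Proof.
move=> h; apply: (@open_Uo _ _ _ (psiP j) [set th]) => // [t ->|t x ->]; [exact: injo|exact: detn0].
Qed.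

(* The integral of k over the moving element, in reference coordinates; by
   transport_psi it does not depend on the time th. *)
Definition Lf j (k : V d -> R) : R := xget 0 [set J | forall th, 0 <= th <= 1 ->
  hasint (Uo (psi j) th)
    (fun y => k (Xo (psi j) (th, y)) / (sg j * Det (psi j) (th, Xo (psi j) (th, y)))) J].

Lemma LfP j k th : isP (fun z : Z d => k z.2) -> 0 <= th <= 1 -> hasint (Uo (psi j) th)
    (fun y => k (Xo (psi j) (th, y)) / (sg j * Det (psi j) (th, Xo (psi j) (th, y)))) (Lf j k).
Proof.
move=> Pk h; have [J HJ] := transport_psi dt0 n0 ms ms' mm j Pk.
by rewrite /Lf; case: xgetP => [J' _ HJ'|/(_ J) nJ]; [exact: HJ'|case: nJ].
Qed.

Lemma LfD j k k' : isP (fun z : Z d => k z.2) -> isP (fun z : Z d => k' z.2) ->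
  Lf j (fun x => k x + k' x) = Lf j k + Lf j k'.
Proof.
move=> Pk Pk'; have h : 0 <= (0 : R) <= 1 by rewrite lexx ler01.
apply: (hasint_uniq (LfP j (isP_add Pk Pk') h)).
by apply: hasint_ext (hasintD (LfP j Pk h) (LfP j Pk' h)) => y _; rewrite mulrDl.
Qed.

Lemma LfZ j c k : isP (fun z : Z d => k z.2) -> Lf j (fun x => c * k x) = c * Lf j k.
Proof.
move=> Pk; have h : 0 <= (0 : R) <= 1 by rewrite lexx ler01.
apply: (hasint_uniq (LfP j (isP_mul (isP_cst d c) Pk) h)).
by apply: hasint_ext (hasintZ c (LfP j Pk h)) => y _; rewrite mulrA.
Qed.

Lemma Lf_sum j (A : Type) (r : seq A) (k : A -> V d -> R) : (forall a, isP (fun z : Z d => k a z.2)) ->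
  Lf j (fun x => \sum_(a <- r) k a x) = \sum_(a <- r) Lf j (k a).
Proof.
move=> Pk; elim: r => [|a r IH].
  have e : Lf j (fun x => 0 * 0) = 0 by rewrite LfZ ?mul0r//; exact: isP_cst.
  by rewrite big_nil -[RHS]e; congr Lf; apply/funext => x; rewrite big_nil mul0r.
rewrite big_cons -IH -LfD//; last by apply: isP_sum => b _; exact: Pk.
by congr Lf; apply/funext => x; rewrite big_cons.
Qed.

Lemma Lf_poly j (f : Z d -> R) : isP f -> exists p : {poly R}, forall t, Lf j (fun x => f (t, x)) = p.[t].
Proof.
move=> /isP_time_expand[N [c [Pc fE]]]; exists (\poly_(l < N) Lf j (c l)) => t.
rewrite horner_poly (_ : (fun x => _) = (fun x => \sum_(l <- index_enum 'I_N) t ^+ l * c l x)); last first.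
  by apply/funext => x; rewrite fE.
rewrite (@Lf_sum j _ _ (fun (l : 'I_N) x => t ^+ l * c l x)); last first.
  by move=> l; apply: isP_mul; [exact: isP_cst|exact: Pc].
apply: eq_bigr => l _; rewrite (@LfZ j (t ^+ l) (c l) (Pc l)); exact: mulrC.
Qed.

(** The factor [sg j * Det] is the absolute value of the determinant; multiplying and dividing by it
    brings f to the form of [LfP] on each element. *)
Lemma fld th f (k : I -> V d -> R) : 0 <= th <= 1 -> (forall j, isP (fun z : Z d => k j z.2)) ->
  (forall j x, Ko x -> f (psi j (th, x)) * (sg j * Det (psi j) (th, x)) = k j x) ->
  hasint (Omega_t n s s' (tmn th)) f (\sum_j Lf j (k j)).
Proof.
move=> h Pk fk; rewrite (Omega_tE dt0 n0 s ms').
have [N [mN N0 hN]] := null_skeleton psiP th.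
have mO : mset (Om psi th) by apply: mset_closed; exact: (closed_Om psiP).
apply: (hasint_bigcup mO mN N0 (U := fun j => Uo (psi j) th)).
- by move=> j y [x Kx <-]; exists j => //; exists x => //; exact: KoK.
- move=> y [j _ [x Kx xy]] Ny; exists j; exists x => //.
  by apply: contrapT => nK; apply: Ny; rewrite -xy; exact: (hN j).
- by move=> i j y; exact: (Uo_disj dt0 n0 ms' mm h).
- move=> j; apply: hasint_ext (LfP j (Pk j) h) => y Uy.
  have [Kx e] := @XoP _ _ (psi j) (th, y) Uy.
  have ey : psi j (th, Xo (psi j) (th, y)) = y by exact: e.
  have D0 := sgD j h Kx.
  by rewrite -(fk _ _ Kx) ey mulfK// gt_eqF.
Qed.

(** Times the determinant, the inverse Jacobian becomes the adjugate. This is what keeps pulled-back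
    integrands polynomial in time and space. *)
Lemma ppsi j th i (F : V d -> R) (f : V d -> R) x : 0 <= th <= 1 -> isP (fun z : Z d => f z.2) -> Ko x ->
  (forall x, Ko x -> F (psi j (th, x)) = f x) ->
  partial i F (psi j (th, x)) * Det (psi j) (th, x) =
    \sum_l (\adj (Jm (psi j) (th, x))) i l * dpart l (fun z : Z d => f z.2) (th, x).
Proof.
move=> h Pf Kx Ff.
have [_ ->] := @partial_pull _ d' (psi j) (fun z => f z.2) F th x i (psiP j) Pf (@injo th j h) (fun x => @detn0 j th x h) Kx Ff.
have D0 := @detn0 j th x h Kx.
rewrite mulr_suml; apply: eq_bigr => l _; rewrite invmxE// mulrAC; congr (_ * _).
by rewrite mulrAC mulVf// mul1r.
Qed.

Variables (q q0 : I -> V d -> V d).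
Hypothesis Pq : forall j i, isP (fun z : Z d => q j z.2 0 i).
Hypothesis Pq0 : forall j i, isP (fun z : Z d => q0 j z.2 0 i).
Hypothesis qE : forall j x, K x -> vel s' (elmap (fpt s') j x) = q j x.
Hypothesis q0E : forall j x, K x -> vel s (elmap (fpt s) j x) = q0 j x.

(* Nodal values of the transport velocity u^(n-1) - w^n; W_ / dt is w^n and r_,
   v_ are u^(n-1) and u^(n-1) - w^n in reference coordinates. *)
Definition nodal_v (i : 'I_(npt (fmesh D))) : V d := vel s (fpt s i) - (dt D)^-1 *: (fpt s' i - fpt s i).
Definition r_ j (x : V d) : V d := interp (fun i => vel s (fpt s i)) j x.
Definition W_ j (x : V d) : V d := elmap (fpt s') j x - elmap (fpt s) j x.
Definition v_ j (x : V d) : V d := interp nodal_v j x.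

Let Pr j k : isP (fun z : Z d => r_ j z.2 0 k) := isP_interp (fun i => vel s (fpt s i)) j k.
Let Pv j k : isP (fun z : Z d => v_ j z.2 0 k) := isP_interp nodal_v j k.
Let PW j k : isP (fun z : Z d => W_ j z.2 0 k).
Proof.
apply: isP_ext (isP_sub (isP_interp (fpt s') j k) (isP_interp (fpt s) j k)) => z.
by rewrite /W_ !mxE.
Qed.

Lemma v_E j x : v_ j x = r_ j x - (dt D)^-1 *: W_ j x.
Proof.
rewrite /v_ /r_ /W_ /elmap /interp -sumrB scaler_sumr -sumrB; apply: eq_bigr => b _.
by apply/rowP => k; rewrite !mxE; ring.
Qed.

Definition q2 j (x : V d) : R := \sum_i q j x 0 i ^+ 2.

Let Pq2 j : isP (fun z : Z d => q2 j z.2).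
Proof. by apply: isP_sum => i _; apply: isP_exp; exact: Pq. Qed.

(** On an interface face only nodes of that face contribute to [v_], the other Lagrange functions
    being zero there, and their values [nodal_v] vanish. On [f_1] the factor |u^n|^2 vanishes, and
    [f_2] carries no point. *)
Lemma front_zero (hfr : frontier (Omega_f s') = faces_set (fpt s') (f_fs D :|: f_1 D :|: f_2 D))
  (h1 : forall x, faces_set (fpt s') (f_1 D) x -> vel s' x = 0)
  (h2 : faces_set (fpt s') (f_2 D) = set0)
  (hn : forall i, i \in face_nodes (f_fs D) -> nodal_v i = 0) j k x :
  K x -> frontier (Om psi 1) (psi j (1, x)) -> q2 j x * v_ j x 0 k = 0.
Proof.
move=> Kx; have -> : Om psi 1 = Omega_f s'.
  apply/seteqP; split => y [i _ [z Kz <-]]; exists i => //; exists z => //; by rewrite psi1.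
rewrite hfr psi1 => -[[j' v] /= jv [y [Ky yv] e]].
have qy : vel s' (elmap (fpt s') j' y) = 0 -> q2 j x = 0.
  by rewrite e qE// => h; rewrite /q2 h big1// => i _; rewrite mxE expr0n.
move: jv; rewrite !inE => /orP[/orP[jf|j1]|j2].
- have -> : v_ j x = v_ j' y by apply/esym; exact: (interp_cons ms' Ky Kx e).
  rewrite /v_ /interp summxE big1 ?mulr0// => b _; rewrite mxE.
  have [bv|bv] := eqVneq (val b v : nat) 0%N; last first.
    by rewrite (@lag_vanish _ _ _ b y v) ?mul0r//; [apply: yv; rewrite !inE negbK|exact/eqP].
  rewrite hn ?mxE ?mulr0//; rewrite inE; apply/existsP; exists (j', v); rewrite jf /=.
  by apply/existsP; exists b; rewrite bv !eqxx.
- rewrite qy ?mul0r//; apply: h1; exists (j', v) => //=; exists y => //.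
- exfalso; have : faces_set (fpt s') (f_2 D) (elmap (fpt s') j' y).
    by exists (j', v) => //=; exists y.
  by rewrite h2.
Qed.

(* Det * divergence of the field with reference components f. *)
Definition adjsum j th x (f : 'I_d -> V d -> R) : R :=
  \sum_k \sum_l (\adj (Jm (psi j) (th, x))) k l * dpart l (fun z : Z d => f k z.2) (th, x).

Lemma isP_adjsum j (f : 'I_d -> V d -> R) : (forall k, isP (fun z : Z d => f k z.2)) ->
  isP (fun z : Z d => adjsum j z.1 z.2 f).
Proof.
move=> Pf; apply: isP_sum => k _; apply: isP_sum => l _.
have h : isP (fun z : Z d => (\adj (Jm (psi j) z)) k l * dpart l (fun z : Z d => f k z.2) z).
  apply: isP_mul; last exact: isP_dpart.
  by apply: isP_adj => a b; exact: isP_Jm (psiP j).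
by apply: isP_ext h => -[].
Qed.

Definition kH j th x : R := sg j * adjsum j th x (fun k x => q2 j x * v_ j x 0 k).

Lemma isP_kH j : isP (fun z : Z d => kH j z.1 z.2).
Proof.
apply: isP_mul; first exact: isP_cst.
by apply: isP_adjsum => k; apply: isP_mul; [exact: Pq2|exact: Pv].
Qed.

(* The left-hand side is a polynomial in th.  For th near 1 it is the integral of
   the divergence of a field vanishing on the boundary, hence zero. *)
Lemma H_zero (hfr : frontier (Omega_f s') = faces_set (fpt s') (f_fs D :|: f_1 D :|: f_2 D))
  (h1 : forall x, faces_set (fpt s') (f_1 D) x -> vel s' x = 0)
  (h2 : faces_set (fpt s') (f_2 D) = set0)
  (hn : forall i, i \in face_nodes (f_fs D) -> nodal_v i = 0) th :
  \sum_j Lf j (kH j th) = 0.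
Proof.
have /choice[p pE] : forall j, exists p : {poly R}, forall t, Lf j (kH j t) = p.[t].
  by move=> j; exact: (Lf_poly j (isP_kH j)).
suff p0 : \sum_j p j = 0.
  by rewrite (eq_bigr (fun j => (p j).[th])) => [|j _]; rewrite ?pE// -horner_sum p0 horner0.
have T01 (t : R) : `[0, 1]%classic t -> 0 <= t <= 1 by rewrite /= in_itv.
have PQ j t x : psi j (t, x) = psi j (1, x) + (1 - t) *: (elmap (fpt s) j x - elmap (fpt s') j x).
  by rewrite psi1 /psi2 /=; apply/rowP => k; rewrite !mxE; ring.
have hcons i j t x y : `[0, 1]%classic t -> K x -> K y ->
    psi i (1, x) = psi j (1, y) <-> psi i (t, x) = psi j (t, y).
  by move=> Tt Kx Ky; rewrite !psi1; exact: (psi_cons dt0 n0 ms' mm i j (T01 t Tt) Kx Ky).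
pose Q j x := elmap (fpt s) j x - elmap (fpt s') j x.
have hQ i j x y : K x -> K y -> psi i (1, x) = psi j (1, y) -> Q i x = Q j y.
  move=> Kx Ky; rewrite !psi1 => e; rewrite /Q e; congr (_ - _).
  exact: (interp_cons ms' Kx Ky e (fpt s)).
pose g j k x := q2 j x * v_ j x 0 k.
have hg j k : isP (fun z : Z d => g j k z.2) by apply: isP_mul; [exact: Pq2|exact: Pv].
have hgc i j k x y : K x -> K y -> psi i (1, x) = psi j (1, y) -> g i k x = g j k y.
  move=> Kx Ky; rewrite !psi1 => e; rewrite /g /q2 -!qE// e; congr (_ * _).
  by rewrite /v_ (interp_cons ms' Kx Ky e).
have hgf j k x : K x -> frontier (Om psi 1) (psi j (1, x)) -> g j k x = 0 by exact: front_zero.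
have hinj j t : `[0, 1]%classic t -> set_inj (@Ko R d) (fun x => psi j (t, x)) by move=> /T01; exact: injo.
have hdet j t x : `[0, 1]%classic t -> Ko x -> Det (psi j) (t, x) != 0 by move=> /T01; exact: detn0.
have hdis i j t y : `[0, 1]%classic t -> Uo (psi i) t y -> Uo (psi j) t y -> i = j.
  by move=> /T01 h; exact: (Uo_disj dt0 n0 ms' mm h).
have [e /andP[e0 e1] he] := @pw_ibp R d' _ psi psiP (fun j => @psi1_inj _ _ _ _ dt0 _ n0 _ _ ms' mm j) (Det_psi1 s ms')
   Q PQ hcons hQ _ g hg hgc hgf hinj hdet hdis id.
apply: (poly_zero_near1 e0) => t te t1; rewrite horner_sum.
have t01 : 0 <= t <= 1 by rewrite t1 andbT; lra.
apply: (he t te t1) => j; rewrite -pE.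
apply: hasint_ext (LfP j (isP_at_time t (isP_kH j)) t01) => y Uy.
have [Kx _] := @XoP _ _ (psi j) (t, y) Uy; move: (Xo _ _) Kx => x Kx.
have D0 := @detn0 j t x t01 Kx; have S0 : sg j != 0.
  by have := sgD j t01 Kx; apply: contraTneq => ->; rewrite mul0r ltxx.
have -> : \sum_k dX psi g t j k (id k) x = (Det (psi j) (t, x))^-1 * adjsum j t x (g j).
  rewrite /adjsum mulr_sumr; apply: eq_bigr => k _; rewrite /dX mulr_sumr.
  by apply: eq_bigr => l _; rewrite invmxE// mulrA.
rewrite /kH -/(g j) /=; move: (adjsum _ _ _ _) (Det _ _) D0 => a c c0.
by field; rewrite ?S0 ?c0.
Qed.

(** Tested with u^n and multiplied by the absolute value of the determinant: [kc] is the convection,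
    [kr] its correction and [kd] the integrand dt |u^n|^2 div w. *)
Definition kc j th x : R := sg j * \sum_i adjsum j th x (fun k x => q j x 0 i * v_ j x 0 k) * q j x 0 i.
Definition kr j th x : R := sg j * (1 / 2 * adjsum j th x (fun k x => r_ j x 0 k) * q2 j x).
Definition kd j th x : R := sg j * (q2 j x * dtime (Det (psi j)) (th, x)).

Lemma isP_kc j : isP (fun z : Z d => kc j z.1 z.2).
Proof.
apply: isP_mul; first exact: isP_cst.
apply: isP_sum => i _; apply: isP_mul; last exact: Pq.
by apply: isP_adjsum => k; apply: isP_mul; [exact: Pq|exact: Pv].
Qed.

Lemma isP_kr j : isP (fun z : Z d => kr j z.1 z.2).
Proof.
apply: isP_mul; first exact: isP_cst.
apply: isP_mul; last exact: Pq2.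
by apply: isP_mul; [exact: isP_cst|exact: isP_adjsum].
Qed.

Lemma isP_kd j : isP (fun z : Z d => kd j z.1 z.2).
Proof.
apply: isP_mul; first exact: isP_cst.
apply: isP_mul; first exact: Pq2.
by apply: isP_ext (isP_dtime (isP_Det (psiP j))) => -[].
Qed.

(* With v = u^(n-1) - w the transport velocity,
   u . div (u (x) v) - |u|^2 div (u^(n-1)) / 2 = div (|u|^2 v) / 2 - |u|^2 div w / 2,
   and Det * div w is the time derivative of Det. *)
Lemma kcrE j th x : kc j th x - kr j th x = 1 / 2 * kH j th x - (2 * dt D)^-1 * kd j th x.
Proof.
have dtn : dt D != 0 by rewrite gt_eqF.
have dE : dtime (Det (psi j)) (th, x) = adjsum j th x (fun k x => W_ j x 0 k).
  rewrite (dtime_Det _ (psiP j)) /adjsum exchange_big /=; apply: eq_bigr => k _; apply: eq_bigr => l _.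
  rewrite mulrC; congr (_ * _).
  have -> : dtime (fun w : Z d => psi j w 0 k) = (fun z : Z d => W_ j z.2 0 k).
    have Pa := isP_interp (fpt s) j k; have dsnd (f : V d -> R) : dtime (fun z : Z d => f z.2) = (fun=> 0).
      by apply/funext => z; rewrite /dtime /= derive1_cst.
    have dfst : dtime fst = (fun _ : Z d => 1) :> (Z d -> R).
      by apply/funext => z; have [<- _] := hasD_unique (hasD_fst z).
    have -> : (fun w : Z d => psi j w 0 k) = (fun z : Z d => elmap (fpt s) j z.2 0 k + fst z * W_ j z.2 0 k).
      by apply/funext => z; rewrite /psi2 /W_ !mxE; ring.
    rewrite (dtimeD Pa (isP_mul (isP_fst d) (PW j k))) (dtimeM (isP_fst d) (PW j k)).
    rewrite (dsnd (fun y => elmap (fpt s) j y 0 k)) (dsnd (fun y => W_ j y 0 k)) dfst.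
    by apply/funext => z; rewrite mul1r mulr0 addr0 add0r.
  by [].
have D1 l (f g : V d -> R) : isP (fun z : Z d => f z.2) -> isP (fun z : Z d => g z.2) ->
    dpart l (fun z : Z d => f z.2 * g z.2) (th, x) =
    dpart l (fun z : Z d => f z.2) (th, x) * g x + f x * dpart l (fun z : Z d => g z.2) (th, x).
  by move=> Pf Pg; rewrite (dpartM l Pf Pg).
have Ec i : adjsum j th x (fun k x => q j x 0 i * v_ j x 0 k) =
   \sum_k \sum_l (\adj (Jm (psi j) (th, x))) k l * (dpart l (fun z : Z d => q j z.2 0 i) (th, x) * v_ j x 0 k
     + q j x 0 i * dpart l (fun z : Z d => v_ j z.2 0 k) (th, x)).
  by apply: eq_bigr => k _; apply: eq_bigr => l _; rewrite (D1 l (fun x => q j x 0 i) (fun x => v_ j x 0 k)).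
have Eq2 l : dpart l (fun z : Z d => q2 j z.2) (th, x) = \sum_i 2 * (dpart l (fun z : Z d => q j z.2 0 i) (th, x) * q j x 0 i).
  rewrite (dpart_sum l (index_enum 'I_d) (f := fun i (z : Z d) => q j z.2 0 i ^+ 2)) => [|i]; last by apply: isP_exp; exact: Pq.
  apply: eq_bigr => i _; have -> : (fun z : Z d => q j z.2 0 i ^+ 2) = (fun z : Z d => q j z.2 0 i * q j z.2 0 i).
    by apply/funext => z; rewrite expr2.
  by rewrite (D1 l (fun x => q j x 0 i) (fun x => q j x 0 i))// mulrC; ring.
have EH : adjsum j th x (fun k x => q2 j x * v_ j x 0 k) =
   \sum_k \sum_l (\adj (Jm (psi j) (th, x))) k l * (dpart l (fun z : Z d => q2 j z.2) (th, x) * v_ j x 0 k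
     + q2 j x * dpart l (fun z : Z d => v_ j z.2 0 k) (th, x)).
  by apply: eq_bigr => k _; apply: eq_bigr => l _; rewrite (D1 l (q2 j) (fun x => v_ j x 0 k)).
have ER : adjsum j th x (fun k x => r_ j x 0 k) = \sum_k \sum_l (\adj (Jm (psi j) (th, x))) k l * dpart l (fun z : Z d => v_ j z.2 0 k) (th, x)
   + (dt D)^-1 * adjsum j th x (fun k x => W_ j x 0 k).
  rewrite /adjsum mulr_sumr -big_split; apply: eq_bigr => k _; rewrite mulr_sumr -big_split; apply: eq_bigr => l _ /=.
  have -> : (fun z : Z d => r_ j z.2 0 k) = (fun z : Z d => v_ j z.2 0 k + (dt D)^-1 * W_ j z.2 0 k).
    by apply/funext => z; rewrite v_E !mxE subrK.
  rewrite (dpartD l (Pv j k) (isP_mul (isP_cst d _) (PW j k))) (dpartZ l _ (PW j k)).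
  by rewrite mulrDr [in RHS]mulrCA.
rewrite /kc /kr /kH /kd dE ER EH.
set a := \sum_k \sum_l (\adj _) k l * dpart l _ _.
have -> : \sum_i adjsum j th x (fun k x => q j x 0 i * v_ j x 0 k) * q j x 0 i =
   1 / 2 * (\sum_k \sum_l (\adj (Jm (psi j) (th, x))) k l * (dpart l (fun z : Z d => q2 j z.2) (th, x) * v_ j x 0 k)) + q2 j x * a.
  rewrite (eq_bigr (fun i => \sum_k \sum_l (\adj (Jm (psi j) (th, x))) k l * (dpart l (fun z : Z d => q j z.2 0 i) (th, x) * v_ j x 0 k) * q j x 0 i
      + q j x 0 i ^+ 2 * a)); last first.
    move=> i _; rewrite Ec /a mulr_suml mulr_sumr -big_split; apply: eq_bigr => k _ /=.
    by rewrite mulr_suml mulr_sumr -big_split; apply: eq_bigr => l _ /=; ring.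
  rewrite big_split /= -mulr_suml; congr (_ + _).
  rewrite exchange_big mulr_sumr; apply: eq_bigr => k _ /=.
  rewrite exchange_big mulr_sumr; apply: eq_bigr => l _ /=.
  by rewrite Eq2 mulr_suml !mulr_sumr; apply: eq_bigr => i _; field.
have -> : \sum_k \sum_l (\adj (Jm (psi j) (th, x))) k l * (dpart l (fun z : Z d => q2 j z.2) (th, x) * v_ j x 0 k
     + q2 j x * dpart l (fun z : Z d => v_ j z.2 0 k) (th, x)) =
   \sum_k \sum_l (\adj (Jm (psi j) (th, x))) k l * (dpart l (fun z : Z d => q2 j z.2) (th, x) * v_ j x 0 k) + q2 j x * a.
  rewrite /a mulr_sumr -big_split; apply: eq_bigr => k _ /=.
  by rewrite mulr_sumr -big_split; apply: eq_bigr => l _ /=; ring.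
move: (\sum_k \sum_l _) a (adjsum _ _ _ _) (q2 j x) (sg j) => b a w c e.
by field.
Qed.

Lemma psi_fields j th x : 0 <= th <= 1 -> K x ->
  [/\ bext n s s' (vel s') (tmn th) (psi j (th, x)) = q j x,
      fext n s s' (tmn th) (psi j (th, x)) = r_ j x &
      fext n s s' (tmn th) (psi j (th, x)) - bext n s s' (mesh_velocity n s s') (tmn th) (psi j (th, x)) = v_ j x].
Proof.
move=> h Kx; have fE := fextE dt0 n0 ms' mm j h Kx.
split => //; first by rewrite (bextE dt0 n0 ms' mm (vel s') j h Kx) qE.
rewrite (bextE dt0 n0 ms' mm (mesh_velocity n s s') j h Kx) (mesh_velocityE dt0 n0 s ms' j Kx) fE.
by rewrite v_E.
Qed.

Lemma conv_int th : 0 <= th <= 1 -> ip (Omega_t n s s' (tmn th))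
       (mxdiv (fun y => outer (bext n s s' (vel s') (tmn th) y)
          (fext n s s' (tmn th) y - bext n s s' (mesh_velocity n s s') (tmn th) y)))
       (bext n s s' (vel s') (tmn th)) = \sum_j Lf j (kc j th).
Proof.
move=> h; apply: hasint_vint; apply: fld => // [j|j x Kx]; first exact: isP_at_time (isP_kc j).
have [e1 _ _] := psi_fields j h (KoK Kx).
rewrite big_ord1 mulr_suml /kc mulr_sumr; apply: eq_bigr => i _; rewrite e1 mxE.
have <- : (\sum_k partial k (fun y => outer (bext n s s' (vel s') (tmn th) y)
          (fext n s s' (tmn th) y - bext n s s' (mesh_velocity n s s') (tmn th) y) i k) (psi j (th, x))) * Det (psi j) (th, x)
  = adjsum j th x (fun k x => q j x 0 i * v_ j x 0 k).
  rewrite mulr_suml; apply: eq_bigr => k _.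
  rewrite -(@ppsi j th k (fun y => outer (bext n s s' (vel s') (tmn th) y)
          (fext n s s' (tmn th) y - bext n s s' (mesh_velocity n s s') (tmn th) y) i k) (fun x => q j x 0 i * v_ j x 0 k))//.
    by apply: isP_mul; [exact: Pq|exact: Pv].
  by move=> y Ky; have [e2 _ e3] := psi_fields j h (KoK Ky); rewrite mxE e2 e3.
by move: (\sum_k _) (Det _ _) (q j x 0 i) (sg j) => a b c e; ring.
Qed.

Lemma corr_int th : 0 <= th <= 1 -> ip (Omega_t n s s' (tmn th))
       (fun y => (1 / 2 * div (fext n s s' (tmn th)) y) *: bext n s s' (vel s') (tmn th) y)
       (bext n s s' (vel s') (tmn th)) = \sum_j Lf j (kr j th).
Proof.
move=> h; apply: hasint_vint; apply: fld => // [j|j x Kx]; first exact: isP_at_time (isP_kr j).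
have [e1 _ _] := psi_fields j h (KoK Kx).
rewrite big_ord1 /kr /q2 e1.
have <- : div (fext n s s' (tmn th)) (psi j (th, x)) * Det (psi j) (th, x) = adjsum j th x (fun k x => r_ j x 0 k).
  rewrite /div mulr_suml; apply: eq_bigr => k _.
  rewrite -(@ppsi j th k (fun y => fext n s s' (tmn th) y 0 k) (fun x => r_ j x 0 k))//.
  by move=> y Ky; have [_ e2 _] := psi_fields j h (KoK Ky); rewrite e2.
have -> : \sum_i ((1 / 2 * div (fext n s s' (tmn th)) (psi j (th, x))) *: q j x) ord0 i * q j x ord0 i =
  1 / 2 * div (fext n s s' (tmn th)) (psi j (th, x)) * \sum_i q j x 0 i ^+ 2.
  by move: (1 / 2 * div _ _) => c; rewrite mulr_sumr; apply: eq_bigr => i _; rewrite mxE expr2 mulrA.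
by move: (div _ _) (Det _ _) (\sum_i _) (sg j) => a b c e; ring.
Qed.

Definition quad_th : seq (R * R) :=
  if d == 2%N then [:: (1 / 2, 1)]
  else [:: (1 / 2 - 1 / (2 * Num.sqrt 3), 1 / 2); (1 / 2 + 1 / (2 * Num.sqrt 3), 1 / 2)].

Lemma quadE : quadrature D n = [seq (tmn p.1, p.2) | p <- quad_th].
Proof.
rewrite /quadrature /quad_th /tm (tkS D n0); case: ifP => _ /=.
  by congr [:: (_, _)]; field.
by move: (1 / (2 * Num.sqrt 3)) => a; congr [:: (_, _); (_, _)]; field.
Qed.

Lemma quad_in p : p \in quad_th -> 0 <= p.1 <= 1.
Proof.
rewrite /quad_th; case: ifP => _; rewrite !inE.
  by move=> /eqP -> /=; lra.
have s3 : (1 : R) <= Num.sqrt 3 by rewrite -[leLHS]sqrtr1 ler_sqrt ?ler1n.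
have h : 0 <= 1 / (2 * Num.sqrt 3) :> R by rewrite divr_ge0 ?mulr_ge0 ?sqrtr_ge0.
have h2 : 1 / (2 * Num.sqrt 3) <= 1 / 2 :> R.
  rewrite !div1r lef_pV2 ?posrE ?mulr_gt0 ?sqrtr_gt0 ?ltr0n//; lra.
by move: (1 / (2 * _)) h h2 => a h h2; move=> /orP[] /eqP -> /=; lra.
Qed.

(* Det is a polynomial of degree at most d in time, so that its derivative is
   integrated exactly by the midpoint rule (d = 2) or two Gauss points (d = 3). *)
Lemma quad_exact (hd : d = 2%N \/ d = 3%N) (p : {poly R}) : (size p <= d.+1)%N ->
  \sum_(r <- quad_th) r.2 * p^`().[r.1] = p.[1] - p.[0].
Proof.
move=> sp; have sp' : (size p^`() <= d)%N.
  by apply: (leq_trans (size_poly _ _)); case: (size p) sp.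
have E t : p.[t] = \sum_(i < d.+1) p`_i * t ^+ i by rewrite (horner_coef_wide _ sp).
have E' t : p^`().[t] = \sum_(i < d) p`_i.+1 *+ i.+1 * t ^+ i.
  by rewrite (horner_coef_wide _ sp'); apply: eq_bigr => i _; rewrite coef_deriv.
rewrite /quad_th; case: hd => d2; rewrite d2 /= in E E' *.
  rewrite big_seq1 E' !E !big_ord_recl !big_ord0 /=.
  by rewrite /bump /= !expr0 !expr1n ?expr1 ?expr0n /=; field.
rewrite big_cons big_seq1 !E' !E !big_ord_recl !big_ord0 /= /bump /=.
rewrite !expr0 !expr1n !expr0n /= !add1n.
have s3 : Num.sqrt 3 ^+ 2 = 3 :> R by rewrite sqr_sqrtr// ler0n.
have s0 : Num.sqrt 3 != 0 :> R by rewrite sqrtr_eq0 -ltNge ltr0n.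
move: (Num.sqrt 3) s3 s0 => r r2 r0.
have rr : (1 / (2 * r)) ^+ 2 = 1 / 12 :> R by rewrite expr_div_n exprMn r2; field.
by move: (1 / (2 * r)) rr => a a2; rewrite !expr1 !sqrrD sqrrN a2; field.
Qed.

Lemma vel_norm1 : hasint (Omega_f s') (fun y => \sum_(i < 1) \sum_k vel s' y i k * vel s' y i k)
   (\sum_j Lf j (fun x => sg j * (q2 j x * Det (psi j) (1, x)))).
Proof.
have h : 0 <= (1 : R) <= 1 by rewrite ler01 lexx.
have -> : Omega_f s' = Omega_t n s s' (tmn 1).
  rewrite (Omega_tE dt0 n0 s ms').
  by apply/seteqP; split => y [i _ [z Kz <-]]; exists i => //; exists z => //; rewrite psi1.
apply: fld => // [j|j x Kx].
  apply: isP_mul; [exact: isP_cst|apply: isP_mul; [exact: Pq2|exact: (isP_at_time 1 (isP_Det (psiP j)))]].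
rewrite psi1 qE; last exact: KoK.
rewrite big_ord1 /q2 (eq_bigr (fun i => q j x 0 i ^+ 2)) => [|i _]; last by rewrite expr2.
by move: (\sum_i _) (Det _ _) (sg j) => a b c; ring.
Qed.

(** At th = 0 the moving domain is the old one: integrals over both domains become values of the
    same functionals [Lf j] and can be compared. *)
Lemma vel_old f (k : I -> V d -> R) : (forall j, isP (fun z : Z d => k j z.2)) ->
  (forall j x, Ko x -> f (elmap (fpt s) j x) = k j x) ->
  hasint (Omega_f s) f (\sum_j Lf j (fun x => sg j * (k j x * Det (psi j) (0, x)))).
Proof.
move=> Pk fk; have h : 0 <= (0 : R) <= 1 by rewrite ler01 lexx.
have -> : Omega_f s = Omega_t n s s' (tmn 0).
  rewrite (Omega_tE dt0 n0 s ms').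
  by apply/seteqP; split => y [i _ [z Kz <-]]; exists i => //; exists z => //; rewrite psi0.
apply: fld => // [j|j x Kx].
  apply: isP_mul; [exact: isP_cst|apply: isP_mul; [exact: Pk|exact: (isP_at_time 0 (isP_Det (psiP j)))]].
by rewrite psi0 fk//; ring.
Qed.

Lemma bext_old j x : K x -> bext n s s' (vel s') (tk D n.-1) (elmap (fpt s) j x) = q j x.
Proof.
move=> Kx; have h : 0 <= (0 : R) <= 1 by rewrite ler01 lexx.
have [e _ _] := psi_fields j h Kx.
by rewrite -e psi0 /tm mul0r addr0.
Qed.

Lemma fluid_energy (hd : d = 2%N \/ d = 3%N)
  (hfr : frontier (Omega_f s') = faces_set (fpt s') (f_fs D :|: f_1 D :|: f_2 D))
  (h1 : forall x, faces_set (fpt s') (f_1 D) x -> vel s' x = 0)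
  (h2 : faces_set (fpt s') (f_2 D) = set0)
  (hn : forall i, i \in face_nodes (f_fs D) -> nodal_v i = 0) :
  (2 * dt D)^-1 * (ip (Omega_f s') (vel s') (vel s') - ip (Omega_f s) (vel s) (vel s)) <=
  (dt D)^-1 * (ip (Omega_f s') (vel s') (vel s') - ip (Omega_f s) (vel s) (bext n s s' (vel s') (tk D n.-1)))
  + convection n s s' (vel s') - convection_correction n s s' (vel s').
Proof.
set A := \sum_j Lf j (fun x => sg j * (q2 j x * Det (psi j) (1, x))).
set B := \sum_j Lf j (fun x => sg j * (q2 j x * Det (psi j) (0, x))).
have E1 : ip (Omega_f s') (vel s') (vel s') = A by exact: hasint_vint vel_norm1.
have Pk0 j : isP (fun z : Z d => q2 j z.2) by exact: Pq2.
have HB : hasint (Omega_f s) (fun y => \sum_k (bext n s s' (vel s') (tk D n.-1) y) 0 k ^+ 2) B.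
  by apply: vel_old => // j x Kx; rewrite (bext_old j (KoK Kx)).
have HC : exists C, hasint (Omega_f s) (fun y => \sum_(i < 1) \sum_k vel s y i k * (bext n s s' (vel s') (tk D n.-1) y) i k) C.
  eexists; apply: (@vel_old _ (fun j x => \sum_k q0 j x 0 k * q j x 0 k)) => [j|j x Kx].
    by apply: isP_sum => k _; apply: isP_mul.
  by rewrite big_ord1 (bext_old j (KoK Kx)) (q0E j (KoK Kx)).
have HE : exists E, hasint (Omega_f s) (fun y => \sum_(i < 1) \sum_k vel s y i k * vel s y i k) E.
  eexists; apply: (@vel_old _ (fun j x => \sum_k q0 j x 0 k * q0 j x 0 k)) => [j|j x Kx].
    by apply: isP_sum => k _; apply: isP_mul.
  by rewrite big_ord1 (q0E j (KoK Kx)).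
have [C hC] := HC; have [E hE] := HE.
(* Young's inequality on the old domain: C is the mixed term, E the old kinetic term, B that of the
   backward extension of u^n. *)
have CE : C <= 1 / 2 * E + 1 / 2 * B.
  apply: (hasint_le (N := set0) _ _ _ hC (hasintD (hasintZ (1 / 2) hE) (hasintZ (1 / 2) HB))).
  - by rewrite /mset preimage_set0.
  - by rewrite /vol preimage_set0 measure0.
  move=> y _ _; rewrite !big_ord1 !mulr_sumr -big_split; apply: ler_sum => k _ /=.
  have sq (a b : R) : a * b <= 1 / 2 * (a * a) + 1 / 2 * b ^+ 2 by have := sqr_ge0 (a - b); nra.
  exact: sq.
rewrite /ip in E1 *; rewrite E1 (hasint_vint hC) (hasint_vint hE).
(* The [kH] part vanishes by [H_zero]; the [kd] part is the quadrature of a time derivative, exactly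
   the change from B to A. With [CE], (A - C) / dt - (A - B) / (2 dt) is then at least (A - E) / (2
   dt). *)
have CC : convection n s s' (vel s') - convection_correction n s s' (vel s') = - (2 * dt D)^-1 * (A - B).
  rewrite /convection /convection_correction quadE !big_map -sumrB /=.
  rewrite big_seq (eq_bigr (fun p : R * R => - (2 * dt D)^-1 * (p.2 * \sum_j Lf j (kd j p.1)))) => [|p pq]; last first.
    have h := quad_in pq; rewrite (conv_int h) (corr_int h) -mulrBr -sumrB.
    have -> : \sum_j (Lf j (kc j p.1) - Lf j (kr j p.1)) = \sum_j (1 / 2 * Lf j (kH j p.1) - (2 * dt D)^-1 * Lf j (kd j p.1)).
      apply: eq_bigr => j _.
      have P1 := isP_at_time p.1 (isP_kc j); have P2 := isP_at_time p.1 (isP_kr j).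
      have P3 := isP_at_time p.1 (isP_kH j); have P4 := isP_at_time p.1 (isP_kd j).
      have e1 := @LfD j (kc j p.1) (fun x => -1 * kr j p.1 x) P1 (isP_mul (isP_cst d (-1)) P2).
      have e2 := @LfD j (fun x => 1 / 2 * kH j p.1 x) (fun x => - (2 * dt D)^-1 * kd j p.1 x) (isP_mul (isP_cst d _) P3) (isP_mul (isP_cst d _) P4).
      rewrite (@LfZ j _ _ P2) in e1; rewrite (@LfZ j _ _ P3) (@LfZ j _ _ P4) in e2.
      rewrite mulN1r in e1; rewrite mulNr in e2; rewrite -e1 -e2; congr (Lf j _); apply/funext => x.
      by rewrite mulN1r mulNr kcrE.
    rewrite sumrB -!mulr_sumr (H_zero hfr h1 h2 hn) mulr0 sub0r mulrN mulNr; congr (- _).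
    by rewrite mulrCA.
  rewrite -big_seq -mulr_sumr; congr (_ * _).
  under eq_bigr do rewrite mulr_sumr.
  rewrite exchange_big /= /A /B -sumrB; apply: eq_bigr => j _.
  have P4 p := isP_at_time p (isP_kd j).
  have PD t : isP (fun z : Z d => sg j * (q2 j z.2 * Det (psi j) (t, z.2))).
    by apply: isP_mul; [exact: isP_cst|apply: isP_mul; [exact: Pq2|exact: (isP_at_time t (isP_Det (psiP j)))]].
  have e1 := @LfD j (fun x => sg j * (q2 j x * Det (psi j) (1, x))) (fun x => -1 * (sg j * (q2 j x * Det (psi j) (0, x)))) (PD 1) (isP_mul (isP_cst d (-1)) (PD 0)).
  rewrite (@LfZ j _ _ (PD 0)) mulN1r in e1; rewrite -e1.
  have e2 := @Lf_sum j _ quad_th (fun p x => p.2 * kd j p.1 x) (fun p => isP_mul (isP_cst d p.2) (P4 p.1)).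
  rewrite -(eq_bigr _ (fun p _ => @LfZ j p.2 _ (P4 p.1))) -e2; congr (Lf j _); apply/funext => x.
  (* The Jacobian of the linearly interpolated element map is affine in time. *)
  have JE t : Jm (psi j) (t, x) = (1 - t) *: Jm (psi j) (0, x) + t *: Jm (psi j) (1, x).
    apply/matrixP => k i; rewrite !mxE.
    have Pa := isP_interp (fpt s) j i; have Pb := isP_interp (fpt s') j i.
    have e r : dpart k (fun w => psi j w 0 i) (r, x) = (1 - r) * dpart k (fun z : Z d => elmap (fpt s) j z.2 0 i) (0, x)
        + r * dpart k (fun z : Z d => elmap (fpt s') j z.2 0 i) (0, x).
      have -> : dpart k (fun w => psi j w 0 i) (r, x) = dpart k (fun z : Z d => (1 - r) * elmap (fpt s) j z.2 0 i + r * elmap (fpt s') j z.2 0 i) (r, x).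
        by rewrite /dpart; congr (partial k _ _); apply/funext => y; rewrite /psi2 /= !mxE.
      by rewrite (dpartD k (isP_mul (isP_cst d _) Pa) (isP_mul (isP_cst d _) Pb)) (dpartZ k _ Pa) (dpartZ k _ Pb).
    by rewrite (e t) (e 0) (e 1); ring.
  have [p [sp pE pE']] := Det_affine (psiP j) JE.
  rewrite /kd (eq_bigr (fun r : R * R => sg j * q2 j x * (r.2 * p^`().[r.1]))) => [|r _]; last first.
    by rewrite pE'; move: (_.[_]) (q2 j x) (sg j) => a b c; ring.
  rewrite -mulr_sumr (quad_exact hd sp) !pE; move: (p.[1]) (p.[0]) (q2 j x) (sg j) => a b c e; ring.
rewrite -addrA CC; have dtn : dt D != 0 by rewrite gt_eqF.
have -> : (dt D)^-1 = 2 * (2 * dt D)^-1 by field.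
have i0 : 0 < (2 * dt D)^-1 by rewrite invr_gt0 mulr_gt0.
move: (2 * dt D)^-1 i0 => r r0; nra.
Qed.

End Fluid.

(** * Convex energies *)

Section Convex.
Context {R : realType}.
Variables (d : nat) (W : 'M[R]_d.+1 -> R).
Hypothesis dW : forall F, differentiable W F.
Hypothesis cW : convex_function (E := 'M[R]_d.+1) setT W.

Lemma convex_le (t : R) A B : 0 <= t <= 1 -> W (t *: A + (1 - t) *: B) <= t * W A + (1 - t) * W B.
Proof.
move=> /andP[t0 t1].
have h : 0 <= t <= 1 by rewrite t0 t1.
have := @cW (Itv01 t0 t1) A B (in_setT _) (in_setT _).
by rewrite convRE /=.
Qed.

Lemma deriv_line A B : is_derive (0 : R) (1 : R) (fun s : R => W (A + s *: B))
  (\sum_i \sum_j dmx W A i j * B i j).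
Proof.
have -> : \sum_i \sum_j dmx W A i j * B i j = 'D_B W A.
  rewrite deriveE// [X in 'd W A X](matrix_sum_delta B) linear_sum; apply: eq_bigr => i _.
  rewrite linear_sum; apply: eq_bigr => j _.
  by rewrite linearZ mxE deriveE// mulrC.
have H := @diff_derivable _ _ _ W A B (dW A).
have E : (fun h : R => h^-1 *: (((fun s : R => W (A + s *: B)) \o shift 0) (h *: 1) - W (A + 0 *: B))) =
  (fun h : R => h^-1 *: ((W \o shift A) (h *: B) - W A)).
  by apply/funext => h /=; rewrite scale0r !addr0 [A + _]addrC /GRing.scale /= mulr1.
by split; [move: H; rewrite /derivable E|rewrite /derive E].
Qed.

(** By convexity no difference quotient from A towards B exceeds W B - W A; the tangent term is
    their limit. *)
Lemma convex_tangent A B : W A + \sum_i \sum_j dmx W A i j * (B - A) i j <= W B.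
Proof.
rewrite -lerBrDl.
have c := is_derive_seq (deriv_line A (B - A)).
apply: (@cvgr_to_le _ _ _ _ _ _ _ c).
apply: nearW => k; rewrite scale0r addr0 -ler_pdivlMl ?ltr0n//.
have h : 0 <= (k.+1%:R^-1 : R) <= 1 by rewrite invr_ge0 ler0n /= invf_le1 ?ltr0n// ler1n.
have := @convex_le k.+1%:R^-1 B A h.
have -> : k.+1%:R^-1 *: B + (1 - k.+1%:R^-1) *: A = A + k.+1%:R^-1 *: (B - A).
  by rewrite scalerBr scalerBl scale1r addrCA.
move: (k.+1%:R^-1) (W _) => r w; lra.
Qed.

Lemma energy_cont : continuous W.
Proof. by move=> A; exact: differentiable_continuous. Qed.

Lemma dmx_bounds A i j (h : R) : 0 < h ->
  - h^-1 * (W (A - h *: delta_mx i j) - W A) <= dmx W A i j <= h^-1 * (W (A + h *: delta_mx i j) - W A).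
Proof.
move=> h0; have e c : \sum_k \sum_l dmx W A k l * (A + c *: delta_mx i j - A) k l = c * dmx W A i j.
  rewrite (bigD1 i)//= (bigD1 j)//= !big1 => [|k ki|l lj].
  - by rewrite !mxE !eqxx/=; ring.
  - by apply: big1 => l _; rewrite !mxE (negPf ki)/=; ring.
  - by rewrite !mxE (negPf lj) andbF/=; ring.
have := convex_tangent A (A + h *: delta_mx i j); have := convex_tangent A (A - h *: delta_mx i j).
rewrite -scaleNr !e; move: (dmx W A i j) (W A) (W (A + - h *: _)) (W (A + h *: _)) => x c b a.
move=> h1 h2; rewrite mulNr lerNl !(mulrC h^-1) ler_pdivlMr// ler_pdivlMr//.
by apply/andP; split; lra.
Qed.

(* By convexity dmx W lies between backward and forward difference quotients,
   which are continuous. *)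
Lemma dmx_cont i j : continuous (fun A => dmx W A i j).
Proof.
move=> A; apply/(@cvgrPdist_lt _ _ _ _ (nbhs_filter A)) => eps eps0.
have e4 : 0 < eps / 4 by lra.
pose g (c : R) (k : nat) (A : 'M[R]_d.+1) : R := k.+1%:R * (W (A + (c * k.+1%:R^-1) *: delta_mx i j) - W A).
have cg c : g c k A @[k --> \oo] --> c * dmx W A i j.
  have := is_derive_seq (deriv_line A (c *: delta_mx i j)).
  have -> : \sum_k \sum_l dmx W A k l * (c *: delta_mx i j) k l = c * dmx W A i j.
    rewrite (bigD1 i)//= (bigD1 j)//= !big1 => [|k ki|l lj].
    - by rewrite !mxE !eqxx/=; ring.
    - by apply: big1 => l _; rewrite !mxE (negPf ki)/=; ring.
    - by rewrite !mxE (negPf lj) andbF/=; ring.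
  have -> // : (fun k => k.+1%:R * (W (A + k.+1%:R^-1 *: (c *: delta_mx i j)) - W (A + 0 *: (c *: delta_mx i j)))) = g c ^~ A.
  by apply/funext => k; rewrite /g scale0r addr0 scalerA [_ * c]mulrC.
have cgA c k : g c k @ A --> g c k A.
  apply: (@cvgM _ _ _ (nbhs_filter A)); first exact: cvg_cst.
  apply: (@cvgB _ _ _ _ (nbhs_filter A)); last exact: energy_cont.
  apply: (@cvg_comp _ _ _ (fun A => A + (c * k.+1%:R^-1) *: delta_mx i j) W _ _ _ _ (@energy_cont _)).
  by apply: cvgD; [exact: cvg_id|exact: cvg_cst].
have /cvgrPdist_lt/(_ _ e4) n1 := cg 1.
have /cvgrPdist_lt/(_ _ e4) n2 := cg (-1).
have [k [k1 k2]] : exists k, `|1 * dmx W A i j - g 1 k A| < eps / 4 /\ `|-1 * dmx W A i j - g (-1) k A| < eps / 4.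
  by have [k _ hk] := @filterI _ \oo _ _ _ n1 n2; exists k; exact: (hk k (leqnn _)).
have /cvgrPdist_lt/(_ _ e4) m1 := cgA 1 k.
have /cvgrPdist_lt/(_ _ e4) m2 := cgA (-1) k.
near=> B.
have b1 : `|g 1 k A - g 1 k B| < eps / 4 by near: B.
have b2 : `|g (-1) k A - g (-1) k B| < eps / 4 by near: B.
have h0 : 0 < k.+1%:R^-1 :> R by rewrite invr_gt0 ltr0n.
have := dmx_bounds B i j h0; rewrite invrK -scaleNr.
have := b1; have := b2; rewrite /g mul1r mulN1r !mulNr => {}b1 {}b2 /andP[].
move: b1 b2 k1 k2; rewrite /g !mul1r !mulN1r.
move: (dmx W A i j) (dmx W B i j) => x y.
move: (k.+1%:R * (W (A + k.+1%:R^-1 *: _) - _)) (k.+1%:R * (W (A + - k.+1%:R^-1 *: _) - _)) => g1 g2.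
move: (k.+1%:R * (W (B + k.+1%:R^-1 *: _) - _)) (k.+1%:R * (W (B + - k.+1%:R^-1 *: _) - _)) => g3 g4.
rewrite !ltr_norml => /andP[a1 a2] /andP[a3 a4] /andP[a5 a6] /andP[a7 a8] a9 a10.
by apply/andP; split; lra.
Unshelve. all: by end_near. Qed.

End Convex.

(** * Piecewise polynomial fields on a fixed mesh *)

Section MeshFields.
Context {R : realType}.
Local Notation V n := ('rV[R]_n).
Local Notation Z n := (R * 'rV[R]_n)%type.
Variables (d' m : nat).
Local Notation d := d'.+1.
Local Notation K := (@simplex R d).
Variables (T : mesh_top d m) (a : 'I_(npt T) -> V d) (ma : is_mesh a).
Local Notation I := 'I_(nelt T).

(** No degree is recorded, only that reference components satisfy [isP]; this is all that
    differentiation and integration ask for. *)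
Definition on_mesh (f : V d -> V d) (q : I -> V d -> V d) :=
  (forall j i, isP (fun z : Z d => q j z.2 0 i)) /\ forall j x, K x -> f (elmap a j x) = q j x.

Lemma pw_polyv_on k f : pw_polyv a k f -> exists q, on_mesh f q.
Proof.
move=> pf; have /choice[q hq] : forall ij : 'I_d * I, exists q : V d -> R, isP (fun z : Z d => q z.2) /\
    forall x, K x -> f (elmap a ij.2 x) 0 ij.1 = q x.
  by move=> [i j]; have [q /isP_polyfun Pq qE] := pf i j; exists q.
exists (fun j x => \row_i q (i, j) x); split => [j i|j x Kx].
  by have [P _] := hq (i, j); apply: isP_ext P => z; rewrite mxE.
by apply/rowP => i; rewrite mxE; have [_ <-] := hq (i, j).
Qed.

Lemma on_mesh_comb f q f' q' c : on_mesh f q -> on_mesh f' q' ->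
  on_mesh (fun x => f x + c *: f' x) (fun j x => q j x + c *: q' j x).
Proof.
move=> [Pq qE] [Pq' qE']; split => [j i|j x Kx]; last by rewrite qE// qE'.
apply: isP_ext (isP_add (Pq j i) (isP_mul (isP_cst d c) (Pq' j i))) => z.
by rewrite !mxE.
Qed.

Definition pgrad j (q : V d -> V d) (x : V d) : 'M[R]_d :=
  \matrix_(i, k) pdx a j (fun x => q x 0 i) k x.

Lemma grad_on f q j x : on_mesh f q -> Ko x -> grad f (elmap a j x) = pgrad j (q j) x.
Proof.
move=> [Pq qE] Kx; apply/matrixP => i k; rewrite !mxE.
by apply: (@partial_emap _ _ _ _ _ ma (fun y => f y 0 i) (fun y => q j y 0 i)) => // y Ky; rewrite qE//; exact: KoK.
Qed.

Lemma pgrad_comb (q q' : V d -> V d) c j x : (forall i, isP (fun z : Z d => q z.2 0 i)) ->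
  (forall i, isP (fun z : Z d => q' z.2 0 i)) ->
  pgrad j (fun x => q x + c *: q' x) x = pgrad j q x + c *: pgrad j q' x.
Proof.
move=> Pq Pq'; apply/matrixP => i k; rewrite !mxE /pdx mulr_sumr -big_split; apply: eq_bigr => l _ /=.
have -> : (fun z : Z d => (q z.2 + c *: q' z.2) 0 i) = (fun z : Z d => q z.2 0 i + c * q' z.2 0 i).
  by apply/funext => z; rewrite !mxE.
rewrite (dpartD l (Pq i) (isP_mul (isP_cst d c) (Pq' i))) (dpartZ l c (Pq' i)).
by rewrite mulrDr mulrCA.
Qed.

Lemma pgrad_cont (q : V d -> V d) j x i k : (forall i, isP (fun z : Z d => q z.2 0 i)) -> K x ->
  {for x, continuous (fun x => pgrad j q x i k)}.
Proof.
move=> Pq Kx; have c := @pdx_cont _ _ _ _ _ ma j (fun x => q x 0 i) k x (Pq i) Kx.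
have -> : (fun x => pgrad j q x i k) = pdx a j (fun x => q x 0 i) k by apply/funext => y; rewrite mxE.
exact: c.
Qed.

Lemma cvg_mxE (U : Type) (F : set_system U) (FF : Filter F) (X : U -> 'M[R]_d) (x : 'M[R]_d) :
  (forall i j, X t i j @[t --> F] --> x i j) -> X t @[t --> F] --> x.
Proof.
move=> h; apply/cvg_mx_entourageP => A entA.
have : \forall t \near F, forall i j, A (x i j, X t i j).
  by apply: filter_forall => i; apply: filter_forall => j; have /cvg_entourageP := h i j; apply.
by apply: filterS => t ht i j; rewrite inE.
Qed.

Lemma fun_pgrad_cont (k : 'M[R]_d -> R) (q : V d -> V d) j x : continuous k -> (forall i, isP (fun z : Z d => q z.2 0 i)) -> K x ->
  {for x, continuous (fun x => k (pgrad j q x))}.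
Proof.
move=> ck Pq Kx; apply: (@cvg_comp _ _ _ (fun x => pgrad j q x) k _ _ _ _ (ck _)).
by apply: (cvg_mxE (nbhs_filter x)) => i l; exact: pgrad_cont.
Qed.

Lemma on_cont f q j i x : on_mesh f q -> {for x, continuous (fun x => q j x 0 i)}.
Proof. by move=> [Pq _]; exact: (@isP_cst_time _ _ _ (Pq j i) 0 x). Qed.

Lemma ip_on f q g r : on_mesh f q -> on_mesh g r ->
  exists I, hasint (domain a) (fun x => \sum_(i < 1) \sum_j f x i j * g x i j) I.
Proof.
move=> hf hg; apply: (domain_int ma (k := fun j x => \sum_i q j x 0 i * r j x 0 i)) => [j x Kx|j x Kx].
  apply: (cvg_sumR (nbhs_filter x)) => i.
  exact: (@cvgM _ _ _ (nbhs_filter x) _ _ _ _ (on_cont (j := j) (i := i) hf) (on_cont hg)).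
by have [_ h] := hf; have [_ h'] := hg; rewrite big_ord1 h ?h'//; exact: KoK.
Qed.

Lemma ip_grad (k : 'I_d -> 'I_d -> V d -> R) (kk : I -> 'I_d -> 'I_d -> V d -> R) g r :
  (forall j i l x, K x -> {for x, continuous (kk j i l)}) ->
  (forall j i l x, Ko x -> k i l (elmap a j x) = kk j i l x) -> on_mesh g r ->
  exists I, hasint (domain a) (fun x => \sum_i \sum_j k i j x * grad g x i j) I.
Proof.
move=> ck kE hg; apply: (domain_int ma (k := fun j x => \sum_i \sum_l kk j i l x * pgrad j (r j) x i l)) => [j x Kx|j x Kx].
  apply: (cvg_sumR (nbhs_filter x)) => i; apply: (cvg_sumR (nbhs_filter x)) => l.
  exact: (@cvgM _ _ _ (nbhs_filter x) _ _ _ _ (ck j i l x Kx) (@pgrad_cont (r j) j x i l (hg.1 j) Kx)).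
by rewrite (grad_on j hg Kx); apply: eq_bigr => i _; apply: eq_bigr => l _; rewrite kE.
Qed.

End MeshFields.

(** * The solid energy and one time step *)

Section SolidStep.
Context {R : realType}.
Local Notation V n := ('rV[R]_n).
Local Notation Z n := (R * 'rV[R]_n)%type.
Variables (d' m : nat).
Local Notation d := d'.+1.
Local Notation K := (@simplex R d).
Variables (D : fsi_data R d m) (ms : is_mesh (@spt _ _ _ D)) (dt0 : 0 < dt D) (rho0 : 0 < rho_s D).
Hypothesis hWdiff : forall F, differentiable (energy D) F.
Hypothesis hWconvex : convex_function (E := 'M[R]_d) setT (energy D).

Lemma energy_int f q : on_mesh (@spt _ _ _ D) f q ->
  exists I, hasint (Omega_s D) (fun x => energy D (grad f x)) I.
Proof.
move=> hf; apply: (domain_int ms (k := fun j x => energy D (pgrad (@spt _ _ _ D) j (q j) x))) => [j x Kx|j x Kx].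
  exact: (@fun_pgrad_cont _ _ _ _ _ ms (energy D) (q j) j x (energy_cont hWdiff) (hf.1 j) Kx).
by rewrite (grad_on ms j hf Kx).
Qed.

(** The new predicted position is the old one plus dt v'. Hence the stress tested with v' is the
    tangent term of W at the new gradient, read at the old one, and convexity bounds the increment
    of the elastic energy. The kinetic part uses 2 a b <= a^2 + b^2. *)
Lemma solid_energy_le f v f' v' p q q' : on_mesh (@spt _ _ _ D) f p -> on_mesh (@spt _ _ _ D) v q ->
  on_mesh (@spt _ _ _ D) v' q' -> on_mesh (@spt _ _ _ D) f' (fun j x => p j x + dt D *: q' j x) ->
  (dt D)^-1 * (solid_energy D v' f' - solid_energy D v f) <=
  ip (Omega_s D) (fun x => rho_s D *: ((dt D)^-1 *: (v' x - v x))) v'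
  + ip (Omega_s D) (stress_s D f') (grad v').
Proof.
move=> hf hv hv' hf'.
have dtn : dt D != 0 by rewrite gt_eqF.
have [I1 h1] := ip_on ms hv' hv'; have [I2 h2] := ip_on ms hv hv; have [I3 h3] := ip_on ms hv hv'.
have [E1 e1] := energy_int hf'; have [E2 e2] := energy_int hf.
have [S s] : exists I, hasint (domain (@spt _ _ _ D)) (fun x => \sum_i \sum_j stress_s D f' x i j * grad v' x i j) I.
  apply: (ip_grad ms (kk := fun j i l x => dmx (energy D) (pgrad (@spt _ _ _ D) j (fun x => p j x + dt D *: q' j x) x) i l)) hv'.
    by move=> j i l x Kx; exact: (@fun_pgrad_cont _ _ _ _ _ ms (fun A => dmx (energy D) A i l) (fun x => p j x + dt D *: q' j x) j x (@dmx_cont _ _ _ hWdiff hWconvex i l) (hf'.1 j) Kx).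
  by move=> j i l x Kx; rewrite /stress_s (grad_on ms j hf' Kx).
have [N [mN N0 hN]] := domain_null (@spt _ _ _ D).
have L1 : E1 <= E2 + dt D * S.
  apply: (hasint_le mN N0 _ e1 (hasintD e2 (hasintZ (dt D) s))) => y Dy Ny.
  have [j [x [Kx ->]]] := hN y Dy Ny.
  rewrite /stress_s (grad_on ms j hf' Kx) (grad_on ms j hf Kx) (grad_on ms j hv' Kx).
  rewrite (pgrad_comb _ (dt D) j x (hf.1 j) (hv'.1 j)).
  set A := pgrad _ _ (p j) x; set B := pgrad _ _ (q' j) x.
  have := convex_tangent hWdiff hWconvex (A + dt D *: B) A.
  have -> : \sum_i \sum_j0 dmx (energy D) (A + dt D *: B) i j0 * (A - (A + dt D *: B)) i j0 =
     - (dt D * \sum_i \sum_j0 dmx (energy D) (A + dt D *: B) i j0 * B i j0).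
    rewrite mulr_sumr -sumrN; apply: eq_bigr => i _; rewrite mulr_sumr -sumrN; apply: eq_bigr => l _.
    move: (dmx _ (A + dt D *: B)) => w; rewrite !mxE; ring.
  lra.
have h4 : hasint (Omega_s D) (fun x => \sum_(i < 1) \sum_j (rho_s D *: ((dt D)^-1 *: (v' x - v x))) i j * v' x i j)
    (rho_s D * (dt D)^-1 * I1 + - (rho_s D * (dt D)^-1) * I3).
  apply: hasint_ext (hasintD (hasintZ (rho_s D * (dt D)^-1) h1) (hasintZ (- (rho_s D * (dt D)^-1)) h3)) => x _ /=.
  rewrite !big_ord1 !mulr_sumr -big_split /=; apply: eq_bigr => i _; rewrite !mxE; ring.
have L2 : 2 * I3 <= I1 + I2.
  have h0 : mset (set0 : set (V d)) by rewrite /mset preimage_set0.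
  have v0 : vol (set0 : set (V d)) = 0%E by rewrite /vol preimage_set0 measure0.
  apply: (hasint_le h0 v0 _ (hasintZ 2 h3) (hasintD h1 h2)) => x _ _.
  rewrite !big_ord1 mulr_sumr -big_split; apply: ler_sum => i _ /=.
  by move: (v x 0 i) (v' x 0 i) => a b; have := sqr_ge0 (a - b); nra.
rewrite /solid_energy /ip (hasint_vint h1) (hasint_vint h2) (hasint_vint e1) (hasint_vint e2) (hasint_vint h4) (hasint_vint s).
have c0 : 0 < (dt D)^-1 by rewrite invr_gt0.
have cd : (dt D)^-1 * dt D = 1 by rewrite mulVf.
have L1' : (dt D)^-1 * E1 <= (dt D)^-1 * E2 + S.
  by rewrite -[S]mul1r -cd -mulrA -mulrDr ler_wpM2l// ltW.
have L2' : rho_s D * (dt D)^-1 * (2 * I3) <= rho_s D * (dt D)^-1 * (I1 + I2).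
  by apply: ler_wpM2l L2; rewrite ltW// mulr_gt0.
move: L1' L2'; move: ((dt D)^-1) (rho_s D) => c rho; lra.
Qed.

End SolidStep.

(** * One time step of the scheme *)

Section Step.
Context {R : realType}.
Local Notation V n := ('rV[R]_n).
Local Notation Z n := (R * 'rV[R]_n)%type.
Variables (d' m : nat).
Local Notation d := d'.+1.
Local Notation K := (@simplex R d).
Variables (D : fsi_data R d m).

(** The viscous stress is symmetric and sees the symmetric part of the gradient only, whence the
    factor 1 / 2. *)
Lemma viscous_work (s : fsi_state D) k : is_mesh (fpt s) ->
  pw_polyv (fpt s) k (vel s) -> pw_poly (fpt s) m.-1 (prs s) ->
  ip (Omega_f s) (stress_f s) (grad (vel s)) =
  rho_f D * nu_f D / 2 * dissipation s - vint (Omega_f s) (fun x => div (vel s) x * prs s x).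
Proof.
move=> ms /pw_polyv_on[q hq] pp.
have /choice[p hp] : forall j, exists p : V d -> R, isP (fun z : Z d => p z.2) /\ forall x, K x -> prs s (elmap (fpt s) j x) = p x.
  by move=> j; have [p /isP_polyfun Pp pE] := pp j; exists p.
have cg j i l x : K x -> {for x, continuous (fun x => pgrad (fpt s) j (q j) x i l)}.
  exact: (@pgrad_cont _ _ _ _ _ ms (q j) j x i l (hq.1 j)).
have cs j i l x : K x -> {for x, continuous (fun x => pgrad (fpt s) j (q j) x i l + pgrad (fpt s) j (q j) x l i)}.
  by move=> Kx; exact: (@cvgD _ _ _ _ (nbhs_filter x) _ _ _ _ (cg j i l x Kx) (cg j l i x Kx)).
have [I1 h1] : exists I, hasint (Omega_f s) (fun x => \sum_i \sum_j symgrad (vel s) x i j * symgrad (vel s) x i j) I.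
  apply: (domain_int ms (k := fun j x => \sum_i \sum_l (pgrad (fpt s) j (q j) x i l + pgrad (fpt s) j (q j) x l i)
     * (pgrad (fpt s) j (q j) x i l + pgrad (fpt s) j (q j) x l i))) => [j x Kx|j x Kx].
    apply: (cvg_sumR (nbhs_filter x)) => i; apply: (cvg_sumR (nbhs_filter x)) => l.
    exact: (@cvgM _ _ _ (nbhs_filter x) _ _ _ _ (cs j i l x Kx) (cs j i l x Kx)).
  apply: eq_bigr => i _; apply: eq_bigr => l _.
  by rewrite /symgrad (grad_on ms j hq Kx) [in LHS]mxE [in X in _ + X]mxE.
have [I2 h2] : exists I, hasint (Omega_f s) (fun x => div (vel s) x * prs s x) I.
  apply: (domain_int ms (k := fun j x => (\sum_i pgrad (fpt s) j (q j) x i i) * p j x)) => [j x Kx|j x Kx].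
    have [Pp _] := hp j.
    have c1 : (fun x => \sum_i pgrad (fpt s) j (q j) x i i) @ x --> \sum_i pgrad (fpt s) j (q j) x i i.
      by apply: (cvg_sumR (nbhs_filter x)) => i; exact: cg.
    exact: (@cvgM _ _ _ (nbhs_filter x) _ _ _ _ c1 (@isP_cst_time _ _ _ Pp 0 x)).
  have [_ <-] := hp j; last exact: KoK.
  congr (_ * _); rewrite -(grad_on ms j hq Kx); apply: eq_bigr => i _.
  by rewrite mxE.
rewrite /dissipation /ip (hasint_vint h1) (hasint_vint h2).
apply: hasint_vint; rewrite -[X in _ - X]mul1r -mulNr.
apply: hasint_ext (hasintD (hasintZ (rho_f D * nu_f D / 2) h1) (hasintZ (-1) h2)) => x _ /=.
have -> : div (vel s) x = \sum_i (grad (vel s) x) i i by apply: eq_bigr => i _; rewrite mxE.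
rewrite /stress_f /symgrad; move: (grad (vel s) x) (prs s x) (rho_f D * nu_f D) => G r c.
have E1 : \sum_i \sum_j (c *: (G + G^T) - r%:M) i j * G i j =
   c * \sum_i \sum_j (G i j + G j i) * G i j - (\sum_i G i i) * r.
  rewrite mulr_sumr mulr_suml -sumrB; apply: eq_bigr => i _.
  rewrite mulr_sumr (bigD1 i)//= [in RHS](bigD1 i)//= addrAC; congr (_ + _).
    by rewrite !mxE eqxx mulr1n; ring.
  by apply: eq_bigr => j ji; rewrite !mxE [i == j]eq_sym (negPf ji) mulr0n; ring.
rewrite E1.
have E2 : \sum_i \sum_j (G + G^T) i j * (G + G^T) i j = 2 * \sum_i \sum_j (G i j + G j i) * G i j.
  have e : \sum_i \sum_j (G i j + G j i) * G i j = \sum_i \sum_j (G i j + G j i) * G j i.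
    by rewrite exchange_big; apply: eq_bigr => i _; apply: eq_bigr => j _; rewrite [G j i + _]addrC.
  rewrite [2]/(1 + 1) mulrDl mul1r {2}e -big_split; apply: eq_bigr => i _ /=.
  by rewrite -big_split; apply: eq_bigr => j _ /=; rewrite !mxE; ring.
rewrite E2; by move: (\sum_i _) (\sum_i _) => A B; field.
Qed.

(** Invariant of a run. [fsi_step] does not state that the new position is piecewise polynomial;
    this is inherited from the previous state. *)
Definition state_ok (s : fsi_state D) :=
  [/\ fluid_mesh_ok s, pw_polyv (@spt _ _ _ D) m (spos s), fluid_velocity s (vel s),
      solid_field D (svel s) & coupled s (vel s) (svel s)].

Lemma initial_state_ok s : initial_ok s -> state_ok s.
Proof. by move=> [a [_ b] c e f]; split. Qed.

Lemma pw_polyv_comb (T : mesh_top d m) (a : 'I_(npt T) -> V d) k f g c : pw_polyv a k f -> pw_polyv a k g ->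
  pw_polyv a k (fun x => f x + c *: g x).
Proof.
move=> hf hg i j; have [p [cp cpE] pE] := hf i j; have [q [cq cqE] qE] := hg i j.
exists (fun x => p x + c * q x); last by move=> x Kx; rewrite !mxE pE// qE.
exists (fun b => cp b + c * cq b) => x; rewrite cpE cqE mulr_sumr -big_split; apply: eq_bigr => b _ /=.
by rewrite mulrDl mulrA.
Qed.

Lemma step_state_ok n s s' : state_ok s -> fsi_step n s s' -> state_ok s'.
Proof.
move=> [ms hp hu hv hc] [he [ms' _] [hu' _ hv' hc'] _ _]; split => //.
have h := pw_polyv_comb (dt D) hp hv.2.
move=> i j; have [q Pq qE] := h i j; exists q => // x Kx; rewrite -qE// he//.
by exists j => //; exists x.
Qed.

Section OneStep.
Variables (dt0 : 0 < dt D) (m0 : (0 < m)%N) (rho_f0 : 0 < rho_f D) (rho_s0 : 0 < rho_s D) (hD : data_ok D).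
Hypothesis hd : d = 2%N \/ d = 3%N.
Hypothesis hWdiff : forall F, differentiable (energy D) F.
Hypothesis hWconvex : convex_function (E := 'M[R]_d) setT (energy D).
Hypothesis hu_b : forall t x, Sigma1 D x -> u_b D t x = 0.
Hypothesis hSigma2 : Sigma2 D = set0.
Hypothesis hphi_b : forall t x, Sigma3 D x -> derive1 (fun r => phi_b D r x) t = 0.
Variables (n : nat) (n0 : (0 < n)%N) (s s' : fsi_state D).
Hypotheses (ok : state_ok s) (st : fsi_step n s s').

Let msp : is_mesh (@spt _ _ _ D). Proof. by case: hD. Qed.

(** Interface grid points are displaced by dt v^(n-1), and at these points v^(n-1) agrees with
    u^(n-1): mesh and fluid velocities coincide there. *)
Lemma nodal_v0 i : i \in face_nodes (f_fs D) -> nodal_v s s' i = 0.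
Proof.
have [_ _ _ _ [_ fsE]] := hD; rewrite -fsE => /imsetP[k gk ->].
have [[_ _ _ _ e1] _ _ _ c1] := ok; have [he [[_ _ _ _ e2] _] _ _ _] := st.
have Ok : Omega_s D (spt k).
  have [_ _ _ /(_ k)[j [b kb]]] := msp.
  exists j => //; exists (nodept R b); first exact: nodept_simplex.
  by rewrite -kb; exact: (interp_nodept m0).
rewrite /nodal_v e1// e2// he// c1// addrAC subrr add0r scalerA mulVf ?scale1r ?subrr//.
by rewrite gt_eqF.
Qed.

Lemma f_2_empty : faces_set (fpt s') (f_2 D) = set0 /\ f_2 D = finset.set0.
Proof.
have [_ [[_ _ _ e _] _] _ _ _] := st; rewrite hSigma2 in e; split => //.
apply/eqP; rewrite -finset.subset0; apply/fintype.subsetP => f fF; exfalso.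
(* A vertex other than the one opposite to the face, hence a point of the face: a face in [f_2]
   would make its point set nonempty. *)
have [x hx] : exists x : V d, forall w : 'I_d.+1, bary x w = (w == lift f.2 ord0)%:R.
apply: bary_exists; rewrite (bigD1 (lift f.2 ord0))//= eqxx big1 ?addr0// => w wv.
  by rewrite (negPf wv).
have Fx : face f.2 x.
  split; first by move=> w; rewrite hx ler0n.
  by move=> w; rewrite !inE negbK => /eqP ->; rewrite hx (negPf (neq_lift _ _)).
have : faces_set (fpt s') (f_2 D) (elmap (fpt s') f.1 x) by exists f => //; exists x.
by rewrite e.
Qed.

Lemma step_energy :
  rho_f D / (2 * dt D) * (ip (Omega_f s') (vel s') (vel s') - ip (Omega_f s) (vel s) (vel s))
  + rho_f D * nu_f D / 2 * dissipation s'
  + (dt D)^-1 * (solid_energy D (svel s') (predicted s') - solid_energy D (svel s) (predicted s))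
  <= power n s'.
Proof.
have [[mf _ _ _ _] hp [cu hu] [cv hv] _] := ok.
have [he [[mf' hfr h1 h2 e'] mm] [[cu' hu'] [cp' hp'] [cv' hv'] cc'] [b1 b3] sch] := st.
have [h20 f20] := f_2_empty.
have u0 x : Sigma1 D x -> vel s' x = 0 by move=> hx; rewrite b1// hu_b.
have v0 x : Sigma3 D x -> svel s' x = 0 by move=> hx; rewrite b3// hphi_b.
have inV q : fluid_pressure s' q -> in_V s' (vel s') q (svel s') by move=> hq; split.
have P0 : fluid_pressure s' (fun=> 0).
  split; first by move=> x; exact: cvg_cst.
  move=> j; exists (fun=> 0) => //; exists (fun=> 0) => x; rewrite big1// => c _; exact: mul0r.
(* Comparing with q = 0 shows that the integral of [div u * p] is zero; the same integral is the
   pressure part of [viscous_work]. *)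
have S1 := sch _ _ _ (inV _ (conj cp' hp')) u0 v0.
have S2 := sch _ _ _ (inV _ P0) u0 v0.
have z0 : vint (Omega_f s') (fun x => div (vel s') x * 0) = 0.
  by apply: hasint_vint; apply: hasint_ext (hasint0 (mset_domain (fpt s'))) => x _; rewrite mulr0.
have [q [Pq qE]] := pw_polyv_on hu'; have [q0 [Pq0 q0E]] := pw_polyv_on hu.
have h1u x : faces_set (fpt s') (f_1 D) x -> vel s' x = 0 by rewrite h1; exact: u0.
have F := @fluid_energy _ _ _ D dt0 n n0 s s' mf mf' mm q q0 Pq Pq0 qE q0E hd hfr h1u h20 nodal_v0.
have VW := viscous_work mf' hu' hp'.
have [r [Pr rE]] := pw_polyv_on hv'; have hr : on_mesh (@spt _ _ _ D) (svel s') r by [].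
have [r0 hr0] := pw_polyv_on hv; have [w0 hw0] := pw_polyv_on hp.
have hp0 := on_mesh_comb (dt D) hw0 hr0.
have hp1 : on_mesh (@spt _ _ _ D) (predicted s') (fun j x => w0 j x + dt D *: r0 j x + dt D *: r j x).
  have [Pa _] := on_mesh_comb (dt D) hp0 hr; split => // j x Kx.
  rewrite /predicted he; last by exists j => //; exists x.
  by rewrite hr0.2// hw0.2// rE.
have SE := solid_energy_le msp dt0 rho_s0 hWdiff hWconvex hp0 hr0 hr hp1.
have {}SE : (dt D)^-1 * (solid_energy D (svel s') (predicted s') - solid_energy D (svel s) (predicted s)) <= _ := SE.
have surf0 : surf_ip (fpt s') (f_2 D) (sigma_fb D (tk D n)) (vel s') = 0 by rewrite /surf_ip f20 big_set0.
move: S1 S2; rewrite /scheme_eq z0 surf0 /power VW.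
move: F SE; set A1 := ip _ (vel s') (vel s'); set A0 := ip _ (vel s) (vel s); set C := ip _ (vel s) _.
move: A1 A0 C (convection _ _ _ _) (convection_correction _ _ _ _) => A1 A0 C cv1 cv2.
move: (solid_energy _ _ _) (solid_energy _ _ _) (dissipation _) => E1 E0 dis.
move: (vint _ _) (ip _ _ _) (ip _ _ _) (ip _ _ _) (ip _ _ _) (surf_ip _ _ _ _) => dv Y1 Y2 g1 g2 g3 F SE S1 S2.
have {}F : rho_f D * ((2 * dt D)^-1 * (A1 - A0)) <= rho_f D * ((dt D)^-1 * (A1 - C) + cv1 - cv2).
  by apply: ler_wpM2l F; exact: ltW.
move: F SE S1 S2; move: ((2 * dt D)^-1) ((dt D)^-1) (rho_f D) (nu_f D) => b c rho nu.
nra.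
Qed.

End OneStep.

End Step.

(** * Pointwise bounds by the L^2 norm *)

Section Gram.
Context {R : realType}.
Variables (N : nat) (G : 'M[R]_N).
Hypothesis symG : G^T = G.
Hypothesis psdG : forall c : 'rV[R]_N, 0 <= (c *m G *m c^T) 0 0.

(** Positivity at both r w + c and - r w + c gives the absolute value. *)
Lemma gram_young (c w : 'rV[R]_N) (r : R) : 0 < r ->
  2 * r * `|(w *m G *m c^T) 0 0| <= r ^+ 2 * (w *m G *m w^T) 0 0 + (c *m G *m c^T) 0 0.
Proof.
move=> r0.
have E (e : R) : ((e *: w + c) *m G *m (e *: w + c)^T) 0 0 = e ^+ 2 * (w *m G *m w^T) 0 0 + 2 * e * (w *m G *m c^T) 0 0 + (c *m G *m c^T) 0 0.
  have s : (c *m G *m w^T) 0 0 = (w *m G *m c^T) 0 0.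
    rewrite -[in LHS](trmxK (c *m G *m w^T)) mxE; congr (_ 0 0).
    by rewrite !trmx_mul trmxK symG mulmxA.
  rewrite linearD linearZ /= !mulmxDl !mulmxDr -!scalemxAr -!scalemxAl.
  move: s; move: (w *m G *m w^T) (w *m G *m c^T) (c *m G *m w^T) (c *m G *m c^T) => P Q Q' T s.
  rewrite !mxE s; ring.
have h1 := psdG (r *: w + c); have h2 := psdG (- r *: w + c); rewrite !E in h1 h2.
move: h1 h2; case: (ger0P ((w *m G *m c^T) 0 0)) => _; move: ((w *m G *m c^T) 0 0) => x; lra.
Qed.

(* A functional that vanishes on the kernel of the Gram matrix is represented by
   it; Cauchy-Schwarz gives the bound, uniformly since the representative depends
   linearly on the functional. *)
Lemma gram_bound (X : Type) (S : set X) (l : X -> 'rV[R]_N) (C : R) :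
  (forall x i, S x -> `|l x 0 i| <= C) ->
  (forall x (c : 'rV[R]_N), S x -> (c *m G *m c^T) 0 0 = 0 -> (l x *m c^T) 0 0 = 0) ->
  exists2 k, 0 < k & forall x (c : 'rV[R]_N), S x -> (l x *m c^T) 0 0 ^+ 2 <= k * (c *m G *m c^T) 0 0.
Proof.
move=> lC l0.
have sub x : S x -> (l x <= G)%MS.
  move=> Sx; rewrite submxE; apply/eqP/rowP => j; rewrite [RHS]mxE.
  pose c := (col j (cokermx G))^T.
  have Gc : G *m c^T = 0 by rewrite trmxK colE mulmxA mulmx_coker mul0mx.
  have e : (l x *m c^T) 0 0 = 0 by apply: l0 => //; rewrite -mulmxA Gc mulmx0 mxE.
  by move: e; rewrite trmxK colE mulmxA -colE mxE.
pose w x := l x *m pinvmx G.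
have wG x : S x -> w x *m G = l x by move=> Sx; rewrite /w mulmxKpV// sub.
have kb : exists k, forall x, S x -> (w x *m G *m (w x)^T) 0 0 <= k.
  exists (\sum_i C * \sum_j (C * `|pinvmx G j i|)) => x Sx; rewrite wG// mxE.
  apply: ler_sum => i _; apply: (le_trans (ler_norm _)); rewrite normrM; apply: ler_pM => //; first exact: lC.
  rewrite mxE /w mxE; apply: (le_trans (ler_norm_sum _ _ _)); apply: ler_sum => k _.
  by rewrite normrM; apply: ler_pM => //; exact: lC.
have [k hk] := kb; exists (`|k| + 1); first by rewrite ltr_wpDl.
move=> x c Sx; set I := (c *m G *m c^T) 0 0; set A := (l x *m c^T) 0 0.
have I0 : 0 <= I by exact: psdG.
have K0 : 0 < `|k| + 1 by rewrite ltr_wpDl.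
have h (r : R) : 0 < r -> 2 * r * `|A| <= r ^+ 2 * (`|k| + 1) + I.
  move=> r0; have := gram_young c (w x) r0; rewrite wG//.
  have : (w x *m G *m (w x)^T) 0 0 <= `|k| + 1.
    by apply: (le_trans (hk x Sx)); apply: (le_trans (ler_norm _)); rewrite lerDl.
  rewrite wG// -/A -/I => h1 h2; apply: (le_trans h2); rewrite lerD2r.
  by apply: ler_wpM2l h1; exact: sqr_ge0.
have [->|A0] := eqVneq A 0; first by rewrite expr0n mulr_ge0// ltW.
have a0 : 0 < `|A| by rewrite normr_gt0.
(* The choice of r that makes Young's inequality sharp. *)
have := h (`|A| / (`|k| + 1)) (divr_gt0 a0 K0).
rewrite -[A ^+ 2]real_normK ?num_real//; move: (`|A|) (`|k| + 1) a0 K0 => a K a0 K0.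
have -> : 2 * (a / K) * a = 2 * (a ^+ 2 / K) by field; rewrite gt_eqF.
have -> : (a / K) ^+ 2 * K = a ^+ 2 / K by field; rewrite gt_eqF.
by move=> h1; rewrite mulrC -ler_pdivrMr//; lra.
Qed.
End Gram.

(** * Inverse estimates on one element *)

Section ElementBound.
Context {R : realType}.
Local Notation V n := ('rV[R]_n).
Local Notation Z n := (R * 'rV[R]_n)%type.
Variables (d' m : nat).
Local Notation d := d'.+1.
Local Notation K := (@simplex R d).
Variables (T : mesh_top d m) (a : 'I_(npt T) -> V d) (ma : is_mesh a).

Lemma Xo_emap j x : Ko x -> Xo (emap a j) (0, elmap a j x) = x.
Proof.
move=> Kx; have h := @XoE _ _ (emap a j) setT (fun t _ => @emap_injo _ _ _ _ a ma j t).
exact: (h 0 x I Kx).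
Qed.

Lemma elem_int j (k : V d -> R) : (forall x, K x -> {for x, continuous k}) ->
  exists I, hasint (Uo (emap a j) 0) (fun y => k (Xo (emap a j) (0, y))) I.
Proof.
move=> ck; have [C _ hC] := compact_bound (@compact_simplex R d) ck.
have XE := @Xo_emap j.
apply: (@hasint_bounded _ _ _ _ C set0).
- by apply: mset_open; exact: Uo_emap_open.
- exact: vol_Uo.
- by rewrite /mset preimage_set0.
- by rewrite /vol preimage_set0 measure0.
- by rewrite setD0; apply: (emap_mfun ma ck) => x Kx; rewrite XE.
- by move=> _ [x Kx <-] _; apply: hC; apply: KoK; rewrite [emap a j _]/emap XE.
Qed.

(** If k x were nonzero, k would be nonzero on a cube of positive volume around the image of x,
    whereas a zero integral of the square allows this on a null set only. *)
Lemma elem_pos j (k : V d -> R) x : (forall x, K x -> {for x, continuous k}) ->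
  hasint (Uo (emap a j) 0) (fun y => k (Xo (emap a j) (0, y)) ^+ 2) 0 -> Ko x -> k x = 0.
Proof.
move=> ck h0 Kx; apply: contrapT => /eqP kx.
set U := Uo (emap a j) 0; set h := fun y => k (Xo (emap a j) (0, y)).
have XE := @Xo_emap j.
have mh : mfun U h by apply: (emap_mfun ma ck) => z Kz; rewrite /h XE.
have mU : mset U by apply: mset_open; exact: Uo_emap_open.
have Uy : U (elmap a j x) by exists x.
have ch : h @ (elmap a j x) --> h (elmap a j x).
  apply: (@cvg_comp _ _ _ (fun y => Xo (emap a j) (0, y)) k _ _ _ (Xo_emap_cont ma Uy)).
  by apply: ck; rewrite XE//; exact: KoK.
have hx : h (elmap a j x) != 0 by rewrite /h XE.
have n1 : \forall y \near elmap a j x, h y != 0 by exact: (@cvgr_neq0 _ _ _ _ (nbhs_filter _) _ _ ch hx).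
have n2 : \forall y \near elmap a j x, U y by apply: open_nbhs_nbhs; split => //; exact: Uo_emap_open.
have [r r0 hr] : exists2 r, 0 < r & cbox (elmap a j x) r `<=` [set y | U y /\ h y != 0].
  have : nbhs (elmap a j x) [set y | U y /\ h y != 0] by exact: filterI n2 n1.
  move=> /nbhs_ballP[e e0 he]; exists (e / 2); first by rewrite divr_gt0.
  move=> y /(cboxP _ _ (ltW (divr_gt0 e0 (ltr0Sn _ 1)))) ye; apply: he.
  rewrite -ball_normE /ball_ /= distrC; apply: (le_lt_trans ye).
  by rewrite ltr_pdivrMr// ltr_pMr// ltr1n.
have E := hasint_EFin h0.
have mh2 : measurable_fun (@row_of R d @^-1` U) (fun t => (h (row_of t) ^+ 2)%:E).
  by apply/measurable_EFinP; exact: measurable_funX.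
have := (ae_eq_integral_abs (leb d) mU mh2).1; move=> /(_ _)[].
  rewrite -[RHS]E; apply: eq_integral => t _ /=.
  by rewrite ger0_norm// sqr_ge0.
move=> A [mA A0 hA].
have : (vol (cbox (elmap a j x) r) <= leb d A)%E.
  apply: le_measure; rewrite ?inE//; first exact: mset_cbox.
  move=> t /= ct; apply: hA => /=; have [Ut /eqP ht] := hr _ ct.
  by move=> /(_ Ut) /= [/eqP]; rewrite sqrf_eq0 => /eqP.
rewrite A0 vol_cbox ?(ltW r0)// lee_fin leNgt exprn_gt0//.
by rewrite mulrn_wgt0.
Qed.

Lemma polyfun_basis k : exists (N : nat) (e : 'I_N -> V d -> R), (forall i, isP (fun z : Z d => e i z.2)) /\
  forall q : V d -> R, polyfun k q -> exists c : 'rV[R]_N, forall x, q x = \sum_i c 0 i * e i x.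
Proof.
pose A := {ffun 'I_d -> 'I_k.+1}.
(* All exponent vectors serve as indices; monomials of too large degree are replaced by 0. *)
exists #|{: A}|, (fun i x => (\sum_l (enum_val i : A) l <= k)%N%:R * \prod_l x 0 l ^+ (enum_val i : A) l); split.
  move=> i; apply: isP_mul; first exact: isP_cst.
  by apply: isP_prod => l _; apply: isP_exp; exact: isP_coord.
move=> q [c qE]; exists (\row_i c (enum_val i)) => x; rewrite qE big_mkcond /=.
rewrite (reindex (enum_val : 'I_#|{: A}| -> A)) /=; last by apply: onW_bij; exact: enum_val_bij.
by apply: eq_bigr => i _; rewrite mxE; case: ifP => _; rewrite ?mul1r ?mul0r ?mulr0.
Qed.

(** [gram_bound] for the Gram matrix of the monomials and two families of functionals: values and
    physical derivatives at the points of the open simplex. A polynomial of zero norm vanishes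
    there, hence so do its derivatives. Values on the closed simplex follow by continuity. *)
Lemma elem_bound j k : exists2 C, 0 < C & forall (q : V d -> R) J, polyfun k q ->
  hasint (Uo (emap a j) 0) (fun y => q (Xo (emap a j) (0, y)) ^+ 2) J ->
  (forall x, K x -> q x ^+ 2 <= C * J) /\ forall i x, Ko x -> pdx a j q i x ^+ 2 <= C * J.
Proof.
have [N [e [Pe eP]]] := polyfun_basis k.
have ce i x : {for x, continuous (e i)} by exact: (@isP_cst_time _ _ _ (Pe i) 0 x).
have /choice[g hg] : forall il : 'I_N * 'I_N, exists I, hasint (Uo (emap a j) 0)
    (fun y => e il.1 (Xo (emap a j) (0, y)) * e il.2 (Xo (emap a j) (0, y))) I.
  move=> [i l]; apply: (@elem_int j (fun x => e i x * e l x)) => x _.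
  exact: (@cvgM _ _ _ (nbhs_filter x) _ _ _ _ (ce i x) (ce l x)).
pose G : 'M[R]_N := \matrix_(i, l) g (i, l).
pose qc (c : 'rV[R]_N) x := \sum_i c 0 i * e i x.
have mU : mset (Uo (emap a j) 0) by apply: mset_open; exact: Uo_emap_open.
have GE c : hasint (Uo (emap a j) 0) (fun y => qc c (Xo (emap a j) (0, y)) ^+ 2) ((c *m G *m c^T) 0 0).
  have -> : (c *m G *m c^T) 0 0 = \sum_i \sum_l c 0 i * c 0 l * g (i, l).
    rewrite mxE exchange_big; apply: eq_bigr => l _; rewrite mxE mulr_suml; apply: eq_bigr => i _.
    by rewrite !mxE; ring.
  apply: (@hasint_ext _ _ _ (fun y => \sum_i \sum_l c 0 i * c 0 l * (e i (Xo (emap a j) (0, y)) * e l (Xo (emap a j) (0, y))))).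
    move=> y _; rewrite expr2 /qc mulr_suml; apply: eq_bigr => i _; rewrite mulr_sumr; apply: eq_bigr => l _.
    by move: (e _ _) (e _ _) => A B; ring.
  by apply: hasint_sum => // i _; apply: hasint_sum => // l _; apply: hasintZ; exact: (hg (i, l)).
have symG : G^T = G.
  apply/matrixP => i l; rewrite !mxE; apply: (hasint_uniq (hg (l, i))).
  by apply: hasint_ext (hg (i, l)) => y _ /=; exact: mulrC.
have psdG (c : 'rV[R]_N) : 0 <= (c *m G *m c^T) 0 0.
  have v0 : vol (set0 : set (V d)) = 0%E by rewrite /vol preimage_set0 measure0.
  have m0 : mset (set0 : set (V d)) by rewrite /mset preimage_set0.
  by apply: (hasint_le m0 v0 _ (hasint0 mU) (GE c)) => y _ _; exact: sqr_ge0.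
have van (c : 'rV[R]_N) x : (c *m G *m c^T) 0 0 = 0 -> Ko x -> qc c x = 0.
  move=> c0; have h := GE c; rewrite c0 in h; apply: (elem_pos _ h) => z _.
  apply: (cvg_sumR (nbhs_filter z)) => i.
  exact: (@cvgM _ _ _ (nbhs_filter z) _ _ _ _ (@cvg_cst _ (c 0 i) _ (nbhs z) (nbhs_filter z)) (ce i z)).
have Pqc c : isP (fun z : Z d => qc c z.2).
  by apply: isP_sum => i _; apply: isP_mul; [exact: isP_cst|exact: Pe].
have pdxE c i x : pdx a j (qc c) i x = \sum_l c 0 l * pdx a j (e l) i x.
  have e1 k0 : dpart k0 (fun z : Z d => qc c z.2) (0, x) = \sum_l c 0 l * dpart k0 (fun z : Z d => e l z.2) (0, x).
    have h := @dpart_sum _ _ k0 _ (index_enum 'I_N) (fun l (z : Z d) => c 0 l * e l z.2) (fun t => isP_mul (isP_cst d (c 0 t)) (Pe t)).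
    have := congr1 (fun F => F (0, x)) h; rewrite /= => h'; rewrite [LHS]h'.
    by apply: eq_bigr => l _; rewrite (dpartZ k0 (c 0 l) (Pe l)).
  rewrite /pdx [RHS](eq_bigr (fun l => \sum_k0 c 0 l * ((invmx (Jm (emap a j) (0, x))) i k0 * dpart k0 (fun z : Z d => e l z.2) (0, x)))) => [|l _]; last by rewrite mulr_sumr.
  rewrite exchange_big; apply: eq_bigr => k0 _ /=; rewrite e1 mulr_sumr; apply: eq_bigr => l _.
  exact: mulrCA.
have [B _ hB] : exists2 B, 0 <= B & forall x i, K x -> `|e i x| <= B.
  have /choice[b hb] : forall i, exists B, forall x, K x -> `|e i x| <= B.
    by move=> i; have [B _ h] := compact_bound (@compact_simplex R d) (fun x _ => ce i x); exists B.
  exists (\sum_i `|b i|) => [|x i Kx]; first exact: sumr_ge0.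
  by apply: (le_trans (hb i x Kx)); rewrite (bigD1 i)//= (le_trans (ler_norm _))// lerDl sumr_ge0.
have [B' _ hB'] : exists2 B, 0 <= B & forall x i l, K x -> `|pdx a j (e l) i x| <= B.
  have /choice[b hb] : forall il : 'I_d * 'I_N, exists B, forall x, K x -> `|pdx a j (e il.2) il.1 x| <= B.
    move=> [i l]; have [B' _ h] := compact_bound (@compact_simplex R d) (fun x Kx => @pdx_cont _ _ _ _ _ ma j (e l) i x (Pe l) Kx).
    by exists B'.
  exists (\sum_i `|b i|) => [|x i l Kx]; first exact: sumr_ge0.
  by apply: (le_trans (hb (i, l) x Kx)); rewrite (bigD1 (i, l))//= (le_trans (ler_norm _))// lerDl sumr_ge0.
have lc (l : 'I_N -> R) (c : 'rV[R]_N) : ((\row_i l i) *m c^T) 0 0 = \sum_i c 0 i * l i.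
  by rewrite mxE; apply: eq_bigr => i _; rewrite !mxE mulrC.
have b1 x i : Ko x -> `|(\row_i e i x : 'rV[R]_N) 0 i| <= B by move=> /KoK Kx; rewrite mxE hB.
have z1 x (c : 'rV[R]_N) : Ko x -> (c *m G *m c^T) 0 0 = 0 -> ((\row_i e i x) *m c^T) 0 0 = 0.
  by move=> Kx c0; rewrite lc; exact: van.
have [C1 C10 h1] := gram_bound symG psdG b1 z1.
have b2 (ix : 'I_d * V d) i : Ko ix.2 -> `|(\row_l pdx a j (e l) ix.1 ix.2 : 'rV[R]_N) 0 i| <= B'.
  by move=> /KoK Kx; rewrite mxE hB'.
have z2 (ix : 'I_d * V d) (c : 'rV[R]_N) : Ko ix.2 -> (c *m G *m c^T) 0 0 = 0 ->
    ((\row_l pdx a j (e l) ix.1 ix.2) *m c^T) 0 0 = 0.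
  move=> Kx c0; rewrite lc -pdxE.
  (* The zero function pulls back to [qc c], so that [partial_emap] identifies the derivative with
     that of a constant. *)
  have q0 y : Ko y -> (fun=> 0 : R) (elmap a j y) = qc c y by move=> Ky; rewrite van.
  have P0 := isP_cst d 0.
  have e1 := @partial_emap _ _ _ _ _ ma (fun=> 0) (qc c) j ix.2 ix.1 (Pqc c) Kx q0.
  by rewrite /pdx -e1 /partial derive_cst.
have [C2 C20 h2] := gram_bound symG psdG b2 z2.
exists (C1 + C2); first exact: addr_gt0.
move=> q J /eP[c qE] hJ.
have qcE : q = qc c by apply/funext.
have JE : J = (c *m G *m c^T) 0 0 by apply: (hasint_uniq hJ); rewrite qcE; exact: GE.
have J0 : 0 <= J by rewrite JE.
split=> [x Kx|i x Kx].
  have cq : {for x, continuous (fun x => q x ^+ 2)}.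
    rewrite qcE /qc; apply: (@isP_cst_time _ _ _ (isP_exp 2 (Pqc c)) 0 x).
  apply: (closure_Ko Kx cq) => y Ky; rewrite mulrDl.
  have := h1 y c Ky; rewrite lc -JE [q y]qE => h; apply: (le_trans h).
  by rewrite lerDl mulr_ge0// ltW.
rewrite mulrDl qcE pdxE; have := h2 (i, x) c Kx; rewrite lc -JE => h; apply: (le_trans h).
by rewrite lerDr mulr_ge0// ltW.
Qed.

End ElementBound.

(** * Inverse estimates on the mesh *)

Section MeshBound.
Context {R : realType}.
Local Notation V n := ('rV[R]_n).
Local Notation Z n := (R * 'rV[R]_n)%type.
Variables (d' m : nat).
Local Notation d := d'.+1.
Local Notation K := (@simplex R d).
Variables (T : mesh_top d m) (a : 'I_(npt T) -> V d) (ma : is_mesh a).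

Lemma field_bound k : exists2 C, 0 < C & forall f J, pw_polyv a k f ->
  hasint (domain a) (fun x => \sum_(i < 1) \sum_j f x i j * f x i j) J ->
  (forall j x i, K x -> f (elmap a j x) 0 i ^+ 2 <= C * J) /\
  forall j x i l, Ko x -> grad f (elmap a j x) i l ^+ 2 <= C * J.
Proof.
have /choice[c hc] : forall j, exists C, 0 < C /\ forall (q : V d -> R) J, polyfun k q ->
  hasint (Uo (emap a j) 0) (fun y => q (Xo (emap a j) (0, y)) ^+ 2) J ->
  (forall x, K x -> q x ^+ 2 <= C * J) /\ forall i x, Ko x -> pdx a j q i x ^+ 2 <= C * J.
  by move=> j; have [C C0 hC] := elem_bound ma j k; exists C.
exists (1 + \sum_j c j); first by rewrite ltr_pwDl// sumr_ge0// => j _; rewrite ltW//; have [] := hc j.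
have cC j : c j <= 1 + \sum_j c j.
  rewrite (bigD1 j)//= addrCA lerDl addr_ge0// sumr_ge0// => i _.
  by rewrite ltW//; have [] := hc i.
move=> f J pf hJ.
have [q hq] : exists q : 'I_(nelt T) -> 'I_d -> V d -> R, forall j i, polyfun k (q j i) /\ forall x, K x -> f (elmap a j x) 0 i = q j i x.
  have /choice[q hq] : forall ji : 'I_(nelt T) * 'I_d, exists q : V d -> R, polyfun k q /\ forall x, K x -> f (elmap a ji.1 x) 0 ji.2 = q x.
    by move=> [j i]; have [q Pq qE] := pf i j; exists q.
  by exists (fun j i => q (j, i)) => j i; exact: (hq (j, i)).
have cq j i x : {for x, continuous (q j i)}.
  by have [/isP_polyfun Pq _] := hq j i; exact: (@isP_cst_time _ _ _ Pq 0 x).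
have cq2 j i x : {for x, continuous (fun x => q j i x ^+ 2)}.
  by have [/isP_polyfun Pq _] := hq j i; exact: (@isP_cst_time _ _ _ (isP_exp 2 Pq) 0 x).
have /choice[I hI] : forall ji : 'I_(nelt T) * 'I_d, exists I, hasint (Uo (emap a ji.1) 0) (fun y => q ji.1 ji.2 (Xo (emap a ji.1) (0, y)) ^+ 2) I.
  by move=> [j i]; exact: (elem_int ma j (k := fun x => q j i x ^+ 2)) => x _.
have m0 : mset (set0 : set (V d)) by rewrite /mset preimage_set0.
have v0 : vol (set0 : set (V d)) = 0%E by rewrite /vol preimage_set0 measure0.
have mU j : mset (Uo (emap a j) 0) by apply: mset_open; exact: Uo_emap_open.
have I0 j i : 0 <= I (j, i).
  by apply: (hasint_le m0 v0 _ (hasint0 (mU j)) (hI (j, i))) => y _ _; exact: sqr_ge0.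
have JE : J = \sum_j \sum_i I (j, i).
  apply: (hasint_uniq hJ); apply: (domain_split ma) => j.
  have h : hasint (Uo (emap a j) 0) (fun y => \sum_i q j i (Xo (emap a j) (0, y)) ^+ 2) (\sum_i I (j, i)).
    by apply: hasint_sum => // i _; exact: (hI (j, i)).
  apply: hasint_ext h => y [x Kx <-]; rewrite big_ord1; apply: eq_bigr => i _.
  by rewrite [emap a j _]/emap Xo_emap//; have [_ ->] := hq j i; [rewrite expr2|exact: KoK].
have IJ j i : c j * I (j, i) <= (1 + \sum_j c j) * J.
  have Ij : I (j, i) <= J.
    rewrite JE (bigD1 j)//= (bigD1 i)//= -addrA lerDl addr_ge0 ?sumr_ge0// => l _.
    by apply: sumr_ge0.
  apply: ler_pM => //; by rewrite ltW//; have [] := hc j.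
split=> [j x i Kx|j x i l Kx].
  have [Pq qE] := hq j i; have [_ /(_ _ _ Pq (hI (j, i)))[h _]] := hc j.
  by rewrite qE//; exact: (le_trans (h x Kx)).
have [Pq qE] := hq j i; have [_ /(_ _ _ Pq (hI (j, i)))[_ h]] := hc j.
have -> : grad f (elmap a j x) i l = pdx a j (q j i) l x.
  rewrite mxE; apply: (@partial_emap _ _ _ _ _ ma (fun y => f y 0 i) (q j i) j x l (isP_polyfun Pq) Kx).
  by move=> z Kz; rewrite qE//; exact: KoK.
exact: (le_trans (h l x Kx)).
Qed.

End MeshBound.

(** * Power of the forces *)

Section Young.
Context {R : realType}.
Local Notation V n := ('rV[R]_n).

Lemma hasint_dom n (D : set (V n)) f h H : mset D -> mfun D f -> hasint D h H ->
  (forall x, D x -> `|f x| <= h x) -> exists I, hasint D f I.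
Proof.
move=> mD mf [N [mN N0 _ ih _]] fh.
have mDN : measurable (@row_of R n @^-1` (D `\` N)) by exact: msetD.
have i1 : (leb n).-integrable (@row_of R n @^-1` (D `\` N)) (EFin \o (f \o @row_of R n)).
  apply: le_integrable ih => //; last first.
    move=> t [Dt _] /=; rewrite lee_fin; apply: (le_trans (fh _ Dt)); exact: ler_norm.
  by apply/measurable_EFinP; apply: measurable_funS mf => // t [].
by exists (\int[leb n]_(t in @row_of R n @^-1` (D `\` N)) f (row_of t)), N; split.
Qed.

Lemma hasint_ge0 n (D : set (V n)) f G : mset D -> mfun D f -> (forall x, D x -> 0 <= f x) ->
  (\int[leb n]_(t in @row_of R n @^-1` D) (f (row_of t))%:E = G%:E)%E -> hasint D f G.
Proof.
move=> mD mf f0 fG; exists set0; rewrite setD0 /mset /vol preimage_set0 measure0; split => //.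
- apply/integrableP; split; first exact/measurable_EFinP.
  under eq_integral => t /set_mem Dt do rewrite /= ger0_norm ?f0//.
  by rewrite fG ltry.
- by rewrite /Rintegral fG.
Qed.

(** The weight is 1 for volume forces and the area element for tractions. J is found before r, which
    is chosen later. *)
Lemma weighted_young n p (D : set (V n)) (g v : V n -> V p) (w : V n -> R) G U : mset D ->
  (forall i, mfun D (fun x => g x 0 i)) -> (forall i, mfun D (fun x => v x 0 i)) -> mfun D w ->
  (forall x, D x -> 0 <= w x) ->
  (\int[leb n]_(t in @row_of R n @^-1` D) ((\sum_i g (row_of t) 0 i ^+ 2) * w (row_of t))%:E = G%:E)%E ->
  hasint D (fun x => (\sum_i v x 0 i ^+ 2) * w x) U ->
  exists2 J, hasint D (fun x => (\sum_i g x 0 i * v x 0 i) * w x) J &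
    forall r, 0 < r -> 2 * J <= r * G + r^-1 * U.
Proof.
move=> mD mg mv mw w0 gG hU.
have hG : hasint D (fun x => (\sum_i g x 0 i ^+ 2) * w x) G.
  apply: hasint_ge0 gG => //; last by move=> x Dx; rewrite mulr_ge0 ?w0// sumr_ge0// => i _; exact: sqr_ge0.
  apply: measurable_funM => //; apply: measurable_sum => i; exact: measurable_funX (mg i).
have bd r x : 0 < r -> D x -> 2 * ((\sum_i g x 0 i * v x 0 i) * w x) <= r * ((\sum_i g x 0 i ^+ 2) * w x) + r^-1 * ((\sum_i v x 0 i ^+ 2) * w x).
  move=> r0 Dx; rewrite !mulrA -mulrDl; apply: ler_wpM2r; first exact: w0.
  rewrite !mulr_sumr -big_split; apply: ler_sum => i _ /=.
  move: (g x 0 i) (v x 0 i) => A B; rewrite -subr_ge0.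
  have -> : r * A ^+ 2 + r^-1 * B ^+ 2 - 2 * (A * B) = r * (A - r^-1 * B) ^+ 2 by field; rewrite gt_eqF.
  by rewrite mulr_ge0 ?sqr_ge0// ltW.
have [J hJ] : exists J, hasint D (fun x => (\sum_i g x 0 i * v x 0 i) * w x) J.
  apply: (hasint_dom mD _ (hasintD hG hU)) => [|x Dx].
    apply: measurable_funM => //; apply: measurable_sum => i; exact: measurable_funM (mg i) (mv i).
  rewrite normrM [`|w x|]ger0_norm ?w0// -mulrDl; apply: ler_wpM2r; first exact: w0.
  rewrite -big_split; apply: (le_trans (ler_norm_sum _ _ _)); apply: ler_sum => i _ /=.
  move: (g x 0 i) (v x 0 i) => A B; rewrite ler_norml; apply/andP; split; nra.
exists J => // r r0.
have m0 : mset (set0 : set (V n)) by rewrite /mset preimage_set0.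
have v0 : vol (set0 : set (V n)) = 0%E by rewrite /vol preimage_set0 measure0.
by apply: (hasint_le m0 v0 _ (hasintZ 2 hJ) (hasintD (hasintZ r hG) (hasintZ r^-1 hU))) => x Dx _; exact: bd.
Qed.

End Young.

Section Powers.
Context {R : realType}.
Local Notation V n := ('rV[R]_n).
Local Notation Z n := (R * 'rV[R]_n)%type.

Lemma ereal_le_real (x : \bar R) M : (0 <= x)%E -> (x <= M%:E)%E -> exists2 G, x = G%:E & 0 <= G <= M.
Proof. by case: x => [r| |]//; rewrite !lee_fin => r0 rM; exists r => //; rewrite r0 rM. Qed.

(** No constant of the mesh enters, so that on the fluid domain the estimate is insensitive to the
    mesh and to its motion. *)
Lemma volume_power d' m (T : mesh_top d'.+1 m) (a : 'I_(npt T) -> V d'.+1) (ma : is_mesh a) k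
    (u g : V d'.+1 -> V d'.+1) M rho r : {within domain a, continuous u} -> pw_polyv a k u ->
  L2_le (domain a) g M -> 0 <= rho -> 0 < r ->
  2 * ip (domain a) (fun x => rho *: g x) u <= rho * (r * M ^+ 2 + r^-1 * ip (domain a) u u).
Proof.
move=> cu /pw_polyv_on[q hq] [mg gM] rho0 r0.
have cD : closed (domain a) by rewrite -(Om_domain a 0); exact: (closed_Om (pmap_emap a)).
have mu i : mfun (domain a) (fun x => u x 0 i).
  apply: mfun_closed => // x; apply: (@cvg_comp _ _ _ u (fun x : V d'.+1 => x 0 i) _ _ _ (cu x)).
  exact: coord_continuous.
have [I hI] := ip_on ma hq hq.
have hI1 : hasint (domain a) (fun x => (\sum_i u x 0 i ^+ 2) * 1) I.
  by apply: hasint_ext hI => x _; rewrite big_ord1 mulr1; apply: eq_bigr => i _; rewrite expr2.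
have g0 : (0 <= \int[leb d'.+1]_(t in @row_of R d'.+1 @^-1` domain a) ((\sum_i g (row_of t) 0 i ^+ 2) * 1)%:E)%E.
  by apply: integral_ge0 => t _; rewrite lee_fin mulr1 sumr_ge0// => i _; exact: sqr_ge0.
have gM1 : (\int[leb d'.+1]_(t in @row_of R d'.+1 @^-1` domain a) ((\sum_i g (row_of t) 0 i ^+ 2) * 1)%:E <= (M ^+ 2)%:E)%E.
  by under eq_integral do rewrite mulr1.
have [G GE /andP[G0 GM]] := ereal_le_real g0 gM1.
have [J hJ /(_ r r0) JG] := @weighted_young R _ _ (domain a) g u (fun=> 1) G I (mset_domain a) mg mu (@measurable_cst _ _ _ _ _ _) (fun _ _ => ler01) GE hI1.
have -> : ip (domain a) (fun x => rho *: g x) u = rho * J.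
  apply: hasint_vint; apply: hasint_ext (hasintZ rho hJ) => x _.
  by rewrite big_ord1 mulr1 mulr_sumr; apply: eq_bigr => i _; rewrite mxE mulrA.
rewrite /ip (hasint_vint hI) mulrCA; apply: ler_wpM2l => //.
by apply: (le_trans JG); rewrite lerD2r ler_pM2l.
Qed.

(** * Surface tractions *)

Section Surface.
Variables (d' m : nat).
Local Notation d := d'.+2.
Local Notation K := (@simplex R d).
Variables (T : mesh_top d m) (a : 'I_(npt T) -> V d).
Implicit Types f : 'I_(nelt T) * 'I_d.+1.

Lemma isP_face_par (v : 'I_d.+1) i : isP (fun z : Z d'.+1 => @face_par R d v z.2 0 i).
Proof.
have h : isP (fun z : Z d'.+1 => \sum_(k < d) bary z.2 k * (vertex (lift v k) : V d) 0 i).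
  by apply: isP_sum => k _; apply: isP_mul; [exact: isP_bary|exact: isP_cst].
apply: isP_ext h => z; rewrite /face_par summxE; apply: eq_bigr => k _.
by rewrite [RHS]mxE.
Qed.

Lemma face_par_simplex (v : 'I_d.+1) (y : V d'.+1) : simplex y -> K (@face_par R d v y).
Proof.
move=> Ky; have E i : @face_par R d v y 0 i = \sum_(k < d) bary y k * (lift v k == i.+1 :> nat)%:R.
  by rewrite /face_par summxE; apply: eq_bigr => k _; rewrite !mxE.
have L (u : 'I_d.+1) : \sum_(i < d) (u == i.+1 :> nat)%:R <= 1 :> R.
  case: (unliftP ord0 u) => [j e|->]; last by rewrite big1.
  rewrite e (bigD1 j)//= eqxx big1 ?addr0// => i ij.
  by rewrite /bump /= !add1n eqSS eq_sym -val_eqE in ij *; rewrite (negPf ij).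
move=> w; case: (unliftP ord0 w) => [i ->|->].
  by rewrite baryL E sumr_ge0// => k _; rewrite mulr_ge0// Ky.
rewrite /bary subr_ge0 -(sum_bary y); under eq_bigr do rewrite E.
rewrite exchange_big; apply: ler_sum => k _ /=; rewrite -mulr_sumr -[leRHS]mulr1.
apply: ler_wpM2l; first exact: Ky.
exact: (L (lift v k)).
Qed.

Lemma isP_fpar f i : isP (fun z : Z d'.+1 => fpar a f z.2 0 i).
Proof.
apply: (isP_comp (f := fun z : Z d => elmap a f.1 z.2 0 i) (G := fun z : Z d'.+1 => (z.1, @face_par R d f.2 z.2))).
- exact: isP_interp.
- exact: isP_fst.
- by move=> k; exact: isP_face_par.
Qed.

Lemma surf_elt_cont f : continuous (surf_elt a f).
Proof.
pose J (z : Z d'.+1) : 'M[R]_(d'.+1, d) := \matrix_(k, i) dpart k (fun w => fpar a f w.2 0 i) z.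
have JE y : 'J (fpar a f) y = J (0, y).
  apply: (@jacobian_hasD _ _ _ _ 0 y (fun i => dtime (fun z : Z d'.+1 => fpar a f z.2 0 i) (0, y))) => i.
  by apply: hasD_eq (isP_hasD (0, y) (isP_fpar f i)) _ _ => // k; rewrite mxE.
have PJ k i : isP (fun z => J z k i).
  by apply: isP_ext (isP_dpart k (isP_fpar f i)) => z; rewrite mxE.
have PD : isP (fun z => \det (J z *m (J z)^T)).
  apply: isP_det => k l; apply: (@isP_ext _ _ (fun z => \sum_i J z k i * J z l i)).
    by move=> z; rewrite mxE; apply: eq_bigr => i _; rewrite [_^T _ _]mxE.
  by apply: isP_sum => i _; apply: isP_mul.
have -> : surf_elt a f = Num.sqrt \o (fun y => \det (J (0, y) *m (J (0, y))^T)).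
  by apply/funext => y; rewrite /surf_elt /= JE.
move=> y; apply: (@cvg_comp _ _ _ (fun y => \det (J (0, y) *m (J (0, y))^T)) _ _ _ _ (@isP_cst_time _ _ _ PD 0 y)).
exact: sqrt_continuous.
Qed.

Lemma simplex_mfun n (f k : V n -> R) : continuous k -> (forall x, simplex x -> f x = k x) -> mfun (@simplex R n) f.
Proof.
move=> ck fk; have mk : mfun setT k by apply: mfun_open => [|x _]; [exact: openT|exact: ck].
apply: (eq_measurable_fun (k \o @row_of R n)); first by move=> t /set_mem St /=; rewrite fk.
exact: (@measurable_funS _ _ _ _ setT _ _ measurableT (@subsetT _ _) mk).
Qed.

Lemma simplex_int n (f k : V n -> R) : continuous k -> (forall x, simplex x -> f x = k x) ->
  exists I, hasint (@simplex R n) f I.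
Proof.
move=> ck fk; have [C _ hC] := compact_bound (@compact_simplex R n) (fun x _ => ck x).
have mS : mset (@simplex R n) by apply: mset_closed; exact: closed_simplex.
apply: (@hasint_bounded _ _ _ _ C set0).
- exact: mS.
- by apply: (@vol_bounded _ _ _ 1) => // x; exact: simplex_norm.
- by rewrite /mset preimage_set0.
- by rewrite /vol preimage_set0 measure0.
- by rewrite setD0; exact: simplex_mfun ck fk.
- by move=> x Kx _; rewrite fk//; exact: hC.
Qed.

(** A trace inequality by finite dimension: the pointwise bound of [field_bound] is integrated over
    the faces, of area [A f], and gives |v|^2 <= d C J on them. *)
Lemma surface_power (ma : is_mesh a) (F : {set 'I_(nelt T) * 'I_d.+1}) k : exists2 C, 0 <= C & forall v g M J r,
  pw_polyv a k v -> hasint (domain a) (fun x => \sum_(i < 1) \sum_j v x i j * v x i j) J ->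
  surf_L2_le a F g M -> 0 < r -> 2 * surf_ip a F g v <= r * M ^+ 2 + r^-1 * (C * J).
Proof.
have [C C0 hC] := field_bound ma k.
have mS : mset (@simplex R d'.+1) by apply: mset_closed; exact: closed_simplex.
have m0 : mset (set0 : set (V d'.+1)) by rewrite /mset preimage_set0.
have v0 : vol (set0 : set (V d'.+1)) = 0%E by rewrite /vol preimage_set0 measure0.
have se0 f y : 0 <= surf_elt a f y by exact: sqrtr_ge0.
have /choice[A hA] : forall f, exists A, hasint (@simplex R d'.+1) (surf_elt a f) A.
  by move=> f; apply: (@simplex_int _ (surf_elt a f) (surf_elt a f)) => //; exact: surf_elt_cont.
have A0 f : 0 <= A f by apply: (hasint_le m0 v0 _ (hasint0 mS) (hA f)) => y _ _.
exists (\sum_(f in F) d%:R * C * A f) => [|v g M J r pv hJ [mg gM] r0].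
  by apply: sumr_ge0 => f _; rewrite !mulr_ge0// ltW.
have [vC _] := hC v J pv hJ.
have [q [Pq qE]] := pw_polyv_on pv.
have cqf f i : continuous (fun y : V d'.+1 => q f.1 (@face_par R d f.2 y) 0 i).
  move=> y; have h : isP (fun z : Z d'.+1 => q f.1 (@face_par R d f.2 z.2) 0 i).
    apply: (isP_comp (f := fun z : Z d => q f.1 z.2 0 i) (G := fun z : Z d'.+1 => (z.1, @face_par R d f.2 z.2))).
    - exact: Pq.
    - exact: isP_fst.
    - by move=> l; exact: isP_face_par.
  exact: (@isP_cst_time _ _ _ h 0 y).
have vE f i y : simplex y -> v (fpar a f y) 0 i = q f.1 (@face_par R d f.2 y) 0 i.
  by move=> Ky; rewrite /fpar qE//; exact: face_par_simplex.
have mw f : mfun (@simplex R d'.+1) (surf_elt a f) by apply: (@simplex_mfun _ (surf_elt a f) (surf_elt a f)) => //; exact: surf_elt_cont.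
have mv f i : mfun (@simplex R d'.+1) (fun y => v (fpar a f y) 0 i).
  by apply: (simplex_mfun (cqf f i)) => y; exact: vE.
have /choice[U hU] : forall f, exists U, hasint (@simplex R d'.+1) (fun y => (\sum_i v (fpar a f y) 0 i ^+ 2) * surf_elt a f y) U.
  move=> f; apply: (@simplex_int _ _ (fun y => (\sum_i q f.1 (@face_par R d f.2 y) 0 i ^+ 2) * surf_elt a f y)).
    move=> y; apply: (@cvgM _ _ _ (nbhs_filter y)); last exact: surf_elt_cont.
    apply: (cvg_sumR (nbhs_filter y)) => i; rewrite expr2.
    under eq_fun do rewrite expr2.
    exact: (@cvgM _ _ _ (nbhs_filter y) _ _ _ _ (cqf f i y) (cqf f i y)).
  by move=> y Ky; congr (_ * _); apply: eq_bigr => i _; rewrite vE.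
have UA f : U f <= d%:R * C * A f * J.
  rewrite -[leRHS]mulrAC; apply: (hasint_le m0 v0 _ (hU f) (hasintZ _ (hA f))) => y Ky _.
  apply: ler_wpM2r => //; have -> : d%:R * C * J = \sum_(i < d) C * J by rewrite sumr_const card_ord -[RHS]mulr_natl mulrA.
  by apply: ler_sum => i _; rewrite /fpar; apply: vC; exact: face_par_simplex.
pose I f := (\int[leb d.-1]_(t in @row_of R d.-1 @^-1` @simplex R d.-1)
     ((\sum_i g (fpar a f (row_of t)) 0 i ^+ 2) * surf_elt a f (row_of t))%:E)%E.
have I0 f : (0 <= I f)%E.
  by apply: integral_ge0 => t _; rewrite lee_fin mulr_ge0// sumr_ge0// => i _; exact: sqr_ge0.
have IM f : f \in F -> (I f <= (M ^+ 2)%:E)%E.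
  by move=> fF; apply: le_trans gM; rewrite (bigD1 f)//=; apply: leeDl; apply: (big_ind (fun x : \bar R => 0 <= x)%E) => [//|x y hx hy|f' _]; [exact: adde_ge0|exact: I0].
have /choice[G hG] : forall f, exists G, f \in F -> I f = G%:E.
  move=> f; case: (boolP (f \in F)) => [fF|_]; last by exists 0.
  by have [G -> _] := ereal_le_real (I0 f) (IM f fF); exists G.
have GM : \sum_(f in F) G f <= M ^+ 2.
  rewrite -lee_fin -sumEFin; apply: le_trans gM; rewrite le_eqVlt; apply/orP; left; apply/eqP.
  by apply: eq_bigr => f fF; rewrite -hG.
rewrite /surf_ip mulr_sumr.
apply: (@le_trans _ _ (\sum_(f in F) (r * G f + r^-1 * U f))).
  apply: ler_sum => f fF.
  have [H hH Hr] := @weighted_young R _ _ (@simplex R d'.+1) (fun y => g (fpar a f y)) (fun y => v (fpar a f y)) (surf_elt a f) (G f) (U f) mS (fun i => mg f i fF) (mv f) (mw f) (fun y _ => se0 f y) (hG f fF) (hU f).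
  by rewrite (hasint_vint hH); exact: Hr.
rewrite big_split /= -!mulr_sumr; apply: lerD; first by rewrite ler_pM2l.
rewrite ler_pM2l ?invr_gt0// mulr_sumr mulr_suml; apply: ler_sum => f _; exact: UA.
Qed.

End Surface.
End Powers.

(** * Energy bounds *)

Section Runs.
Context {R : realType}.
Local Notation V n := ('rV[R]_n).
Variables (d' m : nat).
Local Notation d := d'.+2.
Local Notation K := (@simplex R d).
Variables (D : fsi_data R d m).
Hypotheses (dt0 : 0 < dt D) (m0 : (0 < m)%N) (rho_f0 : 0 < rho_f D) (nu_f0 : 0 < nu_f D) (rho_s0 : 0 < rho_s D).
Hypothesis hD : data_ok D.
Hypothesis hd : d = 2%N \/ d = 3%N.
Hypothesis hWdiff : forall F, differentiable (energy D) F.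
Hypothesis hWconvex : convex_function (E := 'M[R]_d) setT (energy D).
Hypothesis hu_b : forall t x, Sigma1 D x -> u_b D t x = 0.
Hypothesis hSigma2 : Sigma2 D = set0.
Hypothesis hphi_b : forall t x, Sigma3 D x -> derive1 (fun r => phi_b D r x) t = 0.
Local Notation sp := (@spt _ _ _ D).

Let msp : is_mesh sp. Proof. by case: hD. Qed.

Lemma run_state_ok N (S : nat -> fsi_state D) n : fsi_run N S -> (n <= N)%N -> state_ok (S n).
Proof.
move=> [h0 hS]; elim: n => [_|n IH nN]; first exact: initial_state_ok.
have [_ st] := hS n.+1 nN.
by apply: step_state_ok st; apply: IH; exact: ltnW.
Qed.

Lemma run_step N (S : nat -> fsi_state D) n : fsi_run N S -> (0 < n <= N)%N ->
  rho_f D / (2 * dt D) * (ip (Omega_f (S n)) (vel (S n)) (vel (S n)) - ip (Omega_f (S n.-1)) (vel (S n.-1)) (vel (S n.-1)))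
  + rho_f D * nu_f D / 2 * dissipation (S n)
  + (dt D)^-1 * (solid_energy D (svel (S n)) (predicted (S n)) - solid_energy D (svel (S n.-1)) (predicted (S n.-1)))
  <= power n (S n).
Proof.
move=> hS n0N; have /andP[n0 nN] := n0N; have [_ /(_ n n0N)[_ st]] := hS.
apply: step_energy st => //; apply: run_state_ok hS _.
by apply: leq_trans nN; exact: leq_pred.
Qed.

Lemma run_total_step N (S : nat -> fsi_state D) n : fsi_run N S -> (n < N)%N ->
  total_energy S n.+1 <= total_energy S n + 2 * dt D * power n.+1 (S n.+1).
Proof.
move=> hS nN; have := @run_step N S n.+1 hS nN; rewrite /= /total_energy big_nat_recr//=.
move: (\sum_(1 <= l < n.+1) _) (dissipation _) => s e.
move: (ip _ _ _) (ip _ _ _) (solid_energy _ _ _) (solid_energy _ _ _) (power _ _) => u u' E E' P h.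
have : 2 * dt D * (rho_f D / (2 * dt D) * (u' - u) + rho_f D * nu_f D / 2 * e + (dt D)^-1 * (E' - E)) <= 2 * dt D * P.
  by apply: ler_wpM2l h; rewrite mulr_ge0// ltW.
have -> : 2 * dt D * (rho_f D / (2 * dt D) * (u' - u) + rho_f D * nu_f D / 2 * e + (dt D)^-1 * (E' - E)) =
   rho_f D * (u' - u) + rho_f D * nu_f D * e * dt D + 2 * (E' - E) by field; rewrite gt_eqF.
move: (rho_f D * nu_f D * e * dt D) (2 * dt D * P) => x y; lra.
Qed.

Lemma run_total N (S : nat -> fsi_state D) n : fsi_run N S -> (n <= N)%N ->
  total_energy S n <= total_energy S 0 + 2 * dt D * \sum_(1 <= l < n.+1) power l (S l).
Proof.
move=> hS; elim: n => [_|n IH nN]; first by rewrite big_geq// mulr0 addr0.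
apply: (le_trans (run_total_step hS nN)); rewrite big_nat_recr//= [in leRHS]mulrDr [leRHS]addrA.
by apply: lerD => //; apply: IH; exact: ltnW.
Qed.

(** W may be negative, but its tangent at 0 makes the loss at most linear in the bound b on the
    gradient; [step_bound] can absorb this into the quadratic kinetic energy. *)
Lemma energy_lower : exists2 w, 0 <= w & forall f q b, on_mesh sp f q -> 0 <= b ->
  (forall j x i l, Ko x -> `|grad f (elmap sp j x) i l| <= b) ->
  - (w * (1 + b)) <= vint (Omega_s D) (fun x => energy D (grad f x)).
Proof.
have [v hv] : exists v, hasint (Omega_s D) (fun=> 1) v.
  apply: (domain_int msp (k := fun _ _ => 1)) => [j x _|//].
  exact: (@cvg_cst _ (1 : R) _ (nbhs x) (nbhs_filter x)).
have h0 : mset (set0 : set (V d)) by rewrite /mset preimage_set0.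
have v0 : vol (set0 : set (V d)) = 0%E by rewrite /vol preimage_set0 measure0.
have vge : 0 <= v by apply: (hasint_le h0 v0 _ (hasint0 (mset_domain sp)) hv) => x _ _; exact: ler01.
pose c := `|energy D 0| + \sum_i \sum_j `|dmx (energy D) 0 i j|.
have c0 : 0 <= c by rewrite addr_ge0// sumr_ge0// => i _; exact: sumr_ge0.
exists (c * v); first exact: mulr_ge0.
move=> f q b hf b0 hb; have [I hI] := energy_int msp hWdiff hf.
rewrite (hasint_vint hI) [c * v * _]mulrAC -mulNr.
have [N [mN N0 hN]] := domain_null sp.
apply: (hasint_le mN N0 _ (hasintZ (- (c * (1 + b))) hv) hI) => y Dy Ny; rewrite mulr1.
have [j [x [Kx ->]]] := hN y Dy Ny.
apply: le_trans (convex_tangent hWdiff hWconvex 0 _).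
set s := \sum_i _; have : `|energy D 0 + s| <= c * (1 + b).
  apply: (le_trans (ler_normD _ _)); rewrite /c mulrDl; apply: lerD.
    by rewrite ler_peMr// lerDl.
  apply: (@le_trans _ _ ((\sum_i \sum_j0 `|dmx (energy D) 0 i j0|) * b)); last first.
    by apply: ler_wpM2l; [rewrite sumr_ge0// => i _; exact: sumr_ge0|rewrite lerDr].
  rewrite mulr_suml; apply: (le_trans (ler_norm_sum _ _ _)); apply: ler_sum => i _.
  rewrite mulr_suml; apply: (le_trans (ler_norm_sum _ _ _)); apply: ler_sum => l _.
  by rewrite normrM subr0; apply: ler_wpM2l => //; exact: hb.
by rewrite ler_norml => /andP[].
Qed.

(** As the elastic energy may be negative, [total_energy] alone does not control the state; the
    velocity and the deformation gradient are carried along in the recursion. *)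
Definition bounded_state (S : nat -> fsi_state D) n B :=
  [/\ total_energy S n <= B, ip (Omega_s D) (svel (S n)) (svel (S n)) <= B &
   forall j x i l, Ko x -> `|grad (spos (S n)) (elmap sp j x) i l| <= B].

Lemma ip_ge0 n p q (A : set (V n)) (f : V n -> 'M[R]_(p, q)) : 0 <= ip A f f.
Proof.
apply: Rintegral_ge0 => t _; apply: sumr_ge0 => i _; apply: sumr_ge0 => j _.
by rewrite -expr2 sqr_ge0.
Qed.

Lemma initial_bound (s0 : fsi_state D) : exists B, forall N (S : nat -> fsi_state D), S 0%N = s0 ->
  fsi_run N S -> bounded_state S 0 B.
Proof.
case: (pselect (initial_ok s0)) => [ok|nok]; last by exists 0 => N S S0 [h _]; rewrite S0 in h.
have [_ [_ hp] _ _ _] := ok; have [p hp'] := pw_polyv_on hp.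
have /choice[c hc] : forall w : 'I_(nelt (smesh D)) * ('I_d * 'I_d), exists C, forall x, K x -> `|pgrad sp w.1 (p w.1) x w.2.1 w.2.2| <= C.
  move=> [j [i l]]; have [C _ h] := compact_bound (@compact_simplex R d) (fun x Kx => @pgrad_cont _ _ _ _ _ msp (p j) j x i l (hp'.1 j) Kx).
  by exists C.
have gb j x i l : Ko x -> `|grad (spos s0) (elmap sp j x) i l| <= \sum_w `|c w|.
  move=> Kx; rewrite (grad_on msp j hp' Kx); apply: (le_trans (hc (j, (i, l)) x (KoK Kx))).
  by rewrite (bigD1 (j, (i, l)))//= (le_trans (ler_norm _))// lerDl sumr_ge0.
pose e0 := 2 * solid_energy D (svel s0) (predicted s0) + rho_f D * ip (Omega_f s0) (vel s0) (vel s0).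
exists (`|e0| + `|ip (Omega_s D) (svel s0) (svel s0)| + \sum_w `|c w|) => N S S0 _.
have s0' : 0 <= \sum_w `|c w| by exact: sumr_ge0.
have e0' := normr_ge0 e0; have i0' := normr_ge0 (ip (Omega_s D) (svel s0) (svel s0)).
split; rewrite ?S0.
- rewrite /total_energy big_geq// addr0 S0 -/e0; have := ler_norm e0.
  by move: (`|e0|) e0' => y; lra.
- have := ler_norm (ip (Omega_s D) (svel s0) (svel s0)).
  by move: (`|e0|) e0' (`|ip _ _ _|) i0' => y ? z ?; lra.
- move=> j x i l Kx; apply: (le_trans (gb j x i l Kx)); by rewrite lerDr addr_ge0.
Qed.

Lemma comb_entry n p (A B : 'M[R]_(n, p)) c i l : (A + c *: B) i l = A i l + c * B i l.
Proof. by rewrite !mxE. Qed.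

Lemma abs_young (x e : R) : 0 < e -> `|x| <= e^-1 + e * x ^+ 2.
Proof.
move=> e0; have c0 : 0 < e^-1 by rewrite invr_gt0.
have ec : e * e^-1 = 1 by rewrite divff// gt_eqF.
rewrite -[x ^+ 2]real_normK ?num_real//; have a0 := normr_ge0 x.
move: (`|x|) (e^-1) a0 c0 ec => a c a0 c0 ec.
have : 0 <= e * (a - c) ^+ 2 by rewrite mulr_ge0 ?sqr_ge0// ltW.
have -> : e * (a - c) ^+ 2 = e * a ^+ 2 - 2 * (e * c) * a + e * c * c by ring.
by rewrite ec; move: (e * a ^+ 2) => y; lra.
Qed.

Lemma step_bound (M B : R) : exists B', forall N (S : nat -> fsi_state D) n, fsi_run N S ->
  forces_le N S M -> (n < N)%N -> bounded_state S n B -> bounded_state S n.+1 B'.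
Proof.
have [k k0 hk] := field_bound msp m.
have [ks ks0 hks] := surface_power msp (s_4 D) m.
have [w w0 hw] := energy_lower.
pose B0 := `|B|.
(* The deformation gradient changes by dt times the velocity gradient, which is at most 1 + k B0 by
   [field_bound] and [abs_young] with parameter 1. *)
pose G' := B0 + dt D * (1 + k * B0).
(* Choices for the bounds [x1], [x2] and [x3]: terms in the new velocities, from the power and from
   the lower bound on the elastic energy, take at most half of the kinetic terms rho_s I' and rho_f
   U'. Writing w + 1 avoids a division by zero. *)
pose e := rho_s D / (8 * (w + 1) * dt D * k).
pose r := 4 * dt D * (rho_s D + ks) / rho_s D + 2 * dt D.
pose F := dt D * (rho_f D + rho_s D + 1) * (r * M ^+ 2).
pose Q := B0 + 2 * w * (1 + G' + dt D / e) + F.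
have e0 : 0 < e by rewrite divr_gt0// !mulr_gt0// ltr_wpDl.
have r0 : 0 < r by rewrite ltr_wpDl ?mulr_gt0// divr_ge0 ?(ltW rho_s0)// mulr_ge0 ?addr_ge0 ?mulr_ge0 ?(ltW dt0) ?(ltW rho_s0).
have B00 : 0 <= B0 by exact: normr_ge0.
exists (B0 + F + Q + 2 * Q / rho_s D + G') => N S n hS hM nN [hT hv hg].
have n1 : (0 < n.+1 <= N)%N by [].
have ok := run_state_ok hS (ltnW nN); have ok' := run_state_ok hS nN.
have [_ /(_ _ n1)[_ [he _ _ _ _]]] := hS; rewrite /= in he.
have [_ hp _ [_ hv0] _] := ok; have [[mf' _ _ _ _] hp' [cu' hu'] [cv' hv'] _] := ok'.
have [M1 M2 M3] := hM _ n1.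
have TS := run_total_step hS nN.
have [p pE] := pw_polyv_on hp; have [q qE] := pw_polyv_on hv0; have [q' qE'] := pw_polyv_on hv'.
have pE' : on_mesh sp (spos (S n.+1)) (fun j x => p j x + dt D *: q j x).
  have [Pa Ea] := on_mesh_comb (dt D) pE qE; split => // j x Kx.
  by rewrite he ?Ea//; exists j => //; exists x.
have prE := on_mesh_comb (dt D) pE' qE'.
have [I hI] := ip_on msp qE qE; have [I' hI'] := ip_on msp qE' qE'.
have IE : ip (Omega_s D) (svel (S n)) (svel (S n)) = I by exact: hasint_vint hI.
have IE' : ip (Omega_s D) (svel (S n.+1)) (svel (S n.+1)) = I' by exact: hasint_vint hI'.
have [_ g1] := hk _ _ hv0 hI; have [_ g2] := hk _ _ hv' hI'.
have I0' : 0 <= I' by rewrite -IE'; exact: ip_ge0.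
have IB : I <= B0 by rewrite -IE; apply: (le_trans hv); exact: ler_norm.
have U0 := ip_ge0 (Omega_f (S n.+1)) (vel (S n.+1)).
have gG j x i l : Ko x -> `|grad (spos (S n.+1)) (elmap sp j x) i l| <= G'.
  move=> Kx; rewrite (grad_on msp j pE' Kx) (pgrad_comb sp (dt D) j x (pE.1 j) (qE.1 j)).
  rewrite -(grad_on msp j pE Kx) -(grad_on msp j qE Kx) comb_entry.
  apply: (le_trans (ler_normD _ _)); apply: lerD.
    by apply: (le_trans (hg j x i l Kx)); exact: ler_norm.
  rewrite normrM gtr0_norm// ler_pM2l//.
  have := @abs_young (grad (svel (S n)) (elmap sp j x) i l) 1 ltr01; rewrite invr1 mul1r.
  move=> h; apply: (le_trans h); rewrite lerD2l; apply: (le_trans (g1 j x i l Kx)).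
  by rewrite ler_pM2l.
pose b := G' + dt D * (e^-1 + e * (k * I')).
have G0 : 0 <= G' by rewrite addr_ge0// mulr_ge0 ?(ltW dt0)// addr_ge0// mulr_ge0// ltW.
have b0 : 0 <= b.
  by rewrite addr_ge0// mulr_ge0 ?(ltW dt0)// addr_ge0 ?invr_ge0 ?(ltW e0)// mulr_ge0 ?(ltW e0)// mulr_ge0// ltW.
have WL : - (w * (1 + b)) <= vint (Omega_s D) (fun x => energy D (grad (predicted (S n.+1)) x)).
  apply: (hw _ _ _ prE b0) => j x i l Kx.
  rewrite (grad_on msp j prE Kx) (pgrad_comb sp (dt D) j x (pE'.1 j) (qE'.1 j)).
  rewrite -(grad_on msp j pE' Kx) -(grad_on msp j qE' Kx) comb_entry.
  apply: (le_trans (ler_normD _ _)); apply: lerD; first exact: gG.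
  rewrite normrM gtr0_norm// ler_pM2l//; apply: (le_trans (abs_young _ e0)).
  by rewrite lerD2l ler_pM2l//; exact: g2.
have P1 := volume_power mf' cu' hu' M1 (ltW rho_f0) r0.
have P2 := volume_power msp cv' hv' M2 (ltW rho_s0) r0; rewrite -/(Omega_s D) IE' in P2.
have P3 := hks _ _ _ _ _ hv' hI' M3 r0.
have TE : 2 * (rho_s D / 2 * I' + vint (Omega_s D) (fun x => energy D (grad (predicted (S n.+1)) x)))
   + rho_f D * ip (Omega_f (S n.+1)) (vel (S n.+1)) (vel (S n.+1)) <= total_energy S n.+1.
  rewrite /total_energy /solid_energy IE' lerDl; apply: sumr_ge0 => l _.
  by rewrite !mulr_ge0 ?(ltW rho_f0) ?(ltW nu_f0) ?(ltW dt0)//; exact: ip_ge0.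
have x1 : dt D * r^-1 * (rho_s D + ks) <= rho_s D / 4.
  rewrite mulrAC ler_pdivrMr// /r.
  have -> : rho_s D / 4 * (4 * dt D * (rho_s D + ks) / rho_s D + 2 * dt D) = dt D * (rho_s D + ks) + rho_s D / 2 * dt D.
    by field; rewrite gt_eqF.
  by rewrite lerDl mulr_ge0 ?(ltW dt0)// divr_ge0 ?(ltW rho_s0).
have x2 : dt D * r^-1 <= 1 / 2.
  rewrite ler_pdivrMr// /r; have : 0 <= 4 * dt D * (rho_s D + ks) / rho_s D.
    by rewrite divr_ge0 ?(ltW rho_s0)// mulr_ge0 ?addr_ge0 ?mulr_ge0 ?(ltW dt0) ?(ltW rho_s0).
  by move: (4 * _ * _ / _) => y; lra.
have x3 : 2 * w * dt D * e * k <= rho_s D / 4.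
  have -> : 2 * w * dt D * e * k = rho_s D / 4 * (w / (w + 1)).
    by rewrite /e; field; rewrite !gt_eqF//= ltr_wpDl.
  by apply: ler_piMr; [rewrite divr_ge0 ?(ltW rho_s0)|rewrite ler_pdivrMr ?mul1r ?lerDl ?ltr_wpDl].
have F0 : 0 <= F.
  rewrite /F; apply: mulr_ge0; last by rewrite mulr_ge0 ?sqr_ge0// ltW.
  by rewrite mulr_ge0 ?(ltW dt0)// !addr_ge0 ?(ltW rho_f0) ?(ltW rho_s0).
have BB : B <= B0 by exact: ler_norm.
set T' := total_energy S n.+1 in TS TE *; set U' := ip (Omega_f (S n.+1)) (vel (S n.+1)) (vel (S n.+1)) in U0 TE P1.
set W' := vint _ _ in WL TE.
have y1 : dt D * r^-1 * (rho_s D + ks) * I' <= rho_s D / 4 * I' by exact: ler_wpM2r.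
have y2 : dt D * r^-1 * (rho_f D * U') <= 1 / 2 * (rho_f D * U').
  by apply: ler_wpM2r => //; rewrite mulr_ge0 ?(ltW rho_f0).
have y3 : 2 * w * dt D * e * k * I' <= rho_s D / 4 * I' by exact: ler_wpM2r.
have TF : T' <= B0 + F + dt D * r^-1 * (rho_f D * U') + dt D * r^-1 * (rho_s D + ks) * I'.
  apply: (le_trans TS); rewrite -[2 * dt D * _]mulrA mulrCA /power.
  have := ler_wpM2l (ltW dt0) (lerD (lerD P1 P2) P3); rewrite -/(Omega_f _) -/U' -!mulrDr.
  have -> : dt D * (rho_f D * (r * M ^+ 2 + r^-1 * U') + rho_s D * (r * M ^+ 2 + r^-1 * I') + (r * M ^+ 2 + r^-1 * (ks * I'))) =
     F + dt D * r^-1 * (rho_f D * U') + dt D * r^-1 * (rho_s D + ks) * I' by rewrite /F; ring.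
  by move: (dt D * r^-1 * (rho_f D * U')) (dt D * r^-1 * (rho_s D + ks) * I') (dt D * (2 * _)) => a1 a2 a3; move: hT BB; move: (total_energy S n) (F) (B0) => t1 f1 b1; lra.
have WE : w * (1 + b) = w * (1 + G' + dt D / e) + w * dt D * e * k * I' by rewrite /b; ring.
rewrite WE in WL.
have QL : rho_s D / 2 * I' + rho_f D / 2 * U' <= Q.
  rewrite /Q; move: y1 y2 y3 TF TE WL.
  move: (dt D * r^-1 * (rho_f D * U')) (dt D * r^-1 * (rho_s D + ks) * I') => a1 a2.
  move: (1 + G' + _) (B0) (F) (T') (U') (W') => z1 b1 f1 t1 u1 w1; lra.
have Q0 : 0 <= Q.
  by apply: le_trans QL; rewrite addr_ge0// mulr_ge0// divr_ge0// ltW.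
have Q1 : 0 <= 2 * Q / rho_s D by rewrite divr_ge0 ?mulr_ge0 ?(ltW rho_s0).
have fU : 0 <= rho_f D / 2 * U' by rewrite mulr_ge0// divr_ge0// ltW.
have sI : 0 <= rho_s D / 2 * I' by rewrite mulr_ge0// divr_ge0// ltW.
split.
- apply: (@le_trans _ _ (B0 + F + Q)); last by rewrite -[leRHS]addrA lerDl (addr_ge0 Q1 G0).
  move: TF y1 y2 QL sI; rewrite -/T'; move: (dt D * r^-1 * (rho_f D * U')) (dt D * r^-1 * (rho_s D + ks) * I').
  move: (T') (B0) (F) (Q) (U') => t1 z1 f1 q1 u1 a1 a2; lra.
- rewrite IE'; apply: (@le_trans _ _ (2 * Q / rho_s D)).
    rewrite ler_pdivlMr//; move: QL fU; move: (Q) (U') (rho_f D) => q1 u1 f1; lra.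
  by rewrite addrAC lerDr (addr_ge0 (addr_ge0 (addr_ge0 B00 F0) Q0) G0).
- move=> j x i l Kx; apply: (le_trans (gG j x i l Kx)).
  by rewrite lerDr (addr_ge0 (addr_ge0 (addr_ge0 B00 F0) Q0) Q1).
Qed.

(** The constants [c n] depend on s0, M and the data only, being chosen before N and the run. Times
    up to T leave n below |T| / dt, and the finite sum of the |c i| serves as a maximum. *)
Lemma run_bound (s0 : fsi_state D) (T M : R) : exists C, forall N (S : nat -> fsi_state D),
  S 0%N = s0 -> fsi_run N S -> forces_le N S M ->
  forall n, (n <= N)%N -> tk D n <= T -> total_energy S n <= C.
Proof.
have /choice[c hc] : forall n, exists B, forall N (S : nat -> fsi_state D), S 0%N = s0 -> fsi_run N S ->
    forces_le N S M -> (n <= N)%N -> bounded_state S n B.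
  elim=> [|n [B hB]].
    by have [B hB] := initial_bound s0; exists B => N S S0 hS _ _; exact: (hB N).
  have [B' hB'] := step_bound M B; exists B' => N S S0 hS hM nN.
  by apply: (hB' N) => //; apply: (hB N) => //; exact: ltnW.
pose k := Num.bound (`|T| / dt D).
have hk : `|T| / dt D < k%:R by apply: archi_boundP; rewrite divr_ge0 ?(ltW dt0).
exists (\sum_(i < k) `|c i|) => N S S0 hS hM n nN nT.
have nk : (n < k)%N.
  rewrite -(ltr_nat R); apply: le_lt_trans hk; rewrite ler_pdivlMr//.
  by apply: (le_trans nT); exact: ler_norm.
have [h _ _] := hc n N S S0 hS hM nN; apply: (le_trans h).
by rewrite (bigD1 (Ordinal nk))//= (le_trans (ler_norm _))// lerDl sumr_ge0.
Qed.

End Runs.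

Theorem theorem4p1 (R : realType) (d m : nat) (D : fsi_data R d m)
  (hd : d = 2%N \/ d = 3%N) (hm : (1 <= m)%N)
  (hrho_f : 0 < rho_f D) (hnu_f : 0 < nu_f D) (hrho_s : 0 < rho_s D)
  (hdt : 0 < dt D)
  (hD : data_ok D)
  (hWdiff : forall F, differentiable (energy D) F)
  (hWconvex : convex_function (E := 'M[R]_d) setT (energy D))
  (hu_b : forall t x, Sigma1 D x -> u_b D t x = 0)
  (hSigma2 : Sigma2 D = set0)
  (hphi_b : forall t x, Sigma3 D x -> derive1 (fun r => phi_b D r x) t = 0) :
  (forall N (S : nat -> fsi_state D), fsi_run N S ->
     forall n, (0 < n <= N)%N ->
       rho_f D / (2 * dt D) *
         (ip (Omega_f (S n)) (vel (S n)) (vel (S n)) -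
          ip (Omega_f (S n.-1)) (vel (S n.-1)) (vel (S n.-1)))
       + rho_f D * nu_f D / 2 * dissipation (S n)
       + (dt D)^-1 *
         (solid_energy D (svel (S n)) (predicted (S n)) -
          solid_energy D (svel (S n.-1)) (predicted (S n.-1)))
       <= power n (S n)) /\
  (forall N (S : nat -> fsi_state D), fsi_run N S ->
     forall n, (n <= N)%N ->
       total_energy S n <=
         total_energy S 0 + 2 * dt D * \sum_(1 <= l < n.+1) power l (S l)) /\
  (forall (s0 : fsi_state D) (T M : R), exists C : R,
     forall N (S : nat -> fsi_state D), S 0%N = s0 -> fsi_run N S ->
       forces_le N S M ->
       forall n, (n <= N)%N -> tk D n <= T -> total_energy S n <= C).
Proof.
(* The dimension has to be literally a double successor: the faces then have positive dimension as
   well. *)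
case: d D hd hrho_f hnu_f hrho_s hdt hD hWdiff hWconvex hu_b hSigma2 hphi_b => [|[|d]] D hd; try by case: hd.
move=> rf nf rs dt0 hD dW cW ub s2 pb; split; [|split].
- by move=> N S hS n hn; exact: (run_step dt0 hm rf rs hD hd dW cW ub s2 pb hS hn).
- by move=> N S hS n hn; exact: (run_total dt0 hm rf rs hD hd dW cW ub s2 pb hS hn).
- by move=> s0 T M; exact: (run_bound dt0 hm rf nf rs hD hd dW cW ub s2 pb).
Qed.
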